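(* Let $g,h:[0,\infty)\to[0,\infty)$ be integrable with $\|h\|_{L^1}\|g\|_{L^1}<1$, and let $\mu=(\mu_1,\mu_2,\mu_3,\mu_4)\in[0,\infty)^4$ with $\mu_1=\mu_2$ and $\mu_3=\mu_4$. Let $N=(N_1,N_2,N_3,N_4)$ be the $4$-dimensional Hawkes process with parameters $\mu$ and $$\boldsymbol\varphi=\begin{pmatrix} 0 & 0 & h & 0 \\ 0 & 0 & 0 & h \\ g & 0 & 0 & 0 \\ 0 & g & 0 & 0 \end{pmatrix},$$ and let $(S_1,S_2)=(N_1-N_2,\,N_3-N_4)$. Then the $2$-dimensional processes $T^{-1/2}(S_{1,Tv},S_{2,Tv})_{v\in[0,1]}$ converge in law as $T\to\infty$, for the Skorokhod topology, to $$\begin{pmatrix} X_1 \\ X_2 \end{pmatrix}=\frac{\sqrt2}{(1-\|h\|_{L^1}\|g\|_{L^1})^{3/2}}\begin{pmatrix} \nu_1^{1/2}W_1+\nu_2^{1/2}\|h\|_{L^1}W_2 \\ \nu_1^{1/2}\|g\|_{L^1}W_1+\nu_2^{1/2}W_2 \end{pmatrix},$$ where $$\nu_1=\mu_1+\|h\|_{L^1}\mu_3,\qquad \nu_2=\mu_3+\|g\|_{L^1}\mu_1,$$ and $(W_1,W_2)=(W_{1,t},W_{2,t})_{t\in[0,1]}$ is a standard ($2$-dimensional) Brownian motion.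
   Context: A $d$-dimensional Hawkes process with parameters $(\mu,\boldsymbol\varphi)$, $\boldsymbol\varphi=(\varphi_{ij})$, is defined as follows. Let $(T_n)_{n\ge1}$ be a non-decreasing sequence of random variables with values in $(0,\infty]$ with $T_n<T_{n+1}$ on $\{T_n<\infty\}$, and $(Z_n)_{n\ge1}$ random variables with values in $\{1,\dots,d\}$. Put $N_{i,t}=\sum_{n\ge1}\mathbf 1_{\{T_n\le t\}\cap\{Z_n=i\}}$ for $t\ge0$ (so $N_{i,0}=0$ and no two components jump simultaneously) and $\mathscr F_t=\sigma(N_{i,s}:s\le t,\,1\le i\le d)$. Under $P$, for all $n\ge1$ and $i$, the process $N_{i,t\wedge T_n}-\int_0^{t\wedge T_n}\lambda_{i,s}\,ds$ is an $(\mathscr F_t)$-martingale, where $$\lambda_{i,t}=\mu_i+\int_{(0,t)}\sum_{j=1}^d\varphi_{ij}(t-s)\,dN_{j,s},$$ with $\mu_i\ge0$ and Borel kernels $\varphi_{ij}:[0,\infty)\to[0,\infty)$. No stationarity is assumed. Here $d=4$, and $\|f\|_{L^1}=\int_0^\infty f(t)\,dt$ for $f\ge 0$. *)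

(* Defs.v *)
From HB Require Import structures.
From mathcomp Require Import all_boot all_order all_algebra.
From mathcomp Require Import all_classical all_reals all_analysis.
From mathcomp Require Import measurable_realfun.

Set Implicit Arguments.
Unset Strict Implicit.
Unset Printing Implicit Defensive.

Import Order.TTheory GRing.Theory Num.Theory numFieldNormedType.Exports.

Local Open Scope classical_set_scope.
Local Open Scope ring_scope.

Section skorokhod_space.
Context {R : realType} {V : normedModType R}.

Definition cadlag (f : R -> V) : Prop :=
  (forall t, 0 <= t < 1 -> f x @[x --> t^'+] --> f t) /\
  (forall t, 0 < t <= 1 -> cvg (f x @[x --> t^'-])).

(* D([0,1], V).  The values of a path outside [0,1] are irrelevant: two paths
   that agree on [0,1] are at distance 0 below, so that a continuous function
   on this type depends only on the restriction to [0,1]. *)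
Record cadlag_path := CadlagPath {
  path_fun :> R -> V;
  path_cadlag : cadlag path_fun }.

Lemma cadlag_cst0 : cadlag (fun=> 0).
Proof. by split=> t _; [exact: cvg_cst | exact: is_cvg_cst]. Qed.

(* Paths that are not cadlag are sent to the zero path; this is only used for
   processes whose paths are almost surely cadlag. *)
Definition to_path (f : R -> V) : cadlag_path :=
  if pselect (cadlag f) is left cf then CadlagPath cf
  else CadlagPath cadlag_cst0.

Definition time_change (l : R -> R) : Prop :=
  {in `[0, 1] &, {mono l : x y / x <= y}} /\ l @` `[0, 1]%classic = `[0, 1]%classic.

(* The ball {y | d(x, y) < e} of Skorokhod's J1 distance
     d(x, y) = inf_l max (sup_t |l t - t|) (sup_t |x t - y (l t)|). *)
Definition skorokhod_ball (x : cadlag_path) (e : R) (y : cadlag_path) : Prop :=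
  exists2 l, time_change l & exists2 k, k < e &
    forall t, t \in `[0, 1] -> `|l t - t| <= k /\ `|x t - y (l t)| <= k.

Lemma time_change_in l t : time_change l -> t \in `[0, 1] -> l t \in `[0, 1].
Proof.
move=> [_ im] t01; have : (l @` `[0, 1]%classic) (l t) by exists t.
by rewrite im.
Qed.

Lemma time_change_inv l : time_change l ->
  exists2 m, time_change m & {in `[0, 1], cancel m l}.
Proof.
move=> tl; have [mono im] := tl.
have /choice[m mP] (y : R) : exists x, y \in `[0, 1] -> x \in `[0, 1] /\ l x = y.
  case: (boolP (y \in `[0, 1])) => y01; last by exists 0.
  have : `[0, 1]%classic y by [].
  by rewrite -im => -[x x01 lxy]; exists x.
exists m; last by move=> y /mP[].
split=> [x y x01 y01|].
  have [mx ex] := mP _ x01; have [my ey] := mP _ y01.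
  by rewrite -(mono _ _ mx my) ex ey.
apply/seteqP; split=> [_ [y y01 <-]|x x01].
  by have [] := mP y y01.
have lx := time_change_in tl x01; have [mlx e] := mP _ lx.
exists (l x) => //; apply/eqP; rewrite eq_le.
by rewrite -(mono _ _ mlx x01) -(mono _ _ x01 mlx) e lexx.
Qed.

Lemma skorokhod_ball_center x (e : R) : 0 < e -> skorokhod_ball x e x.
Proof.
move=> e0; exists id; first by split=> //; rewrite image_id.
by exists 0 => // t _; rewrite !subrr !normr0.
Qed.

Lemma skorokhod_ball_sym x y (e : R) :
  skorokhod_ball x e y -> skorokhod_ball y e x.
Proof.
move=> [l tl [k ke H]]; have [m tm lm] := time_change_inv tl.
exists m => //; exists k => // t t01.
have := H _ (time_change_in tm t01); rewrite lm// => -[H1 H2].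
by rewrite distrC (distrC (y t)).
Qed.

Lemma skorokhod_ball_triangle x y z (e1 e2 : R) :
  skorokhod_ball x e1 y -> skorokhod_ball y e2 z ->
  skorokhod_ball x (e1 + e2) z.
Proof.
move=> [l tl [k ke H]] [m tm [k' ke' H']]; exists (m \o l).
  have [ml il] := tl; have [mm im] := tm; split=> [a b a01 b01|].
    by rewrite /= mm ?ml// time_change_in.
  by rewrite -image_comp il.
exists (k + k'); first exact: ltrD.
move=> t t01; have [h1 h2] := H _ t01.
have [h1' h2'] := H' _ (time_change_in tl t01); split => /=.
  rewrite -(subrKA (l t)) addrC (le_trans (ler_normD _ _))// lerD//.
by rewrite -(subrKA (y (l t))) (le_trans (ler_normD _ _))// lerD.
Qed.

HB.instance Definition _ := gen_eqMixin cadlag_path.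
HB.instance Definition _ := gen_choiceMixin cadlag_path.
HB.instance Definition _ := hasNbhs.Build cadlag_path (nbhs_ (entourage_ skorokhod_ball)).
HB.instance Definition _ := Nbhs_isPseudoMetric.Build R cadlag_path
  erefl skorokhod_ball_center skorokhod_ball_sym skorokhod_ball_triangle erefl.

End skorokhod_space.
Arguments cadlag_path {R} V.

(* Convergence in law, as T -> +oo, of the processes X T to Y for the
   Skorokhod topology on D([0,1], V).  The Borel sigma-algebra of D([0,1], V)
   for V = R^n is generated by the coordinate maps, so for processes with
   measurable marginals the expectations below are those of random variables. *)
Definition skorokhod_cvg_in_law {R : realType} {V : normedModType R}
    d (Omega : measurableType d) (P : probability Omega R)
    (X : R -> Omega -> R -> V)
    d' (Omega' : measurableType d') (Q : probability Omega' R)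
    (Y : Omega' -> R -> V) : Prop :=
  [/\ forall T, 0 < T -> {ae P, forall w, cadlag (X T w)},
      {ae Q, forall w, cadlag (Y w)} &
      forall F : cadlag_path V -> R,
        continuous F -> (exists M, forall x, `|F x| <= M) ->
        'E_P[fun w => F (to_path (X T w))]%E @[T --> +oo] -->
        'E_Q[fun w => F (to_path (Y w))]%E].

Definition mutually_independent {R : realType}
    d (Omega : measurableType d) (P : probability Omega R)
    (I : finType) (X : I -> Omega -> R) : Prop :=
  forall B : I -> set R, (forall a, measurable (B a)) ->
    P [set w | forall a, B a (X a w)] = (\prod_a P (X a @^-1` B a))%E.

(* Standard n-dimensional Brownian motion on the time interval [0,1]. *)
Record brownian_motion {R : realType}
    d (Omega : measurableType d) (P : probability Omega R)
    (n : nat) (W : 'I_n -> R -> Omega -> R) : Prop := BrownianMotion {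
  bm_measurable : forall i (t : R), 0 <= t <= 1 -> measurable_fun setT (W i t);
  bm_start : {ae P, forall w, forall i, W i 0 w = 0};
  bm_continuous : {ae P, forall w, forall i,
    {within `[0, 1]%classic, continuous (fun t => W i t w)}};
  bm_gaussian : forall i (s t : R), 0 <= s -> s < t -> t <= 1 ->
    forall B, measurable B ->
    P [set w | B (W i t w - W i s w)] = normal_prob 0 (Num.sqrt (t - s)) B;
  bm_independent : forall (m : nat) (t : nat -> R),
    {homo t : j k / (j <= k)%N >-> j <= k} ->
    (forall k, 0 <= t k <= 1) ->
    mutually_independent P
      (fun (a : 'I_n * 'I_m) w => W a.1 (t a.2.+1) w - W a.1 (t a.2) w) }.

(* Martingales indexed by [0, +oo[; the second and last clauses of the
   definition say that M s is the conditional expectation of M t given F s. *)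
Record martingale {R : realType}
    d (Omega : measurableType d) (P : probability Omega R)
    (F : R -> set (set Omega)) (M : R -> Omega -> \bar R) : Prop := Martingale {
  mart_integrable : forall t : R, 0 <= t -> P.-integrable setT (M t);
  mart_adapted : forall t : R, 0 <= t ->
    forall B : set (\bar R), measurable B -> F t (M t @^-1` B);
  mart_cond_expectation : forall s t : R, 0 <= s -> s <= t ->
    forall A, F s A -> (\int[P]_(w in A) M t w = \int[P]_(w in A) M s w)%E }.

(* Multivariate point processes: tau n and Z n are the time and the mark of
   the (n+1)-st jump. *)
Section point_process.
Context {R : realType} d (Omega : measurableType d) (dim : nat).
Variables (tau : nat -> Omega -> \bar R) (Z : nat -> Omega -> 'I_dim).

Definition counting_process (i : 'I_dim) (t : R) (w : Omega) : \bar R :=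
  (\sum_(0 <= n <oo) ((tau n w <= t%:E)%E && (Z n w == i))%:R%:E)%E.

(* The random measure dN_j. *)
Definition jump_measure (j : 'I_dim) (w : Omega) : {measure set R -> \bar R} :=
  mseries (fun n => if (tau n w < +oo)%E && (Z n w == j)
                    then dirac (fine (tau n w)) : {measure set R -> \bar R}
                    else mzero) 0.

Definition history (t : R) : set (set Omega) :=
  <<s [set A | exists i s, 0 <= s <= t /\
         exists2 B : set (\bar R), measurable B & A = counting_process i s @^-1` B] >>.

Definition intensity (mu : 'I_dim -> R) (phi : 'I_dim -> 'I_dim -> R -> R)
    (i : 'I_dim) (t : R) (w : Omega) : \bar R :=
  ((mu i)%:E + \sum_(j < dim)
     \int[jump_measure j w]_(s in `]0%R, t[) (phi i j (t - s))%:E)%E.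

Definition compensated (mu : 'I_dim -> R) (phi : 'I_dim -> 'I_dim -> R -> R)
    (n : nat) (i : 'I_dim) (t : R) (w : Omega) : \bar R :=
  let t' := fine (Order.min t%:E (tau n w)) in
  (counting_process i t' w -
   \int[lebesgue_measure]_(s in `[0%R, t']) intensity mu phi i s w)%E.

Record hawkes (P : probability Omega R) (mu : 'I_dim -> R)
    (phi : 'I_dim -> 'I_dim -> R -> R) : Prop := Hawkes {
  hawkes_time_measurable : forall n, measurable_fun setT (tau n);
  hawkes_mark_measurable : forall n i, measurable (Z n @^-1` [set i]);
  hawkes_time_gt0 : forall n w, (0 < tau n w)%E;
  hawkes_time_le : forall n w, (tau n w <= tau n.+1 w)%E;
  hawkes_time_lt : forall n w, (tau n w < +oo)%E -> (tau n w < tau n.+1 w)%E;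
  hawkes_mu_ge0 : forall i, 0 <= mu i;
  hawkes_phi_ge0 : forall i j (t : R), 0 <= t -> 0 <= phi i j t;
  hawkes_phi_measurable : forall i j,
    measurable_fun (`[0, +oo[%classic : set R) (phi i j);
  hawkes_martingale : forall n i,
    martingale P history (compensated mu phi n i) }.

End point_process.

Section four_dimensional_model.
Context {R : realType}.

Definition kernel4 (g h : R -> R) (i j : 'I_4) : R -> R :=
  let o := cst 0 in
  nth o (nth [::] [:: [:: o; o; h; o];
                      [:: o; o; o; h];
                      [:: g; o; o; o];
                      [:: o; g; o; o]] i) j.

Definition row2 (x y : R) : 'rV[R]_2 :=
  \row_(k < 2) if k == ord0 then x else y.

(* Components 1, 2, 3, 4 are indexed by 0, 1, 2, 3 in 'I_4.  The counting
   processes are almost surely finite, so that fine is harmless. *)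
Definition S_process d (Omega : measurableType d)
    (tau : nat -> Omega -> \bar R) (Z : nat -> Omega -> 'I_4)
    (t : R) (w : Omega) : 'rV[R]_2 :=
  let N k := fine (counting_process tau Z (inord k) t w) in
  row2 (N 0 - N 1) (N 2 - N 3).

Definition L1norm (f : R -> R) : R :=
  \int[lebesgue_measure]_(t in `[0, +oo[) f t.

End four_dimensional_model.

(* Main.v *)
(** Stopping at the [n]-th jump makes the counts [N], the compensators and the
    martingales [M = N - C] bounded.  The quadratic variation of [M] is [N]
    itself; this gives second moments, a fourth moment maximal inequality and,
    through the Volterra equation [N = M + mu t + phi * N], the law of large
    numbers for [N t / t] in [L^2].  A Lindeberg argument carried out directly on
    [E cos] then yields the Gaussian limit of the increments of the two
    martingales [m1], [m2] attached to [N_1 - N_2] and [N_3 - N_4], and sine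
    truncation followed by Bernstein polynomials extends the convergence from
    cosines to bounded Lipschitz functions.

    As [mu_1 = mu_2] and [mu_3 = mu_4], the drift cancels in [S], which solves a
    linear Volterra equation driven by [(m1, m2)] and is therefore uniformly close
    to [(m1 + a m2, m2 + b m1) / (1 - a b)] with [a = |h|], [b = |g|].  The fourth
    moments bound the oscillation of the martingales inside the cells of a fine
    grid, so that [S] is close to a step path built from finitely many increments.
    A continuous bounded functional [F] is an increasing limit of functionals
    that are Lipschitz for the uniform norm; applied to [F] and to [- F], this
    compares [E F(S)] with the Brownian limit. *)

Require Import Defs.
From HB Require Import structures.
From mathcomp Require Import all_boot all_order all_algebra.
From mathcomp Require Import all_classical all_reals all_analysis.
From mathcomp Require Import measurable_realfun.
From mathcomp Require Import ring lra.
Set Implicit Arguments.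
Unset Strict Implicit.
Unset Printing Implicit Defensive.
Import Order.TTheory GRing.Theory Num.Theory numFieldNormedType.Exports.
Local Open Scope classical_set_scope.
Local Open Scope ring_scope.

(** * Expectations of bounded random variables *)

(** The martingale property is given only for the processes stopped at a jump time, through
    integrals over events of the history. At a fixed index [n] everything is bounded, so that
    identities are plain manipulations of expectations; what matters is that each moment bound is
    uniform in [n]. Moments of [N] are bounded by those of [M], whose energy is [N] again: first
    moments give second ones, and these give fourth ones. The fourth order makes the truncation
    error, of order [n^2 * P(tau n <= T)], vanish as [n] grows.

    The limit law is reached with explicit errors instead of a continuity theorem for characteristic
    functions and tightness in the Skorokhod space: a path functional is compared with a Lipschitz
    function of finitely many increments, and that function with a finite sum of cosines. As [F]
    composed with [to_path] may fail to be measurable on [Omega], its integral is only squeezed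
    between integrals of bounded measurable functions. *)

Section bounded_measurable.
Context {R : realType} d (T : measurableType d).
Implicit Types f g : T -> R.

Definition bmf f := measurable_fun setT f /\ exists K, forall w, `|f w| <= K.

Lemma bmf_cst (c : R) : bmf (fun=> c).
Proof. by split; [exact: measurable_cst | exists `|c|]. Qed.

Lemma bmfD f g : bmf f -> bmf g -> bmf (fun w => f w + g w).
Proof.
move=> [mf [K fK]] [mg [L gL]]; split; first exact: measurable_funD.
by exists (K + L) => w; rewrite (le_trans (ler_normD _ _))// lerD.
Qed.

Lemma bmfN f : bmf f -> bmf (fun w => - f w).
Proof.
move=> [mf [K fK]]; split; first exact: measurableT_comp.
by exists K => w; rewrite normrN.
Qed.

Lemma bmfB f g : bmf f -> bmf g -> bmf (fun w => f w - g w).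
Proof. by move=> bf bg; apply: bmfD => //; exact: bmfN. Qed.

Lemma bmfM f g : bmf f -> bmf g -> bmf (fun w => f w * g w).
Proof.
move=> [mf [K fK]] [mg [L gL]]; split; first exact: measurable_funM.
by exists (K * L) => w; rewrite normrM ler_pM.
Qed.

Lemma bmfZ (c : R) f : bmf f -> bmf (fun w => c * f w).
Proof. by move=> bf; apply: bmfM => //; exact: bmf_cst. Qed.

Lemma bmfX n f : bmf f -> bmf (fun w => f w ^+ n).
Proof.
move=> bf; elim: n => [|n IH]; first by under eq_fun do rewrite expr0; exact: bmf_cst.
by under eq_fun do rewrite exprS; exact: bmfM.
Qed.

Lemma bmf_sum I (s : seq I) (p : pred I) (F : I -> T -> R) : (forall i, bmf (F i)) ->
  bmf (fun w => \sum_(i <- s | p i) F i w).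
Proof.
move=> bF; elim: s => [|i s IH].
  by under eq_fun do rewrite big_nil; exact: bmf_cst.
under eq_fun do rewrite big_cons.
by case: (p i) => //; exact: bmfD.
Qed.

Lemma bmf_norm f : bmf f -> bmf (fun w => `|f w|).
Proof.
move=> [mf [K fK]]; split; first exact: measurableT_comp.
by exists K => w; rewrite normr_id.
Qed.

Lemma bmf_max f g : bmf f -> bmf g -> bmf (fun w => Num.max (f w) (g w)).
Proof.
move=> [mf [K fK]] [mg [L gL]]; split; first exact: measurable_maxr.
exists (Num.max K L) => w; have [_|_] := leP (f w) (g w).
  by rewrite le_max gL orbT.
by rewrite le_max fK.
Qed.

Lemma bmf_cos f : measurable_fun setT f -> bmf (fun w => cos (f w)).
Proof.
move=> mf; split; last first.
  by exists 1 => w; rewrite ler_norml cos_geN1 cos_le1.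
apply: (measurableT_comp _ mf); apply: continuous_measurable_fun.
exact: continuous_cos.
Qed.

Lemma bmf_sin f : measurable_fun setT f -> bmf (fun w => sin (f w)).
Proof.
move=> mf; split; last first.
  by exists 1 => w; rewrite ler_norml sin_geN1 sin_le1.
apply: (measurableT_comp _ mf); apply: continuous_measurable_fun.
exact: continuous_sin.
Qed.

Lemma bmf_indic (A : set T) : measurable A -> bmf (\1_A : T -> R).
Proof.
move=> mA; split; first exact: measurable_indic.
by exists 1 => w; rewrite indicE; case: (_ \in _); rewrite ?normr1 ?normr0.
Qed.

End bounded_measurable.

Section expectation.
Context {R : realType} d (T : measurableType d) (P : probability T R).
Implicit Types f g : T -> R.

Definition Ex f : R := \int[P]_w f w.

Lemma bmf_integrable f : bmf f -> P.-integrable setT (EFin \o f).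
Proof.
move=> [mf [K fK]].
apply: (@le_integrable _ _ _ P _ measurableT _ (EFin \o cst `|K|)).
- exact/measurable_EFinP.
- by move=> w _ /=; rewrite lee_fin normr_id (le_trans (fK w))// ler_norm.
- exact: finite_measure_integrable_cst.
Qed.

Lemma Ex_EFin f : bmf f -> (\int[P]_w (f w)%:E)%E = (Ex f)%:E.
Proof.
move=> /bmf_integrable bf; rewrite /Ex /Rintegral fineK//.
exact: integrable_fin_num.
Qed.

Lemma ExD f g : bmf f -> bmf g -> Ex (fun w => f w + g w) = Ex f + Ex g.
Proof. by move=> bf bg; apply: RintegralD => //; exact: bmf_integrable. Qed.

Lemma ExB f g : bmf f -> bmf g -> Ex (fun w => f w - g w) = Ex f - Ex g.
Proof. by move=> bf bg; apply: RintegralB => //; exact: bmf_integrable. Qed.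

Lemma ExZ c f : bmf f -> Ex (fun w => c * f w) = c * Ex f.
Proof. by move=> bf; apply: RintegralZl => //; exact: bmf_integrable. Qed.

Lemma Ex_cst c : Ex (fun=> c) = c.
Proof. by rewrite /Ex Rintegral_cst//= probability_setT mulr1. Qed.

Lemma Ex_sum I (s : seq I) (F : I -> T -> R) : (forall i, bmf (F i)) ->
  Ex (fun w => \sum_(i <- s) F i w) = \sum_(i <- s) Ex (F i).
Proof.
move=> bF; elim: s => [|i s IH].
  by under eq_fun do rewrite big_nil; rewrite big_nil Ex_cst.
under eq_fun do rewrite big_cons.
by rewrite big_cons ExD ?IH//; exact: bmf_sum.
Qed.

Lemma Ex_le f g : bmf f -> bmf g -> (forall w, f w <= g w) -> Ex f <= Ex g.
Proof. by move=> bf bg fg; apply: le_Rintegral => //; exact: bmf_integrable. Qed.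

Lemma Ex_ge0 f : (forall w, 0 <= f w) -> 0 <= Ex f.
Proof. by move=> f0; apply: Rintegral_ge0. Qed.

Lemma Ex_norm f : bmf f -> `|Ex f| <= Ex (fun w => `|f w|).
Proof. by move=> bf; apply: le_normr_Rintegral => //; exact: bmf_integrable. Qed.

Lemma Ex_norm_le f g : bmf f -> bmf g -> (forall w, `|f w| <= g w) -> `|Ex f| <= Ex g.
Proof. by move=> bf bg fg; rewrite (le_trans (Ex_norm bf))// Ex_le//; exact: bmf_norm. Qed.

Lemma Ex_indic (A : set T) : measurable A -> Ex \1_A = fine (P A).
Proof. by move=> mA; rewrite /Ex /Rintegral integral_indic// setIT. Qed.

Lemma eq_Ex f g : f =1 g -> Ex f = Ex g.
Proof. by move=> /funext ->. Qed.

Lemma Ex_markov (A : set T) f e : measurable A -> bmf f -> 0 < e ->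
  (forall w, 0 <= f w) -> (forall w, A w -> e <= f w) -> fine (P A) <= Ex f / e.
Proof.
move=> mA bf e0 f0 fe; rewrite ler_pdivlMr// mulrC -Ex_indic// -ExZ; last exact: bmf_indic.
apply: Ex_le => // [|w]; first exact/bmfZ/bmf_indic.
rewrite indicE; case: (asboolP (A w)) => Aw.
  by rewrite mem_set// mulr1 fe.
by rewrite memNset// mulr0.
Qed.

Lemma Ex_dct (F : nat -> T -> R) f (K : R) : (forall n, measurable_fun setT (F n)) ->
  (forall n w, `|F n w| <= K) -> (forall w, F ^~ w @ \oo --> f w) ->
  bmf f /\ (fun n => Ex (F n)) @ \oo --> Ex f.
Proof.
move=> mF FK Ff.
have mf : measurable_fun setT f by exact: (measurable_fun_cvg mF).
have fK w : `|f w| <= K.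
  have h : (fun n => `|F n w|) @ \oo --> `|f w| by exact: cvg_norm.
  rewrite -(cvg_lim (@Rhausdorff R) h); apply: limr_le; first by apply/cvg_ex; eexists; exact: h.
  exact: nearW.
have bf : bmf f by split => //; exists K.
split => //; have bF n : bmf (F n) by split=> //; exists K.
have [] := @dominated_convergence _ _ _ P setT measurableT (fun n => EFin \o F n)
  (EFin \o f) (EFin \o cst K).
- by move=> n; exact/measurable_EFinP.
- exact/measurable_EFinP.
- by apply: aeW => w _; apply: cvg_comp (Ff w) _ => //; exact: cvg_EFin.
- exact: finite_measure_integrable_cst.
- by apply: aeW => w n _; rewrite lee_fin.
- move=> _ _; rewrite (Ex_EFin bf) => h; have /fine_cvgP[_] := h; apply: cvg_trans; apply: near_eq_cvg; apply: nearW => n //.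
Qed.

End expectation.

Lemma bmf_sub {R : realType} d (T : measurableType d) (G : set (set T)) (f : T -> R) :
  (forall A, G A -> measurable A) ->
  bmf (f : g_sigma_algebraType G -> R) -> bmf f.
Proof.
move=> Gm [mf K]; split => // _ B mB.
have := mf measurableT B mB; rewrite !setTI.
by apply: smallest_sub => //; exact: sigma_algebra_measurable.
Qed.

(** * Discrete martingales *)

Section discrete_martingale.
Context {R : realType} d (T : measurableType d) (P : probability T R).
Local Notation E := (Ex P).

(** A filtration is represented by its classes of bounded adapted functions. Closure under [max]
    makes the running maximum adapted, closure under products supplies the multipliers for the
    orthogonality relations. *)
Record filtration_classes (C : nat -> (T -> R) -> Prop) : Prop := FiltrationClasses {
  fc_bmf : forall j f, C j f -> bmf f;
  fc_incr : forall j f, C j f -> C j.+1 f;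
  fc_cst : forall j c, C j (fun=> c);
  fcD : forall j f g, C j f -> C j g -> C j (fun w => f w + g w);
  fcM : forall j f g, C j f -> C j g -> C j (fun w => f w * g w);
  fc_max : forall j f g, C j f -> C j g -> C j (fun w => Num.max (f w) (g w)) }.

Variables (C : nat -> (T -> R) -> Prop) (D : nat -> T -> R).
Hypothesis fC : filtration_classes C.
Hypothesis D_adapted : forall j, C j (D j).
Hypothesis D_orth : forall j X, C j X -> E (fun w => X w * (D j.+1 w - D j w)) = 0.
Hypothesis D0 : forall w, D 0 w = 0.

Let Q L w := \sum_(j < L) (D j.+1 w - D j w) ^+ 2.

Let bD j : bmf (D j). Proof. exact: (fc_bmf fC). Qed.
Let bd j : bmf (fun w => D j.+1 w - D j w). Proof. exact: bmfB. Qed.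
Let bQ L : bmf (Q L). Proof. by apply: bmf_sum => j; exact/bmfX/bd. Qed.

Lemma C0_mono f j : C 0 f -> C j f.
Proof. by move=> C0; elim: j => // j; exact: (fc_incr fC). Qed.

(** In the expansion of [D L.+1 ^+ 2] the cross term is an increment multiplied by [X * D L], which
    is adapted at step [L], so its expectation vanishes. *)
Lemma mart_sqr_orth X L : C 0 X ->
  E (fun w => X w * D L w ^+ 2) = E (fun w => X w * Q L w).
Proof.
move=> CX; have bX := fc_bmf fC CX; elim: L => [|L IH].
  by apply: eq_Ex => w; rewrite D0 /Q big_ord0 expr0n.
have -> : (fun w => X w * D L.+1 w ^+ 2) = fun w => (X w * D L w ^+ 2
    + X w * (D L.+1 w - D L w) ^+ 2) + 2 * ((X w * D L w) * (D L.+1 w - D L w)).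
  by apply/funext => w; ring.
have b1 : bmf (fun w => X w * D L w ^+ 2) by apply: bmfM => //; exact: bmfX.
have b2 : bmf (fun w => X w * (D L.+1 w - D L w) ^+ 2) by apply: bmfM => //; exact/bmfX/bd.
have b3 : bmf (fun w => (X w * D L w) * (D L.+1 w - D L w)).
  by apply: bmfM => //; exact: bmfM.
rewrite ExD//; [|exact: bmfD|exact: bmfZ].
rewrite ExZ// D_orth ?mulr0 ?addr0; last first.
  by apply: (fcM fC) => //; exact: C0_mono.
rewrite ExD// IH -ExD//; last by apply: bmfM.
by apply: eq_Ex => w; rewrite /Q big_ord_recr /= mulrDr.
Qed.

Fixpoint runmax L w : R :=
  if L is L'.+1 then Num.max (runmax L' w) (D L w ^+ 2) else D 0 w ^+ 2.

Lemma runmax_adapted L : C L (runmax L).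
Proof.
have CX j : C j (fun w => D j w ^+ 2).
  have -> : (fun w => D j w ^+ 2) = fun w => D j w * D j w.
    by apply/funext => w; rewrite expr2.
  exact: (fcM fC).
elim: L => [|L IH]; first exact: CX.
by apply: (fc_max fC) => //; exact: (fc_incr fC).
Qed.

Let bm L : bmf (runmax L). Proof. exact/(fc_bmf fC)/runmax_adapted. Qed.

Lemma runmax_ge0 L w : 0 <= runmax L w.
Proof. by case: L => [|L] /=; rewrite ?le_max ?sqr_ge0 ?orbT. Qed.

Lemma runmax_ge j L w : (j <= L)%N -> D j w ^+ 2 <= runmax L w.
Proof.
elim: L => [|L IH]; first by rewrite leqn0 => /eqP ->.
rewrite leq_eqVlt => /predU1P[->|]; first by rewrite /= le_max lexx orbT.
by rewrite ltnS => /IH h; rewrite /= le_max h.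
Qed.

(* pathwise form of Doob's L^2 maximal inequality for the submartingale D^2 *)
Lemma runmax_doob L w : \sum_(j < L) runmax j w * (D j.+1 w ^+ 2 - D j w ^+ 2)
   <= runmax L w * D L w ^+ 2 - runmax L w ^+ 2 / 2.
Proof.
elim: L => [|L IH]; first by rewrite big_ord0 /= D0; lra.
rewrite big_ord_recr /=.
move: IH; set S := \sum_(_ < _) _; set m := runmax L w; set s := D L w ^+ 2.
set s' := D L.+1 w ^+ 2; have [ms|ms] := leP m s'; nra.
Qed.

(** [D ^+ 2] is a submartingale, so the sum bounded by the pathwise inequality has nonnegative
    expectation. *)
Lemma runmax_sqr_le L : E (fun w => runmax L w ^+ 2) <= 4 * E (fun w => D L w ^+ 4).
Proof.
have h0 : 0 <= E (fun w => \sum_(j < L) runmax j w * (D j.+1 w ^+ 2 - D j w ^+ 2)).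
  rewrite (Ex_sum P _ (F := fun (j : 'I_L) w => runmax j w * (D j.+1 w ^+ 2 - D j w ^+ 2))).
    apply: sumr_ge0 => j _.
    have -> : (fun w => runmax j w * (D j.+1 w ^+ 2 - D j w ^+ 2)) =
       fun w => runmax j w * (D j.+1 w - D j w) ^+ 2 +
          2 * ((runmax j w * D j w) * (D j.+1 w - D j w)).
      by apply/funext => w; ring.
    rewrite ExD//; [|by apply: bmfM => //; exact/bmfX/bd|by apply/bmfZ/bmfM => //; exact: bmfM].
    rewrite ExZ; last by apply: bmfM => //; exact: bmfM.
    rewrite D_orth ?mulr0 ?addr0; last by apply: (fcM fC) => //; exact: runmax_adapted.
    by apply: Ex_ge0 => w; rewrite mulr_ge0 ?runmax_ge0 ?sqr_ge0.
  by move=> j; apply: bmfM => //; apply: bmfB; exact: bmfX.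
(* With [m] the maximum, [m D^2 - m^2 / 2 <= D^4 - m^2 / 4] is the square of [m / 2 - D^2]; this is
   where the factor 4 arises. *)
have : E (fun w => \sum_(j < L) runmax j w * (D j.+1 w ^+ 2 - D j w ^+ 2)) <=
    E (fun w => D L w ^+ 4 - 4^-1 * runmax L w ^+ 2).
  apply: Ex_le.
  - by apply: bmf_sum => j; apply: bmfM => //; apply: bmfB; exact: bmfX.
  - by apply: bmfB; [exact: bmfX|exact/bmfZ/bmfX].
  - move=> w; apply: le_trans (runmax_doob L w) _.
    have -> : D L w ^+ 4 = (D L w ^+ 2) ^+ 2 by ring.
    have := sqr_ge0 (runmax L w / 2 - D L w ^+ 2); nra.
rewrite ExB ?ExZ; try exact: bmfX; last exact/bmfZ/bmfX.
lra.
Qed.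

(** A Burkholder inequality of order four. The maximal inequality turns the term [runmax ^+ 2 / 8]
    into at most half of the left-hand side, which is absorbed; hence 262 = 2 * 131. *)
Lemma mart_fourth_le L : E (fun w => D L w ^+ 4) <= 262 * E (fun w => Q L w ^+ 2).
Proof.
suff : E (fun w => D L w ^+ 4) <=
    E (fun w => 8^-1 * runmax L w ^+ 2 + 131 * Q L w ^+ 2).
  rewrite ExD ?ExZ; try exact: bmfX; try exact/bmfZ/bmfX.
  have := runmax_sqr_le L; lra.
(* For an increment [d] the cubic term satisfies [4 D d^3 <= 2 D^2 d^2 + 2 d^4], which turns the
   coefficients 6 and 1 of [D^2 d^2] and [d^4] into 8 and 3; the term [4 D^3 d] has zero mean. *)
apply: (@le_trans _ _ (E (fun w => \sum_(j < L) (8 * (D j w ^+ 2 * (D j.+1 w - D j w) ^+ 2) +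
    3 * (D j.+1 w - D j w) ^+ 4)))).
  have bt j : bmf (fun w => 8 * (D j w ^+ 2 * (D j.+1 w - D j w) ^+ 2) +
      3 * (D j.+1 w - D j w) ^+ 4).
    by apply: bmfD; apply: bmfZ; [apply: bmfM; apply: bmfX|exact/bmfX/bd].
  elim: L => [|L IH].
    rewrite (_ : (fun w => D 0 w ^+ 4) = fun=> 0) ?Ex_cst.
      by apply: Ex_ge0 => w; rewrite big_ord0.
    by apply/funext => w; rewrite D0 expr0n.
  under [leRHS]eq_Ex do rewrite big_ord_recr /=.
  rewrite ExD//; last by apply: bmf_sum => j.
  apply: le_trans (lerD IH (lexx _)); rewrite -ExD//; last exact: bmfX.
  rewrite -[leLHS]subr0 -(mulr0 4) -(D_orth (j := L) (X := fun w => D L w ^+ 3)); last first.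
    have -> : (fun w => D L w ^+ 3) = fun w => D L w * (D L w * D L w).
      by apply/funext => w; ring.
    by apply: (fcM fC) => //; exact: (fcM fC).
  rewrite -ExZ -?ExB.
  - apply: Ex_le.
    + by apply: bmfB; [exact: bmfX|apply: bmfZ; apply: bmfM => //; exact: bmfX].
    + by apply: bmfD => //; exact: bmfX.
    + move=> w; set x := D L w; set y := D L.+1 w.
      have := sqr_ge0 (x * (y - x) - (y - x) ^+ 2).
      have := sqr_ge0 ((y - x) ^+ 2); nra.
  - exact: bmfX.
  - by apply: bmfZ; apply: bmfM => //; exact: bmfX.
  - by apply: bmfM => //; exact: bmfX.
apply: Ex_le.
- by apply: bmf_sum => j; apply: bmfD; apply: bmfZ; [apply: bmfM; apply: bmfX|exact/bmfX/bd].
- by apply: bmfD; apply: bmfZ; exact: bmfX.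
(* [8 m Q <= m^2 / 8 + 128 Q^2] because [(m - 32 Q)^2 >= 0], and 131 = 128 + 3. *)
- move=> w; apply: (@le_trans _ _ (8 * (runmax L w * Q L w) + 3 * Q L w ^+ 2)); last first.
    have := sqr_ge0 (runmax L w - 32 * Q L w); nra.
  rewrite big_split /= -!mulr_sumr; apply: lerD; rewrite ler_pM2l//.
    rewrite /Q mulr_sumr; apply: ler_sum => j _.
    by rewrite ler_wpM2r ?sqr_ge0// runmax_ge// ltnW.
  rewrite expr2 /Q mulr_suml; apply: ler_sum => j _.
  have -> : (D j.+1 w - D j w) ^+ 4 = (D j.+1 w - D j w) ^+ 2 * (D j.+1 w - D j w) ^+ 2 by ring.
  rewrite ler_wpM2l ?sqr_ge0// (bigD1 j)//= lerDl.
  by apply: sumr_ge0 => i _; exact: sqr_ge0.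
Qed.

Lemma runmax_fourth_le L : E (fun w => runmax L w ^+ 2) <= 1048 * E (fun w => Q L w ^+ 2).
Proof. have := runmax_sqr_le L; have := mart_fourth_le L; lra. Qed.

End discrete_martingale.

(** * From events of a sigma-algebra to bounded measurable multipliers *)

Section martingale_orthogonality.
Context {R : realType} d (T : measurableType d) (P : probability T R).
Variables (G : set (set T)) (D : T -> R).
Hypothesis Gm : forall A, <<s G >> A -> measurable A.
Hypothesis bD : bmf D.
Hypothesis D0 : forall A, <<s G >> A -> Ex P (fun w => \1_A w * D w) = 0.

(** [X] is within [1 / n.+1] of a finite combination of indicators of events of [<<s G >>], for
    which the expectation is zero by hypothesis. *)
Lemma bounded_orth (X : T -> R) : bmf (X : g_sigma_algebraType G -> R) ->
  Ex P (fun w => X w * D w) = 0.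
Proof.
move=> bGX; have bX : bmf X.
  by apply: bmf_sub bGX => A GA; apply: Gm; exact: sub_sigma_algebra.
have [mX [K XK]] := bGX; have [mD [KD DK]] := bD.
have KD0 : 0 <= KD by exact: le_trans (normr_ge0 _) (DK point).
pose L : nat := (Num.truncn K).+1.
have XL w : `|X w| <= L%:R by rewrite (le_trans (XK w))// ltW// truncnS_gt.
suff h n : `|Ex P (fun w => X w * D w)| <= KD / n.+1%:R.
  apply/eqP; rewrite -normr_le0; apply/ler_addgt0Pl => e e0; rewrite addr0.
  have := truncnS_gt (KD / e); rewrite ltr_pdivrMr// => h2.
  by apply: le_trans (h (Num.truncn (KD / e))) _; rewrite ler_pdivrMr// mulrC ltW.
(* Shifting by [L] makes the function nonnegative, so that [truncn] rounds it down. *)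
pose Y w := (X w + L%:R) * n.+1%:R.
have Y0 w : 0 <= Y w.
  by rewrite mulr_ge0// -lerBlDr sub0r; have := XL w; rewrite ler_norml => /andP[].
pose B : nat := (Num.truncn (2 * L%:R * n.+1%:R : R)).+1.
have YB w : (Num.truncn (Y w) < B)%N.
  rewrite ltnS; apply: le_truncn; rewrite ler_pM2r// mulr_natl mulr2n lerD2r.
  by have := XL w; rewrite ler_norml => /andP[].
pose A k := [set w | Num.truncn (Y w) = k].
have GA k : <<s G >> (A k).
  have mY : measurable_fun setT (Y : g_sigma_algebraType G -> R).
    by apply: measurable_funM => //; exact: measurable_funD.
  have := mY measurableT _ (measurable_itv `[k%:R, k.+1%:R[%R).
  rewrite setTI; congr (<<s _ >> _); apply/seteqP; split => w /=.
    by rewrite in_itv /= => h; exact: truncn_def.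
  by move=> <-; rewrite in_itv /=; exact: truncn_itv.
pose Xn w := \sum_(k < B) (k%:R / n.+1%:R - L%:R) * \1_(A k) w : R.
have XnE w : Xn w = (Num.truncn (Y w))%:R / n.+1%:R - L%:R.
  rewrite /Xn (bigD1 (Ordinal (YB w)))//= indicE mem_set// mulr1 big1 ?addr0// => i ik.
  rewrite indicE memNset ?mulr0// => /= e; move/eqP: ik; apply.
  exact/val_inj.
have bXn : bmf Xn by apply: bmf_sum => k; apply/bmfZ/bmf_indic/Gm.
have ->  : Ex P (fun w => X w * D w) = Ex P (fun w => (X w - Xn w) * D w).
  under [RHS]eq_Ex do rewrite mulrBl.
  rewrite ExB; [|exact: bmfM|exact: bmfM].
  suff -> : Ex P (fun w => Xn w * D w) = 0 by rewrite subr0.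
  under eq_Ex do rewrite mulr_suml.
  rewrite (Ex_sum P _ (F := fun (k : 'I_B) w => (k%:R / n.+1%:R - L%:R) * \1_(A k) w * D w)).
    apply: big1 => k _; under eq_Ex do rewrite -mulrA.
    by rewrite ExZ ?D0 ?mulr0//; apply: bmfM => //; apply/bmf_indic/Gm.
  by move=> k; apply: bmfM => //; apply/bmfZ/bmf_indic/Gm.
rewrite -[leRHS](Ex_cst P); apply: Ex_norm_le.
- by apply: bmfM => //; exact: bmfB.
- exact: bmf_cst.
- move=> w; rewrite normrM mulrC ler_pM//.
  have -> : X w - Xn w = (Y w - (Num.truncn (Y w))%:R) / n.+1%:R.
    by rewrite XnE /Y mulrBl mulfK ?pnatr_eq0//; ring.
  rewrite normrM normfV normr_nat -[leRHS]mul1r ler_pM2r ?invr_gt0//.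
  have /andP[h1 h2] := truncn_itv (Y0 w).
  rewrite ger0_norm ?subr_ge0// lerBlDr addrC.
  by rewrite -natr1 in h2; rewrite ltW.
Qed.

End martingale_orthogonality.

(** * Convolution with an integrable kernel *)

Section convolution.
Context {R : realType}.
Notation leb := (@lebesgue_measure R).
Variable k : R -> R.
Hypothesis k_ge0 : forall r, 0 <= k r.
Hypothesis k_neg : forall r, r < 0 -> k r = 0.
Hypothesis k_int : leb.-integrable setT (EFin \o k).

Let mk : measurable_fun setT k.
Proof. by apply/measurable_EFinP; exact: measurable_int k_int. Qed.

Definition mass := \int[leb]_r k r.
Definition cumul x := \int[leb]_r (k r * (r <= x)%R%:R).
(** Since [k] vanishes on negative reals, only the values of [f] up to time [t] matter. The
    functions convolved later vanish at negative times, which makes this the usual integral over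
    [[0, t]]. *)
Definition kconv (f : R -> R) t := \int[leb]_r (k r * f (t - r)).

Lemma kM_integrable (f : R -> R) (B : R) : measurable_fun setT f ->
  (forall r, 0 <= r -> `|f r| <= B) -> leb.-integrable setT (EFin \o (fun r => k r * f r)).
Proof.
move=> mf fB.
apply: (@le_integrable _ _ _ leb _ measurableT _ (EFin \o (fun r => `|B| * k r))).
- by apply/measurable_EFinP; exact: measurable_funM.
- move=> r _ /=; rewrite lee_fin !normrM normr_id mulrC (ger0_norm (k_ge0 r)).
  have [r0|r0] := ltP r 0; first by rewrite k_neg// !mulr0.
  by rewrite ler_wpM2r// (le_trans (fB _ r0))// ler_norm.
- by have := integrableZl measurableT `|B| k_int; apply: eq_integrable.
Qed.

Lemma measurable_le_fun (x : R) : measurable_fun setT (fun r : R => (r <= x)%R%:R : R).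
Proof.
have -> : (fun r : R => (r <= x)%R%:R : R) = \1_`]-oo, x].
  apply/funext => r; rewrite indicE; congr (_%:R).
  by apply/esym; case: (leP r x) => rx; [rewrite mem_set//= in_itv | rewrite memNset//= in_itv /= leNgt rx].
exact: measurable_indic.
Qed.

Lemma measurable_rev (f : R -> R) (t : R) : measurable_fun setT f ->
  measurable_fun setT (fun r : R => f (t - r)).
Proof. by move=> mf; apply: (measurableT_comp mf); exact: measurable_funB. Qed.

Lemma kM_bound (f : R -> R) (B : R) : measurable_fun setT f ->
  (forall r, 0 <= r -> `|f r| <= B) -> `|\int[leb]_r (k r * f r)| <= mass * B.
Proof.
move=> mf fB; have i := kM_integrable mf fB.
apply: (le_trans (le_normr_Rintegral _ i)) => //.
rewrite /mass -RintegralZr//; apply: le_Rintegral => //.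
- exact: (integrable_norm i).
- have := integrableZr measurableT B k_int; apply: eq_integrable => //.
- move=> r _; rewrite normrM (ger0_norm (k_ge0 r)).
  have [r0|r0] := ltP r 0; first by rewrite k_neg// !mul0r.
  by rewrite ler_wpM2l// fB.
Qed.

Lemma cumul_integrable x : leb.-integrable setT (EFin \o (fun r => k r * (r <= x)%R%:R)).
Proof.
apply: (@kM_integrable (fun r => (r <= x)%R%:R) 1); first exact: measurable_le_fun.
by move=> r _; rewrite normr_nat lern1 leq_b1.
Qed.

Lemma cumul_neg x : x < 0 -> cumul x = 0.
Proof.
move=> x0; rewrite /cumul (_ : (fun r => _) = fun=> 0).
  by rewrite Rintegral_cst// mul0r.
apply/funext => r; have [rx|_] := leP r x; last by rewrite mulr0.
by rewrite k_neg ?mul0r// (le_lt_trans rx).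
Qed.

Lemma cumul_ge0 x : 0 <= cumul x.
Proof. by apply: Rintegral_ge0 => r _; rewrite mulr_ge0. Qed.

Lemma cumul_nd x y : x <= y -> cumul x <= cumul y.
Proof.
move=> xy; apply: le_Rintegral; [by []|exact: cumul_integrable|exact: cumul_integrable|].
move=> r _; rewrite ler_wpM2l// ler_nat.
by case: (leP r x) => // /le_trans -> //.
Qed.

Lemma cumul_le_mass x : cumul x <= mass.
Proof.
apply: le_Rintegral => //; first exact: cumul_integrable.
by move=> r _; rewrite ler_piMr// lern1 leq_b1.
Qed.

Lemma R_dct (F : nat -> R -> R) (f g : R -> R) :
  (forall n, measurable_fun setT (F n)) -> leb.-integrable setT (EFin \o g) ->
  (forall n r, `|F n r| <= g r) -> (forall r, F ^~ r @ \oo --> f r) ->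
  leb.-integrable setT (EFin \o f) /\
  (fun n => \int[leb]_r F n r) @ \oo --> \int[leb]_r f r.
Proof.
move=> mF ig Fg Ff.
have mf : measurable_fun setT f by exact: (measurable_fun_cvg mF).
have [] := @dominated_convergence _ _ _ leb setT measurableT (fun n => EFin \o F n)
  (EFin \o f) (EFin \o g).
- by move=> n; apply/measurable_EFinP; exact: mF.
- by apply/measurable_EFinP; exact: mf.
- by apply: aeW => w _; apply: cvg_comp (Ff w) _ => //; exact: cvg_EFin.
- exact: ig.
- by apply: aeW => w n _; rewrite lee_fin.
move=> fi _ h; split => //; move: h.
rewrite -[X in _ --> X -> _]fineK; last exact: integrable_fin_num.
by move=> /fine_cvgP[_]; exact: id.
Qed.

Lemma cumul_cvg (e : R) : 0 < e -> exists2 x, 0 <= x & mass - cumul x <= e.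
Proof.
move=> e0; have [] := @R_dct (fun n r => k r * (r <= n%:R)%R%:R) k k.
- by move=> n; apply: measurable_funM => //; exact: measurable_le_fun.
- exact: k_int.
- by move=> n r; rewrite normrM normr_nat (ger0_norm (k_ge0 r)) ler_piMr// lern1 leq_b1.
- move=> r; apply: cvg_near_cst; near=> n.
  rewrite (_ : (r <= n%:R) = true) ?mulr1//; apply/ltW.
  near: n; exact: nbhs_infty_gtr.
move=> _ /cvgrPdist_le/(_ e e0)[n _ /(_ n (leqnn n))] h.
by exists n%:R => //; rewrite (le_trans (ler_norm _)).
Unshelve. all: by end_near. Qed.

(** The part of [k] above the level [n] has mass at most [e / 2] for some [n], by dominated
    convergence; the part below it contributes at most [n (y - x)]. *)
Lemma cumul_unif (e : R) : 0 < e -> exists2 dl, 0 < dl &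
  forall x y, x <= y -> y <= x + dl -> cumul y - cumul x <= e.
Proof.
move=> e0; have [] := @R_dct (fun n r => Num.max (k r - n%:R) 0) (fun=> 0) k.
- by move=> n; apply: measurable_maxr => //; exact: measurable_funB.
- exact: k_int.
- move=> n r; have [h|h] := leP (k r - n%:R) 0; first by rewrite normr0.
  by rewrite gtr0_norm// gerBl.
- move=> r; apply: cvg_near_cst; near=> n; apply/max_idPr.
  rewrite subr_le0 ltW//; near: n; exact: nbhs_infty_gtr.
move=> _; rewrite Rintegral_cst// mul0r => /cvgrPdist_le/(_ (e / 2)).
rewrite divr_gt0// => /(_ isT)[n _ /(_ n (leqnn n))].
set J := \int[leb]_r _; rewrite sub0r normrN => hJ.
have mtail : measurable_fun setT (fun r => Num.max (k r - n%:R) 0).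
  by apply: measurable_maxr => //; exact: measurable_funB.
have itail : leb.-integrable setT (EFin \o (fun r => Num.max (k r - n%:R) 0)).
  apply: (@le_integrable _ _ _ leb _ measurableT) k_int; first exact/measurable_EFinP.
  move=> r _ /=; rewrite lee_fin (ger0_norm (k_ge0 r)).
  have [h|h] := leP (k r - n%:R) 0; first by rewrite normr0.
  by rewrite gtr0_norm// gerBl.
exists (e / (2 * n.+1%:R)); first by rewrite divr_gt0// mulr_gt0.
move=> x y xy yx.
have iI : leb.-integrable setT (EFin \o (\1_`]x, y] : R -> R)).
  exact: integrable_indic_itv.
rewrite /cumul -RintegralB//; [|exact: cumul_integrable|exact: cumul_integrable].
apply: (@le_trans _ _ (\int[leb]_r (Num.max (k r - n%:R) 0 + n%:R * \1_`]x, y] r))).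
  apply: le_Rintegral => //.
  - have := integrableB measurableT (cumul_integrable y) (cumul_integrable x).
    by apply: eq_integrable.
  - have := integrableD measurableT itail (integrableZl measurableT n%:R iI).
    by apply: eq_integrable.
  - move=> r _; rewrite indicE.
    have [rx|rx] := leP r x.
      rewrite (le_trans rx xy) subrr memNset ?mulr0 ?addr0 ?le_max ?lexx ?orbT//.
      by rewrite /= in_itv /= ltNge rx.
    have [ry|ry] := leP r y; last first.
      rewrite !mulr0 subr0 memNset ?mulr0 ?addr0 ?le_max ?lexx ?orbT//.
      by rewrite /= in_itv /= rx leNgt ry.
    rewrite mem_set; last by rewrite /= in_itv /= rx ry.
    rewrite mulr1 mulr0 subr0 mulr1 -lerBlDr le_max lexx//.
rewrite RintegralD//; last first.
  by have := integrableZl measurableT n%:R iI; apply: eq_integrable.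
rewrite RintegralZl// -/J.
have -> : \int[leb]_r \1_`]x, y] r = y - x.
  rewrite /Rintegral integral_indic// setIT; transitivity (fine (lebesgue_measure [set` `]x, y]])) => //; rewrite lebesgue_measure_itv /= lte_fin.
  case: ltP => //= ?.
  by apply/esym/eqP; rewrite subr_eq0 eq_le xy andbT.
have {}yx : y - x <= e / (2 * n.+1%:R) by rewrite lerBlDl.
apply: (@le_trans _ _ (e / 2 + n.+1%:R * (e / (2 * n.+1%:R)))).
  apply: lerD; first by rewrite (le_trans (ler_norm _)).
  by rewrite ler_pM// ?subr_ge0// ler_nat.
have -> : n.+1%:R * (e / (2 * n.+1%:R)) = e / 2 by field; rewrite ?pnatr_eq0.
by rewrite -splitr.
Unshelve. all: by end_near. Qed.

Lemma conv_step (s t : R) : kconv (fun x => (s <= x)%R%:R) t = cumul (t - s).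
Proof.
by apply: eq_Rintegral => r _; congr (_ * _%:R); rewrite lerBrDr lerBrDr addrC.
Qed.

Lemma conv_integrable (f : R -> R) (B t : R) : measurable_fun setT f ->
  (forall s, s <= t -> `|f s| <= B) ->
  leb.-integrable setT (EFin \o (fun r => k r * f (t - r))).
Proof.
move=> mf fB; apply: (@kM_integrable (fun r => f (t - r)) B).
  exact: measurable_rev.
by move=> r r0; apply: fB; rewrite gerBl.
Qed.

Lemma conv_lin (a b : R) (f g : R -> R) (B C t : R) : measurable_fun setT f -> measurable_fun setT g ->
  (forall s, s <= t -> `|f s| <= B) -> (forall s, s <= t -> `|g s| <= C) ->
  kconv (fun s => a * f s + b * g s) t = a * kconv f t + b * kconv g t.
Proof.
move=> mf mg fB gC; have i1 := conv_integrable mf fB; have i2 := conv_integrable mg gC.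
rewrite /kconv -RintegralZl// -RintegralZl// -RintegralD//.
- by apply: eq_Rintegral => r _; ring.
- by have := integrableZl measurableT a i1; apply: eq_integrable.
- by have := integrableZl measurableT b i2; apply: eq_integrable.
Qed.

(** Allowing two functions and two times covers both uses: [g = 0] yields a bound for the supremum,
    [f = g] carries a modulus of continuity through the convolution. *)
Lemma conv_diff (f g : R -> R) (B C s t w : R) : measurable_fun setT f -> measurable_fun setT g ->
  (forall x, x <= s -> `|f x| <= B) -> (forall x, x <= t -> `|g x| <= C) ->
  (forall r, 0 <= r -> `|f (s - r) - g (t - r)| <= w) ->
  `|kconv f s - kconv g t| <= mass * w.
Proof.
move=> mf mg fB gC fg.
rewrite /kconv -RintegralB//; [|exact: conv_integrable fB|exact: conv_integrable gC].
rewrite (_ : (fun r => _) = fun r => k r * (f (s - r) - g (t - r))).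
  apply: kM_bound => //; apply: measurable_funB; exact: measurable_rev.
by apply/funext => r; rewrite mulrBr.
Qed.

(** Lags up to [D] cost the modulus [w]; longer lags cost [2 B] times the mass of the kernel beyond
    [D]. *)
Lemma conv_approx (f : R -> R) (B D w T t : R) : measurable_fun setT f -> t <= T -> 0 <= B -> 0 <= w ->
  (forall x, x <= T -> `|f x| <= B) ->
  (forall x y, x <= y -> y <= T -> y - x <= D -> `|f y - f x| <= w) ->
  `|mass * f t - kconv f t| <= mass * w + 2 * B * (mass - cumul D).
Proof.
move=> mf tT B0 w0 fB fw.
have fBt x : x <= t -> `|f x| <= B by move=> xt; apply: fB; exact: le_trans tT.
have i1 := conv_integrable mf fBt.
rewrite /mass -RintegralZr// /kconv -RintegralB//; last first.
  by have := integrableZr measurableT (f t) k_int; apply: eq_integrable.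
rewrite (_ : (fun r => _) = fun r => k r * (f t - f (t - r))); last first.
  by apply/funext => r; rewrite mulrBr.
have i2 : leb.-integrable setT (EFin \o (fun r => k r * (f t - f (t - r)))).
  apply: (@kM_integrable _ (2 * B)).
    by apply: measurable_funB => //; exact: measurable_rev.
  move=> r r0; rewrite (le_trans (ler_normB _ _))// mulr_natl mulr2n lerD// fBt//.
  by rewrite gerBl.
apply: (le_trans (le_normr_Rintegral _ i2)) => //.
have i3 : leb.-integrable setT (EFin \o (fun r => w * k r)).
  by have := integrableZl measurableT w k_int; apply: eq_integrable.
have i4 : leb.-integrable setT (EFin \o (fun r => k r - k r * (r <= D)%R%:R)).
  by have := integrableB measurableT k_int (cumul_integrable D); apply: eq_integrable.
have i5 : leb.-integrable setT (EFin \o (fun r => 2 * B * (k r - k r * (r <= D)%R%:R))).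
  by have := integrableZl measurableT (2 * B) i4; apply: eq_integrable.
rewrite [_ * w]mulrC -RintegralZl// /cumul -RintegralB//; last exact: cumul_integrable.
rewrite -RintegralZl// -RintegralD//; apply: le_Rintegral => //.
- exact: (integrable_norm i2).
- by have := integrableD measurableT i3 i5; apply: eq_integrable.
move=> r _; rewrite normrM (ger0_norm (k_ge0 r)).
have [r0|r0] := ltP r 0; first by rewrite k_neg// !(mul0r, mulr0, subr0, addr0).
have [rD|rD] := leP r D.
  rewrite mulr1 subrr mulr0 addr0 mulrC ler_wpM2r// fw ?gerBl//.
  by rewrite opprB addrC subrK.
rewrite !mulr0 subr0 -mulrDl mulrC ler_wpM2r//.
apply: (@le_trans _ _ (B + B)); last by rewrite mulr_natl mulr2n lerDr.
by rewrite (le_trans (ler_normB _ _))// lerD// fBt// gerBl.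
Qed.

End convolution.

(** * Stopped counting processes and compensators *)

Section translation.
Context {R : realType}.
Notation leb := (@lebesgue_measure R).

(** The image measure agrees with Lebesgue measure on half-open intervals, and this characterises
    Lebesgue measure. *)
Lemma lebesgue_measure_translate (r : R) (A : set R) : measurable A ->
  leb ((fun x => x - r) @^-1` A) = leb A.
Proof.
move=> mA.
have mshift : measurable_fun setT (fun x : measurableTypeR R => (x : R) - r : measurableTypeR R).
  exact: measurable_funB.
pose shift_mixin := isMeasurableFun.Build _ _ _ _ _ mshift.
pose shift_mfun : {mfun _ >-> _} := HB.pack (fun x : measurableTypeR R => (x : R) - r : measurableTypeR R) shift_mixin.
suff : leb A = pushforward leb shift_mfun A by [].
apply: lebesgue_measure_unique => // X [[a b] _ <-].
rewrite /pushforward /=.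
transitivity (leb [set` `]a + r, b + r]]); last first.
  by congr (leb _); apply/seteqP; split => x /=; rewrite !in_itv /= ltrBrDr lerBlDr.
rewrite !lebesgue_measure_itv /= !lte_fin ltrD2r; case: ifPn => // _.
by rewrite -!EFinB; congr (_%:E); ring.
Qed.

Lemma ge0_integral_translate (r : R) (f : R -> \bar R) : measurable_fun setT f ->
  (forall x, 0 <= f x)%E -> (\int[leb]_x f (x - r)%R = \int[leb]_x f x)%E.
Proof.
move=> mf f0.
have mshift : measurable_fun setT (fun x : measurableTypeR R => (x : R) - r : measurableTypeR R).
  exact: measurable_funB.
have := @ge0_integral_pushforward _ _ _ _ R _ mshift leb setT f measurableT mf.
move=> /(_ (fun y _ => f0 y)); rewrite preimage_setT => <-.
apply: eq_measure_integral => A mA _.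
exact: lebesgue_measure_translate.
Qed.

Lemma in_set_itv (i : interval R) s : (s \in [set` i]) = (s \in i).
Proof. by apply/idP/idP; rewrite inE. Qed.

(** The contribution to a compensator at time [t] of a single jump at time [r]. *)
Lemma translated_kernel_integral (k : R -> R) (r t : R) :
  (forall x, 0 <= k x) -> (forall x, x < 0 -> k x = 0) ->
  leb.-integrable setT (EFin \o k) -> 0 <= r ->
  (\int[leb]_(s in `[0%R, t]) ((r < s)%R%:R * k (s - r))%:E = (cumul k (t - r))%:E)%E.
Proof.
move=> k0 kn ik r0.
have mk : measurable_fun setT k by apply/measurable_EFinP; exact: measurable_int ik.
transitivity (\int[leb]_(s in `]r, t]) (k (s - r))%:E)%E.
  rewrite integral_mkcond [RHS]integral_mkcond; apply: eq_integral => s _.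
  rewrite !patchE !in_set_itv !in_itv /=.
  have [rs|rs] := ltP r s; last by rewrite mul0r; case: ifP.
  by rewrite (le_trans r0 (ltW rs)) /= mul1r.
rewrite integral_itv_obnd_cbnd; last first.
  apply: measurable_funTS; apply/measurable_EFinP.
  by apply: (measurableT_comp mk); exact: measurable_funB.
transitivity (\int[leb]_s (k (s - r) * (s - r <= t - r)%R%:R)%:E)%E.
  rewrite integral_mkcond; apply: eq_integral => s _; rewrite patchE lerD2r in_set_itv in_itv /=.
  have [rs|rs] := leP r s; last by rewrite kn ?mul0r// subr_lt0.
  by case: (s <= t); rewrite ?mulr1 ?mulr0.
rewrite (@ge0_integral_translate r (fun s => (k s * (s <= t - r)%R%:R)%:E)).
- rewrite /cumul /Rintegral fineK//.
  by apply: integrable_fin_num => //; exact: cumul_integrable.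
- by apply: (@measurable_int _ _ _ leb); exact: cumul_integrable.
- by move=> x; rewrite lee_fin mulr_ge0.
Qed.

End translation.

(** * Explicit intensity and compensator up to a jump time *)

Section stopped_processes.
Context {R : realType} d (Omega : measurableType d) (dim : nat).
Notation leb := (@lebesgue_measure R).
Variables (tau : nat -> Omega -> \bar R) (Z : nat -> Omega -> 'I_dim).
Variables (mu : 'I_dim -> R) (phi : 'I_dim -> 'I_dim -> R -> R).

Hypothesis tau_gt0 : forall n w, (0 < tau n w)%E.
Hypothesis tau_le : forall n w, (tau n w <= tau n.+1 w)%E.
Hypothesis tau_lt : forall n w, (tau n w < +oo)%E -> (tau n w < tau n.+1 w)%E.
Hypothesis mu_ge0 : forall i, 0 <= mu i.
Hypothesis phi_ge0 : forall i j (t : R), 0 <= t -> 0 <= phi i j t.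
Hypothesis phi_int : forall i j, leb.-integrable `[0, +oo[ (EFin \o phi i j).

(* the kernel extended by 0 to negative times *)
Definition ext0 (f : R -> R) : R -> R := f \_ `[0, +oo[.

Lemma ext0E f x : 0 <= x -> ext0 f x = f x.
Proof. by move=> x0; rewrite /ext0 patchE mem_set//= in_itv /= x0. Qed.

Lemma ext0_neg f x : x < 0 -> ext0 f x = 0.
Proof. by move=> x0; rewrite /ext0 patchE memNset//= in_itv /= leNgt x0. Qed.

Lemma ext0_ge0 f : (forall x, 0 <= x -> 0 <= f x) -> forall x, 0 <= ext0 f x.
Proof. by move=> f0 x; have [x0|x0] := ltP x 0; [rewrite ext0_neg|rewrite ext0E// f0]. Qed.

Lemma ext0_integrable f : leb.-integrable `[0, +oo[ (EFin \o f) ->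
  leb.-integrable setT (EFin \o ext0 f).
Proof.
move=> fi; have := (integrable_mkcond (mu := leb) (EFin \o f) (measurable_itv `[0%R, +oo[)).1 fi.
apply: eq_integrable => // x _; rewrite /= /ext0 !patchE.
by case: ifP.
Qed.

Lemma mass_ext0 f : mass (ext0 f) = L1norm f.
Proof. by rewrite /mass /L1norm [RHS]Rintegral_mkcond. Qed.

Lemma tau_nd m n w : (m <= n)%N -> (tau m w <= tau n w)%E.
Proof.
elim: n => [|n IH]; first by rewrite leqn0 => /eqP ->.
rewrite leq_eqVlt => /predU1P[->//|]; rewrite ltnS => /IH h.
exact: le_trans h (tau_le n w).
Qed.

Lemma tau_gt m n w : (m < n)%N -> (tau m w < +oo)%E -> (tau m w < tau n w)%E.
Proof. by move=> mn h; apply: lt_le_trans (tau_lt h) (tau_nd w mn). Qed.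

Definition stopped_time (n : nat) (t : R) (w : Omega) : R := fine (Order.min t%:E (tau n w)).

Definition stopped_count (n : nat) (i : 'I_dim) (t : R) (w : Omega) : R :=
  \sum_(k < n.+1) ((tau k w <= t%:E)%E && (Z k w == i))%:R.

(** Jump [n] occurs at the stopping time and excites nothing before it, so the sum stops at [k < n],
    whereas the count runs up to [n]. The indicator matters when [tau k w = +oo]: then [fine]
    returns 0, and [cumul] alone would count a jump at the origin. *)
Definition stopped_comp (n : nat) (i : 'I_dim) (t : R) (w : Omega) : R :=
  mu i * stopped_time n t w +
  \sum_(k < n) (tau k w <= t%:E)%E%:R *
     cumul (ext0 (phi i (Z k w))) (stopped_time n t w - fine (tau k w)).

Lemma stopped_timeE n t w : 0 <= t -> (stopped_time n t w)%:E = Order.min t%:E (tau n w).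
Proof.
move=> t0; rewrite /stopped_time fineK// minEle; case: ifPn => //; rewrite -ltNge => h.
rewrite fin_numE; apply/andP; split; apply/eqP => e.
  by have := tau_gt0 n w; rewrite e.
by move: h; rewrite e.
Qed.

Lemma stopped_time_ge0 n t w : 0 <= t -> 0 <= stopped_time n t w.
Proof.
by move=> t0; rewrite -lee_fin stopped_timeE// le_min lee_fin t0 ltW.
Qed.

Lemma stopped_time_le n t w : 0 <= t -> stopped_time n t w <= t.
Proof. by move=> t0; rewrite -lee_fin stopped_timeE// ge_min lexx. Qed.

Lemma stopped_time_id n t w : 0 <= t -> (t%:E < tau n w)%E -> stopped_time n t w = t.
Proof. by move=> t0 h; rewrite /stopped_time minEle ltW. Qed.

Lemma series_finite (u : nat -> \bar R) n : (forall k, (n <= k)%N -> u k = 0%E) ->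
  (\sum_(0 <= k <oo) u k = \sum_(k < n) u k)%E.
Proof.
move=> u0; apply: lim_near_cst => //; exists n => // m /= nm.
rewrite big_mkord -(subnKC nm) big_split_ord /= [X in (_ + X)%E]big1 ?adde0//.
by move=> i _; rewrite u0// leq_addr.
Qed.

(** A jump [k > n] before [t] would give [tau k <= t <= tau n < tau n.+1 <= tau k]. *)
Lemma counting_processE n i t w : (t%:E <= tau n w)%E ->
  counting_process tau Z i t w = (stopped_count n i t w)%:E.
Proof.
move=> tn; rewrite /counting_process (@series_finite _ n.+1); last first.
  move=> k nk; case: leP => //= h; exfalso.
  have tkn := tau_nd w (ltnW nk).
  have tn' : (tau n w < +oo)%E by rewrite (le_lt_trans (le_trans tkn h))// ltry.
  have := tau_lt tn'; have := tau_nd w nk => h1 h2.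
  by have := lt_le_trans h2 (le_trans h1 (le_trans h tn)); rewrite ltxx.
by rewrite /stopped_count -sumEFin.
Qed.

Lemma counting_process_stopped n i t w : 0 <= t ->
  counting_process tau Z i (stopped_time n t w) w = (stopped_count n i t w)%:E.
Proof.
move=> t0; rewrite (@counting_processE n); last first.
  by rewrite stopped_timeE// ge_min lexx orbT.
congr (_%:E); apply: eq_bigr => k _; congr ((_ && _)%:R).
rewrite stopped_timeE// le_min (_ : (tau k w <= tau n w)%E) ?andbT//.
by apply: tau_nd; rewrite -ltnS.
Qed.

(** The domain []0, s[] of the intensity is open at [s], hence the strict inequality; for
    [s <= tau n] it excludes jump [n] and all later ones, and the series of Dirac integrals becomes
    a finite sum. *)
Lemma intensityE n i s w : (s%:E <= tau n w)%E ->
  intensity tau Z mu phi i s w = (mu i + \sum_(k < n) (tau k w < s%:E)%E%:R *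
     ext0 (phi i (Z k w)) (s - fine (tau k w)))%:E.
Proof.
move=> sn; rewrite /intensity EFinD; congr (_ + _)%E.
have mphi i' j : measurable_fun setT (ext0 (phi i' j)).
  by apply/measurable_EFinP; apply: (@measurable_int _ _ _ leb); exact: ext0_integrable.
transitivity (\sum_(j < dim) \sum_(k < n) ((Z k w == j)%:R * ((tau k w < s%:E)%E%:R *
     ext0 (phi i j) (s - fine (tau k w))))%:E)%E.
  apply: eq_bigr => j _.
  rewrite /jump_measure ge0_integral_measure_series//=; last 2 first.
  - by move=> u; rewrite in_itv /= => /andP[_ us]; rewrite lee_fin phi_ge0// subr_ge0 ltW.
  - apply/measurable_EFinP; apply: (eq_measurable_fun (fun u : R => ext0 (phi i j) (s - u))).
      move=> u; rewrite inE /= in_itv /= => /andP[_ us].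
      by rewrite ext0E// subr_ge0 ltW.
    by apply: measurable_funTS; apply: (measurableT_comp (mphi i j)); exact: measurable_funB.
  have term k : (\int[if ((tau k w < +oo)%E && (Z k w == j))
      then dirac (fine (tau k w)) : {measure set R -> \bar R} else mzero]_(u in `]0%R, s[)
        (phi i j (s - u))%:E = ((Z k w == j)%:R * ((tau k w < s%:E)%E%:R *
     ext0 (phi i j) (s - fine (tau k w))))%:E)%E.
    have [->|tk] := eqVneq (tau k w) +oo%E.
      by rewrite ltxx /= integral_measure_zero//= mul0r mulr0.
    have tk' : (tau k w < +oo)%E by rewrite lt_neqAle tk leey.
    rewrite tk'; case: (Z k w == j) => /=; last by rewrite integral_measure_zero// mul0r.
    have tkE : tau k w = (fine (tau k w))%:E.
      by rewrite fineK// fin_numE tk andbT gt_eqF// (lt_trans _ (tau_gt0 k w))// ltNy0.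
    have r0 : 0 < fine (tau k w) by rewrite -lte_fin -tkE.
    set r := fine (tau k w) in tkE r0 *; rewrite tkE lte_fin mul1r.
    transitivity (\int[\d_ r]_(u in `]0%R, s[) (ext0 (phi i j) (s - u))%:E)%E.
      apply: eq_integral => u; rewrite inE /= in_itv /= => /andP[_ us].
      by rewrite ext0E// subr_ge0 ltW.
    rewrite integral_dirac//; last first.
      apply/measurable_EFinP/measurable_funTS.
      by apply: (measurableT_comp (mphi i j)); exact: measurable_funB.
    rewrite diracE -EFinM; congr ((_ * _)%:E); congr (_%:R).
    case: (ltP r s) => rs; first by rewrite mem_set//= in_itv /= r0.
    by rewrite memNset//= in_itv /= r0 ltNge rs.
  rewrite (eq_eseriesr (g := fun k => ((Z k w == j)%:R * ((tau k w < s%:E)%E%:R *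
     ext0 (phi i j) (s - fine (tau k w))))%:E)); last by move=> k _; exact: term.
  apply: series_finite => k nk.
  by rewrite ltNge (le_trans sn (tau_nd w nk)) /= mul0r mulr0.
rewrite exchange_big /= -sumEFin; apply: eq_bigr => k _.
rewrite (bigD1 (Z k w))//= eqxx mul1r big1 ?adde0// => j jZ.
by rewrite eq_sym (negbTE jZ) mul0r.
Qed.

Lemma tau_fine_gt0 k w (t : R) : (tau k w <= t%:E)%E ->
  0 < fine (tau k w) /\ tau k w = (fine (tau k w))%:E.
Proof.
move=> h; have e : tau k w = (fine (tau k w))%:E.
  rewrite fineK// fin_numE; apply/andP; split; apply/eqP => e.
    by have := tau_gt0 k w; rewrite e.
  by move: h; rewrite e.
by split=> //; rewrite -lte_fin -e.
Qed.

(** By positivity the integral may be taken jump by jump, and [cumul] is a primitive of each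
    translated kernel. *)
Lemma compensatorE n i t w : 0 <= t ->
  (\int[leb]_(s in `[0%R, stopped_time n t w]) intensity tau Z mu phi i s w =
   (stopped_comp n i t w)%:E)%E.
Proof.
move=> t0; set t' := stopped_time n t w.
have t'0 : 0 <= t' by exact: stopped_time_ge0.
have mphi i' j : measurable_fun setT (ext0 (phi i' j)).
  by apply/measurable_EFinP; apply: (@measurable_int _ _ _ leb); exact: ext0_integrable.
have k0 j x : 0 <= ext0 (phi i j) x by apply: ext0_ge0 => y; exact: phi_ge0.
pose G k s := ((tau k w < s%:E)%E%:R * ext0 (phi i (Z k w)) (s - fine (tau k w)))%:E.
transitivity (\int[leb]_(s in `[0%R, t']) ((mu i)%:E + \sum_(k < n) G k s))%E.
  apply: eq_integral => s; rewrite inE /= in_itv /= => /andP[_ st].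
  rewrite (@intensityE n) ?EFinD ?sumEFin//.
  by apply: (@le_trans _ _ t'%:E); rewrite ?lee_fin// stopped_timeE// ge_min lexx orbT.
have mG k : measurable_fun setT (G k).
  apply/measurable_EFinP; apply: measurable_funM; last first.
    by apply: (measurableT_comp (mphi _ _)); exact: measurable_funB.
  case: (tau k w) => [r||].
  - have -> : (fun s : R => (r%:E < s%:E)%E%:R : R) = \1_`]r, +oo[.
      apply/funext => s; rewrite indicE lte_fin; congr (_%:R); apply/esym.
      by case: (ltP r s) => rs; [rewrite mem_set//= in_itv /= rs|rewrite memNset//= in_itv /= ltNge rs].
    exact: measurable_indic.
  - rewrite (_ : (fun s : R => _) = fun=> 0); first exact: measurable_cst.
    by apply/funext => s; rewrite ltNge leey.
  - rewrite (_ : (fun s : R => _) = fun=> 1); first exact: measurable_cst.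
    by apply/funext => s; rewrite ltNyr.
have G0 k s : (0 <= G k s)%E by rewrite lee_fin mulr_ge0.
rewrite ge0_integralD//; last 3 first.
- by move=> s _; rewrite lee_fin.
- by move=> s _; apply: sume_ge0.
- by apply: emeasurable_sum => k; apply: measurable_funTS; exact: mG.
rewrite integral_cst//= lebesgue_measure_itv /= lte_fin.
have -> : (if (0 < t')%R then (t'%:E + - 0%:E)%E else 0%E) = t'%:E.
  case: ifPn => [_|]; first by rewrite oppe0 adde0.
  by rewrite -leNgt => h; congr (_%:E); apply/eqP; rewrite eq_le t'0.
rewrite ge0_integral_sum//; last by move=> k; apply: measurable_funTS; exact: mG.
rewrite /stopped_comp EFinD EFinM -sumEFin; congr (_ + _)%E.
apply: eq_bigr => k _; rewrite /G.
case: (leP (tau k w) t%:E) => [tk|tk]; last first.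
  rewrite mul0r (eq_integral (cst 0%E)) ?integral_cst ?mul0e//.
  move=> s; rewrite inE /= in_itv /= => /andP[_ st].
  rewrite ltNge (le_trans _ (ltW tk)) ?mul0r// lee_fin (le_trans st)//.
  exact: stopped_time_le.
have [r0 e] := tau_fine_gt0 tk; rewrite mul1r.
rewrite -(@translated_kernel_integral _ (ext0 (phi i (Z k w))) (fine (tau k w)) t')//.
- by apply: eq_integral => s _; rewrite {1}e lte_fin.
- by move=> x; exact: ext0_neg.
- exact: ext0_integrable.
- exact: ltW.
Qed.

Lemma compensatedE n i t w : 0 <= t ->
  compensated tau Z mu phi n i t w = (stopped_count n i t w - stopped_comp n i t w)%:E.
Proof.
move=> t0; rewrite /compensated -/(stopped_time n t w).
by rewrite counting_process_stopped// compensatorE// EFinB.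
Qed.

End stopped_processes.

(** * Quadratic variation along dyadic grids *)

Section dyadic_grid.
Context {R : realType}.

Definition grid (s t : R) (l j : nat) : R := s + (t - s) * (j%:R / 2 ^+ l).

Lemma grid0 s t l : grid s t l 0 = s.
Proof. by rewrite /grid mul0r mulr0 addr0. Qed.

Lemma gridN s t l : grid s t l (2 ^ l) = t.
Proof. by rewrite /grid natrX divff ?expf_neq0// mulr1 addrC subrK. Qed.

Lemma grid_step s t l j : grid s t l j.+1 - grid s t l j = (t - s) / 2 ^+ l.
Proof. by rewrite /grid -natr1; field; rewrite expf_neq0. Qed.

Lemma grid_nd s t l i j : s <= t -> (i <= j)%N -> grid s t l i <= grid s t l j.
Proof.
move=> st ij; rewrite lerD2l ler_wpM2l ?subr_ge0// ler_pM2r ?ler_nat//.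

Qed.

Lemma grid_ge s t l j : s <= t -> s <= grid s t l j.
Proof. by move=> st; rewrite -{1}(grid0 s t l) grid_nd. Qed.

Lemma grid_le s t l j : s <= t -> (j <= 2 ^ l)%N -> grid s t l j <= t.
Proof. by move=> st jl; rewrite -{2}(gridN s t l) grid_nd. Qed.

Lemma grid_double s t l j : grid s t l.+1 (2 * j)%N = grid s t l j.
Proof. by rewrite /grid natrM exprS; congr (_ + _ * _); field; rewrite expf_neq0. Qed.

Lemma mesh_small (x e : R) : 0 < e -> \forall l \near \oo, x / 2 ^+ l <= e.
Proof.
move=> e0; near=> l; rewrite ler_pdivrMr ?exprn_gt0//.
apply: (@le_trans _ _ (e * l%:R)).
  by rewrite mulrC -ler_pdivrMr// ltW//; near: l; exact: nbhs_infty_gtr.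
by rewrite ler_pM2l// -natrX ler_nat ltnW// ltn_expl.
Unshelve. all: by end_near. Qed.

Lemma finite_common_bound (I : finType) (Q : I -> R -> Prop) :
  (forall i x y, 0 < x -> x <= y -> Q i y -> Q i x) ->
  (forall i, exists2 x, 0 < x & Q i x) -> exists2 x, 0 < x & forall i, Q i x.
Proof.
move=> Qle Qex.
suff [x x0 Qx] : exists2 x, 0 < x & forall i, i \in enum I -> Q i x.
  by exists x => // i; apply: Qx; rewrite mem_enum.
elim: (enum I) => [|i s [x x0 Qx]]; first by exists 1.
have [y y0 Qy] := Qex i; exists (Num.min x y); first by rewrite lt_min x0.
move=> j; rewrite inE => /predU1P[->|js].
  by apply: Qle Qy; rewrite ?lt_min ?x0 ?y0// ge_min lexx orbT.
by apply: Qle (Qx j js); rewrite ?lt_min ?x0 ?y0// ge_min lexx.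
Qed.

Lemma telescope_grid (f : R -> R) s t l :
  \sum_(j < 2 ^ l) (f (grid s t l j.+1) - f (grid s t l j)) = f t - f s.
Proof.
rewrite -(big_mkord xpredT (fun j => f (grid s t l j.+1) - f (grid s t l j))).
by rewrite telescope_sumr// gridN grid0.
Qed.

(* Only the jump part [A] of [A - B] contributes to the quadratic variation. *)
Lemma quadratic_variation_limit (A B V A' B' : R -> R) s t : s <= t ->
  (\forall l \near \oo, forall j, (j < 2 ^ l)%N ->
     (A (grid s t l j.+1) - A (grid s t l j)) ^+ 2 = V (grid s t l j.+1) - V (grid s t l j)) ->
  (forall x y, s <= x -> x <= y -> `|A y - A x| <= A' y - A' x) ->
  (forall x y, s <= x -> x <= y -> `|B y - B x| <= B' y - B' x) ->
  (forall e, 0 < e -> \forall l \near \oo, forall j, (j < 2 ^ l)%N ->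
     `|B (grid s t l j.+1) - B (grid s t l j)| <= e) ->
  (fun l => \sum_(j < 2 ^ l) ((A (grid s t l j.+1) - B (grid s t l j.+1)) -
      (A (grid s t l j) - B (grid s t l j))) ^+ 2) @ \oo --> V t - V s.
Proof.
move=> st hV hA hB hBe; apply/cvgrPdist_le => e e0.
have A'0 : 0 <= A' t - A' s by rewrite (le_trans _ (hA s t _ _))//.
have B'0 : 0 <= B' t - B' s by rewrite (le_trans _ (hB s t _ _))//.
set K := 2 * (A' t - A' s) + (B' t - B' s) + 1.
have K0 : 0 < K by rewrite ltr_wpDl// addr_ge0// mulr_ge0.
near=> l.
have hl1 : forall j, (j < 2 ^ l)%N -> (A (grid s t l j.+1) - A (grid s t l j)) ^+ 2 =
  V (grid s t l j.+1) - V (grid s t l j) by near: l.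
have hl2 : forall j, (j < 2 ^ l)%N -> `|B (grid s t l j.+1) - B (grid s t l j)| <= e / K.
  by near: l; apply: hBe; rewrite divr_gt0.
rewrite -(telescope_grid V s t l) -sumrB (le_trans (ler_norm_sum _ _ _))//.
apply: (@le_trans _ _ (\sum_(j < 2 ^ l) (e / K *
   (2 * (A' (grid s t l j.+1) - A' (grid s t l j)) + (B' (grid s t l j.+1) - B' (grid s t l j)))))).
  apply: ler_sum => j _; rewrite -hl1//.
  have := hl2 j (ltn_ord j).
  have := hA _ _ (grid_ge l j st) (grid_nd l st (leqnSn j)).
  have := hB _ _ (grid_ge l j st) (grid_nd l st (leqnSn j)).
  set a := A _ - A _; set b := B _ - B _; set a' := A' _ - A' _; set b' := B' _ - B' _.
  move=> bb' aa' be.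
  have -> : a ^+ 2 - (A (grid s t l j.+1) - B (grid s t l j.+1) -
    (A (grid s t l j) - B (grid s t l j))) ^+ 2 = b * (2 * a - b) by rewrite /a /b; ring.
  rewrite normrM ler_pM//; apply: (le_trans (ler_normB _ _)).
  by rewrite normrM ger0_norm// lerD// ler_pM2l.
rewrite -mulr_sumr big_split /= -mulr_sumr !telescope_grid.
rewrite mulrAC ler_pdivrMr// ler_pM2l// /K; lra.
Unshelve. all: by end_near. Qed.

End dyadic_grid.

(** * Path properties of counts and compensators *)

Section stopped_paths.
Context {R : realType} d (Omega : measurableType d) (dim : nat).
Notation leb := (@lebesgue_measure R).
Variables (tau : nat -> Omega -> \bar R) (Z : nat -> Omega -> 'I_dim).
Variables (mu : 'I_dim -> R) (phi : 'I_dim -> 'I_dim -> R -> R).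
Hypothesis tau_gt0 : forall n w, (0 < tau n w)%E.
Hypothesis tau_le : forall n w, (tau n w <= tau n.+1 w)%E.
Hypothesis tau_lt : forall n w, (tau n w < +oo)%E -> (tau n w < tau n.+1 w)%E.
Hypothesis mu_ge0 : forall i, 0 <= mu i.
Hypothesis phi_ge0 : forall i j (t : R), 0 <= t -> 0 <= phi i j t.
Hypothesis phi_int : forall i j, leb.-integrable `[0, +oo[ (EFin \o phi i j).
Variable n : nat.
Local Notation N := (stopped_count tau Z n).
Local Notation C := (stopped_comp tau Z mu phi n).

Lemma wcountE (th : 'I_dim -> R) t w : \sum_i th i * N i t w =
  \sum_(k < n.+1) th (Z k w) * (tau k w <= t%:E)%E%:R.
Proof.
under eq_bigr do rewrite mulr_sumr.
rewrite exchange_big /=; apply: eq_bigr => k _.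
rewrite (bigD1 (Z k w))//= eqxx andbT big1 ?addr0// => i iZ.
by rewrite eq_sym (negbTE iZ) andbF mulr0.
Qed.

Lemma stopped_count_ge0 i t w : 0 <= N i t w.
Proof. by apply: sumr_ge0. Qed.

Lemma stopped_count_le i t w : N i t w <= n.+1%:R.
Proof.
have -> : n.+1%:R = \sum_(k < n.+1) 1 :> R by rewrite sumr_const card_ord.
by apply: ler_sum => k _; rewrite lern1 leq_b1.
Qed.

Lemma stopped_count_nd i x y w : x <= y -> N i x w <= N i y w.
Proof.
move=> xy; apply: ler_sum => k _; rewrite ler_nat.
case: (Z k w == i); rewrite ?andbF// !andbT.
case: (leP (tau k w) x%:E) => // h.
by rewrite (le_trans h)// lee_fin.
Qed.

Lemma stopped_count0 i t w : t <= 0 -> N i t w = 0.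
Proof.
move=> t0; apply: big1 => k _; rewrite leNgt (le_lt_trans _ (tau_gt0 k w))//.
Qed.

Lemma stopped_time_incr x y w : 0 <= x -> x <= y ->
  0 <= stopped_time tau n y w - stopped_time tau n x w <= y - x.
Proof.
move=> x0 xy; have y0 := le_trans x0 xy.
rewrite /stopped_time; case e : (tau n w) => [r||].
- rewrite -!EFin_min /=; rewrite !minEle; case: (leP x r); case: (leP y r) => *; lra.
- by rewrite !minEle !leey /=; lra.
- by have := tau_gt0 n w; rewrite e.
Qed.

(** If the jump falls in []x, y]], the stopped time at [x] precedes it, so [cumul] vanishes there
    and the indicator at [x] can be replaced by the one at [y]. *)
Lemma stopped_comp_term x y w i k : 0 <= x -> x <= y ->
  let K := cumul (ext0 (phi i (Z k w))) in let T := stopped_time tau n in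
  (tau k w <= y%:E)%E%:R * K (T y w - fine (tau k w)) -
  (tau k w <= x%:E)%E%:R * K (T x w - fine (tau k w)) =
  (tau k w <= y%:E)%E%:R * (K (T y w - fine (tau k w)) - K (T x w - fine (tau k w))).
Proof.
move=> x0 xy K T; have y0 := le_trans x0 xy.
case: (leP (tau k w) x%:E) => hx.
  by rewrite (le_trans hx) ?lee_fin// !mul1r.
case: (leP (tau k w) y%:E) => hy; last by rewrite !mul0r subrr.
have [r0 e] := tau_fine_gt0 tau_gt0 hy.
rewrite !mul0r !mul1r subr0 [X in _ = _ - X](_ : _ = 0) ?subr0//.
apply: cumul_neg; first by move=> r; exact: ext0_neg.
rewrite subr_lt0 (le_lt_trans (stopped_time_le tau_gt0 _ _ x0))//.
by rewrite -lte_fin -e.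
Qed.

Lemma stopped_comp_nd i x y w : 0 <= x -> x <= y -> C i x w <= C i y w.
Proof.
move=> x0 xy; have y0 := le_trans x0 xy.
have /andP[h1 h2] := stopped_time_incr w x0 xy.
apply: lerD; first by rewrite ler_wpM2l// -subr_ge0.
rewrite -subr_ge0 -sumrB; apply: sumr_ge0 => k _.
rewrite stopped_comp_term// mulr_ge0// subr_ge0 cumul_nd//.
- by apply: ext0_ge0 => r; exact: phi_ge0.
- by move=> r; exact: ext0_neg.
- exact: ext0_integrable.
- by rewrite lerD2r -subr_ge0.
Qed.

Lemma stopped_comp0 i w : C i 0 w = 0.
Proof.
rewrite /stopped_comp /stopped_time minEle (ltW (tau_gt0 n w)) mulr0 add0r.
by apply: big1 => k _; rewrite leNgt tau_gt0 mul0r.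
Qed.

Lemma stopped_comp_ge0 i t w : 0 <= t -> 0 <= C i t w.
Proof. by move=> t0; rewrite -(stopped_comp0 i w) stopped_comp_nd. Qed.

Lemma cumul_L1 i j x : 0 <= cumul (ext0 (phi i j)) x <= L1norm (phi i j).
Proof.
have h r : 0 <= ext0 (phi i j) r by apply: ext0_ge0 => ?; exact: phi_ge0.
rewrite cumul_ge0//= -mass_ext0 cumul_le_mass//; first by move=> r; exact: ext0_neg.
exact: ext0_integrable.
Qed.

Lemma stopped_comp_le i t w : 0 <= t ->
  C i t w <= mu i * t + \sum_j L1norm (phi i j) * N j t w.
Proof.
move=> t0; apply: lerD; first by rewrite ler_wpM2l// stopped_time_le.
rewrite (wcountE (fun j => L1norm (phi i j))) [leRHS]big_ord_recr /=.
apply: (@le_trans _ _ (\sum_(k < n) L1norm (phi i (Z k w)) * (tau k w <= t%:E)%E%:R)).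
  apply: ler_sum => k _; rewrite mulrC ler_wpM2r//.
  by have /andP[] := cumul_L1 i (Z k w) (stopped_time tau n t w - fine (tau k w)).
rewrite lerDl mulr_ge0//.
by have /andP[h1 h2] := cumul_L1 i (Z n w) 0; exact: le_trans h2.
Qed.

Lemma stopped_comp_bound i t : 0 <= t -> exists K, forall w, C i t w <= K.
Proof.
move=> t0; exists (mu i * t + \sum_j L1norm (phi i j) * n.+1%:R) => w.
apply: (le_trans (stopped_comp_le i w t0)); rewrite lerD2l; apply: ler_sum => j _.
rewrite ler_wpM2l ?stopped_count_le//.
by have /andP[h1 h2] := cumul_L1 i j 0; exact: le_trans h2.
Qed.

(** The modulus is uniform in [w] because the jump times enter only as translations of the finitely
    many uniformly continuous functions [cumul (ext0 (phi i j))]. *)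
Lemma stopped_comp_unif (e : R) : 0 < e -> exists2 dl, 0 < dl &
  forall i w x y, 0 <= x -> x <= y -> y <= x + dl -> C i y w - C i x w <= e.
Proof.
move=> e0; pose e1 := e / (2 * n.+1%:R); have e10 : 0 < e1 by rewrite divr_gt0// mulr_gt0.
have [d1 d10 hd1] : exists2 dl, 0 < dl & forall (ij : 'I_dim * 'I_dim) x y,
    x <= y -> y <= x + dl ->
    cumul (ext0 (phi ij.1 ij.2)) y - cumul (ext0 (phi ij.1 ij.2)) x <= e1.
  apply: finite_common_bound => [ij a b a0 ab h x y xy yx|ij].
    by apply: h => //; rewrite (le_trans yx)// lerD2l.
  apply: cumul_unif => //.
  - by apply: ext0_ge0 => r; exact: phi_ge0.
  - by move=> r; exact: ext0_neg.
  - exact: ext0_integrable.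
have [d2 d20 hd2] : exists2 dl, 0 < dl & forall i, mu i * dl <= e / 2.
  apply: finite_common_bound => [i a b a0 ab h|i].
    by apply: le_trans h; rewrite ler_wpM2l.
  exists (e / 2 / (mu i + 1)).
    by rewrite divr_gt0// ?divr_gt0// ltr_wpDl.
  by rewrite mulrC mulrAC ler_pdivrMr ?ltr_wpDl// ler_wpM2l ?divr_ge0 ?ltW// ltrDl.
exists (Num.min d1 d2); first by rewrite lt_min d10.
move=> i w x y x0 xy yx; have y0 := le_trans x0 xy.
have /andP[h1 h2] := stopped_time_incr w x0 xy.
rewrite /stopped_comp opprD addrACA -mulrBr -sumrB [leRHS]splitr; apply: lerD.
  apply: le_trans (hd2 i); rewrite ler_wpM2l// (le_trans h2)// lerBlDl (le_trans yx)//.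
  by rewrite lerD2l ge_min lexx orbT.
apply: (@le_trans _ _ (\sum_(k < n) e1)).
  apply: ler_sum => k _; rewrite stopped_comp_term//.
  have hk := hd1 (i, Z k w) (stopped_time tau n x w - fine (tau k w))
     (stopped_time tau n y w - fine (tau k w)).
  case: (tau k w <= y%:E)%E; last by rewrite mul0r ltW.
  rewrite mul1r; apply: hk; first by rewrite lerD2r -subr_ge0.
  rewrite addrAC lerD2r -lerBlDl (le_trans h2)// lerBlDl (le_trans yx)//.
  by rewrite lerD2l ge_min lexx.
apply: (@le_trans _ _ (e1 * n.+1%:R)).
  by rewrite sumr_const card_ord -[leLHS]mulr_natr ler_pM2l// ler_nat.
by rewrite /e1 invfM mulrA divfK ?pnatr_eq0.
Qed.

Lemma jump_gap w : exists2 dl, 0 < dl & forall k m : 'I_n.+1, (k < m)%N ->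
  (tau m w < +oo)%E -> fine (tau k w) + dl <= fine (tau m w).
Proof.
have [dl dl0 h] : exists2 dl, 0 < dl & forall km : 'I_n.+1 * 'I_n.+1, (km.1 < km.2)%N ->
    (tau km.2 w < +oo)%E -> fine (tau km.1 w) + dl <= fine (tau km.2 w).
  apply: finite_common_bound => [[k m] x y x0 xy /= h km tm|[k m] /=].
    by apply: le_trans (h km tm); rewrite lerD2l.
  have [km|] := ltnP k m; last by exists 1.
  have [tm|] := ltP (tau m w) +oo%E; last by exists 1.
  have tk : (tau k w < +oo)%E by apply: le_lt_trans _ tm; apply: tau_nd (ltnW km).
  exists (fine (tau m w) - fine (tau k w)); last by move=> _ _; rewrite addrC subrK.
  rewrite subr_gt0 fine_lt ?(tau_gt tau_le tau_lt)// fin_numElt.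
    by rewrite tk (lt_trans _ (tau_gt0 k w))// ltNy0.
  by rewrite tm (lt_trans _ (tau_gt0 m w))// ltNy0.
by exists dl => // k m; exact: (h (k, m)).
Qed.

(** Once the mesh is smaller than the least gap between finite jump times, a cell contains at most
    one jump, and the square of the weighted increment is the increment weighted by squares. *)
Lemma wcount_sqr_incr (th : 'I_dim -> R) s t w : 0 <= s -> s <= t ->
  \forall l \near \oo, forall j, (j < 2 ^ l)%N ->
  (\sum_i th i * N i (grid s t l j.+1) w - \sum_i th i * N i (grid s t l j) w) ^+ 2 =
  \sum_i th i ^+ 2 * N i (grid s t l j.+1) w - \sum_i th i ^+ 2 * N i (grid s t l j) w.
Proof.
move=> s0 st; have [dl dl0 gap] := jump_gap w.
have [l0 _ hl0] := @mesh_small _ (t - s) (dl / 2) (divr_gt0 dl0 (ltr0Sn _ 1)).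
exists l0 => // l /hl0 mesh j jl.
rewrite (wcountE th) (wcountE th) (wcountE (fun i => th i ^+ 2)) (wcountE (fun i => th i ^+ 2)).
rewrite -!sumrB; set x := grid s t l j; set y := grid s t l j.+1.
have xy : x <= y by exact: grid_nd.
have yx : y - x < dl.
  rewrite /x /y grid_step (le_lt_trans mesh)// ltr_pdivrMr// ltr_pMr//; lra.
pose e (k : 'I_n.+1) := ~~ (tau k w <= x%:E)%E && (tau k w <= y%:E)%E.
have eE (c : R) (k : 'I_n.+1) : c * (tau k w <= y%:E)%E%:R - c * (tau k w <= x%:E)%E%:R = c * (e k)%:R.
  rewrite -mulrBr /e; case: (leP (tau k w) x%:E) => hx /=; last by rewrite subr0.
  by rewrite (le_trans hx) ?lee_fin// subrr.
under eq_bigr do rewrite eE; under [RHS]eq_bigr do rewrite eE.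
(* [e k] says that jump [k] falls in the cell []x, y]]; two such jumps would be closer than [dl]. *)
have e_uniq k m : e k -> e m -> k = m.
  wlog km : k m / (k < m)%N.
    move=> hw ek em; have [km|km|/val_inj//] := ltngtP k m; first exact: hw.
    by apply/esym/hw.
  rewrite /e -!ltNge => /andP[k1 k2] /andP[m1 m2]; exfalso.
  have [_ ke] := tau_fine_gt0 tau_gt0 k2; have [_ me] := tau_fine_gt0 tau_gt0 m2.
  have tm : (tau m w < +oo)%E by rewrite me ltry.
  move: (gap _ _ km tm) k1 m2; rewrite ke me !lte_fin !lee_fin /= => h1 h2 h3; lra.
have [[k ek]|noe] := pselect (exists k, e k).
  rewrite (bigD1 k)//= [in RHS](bigD1 k)//= !big1 ?addr0 ?ek ?mulr1//.
    by move=> m mk; case em : (e m); rewrite ?mulr0//; move/eqP: mk; case; exact: e_uniq.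
  by move=> m mk; case em : (e m); rewrite ?mulr0//; move/eqP: mk; case; exact: e_uniq.
rewrite !big1 ?expr0n// => m _; case em : (e m); rewrite ?mulr0//; exfalso; apply: noe;
  by exists m.
Qed.

(** General weights serve three purposes: unit weights for the moments, differences of two
    components for [S], and linear combinations of these for joint laws of increments. *)
Definition wmart (th : 'I_dim -> R) t w := \sum_i th i * N i t w - \sum_i th i * C i t w.

Lemma wmart_quadratic_variation (th : 'I_dim -> R) s t w : 0 <= s -> s <= t ->
  (fun l => \sum_(j < 2 ^ l) (wmart th (grid s t l j.+1) w - wmart th (grid s t l j) w) ^+ 2) @ \oo
  --> \sum_i th i ^+ 2 * N i t w - \sum_i th i ^+ 2 * N i s w.
Proof.
move=> s0 st.
apply: (@quadratic_variation_limit _ (fun t => \sum_i th i * N i t w)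
  (fun t => \sum_i th i * C i t w) (fun t => \sum_i th i ^+ 2 * N i t w)
  (fun t => \sum_i `|th i| * N i t w) (fun t => \sum_i `|th i| * C i t w)) => //.
- exact: wcount_sqr_incr.
- move=> x y sx xy; rewrite -!sumrB (le_trans (ler_norm_sum _ _ _))//; apply: ler_sum => i _.
  by rewrite -!mulrBr normrM ler_wpM2l// ger0_norm// subr_ge0 stopped_count_nd.
- move=> x y sx xy; rewrite -!sumrB (le_trans (ler_norm_sum _ _ _))//; apply: ler_sum => i _.
  rewrite -!mulrBr normrM ler_wpM2l// ger0_norm// subr_ge0 stopped_comp_nd//.
  exact: le_trans sx.
- move=> e e0; pose S := \sum_i `|th i| + 1.
  have S0 : 0 < S by rewrite ltr_wpDl// sumr_ge0.
  have [dl dl0 h] := stopped_comp_unif (divr_gt0 e0 S0).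
  have [l0 _ hl0] := @mesh_small _ (t - s) dl dl0.
  exists l0 => // l /hl0 mesh j jl.
  rewrite -!sumrB (le_trans (ler_norm_sum _ _ _))//.
  apply: (@le_trans _ _ (\sum_i `|th i| * (e / S))).
    apply: ler_sum => i _; rewrite -!mulrBr normrM ler_wpM2l//.
    have g0 := le_trans s0 (grid_ge l j st); have gg := grid_nd l st (leqnSn j).
    rewrite ger0_norm ?subr_ge0 ?stopped_comp_nd// h//.
    by rewrite -lerBlDl grid_step.
  rewrite -mulr_suml mulrCA; apply: ler_piMr; first exact: ltW.
  by rewrite ler_pdivrMr// mul1r /S lerDl.
Qed.

(** Immediately to the right of [u] the finitely many indicators do not change, and only the
    uniformly continuous compensator moves. *)
Lemma wmart_right (th : 'I_dim -> R) u w (e : R) : 0 <= u -> 0 < e ->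
  exists2 dl, 0 < dl & forall v, u <= v -> v <= u + dl -> `|wmart th v w - wmart th u w| <= e.
Proof.
move=> u0 e0; pose S := \sum_i `|th i| + 1.
have S0 : 0 < S by rewrite ltr_wpDl// sumr_ge0.
have [d1 d10 h] := stopped_comp_unif (divr_gt0 e0 S0).
have [d2 d20 g] : exists2 dl, 0 < dl & forall (k : 'I_n.+1) v, u <= v -> v < u + dl ->
    (tau k w <= v%:E)%E = (tau k w <= u%:E)%E.
  apply: finite_common_bound => [k x y x0 xy hy v uv vx|k].
    by apply: hy => //; rewrite (lt_le_trans vx)// lerD2l.
  case: (leP (tau k w) u%:E) => tu.
    by exists 1 => // v uv _; rewrite (le_trans tu).
  case e' : (tau k w) tu => [r| |]; rewrite ?ltNge ?leNye//.
    rewrite -ltNge lte_fin => ur; exists (r - u); first by rewrite subr_gt0.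
    by move=> v uv; rewrite addrC subrK lee_fin ltNge => /negbTE.
  by move=> _; exists 1.
exists (Num.min d1 (d2 / 2)); first by rewrite lt_min d10 divr_gt0.
move=> v uv vu.
have Nv i : N i v w = N i u w.
  apply: eq_bigr => k _; rewrite g// (le_lt_trans vu)// ltrD2l.
  rewrite (@le_lt_trans _ _ (d2 / 2)) ?ge_min ?lexx ?orbT//.
  by rewrite ltr_pdivrMr// ltr_pMr//; lra.
rewrite /wmart; under eq_bigr do rewrite Nv.
rewrite opprD addrACA subrr add0r opprK addrC -sumrB (le_trans (ler_norm_sum _ _ _))//.
apply: (@le_trans _ _ (\sum_i `|th i| * (e / S))).
  apply: ler_sum => i _; rewrite -!mulrBr normrM ler_wpM2l// distrC.
  rewrite ger0_norm ?subr_ge0 ?stopped_comp_nd// h// (le_trans vu)//.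
  by rewrite lerD2l ge_min lexx.
rewrite -mulr_suml mulrCA; apply: ler_piMr; first exact: ltW.
  by rewrite ler_pdivrMr// mul1r /S lerDl.
Qed.

End stopped_paths.

(** * Moment identities for the martingales *)

Section continuous_time_martingale.
Context {R : realType} d (T : measurableType d) (P : probability T R).
Local Notation E := (Ex P).

Record adapted_classes (A : R -> (T -> R) -> Prop) : Prop := AdaptedClasses {
  cc_bmf : forall t f, A t f -> bmf f;
  cc_mono : forall s t f, s <= t -> A s f -> A t f;
  cc_cst : forall t c, A t (fun=> c);
  ccD : forall t f g, A t f -> A t g -> A t (fun w => f w + g w);
  ccM : forall t f g, A t f -> A t g -> A t (fun w => f w * g w);
  cc_max : forall t f g, A t f -> A t g -> A t (fun w => Num.max (f w) (g w)) }.

Lemma ccB A (hA : adapted_classes A) t f g : A t f -> A t g -> A t (fun w => f w - g w).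
Proof.
move=> Af Ag; rewrite (_ : (fun w => _) = fun w => f w + (-1) * g w).
  by apply: (ccD hA) => //; apply: (ccM hA) => //; exact: (cc_cst hA).
by apply/funext => w; rewrite mulN1r.
Qed.

Variables (A : R -> (T -> R) -> Prop) (M V : R -> T -> R).
Hypothesis hA : adapted_classes A.
Hypothesis M_adapted : forall t, 0 <= t -> A t (M t).
Hypothesis M_orth : forall s t X, 0 <= s -> s <= t -> A s X ->
  E (fun w => X w * (M t w - M s w)) = 0.
Hypothesis M_bound : forall t, 0 <= t -> exists B : R, forall w u, 0 <= u -> u <= t -> `|M u w| <= B.
Hypothesis M_right : forall u w (e : R), 0 <= u -> 0 < e -> exists2 dl, 0 < dl &
  forall v, u <= v -> v <= u + dl -> `|M v w - M u w| <= e.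
Hypothesis M_quadratic_cvg : forall s t w, 0 <= s -> s <= t ->
  (fun l => \sum_(j < 2 ^ l) (M (grid s t l j.+1) w - M (grid s t l j) w) ^+ 2) @ \oo
  --> V t w - V s w.
Hypothesis M_quadratic_bound : forall s t, 0 <= s -> s <= t -> exists K : R, forall l w,
  `|\sum_(j < 2 ^ l) (M (grid s t l j.+1) w - M (grid s t l j) w) ^+ 2| <= K.

(** The index is clamped at [2 ^ l]: the discrete results concern infinite sequences, and past the
    end of the grid the process stays constant. *)
Let Cls s t l (j : nat) (f : T -> R) := A (grid s t l (minn j (2 ^ l))) f.
Let Dl s t l (j : nat) w := M (grid s t l (minn j (2 ^ l))) w - M s w.

Let fC s t l : s <= t -> filtration_classes (Cls s t l).
Proof.
move=> st; split.
- by move=> j f; exact: (cc_bmf hA).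
- move=> j f; apply: (cc_mono hA); apply: grid_nd => //.
  by rewrite leq_min geq_minr (leq_trans (geq_minl _ _))//.
- by move=> j c; exact: (cc_cst hA).
- by move=> j f g; exact: (ccD hA).
- by move=> j f g; exact: (ccM hA).
- by move=> j f g; exact: (cc_max hA).
Qed.

Let D_adapted s t l j : 0 <= s -> s <= t -> Cls s t l j (Dl s t l j).
Proof.
move=> s0 st; have sg := grid_ge l (minn j (2 ^ l)) st.
apply: (ccB hA); first by apply: M_adapted; exact: le_trans sg.
by apply: (cc_mono hA sg); exact: M_adapted.
Qed.

Let D_orth s t l j X : 0 <= s -> s <= t -> Cls s t l j X ->
  E (fun w => X w * (Dl s t l j.+1 w - Dl s t l j w)) = 0.
Proof.
move=> s0 st cX; have sg i := grid_ge l i st.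
rewrite (_ : (fun w => _) = fun w => X w * (M (grid s t l (minn j.+1 (2 ^ l))) w -
    M (grid s t l (minn j (2 ^ l))) w)); last first.
  by apply/funext => w; rewrite /Dl opprB addrA subrK.
apply: M_orth => //; first exact: le_trans (sg _).
apply: grid_nd => //; rewrite leq_min geq_minr (leq_trans (geq_minl _ _))//.
Qed.

Let D0 s t l w : Dl s t l 0 w = 0.
Proof. by rewrite /Dl min0n grid0 subrr. Qed.

Let Ql s t l w := \sum_(j < 2 ^ l) (Dl s t l j.+1 w - Dl s t l j w) ^+ 2.

Let QlE s t l w : Ql s t l w =
  \sum_(j < 2 ^ l) (M (grid s t l j.+1) w - M (grid s t l j) w) ^+ 2.
Proof.
apply: eq_bigr => j _; congr (_ ^+ 2).
have e1 : minn j.+1 (2 ^ l) = j.+1 by apply/minn_idPl; exact: ltn_ord.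
have e2 : minn j (2 ^ l) = j by apply/minn_idPl; rewrite ltnW// ltn_ord.
by rewrite /Dl e1 e2 opprB addrA subrK.
Qed.

Let energy s t w := V t w - V s w.

Let Q_cvg s t w : 0 <= s -> s <= t -> Ql s t ^~ w @ \oo --> energy s t w.
Proof.
move=> s0 st; rewrite (_ : (fun l => Ql s t l w) = fun l =>
  \sum_(j < 2 ^ l) (M (grid s t l j.+1) w - M (grid s t l j) w) ^+ 2).
  exact: M_quadratic_cvg.
by apply/funext => l; exact: QlE.
Qed.

Let Q_bound s t : 0 <= s -> s <= t -> exists K : R, forall l w, `|Ql s t l w| <= K.
Proof.
move=> s0 st; have [K QK] := M_quadratic_bound s0 st; exists K => l w.
by rewrite QlE; exact: QK.
Qed.

Let bQ s t l : 0 <= s -> s <= t -> bmf (Ql s t l).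
Proof.
move=> s0 st; apply: bmf_sum => j; apply: bmfX; apply: bmfB.
  exact/(cc_bmf hA)/(D_adapted l j.+1 s0 st).
exact/(cc_bmf hA)/(D_adapted l j s0 st).
Qed.

(** On every dyadic grid the left-hand side equals the expectation of [X] times the sum of squared
    increments; it does not depend on the level [l], and dominated convergence identifies the
    limit. *)
Lemma second_moment_identity s t X : 0 <= s -> s <= t -> A s X ->
  E (fun w => X w * (M t w - M s w) ^+ 2) = E (fun w => X w * energy s t w).
Proof.
move=> s0 st aX; have [bX [KX XK]] := cc_bmf hA aX.
have [K QK] := Q_bound s0 st.
have [] := @Ex_dct _ _ _ P (fun l w => X w * Ql s t l w)
  (fun w => X w * energy s t w) (KX * K).
- by move=> l; apply: measurable_funM => //; exact: (bQ l s0 st).1.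
- by move=> l w; rewrite normrM ler_pM.
- by move=> w; apply: cvgM; [exact: cvg_cst|exact: Q_cvg].
move=> _; rewrite (_ : (fun l => _) = fun=> E (fun w => X w * (M t w - M s w) ^+ 2)).
  by move=> /(cvg_lim (@Rhausdorff R)) <-; rewrite lim_cst.
apply/funext => l.
have aX0 : Cls s t l 0 X by rewrite /Cls min0n grid0.
rewrite -(mart_sqr_orth (fC l st) (fun j => D_adapted l j s0 st)
  (fun j X => @D_orth s t l j X s0 st) (D0 s t l) (2 ^ l) aX0).
by apply: eq_Ex => w; rewrite /Dl minnn gridN.
Qed.

(* [W] is the supremum over the dyadic points, and by right continuity it bounds
   the increments at all times; the running supremum need not be measurable. *)
Lemma sup_fourth_moment s t : 0 <= s -> s <= t -> exists W : T -> R, [/\ bmf W,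
  forall w, 0 <= W w,
  forall u w, s <= u -> u <= t -> (M u w - M s w) ^+ 4 <= W w &
  E W <= 1048 * E (fun w => energy s t w ^+ 2)].
Proof.
move=> s0 st; have t0 := le_trans s0 st.
pose U l w := runmax (Dl s t l) (2 ^ l) w ^+ 2.
have Uge l w j : (j <= 2 ^ l)%N -> (M (grid s t l j) w - M s w) ^+ 4 <= U l w.
  move=> jl; have := @runmax_ge _ _ _ (Dl s t l) j (2 ^ l) w jl.
  rewrite /Dl (minn_idPl jl) => h; rewrite /U.
  rewrite (_ : _ ^+ 4 = ((M (grid s t l j) w - M s w) ^+ 2) ^+ 2); last by rewrite -exprM.
  by rewrite ler_pXn2r// nnegrE ?sqr_ge0// runmax_ge0.
have Ule l w c : 0 <= c -> (forall j, (j <= 2 ^ l)%N -> (M (grid s t l j) w - M s w) ^+ 4 <= c ^+ 2) ->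
    U l w <= c ^+ 2.
  move=> c0 h; rewrite /U ler_pXn2r ?nnegrE ?runmax_ge0//.
  have {}h j : Dl s t l j w ^+ 2 <= c.
    have := h (minn j (2 ^ l)) (geq_minr _ _).
    rewrite (_ : _ ^+ 4 = (Dl s t l j w ^+ 2) ^+ 2); last by rewrite -exprM.
    by rewrite ler_pXn2r// nnegrE sqr_ge0.
  by elim: (2 ^ l)%N => [|m IH] /=; rewrite ?ge_max ?IH ?h.
have bM u : 0 <= u -> bmf (M u) by move=> u0; exact/(cc_bmf hA)/M_adapted.
have Und w : nondecreasing_seq (U ^~ w).
  apply/nondecreasing_seqP => l; apply: Ule; first exact: runmax_ge0.
  move=> j jl; rewrite -(grid_double s t l j); apply: Uge.
  by rewrite expnS leq_mul2l jl orbT.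
have [K UK] : exists K : R, forall l w, `|U l w| <= K.
  have [B MB] := M_bound t0.
  exists (((2 * B) ^+ 2) ^+ 2) => l w; rewrite ger0_norm ?sqr_ge0//.
  apply: Ule; first exact: sqr_ge0.
  move=> j jl; rewrite (_ : _ ^+ 4 = ((M (grid s t l j) w - M s w) ^+ 2) ^+ 2); last by rewrite -exprM.
  have h : `|M (grid s t l j) w - M s w| <= 2 * B.
    rewrite (le_trans (ler_normB _ _))// mulr_natl mulr2n lerD// MB//.
      exact: le_trans (grid_ge _ _ st).
    exact: grid_le.
  rewrite ler_pXn2r ?nnegrE ?sqr_ge0// -(ger0_norm (sqr_ge0 _)) normrX ler_pXn2r ?nnegrE//.
  exact: le_trans (normr_ge0 _) h.
have Ucvg w : cvgn (U ^~ w).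
  apply: nondecreasing_is_cvgn => //; exists K => _ [l _ <-].
  exact: le_trans (ler_norm _) (UK l w).
have mU l : measurable_fun setT (U l).
  apply: (bmfX 2 _).1.
  exact: (fc_bmf (fC l st) (runmax_adapted (fC l st) (fun j => D_adapted l j s0 st) _)).
pose W w := limn (U ^~ w).
have [bW EW] := Ex_dct P mU UK (fun w => Ucvg w).
have UW l w : U l w <= W w by exact: (nondecreasing_cvgn_le (Und w) (@Ucvg w) l).
exists W; split => //.
- by move=> w; exact: le_trans (sqr_ge0 _) (UW 0 w).
- move=> u w su ut; apply/ler_addgt0Pr => e e0.
  have u0 := le_trans s0 su.
  (* x -> (x - M s)^4 is continuous at M u *)
  have [eta eta0 Heta] : exists2 eta, 0 < eta & forall y, `|y - M u w| <= eta ->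
      (M u w - M s w) ^+ 4 - (y - M s w) ^+ 4 <= e.
    have : (fun y : R => (y - M s w) ^+ 4) y @[y --> M u w] --> (M u w - M s w) ^+ 4.
      apply: (@continuous_comp _ _ _ (fun y : R => y - M s w) (fun z => z ^+ 4)).
        by apply: cvgB; [exact: cvg_id|exact: cvg_cst].
      exact: exprn_continuous.
    move=> /cvgrPdist_le/(_ e e0) /nbhs_ballP[eta /= eta0 h].
    exists (eta / 2); first by rewrite divr_gt0.
    move=> y hy; apply: le_trans (ler_norm _) _; apply: h.
    rewrite /ball /= distrC (le_lt_trans hy)// ltr_pdivrMr// ltr_pMr//; lra.
  have [dl dl0 Hdl] := M_right w u0 eta0.
  have [l _ /(_ l (leqnn l)) mesh] := @mesh_small _ (t - s) dl dl0.
  have [j jl ju] : exists2 j, (j <= 2 ^ l)%N & u <= grid s t l j <= u + dl.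
    move: su; rewrite le_eqVlt => /predU1P[->|su].
      by exists 0 => //; rewrite grid0 lexx lerDl ltW.
    have st' : 0 < t - s by rewrite subr_gt0 (lt_le_trans su).
    pose x := (u - s) / (t - s) * 2 ^+ l.
    have x0 : 0 < x by rewrite mulr_gt0 ?exprn_gt0// divr_gt0// subr_gt0.
    have gE c : grid s t l c = s + (t - s) / 2 ^+ l * c%:R by rewrite /grid mulrA mulrAC.
    have xu : s + (t - s) / 2 ^+ l * x = u.
      rewrite /x; field; rewrite expf_neq0//= gt_eqF//.
    have xl : x <= (2 ^ l)%N%:R.
      by rewrite natrX /x ler_piMl ?exprn_ge0// ler_pdivrMr// mul1r lerD2r.
    (* The first grid point strictly after [u], or the end [t] of the grid; it lies at most one mesh
       after [u]. *)
    exists (minn (Num.truncn x).+1 (2 ^ l)); first exact: geq_minr.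
    have ms0 : 0 < (t - s) / 2 ^+ l by rewrite divr_gt0// exprn_gt0.
    have hx1 := truncnS_gt x.
    have /andP[hx2 _] := truncn_itv (ltW x0).
    apply/andP; split.
      rewrite gE -{1}xu lerD2l ler_pM2l//.
      by have [_|_] := leqP (Num.truncn x).+1 (2 ^ l) => //; exact: ltW.
    rewrite gE -xu -addrA lerD2l.
    apply: (@le_trans _ _ ((t - s) / 2 ^+ l * (x + 1))); last by rewrite mulrDr mulr1 lerD2l.
    rewrite ler_pM2l// (@le_trans _ _ (Num.truncn x).+1%:R)//.
      by rewrite ler_nat geq_minl.
    by rewrite -natr1 lerD2r.
  move/andP: ju => [ju1 ju2].
  have := Heta _ (Hdl _ ju1 ju2); have := Uge l w j jl; have := UW l w; lra.
- have [KQ QKQ] := Q_bound s0 st.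
  have [_ EQ] := @Ex_dct _ _ _ P (fun l w => Ql s t l w ^+ 2)
     (fun w => energy s t w ^+ 2) (KQ ^+ 2)
     (fun l => (bmfX 2 (bQ l s0 st)).1)
     (fun l w => ltac:(rewrite normrX ler_pXn2r ?nnegrE//; exact: le_trans (normr_ge0 _) (QKQ l w)))
     (fun w => ltac:(apply: cvgM; exact: Q_cvg)).
  have h : (fun l => 1048 * E (fun w => Ql s t l w ^+ 2)) @ \oo --> 1048 * E (fun w => energy s t w ^+ 2).
    by apply: cvgM; [exact: cvg_cst|exact: EQ].
  rewrite -(cvg_lim (@Rhausdorff R) EW) -(cvg_lim (@Rhausdorff R) h); apply: ler_lim.
  - by apply/cvg_ex; eexists; exact: EW.
  - by apply/cvg_ex; eexists; exact: h.
  - apply: nearW => l.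
    exact: (runmax_fourth_le (fC l st) (fun j => D_adapted l j s0 st)
     (fun j X => @D_orth s t l j X s0 st) (D0 s t l)).
Qed.

End continuous_time_martingale.

(* keeps the unifier from unfolding the stopped processes *)
#[local] Opaque stopped_comp stopped_count stopped_time compensated.

Lemma norm_incr_diff {R : realType} (a b c e : R) : a <= b -> c <= e ->
  `|b - a - (e - c)| <= b + e - (a + c).
Proof. by move=> ab ce; rewrite ler_norml; apply/andP; split; lra. Qed.

Lemma scaled_incr {R : realType} (a x y z u : R) :
  a * y - a * z - (a * x - a * u) = a * (y - x - (z - u)).
Proof. by ring. Qed.

(** * Moment identities for the weighted Hawkes martingales *)

Section hawkes_martingale.
Context {R : realType} d (Omega : measurableType d) (P : probability Omega R) (dim : nat).
Notation leb := (@lebesgue_measure R).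
Variables (tau : nat -> Omega -> \bar R) (Z : nat -> Omega -> 'I_dim).
Variables (mu : 'I_dim -> R) (phi : 'I_dim -> 'I_dim -> R -> R).
Hypothesis H : hawkes tau Z P mu phi.
Hypothesis phi_int : forall i j, leb.-integrable `[0, +oo[ (EFin \o phi i j).
Variable n : nat.
Local Notation N := (stopped_count tau Z n).
Local Notation C := (stopped_comp tau Z mu phi n).
Local Notation E := (Ex P).
Local Notation M := (wmart tau Z mu phi n).

Let tau_gt0 := hawkes_time_gt0 H.
Let tau_le := hawkes_time_le H.
Let tau_lt := hawkes_time_lt H.
Let mu_ge0 := hawkes_mu_ge0 H.
Let phi_ge0 := hawkes_phi_ge0 H.

Definition history_gen (t : R) : set (set Omega) :=
  [set A | exists i s, 0 <= s <= t /\
     exists2 B : set (\bar R), measurable B & A = counting_process tau Z i s @^-1` B].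

Definition adapted (t : R) (f : Omega -> R) := bmf (f : g_sigma_algebraType (history_gen t) -> R).

Lemma measurable_time_le k (t : R) : measurable [set w | (tau k w <= t%:E)%E].
Proof.
have := hawkes_time_measurable H k measurableT (emeasurable_itv `]-oo, t%:E]).
by rewrite setTI set_itvNyc.
Qed.

Lemma measurable_jump k i (t : R) :
  measurable_fun setT (fun w => ((tau k w <= t%:E)%E && (Z k w == i))%:R : R).
Proof.
rewrite (_ : (fun w => _) = \1_([set w | (tau k w <= t%:E)%E] `&` Z k @^-1` [set i])).
  by apply: measurable_indic; apply: measurableI;
    [exact: measurable_time_le | exact: hawkes_mark_measurable H _ _].
apply/funext => w; rewrite indicE; congr ((nat_of_bool _)%:R).
apply/idP/idP => [/andP[h1 /eqP h2]|]; first exact: mem_set.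
by rewrite inE => -[/= -> ->]; rewrite eqxx.
Qed.

Lemma bmf_count i t : bmf (N i t).
Proof.
split; last by exists n.+1%:R => w; rewrite ger0_norm ?stopped_count_ge0// stopped_count_le.
by apply: measurable_sum => k; exact: measurable_jump.
Qed.

Lemma measurable_counting i t : measurable_fun setT (counting_process tau Z i t).
Proof.
apply: ge0_emeasurable_sum => [k w _ _|k _]; first by rewrite lee_fin.
by apply/measurable_EFinP; exact: measurable_jump.
Qed.

Lemma history_measurable t A : <<s history_gen t >> A -> measurable A.
Proof.
apply: smallest_sub; first exact: sigma_algebra_measurable.
move=> _ [i [s [_ [B mB ->]]]].
by rewrite -[X in measurable X]setTI; exact: measurable_counting.
Qed.

Lemma adapted_bmf t f : adapted t f -> bmf f.
Proof.
by apply: bmf_sub => A hA; apply: (@history_measurable t); exact: sub_sigma_algebra.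
Qed.

Lemma adapted_mono s t f : s <= t -> adapted s f -> adapted t f.
Proof.
move=> st [mf K]; split => // mT B mB.
have sub : history_gen s `<=` history_gen t.
  by move=> A [i [u [/andP[u0 us] hB]]]; exists i, u; rewrite u0 (le_trans us).
have : <<s history_gen s >> (setT `&` f @^-1` B) by exact: mf measurableT B mB.
exact: sub_sigma_algebra2 sub _.
Qed.

Lemma compensated_real i t w : 0 <= t -> compensated tau Z mu phi n i t w = (N i t w - C i t w)%:E.
Proof. by move=> t0; rewrite compensatedE. Qed.

Lemma adapted_mart i t : 0 <= t -> adapted t (fun w => N i t w - C i t w).
Proof.
move=> t0; split; last first.
  have [K CK] := stopped_comp_bound Z tau_gt0 mu_ge0 phi_ge0 phi_int n i t0.
  exists (n.+1%:R + K) => w; rewrite (le_trans (ler_normB _ _))// lerD//.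
    by rewrite ger0_norm ?stopped_count_ge0// stopped_count_le.
  by rewrite ger0_norm// stopped_comp_ge0.
move=> mT B mB; rewrite setTI.
have mB' : measurable (EFin @` B) by exact: measurable_image_EFin.
have := mart_adapted (hawkes_martingale H n i) t0 mB'.
rewrite (_ : compensated _ _ _ _ _ _ _ @^-1` _ = (fun w => N i t w - C i t w) @^-1` B) //.
apply/seteqP; split => w /=; rewrite compensated_real//.
  by move=> [x Bx [<-]].
by move=> Bw; eexists; first exact: Bw.
Qed.

Lemma adapted_wmart th t : 0 <= t -> adapted t (M th t).
Proof.
move=> t0; rewrite /wmart.
rewrite (_ : (fun w => _) = fun w => \sum_i th i * (N i t w - C i t w)).
  by apply: bmf_sum => i; apply: bmfZ; exact: adapted_mart.
by apply/funext => w; rewrite -sumrB; apply: eq_bigr => i _; rewrite mulrBr.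
Qed.

(** The definition of a martingale gives the identity for indicators of events of the history at
    [s]; [bounded_orth] extends it to bounded adapted multipliers. *)
Lemma wmart_orth th s t X : 0 <= s -> s <= t -> adapted s X ->
  E (fun w => X w * (M th t w - M th s w)) = 0.
Proof.
move=> s0 st aX; have t0 := le_trans s0 st; have bX := adapted_bmf aX.
have bM i u : 0 <= u -> bmf (fun w => N i u w - C i u w).
  by move=> u0; exact/adapted_bmf/adapted_mart.
have -> : (fun w => X w * (M th t w - M th s w)) =
    fun w => \sum_i th i * (X w * ((N i t w - C i t w) - (N i s w - C i s w))).
  apply/funext => w; rewrite /wmart -!sumrB mulr_sumr; apply: eq_bigr => i _.
  by rewrite -!mulrBr mulrCA.
rewrite (Ex_sum P _ (F := fun i w => th i * (X w * ((N i t w - C i t w) - (N i s w - C i s w))))).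
  apply: big1 => i _; rewrite ExZ; last by apply: bmfM => //; apply: bmfB; exact: bM.
  rewrite (@bounded_orth _ _ _ P (history_gen s)) ?mulr0//.
  - exact: history_measurable.
  - by apply: bmfB; exact: bM.
  move=> A hA; have mA := history_measurable hA.
  have hc := mart_cond_expectation (hawkes_martingale H n i) s0 st hA.
  pose Y u w := \1_A w * (N i u w - C i u w).
  have bY u : 0 <= u -> bmf (Y u).
    by move=> u0; apply: bmfM; [exact: bmf_indic|exact: bM].
  have e u : 0 <= u -> (\int[P]_(w in A) compensated tau Z mu phi n i u w = (E (Y u))%:E)%E.
    move=> u0; rewrite -(Ex_EFin P (bY u u0)).
    rewrite integral_mkcond; apply: eq_integral => w _.
    rewrite patchE /Y indicE; case: ifPn => _; last by rewrite mul0r.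
    by rewrite mul1r (compensated_real i w u0).
  have h : (E (Y t))%:E = (E (Y s))%:E := etrans (esym (e t t0)) (etrans hc (e s s0)).
  transitivity (E (fun w => Y t w - Y s w)).
    by apply: eq_Ex => w; exact: mulrBr.
  by rewrite (ExB P (bY t t0) (bY s s0)); apply/eqP; rewrite subr_eq0; apply/eqP; exact: EFin_inj h.
by move=> i; apply/bmfZ/bmfM => //; apply: bmfB; exact: bM.
Qed.

Lemma wmart_bound th t : 0 <= t -> exists B : R, forall w u, 0 <= u -> u <= t -> `|M th u w| <= B.
Proof.
move=> t0; have hK i := stopped_comp_bound Z tau_gt0 mu_ge0 phi_ge0 phi_int n i t0.
have /choice[K CK] := hK.
exists (\sum_i `|th i| * (n.+1%:R + K i)) => w u u0 ut.
rewrite /wmart -sumrB (le_trans (ler_norm_sum _ _ _))//; apply: ler_sum => i _.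
rewrite -mulrBr normrM ler_wpM2l// (le_trans (ler_normB _ _))// lerD//.
  by rewrite ger0_norm ?stopped_count_ge0// stopped_count_le.
rewrite ger0_norm ?stopped_comp_ge0//; apply: le_trans (CK i w).
exact: stopped_comp_nd.
Qed.

(** [M] has finite variation, dominated by the increments of the monotone function [V]. One factor
    of each square is bounded by [V t - V s] and the other one telescopes. *)
Lemma wmart_quadratic_bound th s t : 0 <= s -> s <= t -> exists K : R, forall l w,
  `|\sum_(j < 2 ^ l) (M th (grid s t l j.+1) w - M th (grid s t l j) w) ^+ 2| <= K.
Proof.
move=> s0 st; have t0 := le_trans s0 st.
have hK i := stopped_comp_bound Z tau_gt0 mu_ge0 phi_ge0 phi_int n i t0.
have /choice[K CK] := hK.
exists ((\sum_i `|th i| * (n.+1%:R + K i)) ^+ 2) => l w.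
rewrite ger0_norm; last by apply: sumr_ge0 => j _; exact: sqr_ge0.
pose V u := \sum_i `|th i| * (N i u w + C i u w).
have Vd x y : 0 <= x -> x <= y -> `|M th y w - M th x w| <= V y - V x.
  move=> x0 xy; rewrite /V -sumrB.
  have -> : M th y w - M th x w = \sum_i th i * ((N i y w - N i x w) - (C i y w - C i x w)).
    by rewrite /wmart -!sumrB; apply: eq_bigr => i _; exact: scaled_incr.
  rewrite (le_trans (ler_norm_sum _ _ _))//; apply: ler_sum => i _.
  have h1 := stopped_count_nd tau Z n i w xy.
  have h2 := stopped_comp_nd Z tau_gt0 mu_ge0 phi_ge0 phi_int n i w x0 xy.
  rewrite -mulrBr normrM ler_wpM2l//.
  exact: norm_incr_diff.
have V0 u : 0 <= u -> 0 <= V u.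
  move=> u0; apply: sumr_ge0 => i _; rewrite mulr_ge0// addr_ge0 ?stopped_count_ge0//.
  exact: stopped_comp_ge0.
have VK : V t <= \sum_i `|th i| * (n.+1%:R + K i).
  by apply: ler_sum => i _; rewrite ler_wpM2l// lerD// stopped_count_le.
have Vnd x y : 0 <= x -> x <= y -> V x <= V y.
  by move=> x0 xy; rewrite -subr_ge0 (le_trans (normr_ge0 _) (Vd x y x0 xy)).
apply: (@le_trans _ _ ((V t - V s) ^+ 2)); last first.
  rewrite ler_pXn2r ?nnegrE ?subr_ge0 ?Vnd//.
  - by rewrite (le_trans _ VK)// gerBl V0.
  - exact: le_trans (V0 _ t0) VK.
rewrite -(telescope_grid V s t l) expr2 mulr_suml; apply: ler_sum => j _.
have gs := le_trans s0 (grid_ge l j st).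
have gt : grid s t l j.+1 <= t by exact: grid_le.
have hj := Vd _ _ gs (grid_nd l st (leqnSn j)).
rewrite -[leLHS]ger0_norm ?sqr_ge0// normrX expr2; apply: ler_pM => //.
rewrite (le_trans hj)// telescope_grid; apply: lerB; apply: Vnd => //.
  exact: le_trans s0 (grid_ge _ _ st).
exact: grid_ge.
Qed.

Lemma adapted_classesP : adapted_classes adapted.
Proof.
split.
- by move=> t f; exact: adapted_bmf.
- by move=> s t f; exact: adapted_mono.
- by move=> t c; exact: bmf_cst.
- by move=> t f g; exact: bmfD.
- by move=> t f g; exact: bmfM.
- by move=> t f g; exact: bmf_max.
Qed.

Lemma wmart_second_moment th s t X : 0 <= s -> s <= t -> adapted s X ->
  E (fun w => X w * (M th t w - M th s w) ^+ 2) =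
  E (fun w => X w * (\sum_i th i ^+ 2 * N i t w - \sum_i th i ^+ 2 * N i s w)).
Proof.
apply: (@second_moment_identity _ _ _ P adapted (M th) (fun t w => \sum_i th i ^+ 2 * N i t w)).
- exact: adapted_classesP.
- by move=> u; exact: adapted_wmart.
- by move=> u v Y; exact: wmart_orth.
- by move=> u v w u0 uv; exact: wmart_quadratic_variation.
- by move=> u v; exact: wmart_quadratic_bound.
Qed.

Lemma wmart_sup th s t : 0 <= s -> s <= t -> exists W : Omega -> R, [/\ bmf W,
  forall w, 0 <= W w,
  forall u w, s <= u -> u <= t -> (M th u w - M th s w) ^+ 4 <= W w &
  E W <= 1048 * E (fun w => (\sum_i th i ^+ 2 * N i t w - \sum_i th i ^+ 2 * N i s w) ^+ 2)].
Proof.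
apply: (@sup_fourth_moment _ _ _ P adapted (M th) (fun t w => \sum_i th i ^+ 2 * N i t w)).
- exact: adapted_classesP.
- by move=> u; exact: adapted_wmart.
- by move=> u v Y; exact: wmart_orth.
- by move=> u; exact: wmart_bound.
- by move=> u w e; exact: wmart_right.
- by move=> u v w u0 uv; exact: wmart_quadratic_variation.
- by move=> u v; exact: wmart_quadratic_bound.
Qed.

End hawkes_martingale.

(** * Moments of the four-dimensional model *)

Section model_kernel.
Context {R : realType}.
Notation leb := (@lebesgue_measure R).
Variables (g h : R -> R).

(** The only component that excites component [i], and [kern i] is the kernel of this excitation. *)
Definition par (i : 'I_4) : 'I_4 := inord (nth 0%N [:: 2; 3; 0; 1]%N i).
Definition kern (i : 'I_4) : R -> R := if (i < 2)%N then h else g.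
Definition kmass (i : 'I_4) : R := L1norm (kern i).

Lemma parK i : par (par i) = i.
Proof.
apply/val_inj; case: i => [[|[|[|[|//]]]] hi]; by rewrite /par /= !inordK.
Qed.

Lemma par_lt2 i : (par i < 2)%N = ~~ (i < 2)%N.
Proof. by case: i => [[|[|[|[|//]]]] hi]; rewrite /par /= inordK. Qed.

Lemma kernel4E i j : kernel4 g h i j = if j == par i then kern i else cst 0.
Proof.
by case: i => [[|[|[|[|//]]]] hi]; case: j => [[|[|[|[|//]]]] hj];
  rewrite /kernel4 /par /kern /= -val_eqE /= inordK.
Qed.

Lemma L1norm0 : L1norm (cst 0 : R -> R) = 0.
Proof.
by rewrite /L1norm /Rintegral (eq_integral (cst 0%E))// integral0.
Qed.

Lemma kernel4_L1norm i j : L1norm (kernel4 g h i j) = (j == par i)%:R * kmass i.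
Proof. by rewrite kernel4E; case: eqP => _; rewrite ?mul1r// L1norm0 mul0r. Qed.

Hypothesis g_ge0 : forall t : R, 0 <= t -> 0 <= g t.
Hypothesis h_ge0 : forall t : R, 0 <= t -> 0 <= h t.
Hypothesis g_int : leb.-integrable `[0, +oo[ (EFin \o g).
Hypothesis h_int : leb.-integrable `[0, +oo[ (EFin \o h).

Lemma kern_ge0 i t : 0 <= t -> 0 <= kern i t.
Proof. by rewrite /kern; case: ifP => _; [exact: h_ge0|exact: g_ge0]. Qed.

Lemma kern_int i : leb.-integrable `[0, +oo[ (EFin \o kern i).
Proof. by rewrite /kern; case: ifP. Qed.

Lemma kernel4_int i j : leb.-integrable `[0, +oo[ (EFin \o kernel4 g h i j).
Proof.
rewrite kernel4E; case: eqP => _; first exact: kern_int.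
by have := integrable0 leb (`[0%R, +oo[%classic : set R); apply: eq_integrable.
Qed.

Lemma kmass_ge0 i : 0 <= kmass i.
Proof.
apply: Rintegral_ge0 => t /=; rewrite in_itv /= andbT; exact: kern_ge0.
Qed.

Lemma kmassM i : kmass i * kmass (par i) = L1norm h * L1norm g.
Proof.
by rewrite /kmass /kern par_lt2; case: ifP => _ //=; rewrite mulrC.
Qed.

End model_kernel.

(** * Moments uniform in the localisation and non-explosion *)

Section model_moments.
Context {R : realType}.
Notation leb := (@lebesgue_measure R).
Variables (g h : R -> R).
Hypothesis g_ge0 : forall t : R, 0 <= t -> 0 <= g t.
Hypothesis h_ge0 : forall t : R, 0 <= t -> 0 <= h t.
Hypothesis g_int : leb.-integrable `[0, +oo[ (EFin \o g).
Hypothesis h_int : leb.-integrable `[0, +oo[ (EFin \o h).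
Hypothesis hg_lt1 : L1norm h * L1norm g < 1.
Variables (mu : 'I_4 -> R) (d : measure_display) (Omega : measurableType d).
Variables (P : probability Omega R) (tau : nat -> Omega -> \bar R) (Z : nat -> Omega -> 'I_4).
Hypothesis H : hawkes tau Z P mu (kernel4 g h).
Local Notation E := (Ex P).
Local Notation N := (stopped_count tau Z).
Local Notation C := (stopped_comp tau Z mu (kernel4 g h)).
Local Notation M := (wmart tau Z mu (kernel4 g h)).
Local Notation k := (kmass g h).
Local Notation q := (L1norm h * L1norm g).

Let ki := kernel4_int g_int h_int.
Let k0 := kmass_ge0 g_ge0 h_ge0.
Let q1 : 0 < 1 - q. Proof. by rewrite subr_gt0. Qed.
Let mu0 := hawkes_mu_ge0 H.

(** The asymptotic speed of component [i]: solving the two equations [r_i = mu_i + k_i r_(par i)]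
    gives [nu_1 / (1 - q)] for the first two components and [nu_2 / (1 - q)] for the others. *)
Definition rate i := (mu i + k i * mu (par i)) / (1 - q).

Lemma rate_ge0 i : 0 <= rate i.
Proof. by rewrite divr_ge0 ?(ltW q1)// addr_ge0// mulr_ge0. Qed.

Lemma rateE i : rate i = mu i + k i * rate (par i).
Proof.
have := kmassM g h i; rewrite /rate parK => e.
apply: (mulIf (lt0r_neq0 q1)); rewrite divfK ?gt_eqF// mulrDl -[k i * _ * _]mulrA divfK ?gt_eqF//.
by rewrite -e; ring.
Qed.

(** Going once around the cycle between [i] and [par i] multiplies [x] by [q < 1], so [x] can be
    absorbed. *)
Lemma two_step_bound x y e e' i : 0 <= k i -> x <= e + k i * y -> y <= e' + k (par i) * x ->
  x <= (e + k i * e') / (1 - q).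
Proof.
move=> ki0 hx hy; rewrite ler_pdivlMr// -(kmassM g h i).
have : k i * y <= k i * (e' + k (par i) * x) by rewrite ler_wpM2l.
set a := k i; set b := k (par i) => h2; rewrite -/a in hx; nra.
Qed.

Definition unit_weight (i j : 'I_4) : R := (j == i)%:R.

Lemma sum_unit_weight i (F : 'I_4 -> R) : \sum_j unit_weight i j * F j = F i.
Proof.
rewrite (bigD1 i)//= /unit_weight eqxx mul1r big1 ?addr0// => j /negbTE ->.
by rewrite mul0r.
Qed.

Lemma wmart_unit n i t w : M n (unit_weight i) t w = N n i t w - C n i t w.
Proof. by rewrite /wmart !sum_unit_weight. Qed.

Lemma wmart0 n th w : M n th 0 w = 0.
Proof.
rewrite /wmart !big1 ?subrr// => i _.
  by rewrite (stopped_comp0 _ _ _ (hawkes_time_gt0 H)) mulr0.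
by rewrite (stopped_count0 _ (hawkes_time_gt0 H)) ?mulr0.
Qed.

Lemma comp_le n i t w : 0 <= t -> C n i t w <= mu i * t + k i * N n (par i) t w.
Proof.
move=> t0.
have := stopped_comp_le Z (hawkes_time_gt0 H) mu0 (hawkes_phi_ge0 H) ki n i w t0.
rewrite (_ : \sum_j _ = k i * N n (par i) t w)//.
rewrite (bigD1 (par i))//= kernel4_L1norm eqxx mul1r big1 ?addr0// => j /negbTE ji.
by rewrite kernel4_L1norm ji !mul0r.
Qed.

Let bN n i t : bmf (N n i t) := bmf_count H n i t.
Let bM n th t : 0 <= t -> bmf (M n th t).
Proof. by move=> t0; exact: (adapted_bmf H (adapted_wmart H ki n th t0)). Qed.
Let bC n i t : 0 <= t -> bmf (C n i t).
Proof.
move=> t0; rewrite (_ : C n i t = fun w => N n i t w - M n (unit_weight i) t w).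
  by apply: bmfB => //; exact: bM.
by apply/funext => w; rewrite wmart_unit opprB addrC subrK.
Qed.

Let c1_adapted (s c : R) : adapted tau Z s (fun=> c).
Proof. exact: bmf_cst. Qed.

Lemma Ex_wmart n th t : 0 <= t -> E (M n th t) = 0.
Proof.
move=> t0; have := wmart_orth H ki n th (lexx 0) t0 (c1_adapted 0 1) => <-.
by apply: eq_Ex => w; rewrite mul1r wmart0 subr0.
Qed.

Lemma Ex_count n i t : 0 <= t -> E (N n i t) = E (C n i t).
Proof.
move=> t0; apply/eqP; rewrite -subr_eq0 -ExB//; last exact: bC.
rewrite -(Ex_wmart n (unit_weight i) t0); apply/eqP; apply: eq_Ex => w.
by rewrite wmart_unit.
Qed.

(** The inequality between means closes after two steps; its bound is independent of [n], which
    starts the chain of uniform moment estimates. *)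
Lemma Ex_count_le n i t : 0 <= t -> E (N n i t) <= rate i * t.
Proof.
move=> t0.
have h1 j : E (N n j t) <= mu j * t + k j * E (N n (par j) t).
  rewrite Ex_count// -ExZ// -[X in X + _](Ex_cst P) -ExD//; [|exact: bmf_cst|exact: bmfZ].
  apply: Ex_le; first exact: bC.
    by apply: bmfD; [exact: bmf_cst|exact: bmfZ].
  by move=> w; exact: comp_le.
have := h1 (par i); rewrite parK => h2.
have := two_step_bound (k0 i) (h1 i) h2.
by rewrite /rate mulrA -mulrDl mulrAC.
Qed.

(** The same absorption carried out path by path: the count exceeds its drift by at most a multiple
    of the martingales. *)
Lemma count_le_mart n i t w : 0 <= t -> N n i t w <=
  (`|M n (unit_weight i) t w| + k i * `|M n (unit_weight (par i)) t w|) / (1 - q) + rate i * t.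
Proof.
move=> t0.
have h1 j : N n j t w <= (`|M n (unit_weight j) t w| + mu j * t) + k j * N n (par j) t w.
  have e : N n j t w = M n (unit_weight j) t w + C n j t w by rewrite wmart_unit subrK.
  by rewrite {1}e (le_trans (lerD (ler_norm _) (comp_le n j w t0)))// addrA.
have := h1 (par i); rewrite parK => h2.
have := two_step_bound (k0 i) (h1 i) h2; move/le_trans; apply.
rewrite /rate mulrAC -mulrDl; apply: ler_wpM2r; first by rewrite invr_ge0 ltW.
by rewrite le_eqVlt; apply/orP; left; apply/eqP; ring.
Qed.

Lemma Ex_unit_mart_sqr n i t : 0 <= t -> E (fun w => M n (unit_weight i) t w ^+ 2) = E (N n i t).
Proof.
move=> t0; have := wmart_second_moment H ki n (unit_weight i) (lexx 0) t0 (c1_adapted 0 1).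
rewrite (_ : (fun w => _ * (_ - M n _ 0 w) ^+ 2) = fun w => M n (unit_weight i) t w ^+ 2); last first.
  by apply/funext => w; rewrite mul1r wmart0 subr0.
move=> ->; apply: eq_Ex => w; rewrite mul1r.
rewrite (_ : \sum_j _ = N n i t w); last first.
  rewrite -[RHS](sum_unit_weight i (fun j => N n j t w)); apply: eq_bigr => j _.
  by rewrite /unit_weight; case: eqP; rewrite ?expr1n ?expr0n.
rewrite big1 ?subr0// => j _.
by rewrite (stopped_count0 _ (hawkes_time_gt0 H)) ?mulr0.
Qed.

Lemma unit_mart_sup n i t : 0 <= t -> exists W : Omega -> R, [/\ bmf W,
  forall w, 0 <= W w,
  forall u w, 0 <= u -> u <= t -> M n (unit_weight i) u w ^+ 4 <= W w &
  E W <= 1048 * E (fun w => N n i t w ^+ 2)].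
Proof.
move=> t0; have [W [bW W0 MW EW]] := wmart_sup H ki n (unit_weight i) (lexx 0) t0.
exists W; split => //.
  by move=> u w u0 ut; have := MW u w u0 ut; rewrite wmart0 subr0.
rewrite (_ : (fun w => N n i t w ^+ 2) = (fun w => (\sum_j unit_weight i j ^+ 2 * N n j t w -
  \sum_j unit_weight i j ^+ 2 * N n j 0 w) ^+ 2))//; apply/funext => w; congr (_ ^+ 2).
rewrite (_ : \sum_j _ = N n i t w); last first.
  rewrite -[RHS](sum_unit_weight i (fun j => N n j t w)); apply: eq_bigr => j _.
  by rewrite /unit_weight; case: eqP; rewrite ?expr1n ?expr0n.
rewrite big1 ?subr0// => j _.
by rewrite (stopped_count0 _ (hawkes_time_gt0 H)) ?mulr0.
Qed.

Lemma sqr_le3 (a b c : R) : (a + b + c) ^+ 2 <= 3 * (a ^+ 2 + b ^+ 2 + c ^+ 2).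
Proof.
have := sqr_ge0 (a - b); have := sqr_ge0 (b - c); have := sqr_ge0 (a - c); nra.
Qed.

Lemma count_sqr_le : exists K : R, 0 <= K /\ forall n i t w, 0 <= t -> N n i t w ^+ 2 <=
  K * (M n (unit_weight i) t w ^+ 2 + M n (unit_weight (par i)) t w ^+ 2 + t ^+ 2).
Proof.
pose K i := 3 * ((1 - q)^-1 ^+ 2 + (k i / (1 - q)) ^+ 2 + rate i ^+ 2).
have K0 i : 0 <= K i by rewrite mulr_ge0// !addr_ge0 ?sqr_ge0.
exists (\sum_i K i); split; first exact: sumr_ge0.
move=> n i t w t0; set x := M n _ t w; set y := M n _ t w.
have KK : K i <= \sum_i K i by rewrite (bigD1 i)//= lerDl sumr_ge0.
apply: (@le_trans _ _ (K i * (x ^+ 2 + y ^+ 2 + t ^+ 2))); last first.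
  by rewrite ler_wpM2r// !addr_ge0 ?sqr_ge0.
have N0 := stopped_count_ge0 tau Z n i t w.
apply: (@le_trans _ _ ((`|x| / (1 - q) + k i / (1 - q) * `|y| + rate i * t) ^+ 2)).
  rewrite ler_pXn2r ?nnegrE//; last first.
    have iq : 0 <= (1 - q)^-1 by rewrite invr_ge0 ltW.
    apply: addr_ge0; last by apply: mulr_ge0 => //; exact: rate_ge0.
    apply: addr_ge0; first exact: mulr_ge0.
    by apply: mulr_ge0 => //; exact: mulr_ge0.
  apply: le_trans (count_le_mart n i w t0) _; rewrite -/x -/y.
  by rewrite le_eqVlt; apply/orP; left; apply/eqP; ring.
apply: le_trans (sqr_le3 _ _ _) _.
rewrite /K -[leRHS]mulrA ler_pM2l//.
rewrite -(real_normK (num_real x)) -(real_normK (num_real y)).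
have e1 : (`|x| / (1 - q)) ^+ 2 = (1 - q)^-1 ^+ 2 * `|x| ^+ 2 by ring.
have e2 : (k i / (1 - q) * `|y|) ^+ 2 = (k i / (1 - q)) ^+ 2 * `|y| ^+ 2 by ring.
have e3 : (rate i * t) ^+ 2 = rate i ^+ 2 * t ^+ 2 by ring.
rewrite e1 e2 e3.
have := sqr_ge0 ((1 - q)^-1); have := sqr_ge0 (k i / (1 - q)); have := sqr_ge0 (rate i).
have := sqr_ge0 `|x|; have := sqr_ge0 `|y|; have := sqr_ge0 t.
move: (_ ^+ 2) (_ ^+ 2) (_ ^+ 2) (_ ^+ 2) (_ ^+ 2) (_ ^+ 2) => A1 A2 A3 A4 A5 A6.
nra.
Qed.

(** [N ^+ 2] is bounded by squares of martingales, whose expectations are again first moments of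
    counts. *)
Lemma Ex_count_sqr : exists K : R, 0 <= K /\ forall n i t, 0 <= t ->
  E (fun w => N n i t w ^+ 2) <= K * (t + t ^+ 2).
Proof.
have [K [K0 hK]] := count_sqr_le.
pose S := \sum_i rate i; have S0 : 0 <= S by apply: sumr_ge0 => i _; exact: rate_ge0.
have Sr i : rate i <= S.
  by rewrite /S (bigD1 i)//= lerDl sumr_ge0// => j _; exact: rate_ge0.
exists (K * (2 * S + 1)); split; first by rewrite mulr_ge0// addr_ge0// mulr_ge0.
move=> n i t t0; have bM2 j : bmf (fun w => M n (unit_weight j) t w ^+ 2) by apply: bmfX; exact: bM.
apply: (@le_trans _ _ (K * (E (N n i t) + E (N n (par i) t) + t ^+ 2))).
  rewrite -!Ex_unit_mart_sqr// -[X in _ + X](Ex_cst P) -ExD// -ExD//; last 2 first.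
  - exact: bmfD.
  - exact: bmf_cst.
  rewrite -ExZ; last by apply: bmfD; [exact: bmfD|exact: bmf_cst].
  apply: Ex_le; first exact: bmfX.
    by apply: bmfZ; apply: bmfD; [exact: bmfD|exact: bmf_cst].
  by move=> w; exact: hK.
rewrite -mulrA ler_wpM2l//.
have h1 := Ex_count_le n i t0; have h2 := Ex_count_le n (par i) t0.
have h3 : rate i * t <= S * t by rewrite ler_wpM2r.
have h4 : rate (par i) * t <= S * t by rewrite ler_wpM2r.
have h5 : 0 <= S * t ^+ 2 by rewrite mulr_ge0 ?sqr_ge0.
nra.
Qed.

(** Fourth powers of the martingales are dominated by variables of mean at most [1048 * E N^2], so
    the second moments of the counts control their fourth moments. *)
Lemma Ex_count_fourth t : 0 <= t -> exists K : R, forall n i,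
  E (fun w => N n i t w ^+ 4) <= K.
Proof.
move=> t0; have [K [K0 hK]] := count_sqr_le; have [L [L0 hL]] := Ex_count_sqr.
pose B := L * (t + t ^+ 2).
exists (3 * K ^+ 2 * (2 * (1048 * B) + t ^+ 4)) => n i.
have [W [bW W0 MW EW]] := unit_mart_sup n i t0.
have [W' [bW' W'0 MW' EW']] := unit_mart_sup n (par i) t0.
apply: (@le_trans _ _ (E (fun w => 3 * K ^+ 2 * (W w + W' w + t ^+ 4)))).
  apply: Ex_le; first exact: bmfX.
    by apply: bmfZ; apply: bmfD; [exact: bmfD|exact: bmf_cst].
  move=> w; have := hK n i t w t0; have := MW t w t0 (lexx t); have := MW' t w t0 (lexx t).
  set y := M n _ t w; set x := M n _ t w; set z := N n i t w => h1 h2 h3.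
  have e4 (v : R) : v ^+ 4 = (v ^+ 2) ^+ 2 by rewrite -exprM.
  rewrite e4; apply: (@le_trans _ _ ((K * (x ^+ 2 + y ^+ 2 + t ^+ 2)) ^+ 2)).
    have zz : 0 <= K * (x ^+ 2 + y ^+ 2 + t ^+ 2).
      by apply: mulr_ge0 => //; apply: addr_ge0; [apply: addr_ge0|]; exact: sqr_ge0.
    by rewrite (@ler_pXn2r _ 2)// nnegrE// sqr_ge0.
  rewrite exprMn [3 * _]mulrC -[leRHS]mulrA; apply: ler_wpM2l; first exact: sqr_ge0.
  apply: le_trans (sqr_le3 _ _ _) _; rewrite ler_pM2l// -!e4; apply: lerD => //.
  exact: lerD.
rewrite ExZ; last by apply: bmfD; [exact: bmfD|exact: bmf_cst].
rewrite ler_wpM2l ?mulr_ge0 ?sqr_ge0// ExD//; [|exact: bmfD|exact: bmf_cst].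
rewrite ExD// Ex_cst lerD2r mulr_natl mulr2n; apply: lerD.
  by apply: le_trans EW _; apply: ler_wpM2l; [exact: ler0n|exact: hL].
by apply: le_trans EW' _; apply: ler_wpM2l; [exact: ler0n|exact: hL].
Qed.

Lemma total_count n t w : (tau n w <= t%:E)%E -> \sum_i N n i t w = n.+1%:R.
Proof.
move=> nt; have := wcountE tau Z n (fun=> 1) t w.
under eq_bigr do rewrite mul1r; move=> ->.
rewrite (eq_bigr (fun=> 1)) ?sumr_const ?card_ord// => j _.
by rewrite (le_trans _ nt) ?mulr1// (tau_nd (hawkes_time_le H))// -ltnS.
Qed.

(** If [tau n <= t] then the total count is [n.+1]; the rate is Markov's inequality of order four.
    It must beat the factor [n ^ 2] of the trivial bound for squared counts in the law of large
    numbers. *)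
Lemma explosion_bound t : 0 <= t -> exists K : R, forall n,
  fine (P [set w | (tau n w <= t%:E)%E]) <= K / n.+1%:R ^+ 4.
Proof.
move=> t0; have [K hK] := Ex_count_fourth t0.
exists (64 * (4 * K)) => n.
have bs : bmf (fun w => (\sum_i N n i t w) ^+ 4) by apply: bmfX; apply: bmf_sum.
apply: (@le_trans _ _ (E (fun w => (\sum_i N n i t w) ^+ 4) / n.+1%:R ^+ 4)).
  apply: Ex_markov.
  - exact: (measurable_time_le H).
  - exact: bs.
  - by apply: exprn_gt0; rewrite ltr0n.
  - by move=> w; rewrite exprn_even_ge0.
  - by move=> w /= /total_count ->.
rewrite ler_wpM2r ?invr_ge0 ?exprn_ge0//.
(* Two rounds of [(a + b)^4 <= 8 (a^4 + b^4)] give 64 for four summands. *)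
apply: (@le_trans _ _ (E (fun w => 64 * \sum_i N n i t w ^+ 4))).
  apply: Ex_le => //.
    by apply: bmfZ; apply: bmf_sum => i; exact: bmfX.
  move=> w; rewrite !big_ord_recr !big_ord0 /= !add0r.
  move: (N _ _ _ _) (N _ _ _ _) (N _ _ _ _) (N _ _ _ _) => x y z u.
  have e4 (v : R) : v ^+ 4 = (v ^+ 2) ^+ 2 by rewrite -exprM.
  have s2 (a b : R) : (a + b) ^+ 2 <= 2 * (a ^+ 2 + b ^+ 2).
    have := sqr_ge0 (a - b); nra.
  have s4 (a b : R) : (a + b) ^+ 4 <= 8 * (a ^+ 4 + b ^+ 4).
    rewrite !e4; apply: (@le_trans _ _ ((2 * (a ^+ 2 + b ^+ 2)) ^+ 2)).
      by rewrite ler_pXn2r ?nnegrE ?sqr_ge0// mulr_ge0// addr_ge0 ?sqr_ge0.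
    have := s2 (a ^+ 2) (b ^+ 2); nra.
  have := s4 (x + y) (z + u); have := s4 x y; have := s4 z u; rewrite !addrA; lra.
rewrite ExZ; last by apply: bmf_sum => i; exact: bmfX.
rewrite ler_pM2l// (Ex_sum P _ (F := fun i w => N n i t w ^+ 4)); last by move=> i; exact: bmfX.
apply: (@le_trans _ _ (\sum_(i < 4) K)); first by apply: ler_sum => i _; exact: hK.
by rewrite sumr_const card_ord mulr_natl.
Qed.

End model_moments.

#[local] Transparent stopped_comp stopped_count stopped_time compensated.

(** * Volterra equations *)

Section volterra.
Context {R : realType}.

(* The two inequalities bound [sup x] by itself with the factor [a b < 1]; the
   supremum is finite by assumption, hence can be absorbed. *)
Lemma volterra_sup (I : Type) (D : I -> Prop) (x y : I -> R) (e e' a b : R) :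
  0 <= e -> 0 <= e' -> 0 <= a -> 0 <= b -> a * b < 1 ->
  (exists B, forall p, D p -> `|x p| <= B) ->
  (forall B, 0 <= B -> (forall p, D p -> `|y p| <= B) -> forall p, D p -> `|x p| <= e + a * B) ->
  (forall B, 0 <= B -> (forall p, D p -> `|x p| <= B) -> forall p, D p -> `|y p| <= e' + b * B) ->
  forall p, D p -> `|x p| <= (e + a * e') / (1 - a * b).
Proof.
move=> e0 e'0 a0 b0 ab1 [B xB] hx hy p Dp.
pose X := [set `|x r| | r in [set r | D r]].
have hX : has_sup X.
  split; first by exists `|x p|, p.
  by exists B => _ [r Dr <-]; exact: xB.
have xS r : D r -> `|x r| <= sup X by move=> Dr; apply: ub_le_sup; [exact: hX.2|exists r].
have S0 : 0 <= sup X := le_trans (normr_ge0 _) (xS p Dp).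
have yS := hy _ S0 xS.
have yS0 : 0 <= e' + b * sup X by rewrite addr_ge0// mulr_ge0.
have SE : sup X <= e + a * (e' + b * sup X).
  apply: ge_sup; first by exists `|x p|, p.
  by move=> _ [r Dr <-]; exact: (hx _ yS0 yS).
apply: le_trans (xS p Dp) _; rewrite ler_pdivlMr ?subr_gt0//.
move: SE; move: (sup X) => s; lra.
Qed.

Lemma conv_sum (k : R -> R) (k_ge0 : forall r, 0 <= k r) (k_neg : forall r, r < 0 -> k r = 0)
  (k_int : lebesgue_measure.-integrable setT (EFin \o k)) (m : nat) (F : nat -> R -> R) (B t : R) :
  (forall j, measurable_fun setT (F j)) -> (forall j s, `|F j s| <= B) ->
  kconv k (fun s => \sum_(j < m) F j s) t = \sum_(j < m) kconv k (F j) t.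
Proof.
move=> mF FB; elim: m => [|m IH].
  rewrite big_ord0 /kconv (_ : (fun r => _) = fun=> 0) ?Rintegral_cst ?mul0r//.
  by apply/funext => r; rewrite big_ord0 mulr0.
rewrite big_ord_recr /= -IH -[X in X + _]mul1r -[X in _ + X]mul1r.
rewrite -(@conv_lin _ k k_ge0 k_neg k_int 1 1 _ _ (\sum_(j < m) B) B).
- by congr (kconv k _ t); apply/funext => s; rewrite big_ord_recr /= !mul1r.
- exact: measurable_sum.
- exact: mF.
- by move=> s _; rewrite (le_trans (ler_norm_sum _ _ _))//; apply: ler_sum.
- by move=> s _; exact: FB.
Qed.

End volterra.

(** The identity on positive times extended by 0, so that the linear drift can be convolved like the
    counts, which also vanish at negative times. *)
Definition pos {R : realType} (t : R) : R := Num.max t 0.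

Lemma pos_incr {R : realType} (u v : R) : u <= v -> `|pos v - pos u| <= v - u.
Proof.
move=> uv; rewrite /pos; have [u0|u0] := leP u 0; have [v0|v0] := leP v 0;
  rewrite ler_norml; apply/andP; split; lra.
Qed.

Section counting_convolution.
Context {R : realType} d (Omega : measurableType d) (dim : nat).
Variables (tau : nat -> Omega -> \bar R) (Z : nat -> Omega -> 'I_dim).
Hypothesis tau_gt0 : forall n w, (0 < tau n w)%E.
Local Notation N := (stopped_count tau Z).

Lemma jump_fun_cases k j w : (exists2 r : R, tau k w = r%:E &
    (fun s : R => ((tau k w <= s%:E)%E && (Z k w == j))%:R : R) = fun s => (r <= s)%R%:R) \/
  (forall s : R, ((tau k w <= s%:E)%E && (Z k w == j)) = false).
Proof.
case: (Z k w == j); last by right => s; rewrite andbF.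
case e : (tau k w) => [r||]; last by have := tau_gt0 k w; rewrite e.
  by left; exists r => //; apply/funext => s; rewrite andbT lee_fin.
by right.
Qed.

Lemma measurable_jump_time k j w :
  measurable_fun setT (fun s : R => ((tau k w <= s%:E)%E && (Z k w == j))%:R : R).
Proof.
have [[r _ ->]|h] := jump_fun_cases k j w.
  rewrite (_ : (fun s : R => _) = \1_`[r, +oo[); first exact: measurable_indic.
  by apply/funext => s; rewrite indicE in_set_itv in_itv /= andbT.
rewrite (_ : (fun s : R => _) = fun=> 0); first exact: measurable_cst.
by apply/funext => s; rewrite h.
Qed.

Lemma measurable_count_time n j w : measurable_fun setT (fun s => N n j s w).
Proof. by apply: measurable_sum => k; exact: measurable_jump_time. Qed.

Lemma conv_count (k : R -> R) (k_ge0 : forall r, 0 <= k r) (k_neg : forall r, r < 0 -> k r = 0)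
  (k_int : lebesgue_measure.-integrable setT (EFin \o k)) n j t w :
  kconv k (fun s => N n j s w) t =
  \sum_(m < n.+1) ((tau m w <= t%:E)%E && (Z m w == j))%:R * cumul k (t - fine (tau m w)).
Proof.
rewrite /stopped_count (@conv_sum _ k k_ge0 k_neg k_int n.+1
   (fun m s => ((tau m w <= s%:E)%E && (Z m w == j))%:R) 1).
- apply: eq_bigr => m _; have [[r e ef]|h] := jump_fun_cases m j w.
    rewrite ef conv_step e /=.
    have -> : ((r%:E <= t%:E)%E && (Z m w == j))%:R = (r <= t)%R%:R :> R.
      by have := congr1 (fun f : R -> R => f t) ef; rewrite /= e.
    have [rt|rt] := leP r t; first by rewrite mul1r.
    by rewrite mul0r cumul_neg// subr_lt0.
  rewrite h mul0r /kconv (_ : (fun r => _) = fun=> 0) ?Rintegral_cst ?mul0r//.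
  by apply/funext => r; rewrite h mulr0.
- by move=> m; exact: measurable_jump_time.
- by move=> m s; rewrite normr_nat lern1 leq_b1.
Qed.

End counting_convolution.

(** * Pathwise Volterra equations before the stopping time *)

Section model_paths.
Context {R : realType}.
Notation leb := (@lebesgue_measure R).
Variables (g h : R -> R).
Hypothesis g_ge0 : forall t : R, 0 <= t -> 0 <= g t.
Hypothesis h_ge0 : forall t : R, 0 <= t -> 0 <= h t.
Hypothesis g_int : leb.-integrable `[0, +oo[ (EFin \o g).
Hypothesis h_int : leb.-integrable `[0, +oo[ (EFin \o h).
Hypothesis hg_lt1 : L1norm h * L1norm g < 1.
Variables (mu : 'I_4 -> R) (d : measure_display) (Omega : measurableType d).
Variables (P : probability Omega R) (tau : nat -> Omega -> \bar R) (Z : nat -> Omega -> 'I_4).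
Hypothesis H : hawkes tau Z P mu (kernel4 g h).
Local Notation N := (stopped_count tau Z).
Local Notation C := (stopped_comp tau Z mu (kernel4 g h)).
Local Notation M := (wmart tau Z mu (kernel4 g h)).
Local Notation k := (kmass g h).
Local Notation q := (L1norm h * L1norm g).
Local Notation kern0 i := (ext0 (kern g h i)).
Local Notation rate := (rate g h mu).

Let k0 := kmass_ge0 g_ge0 h_ge0.
Let kern0_ge0 i : forall r, 0 <= kern0 i r.
Proof. by apply: ext0_ge0 => t; exact: kern_ge0. Qed.
Let kern0_neg i : forall r, r < 0 -> kern0 i r = 0.
Proof. by move=> r; exact: ext0_neg. Qed.
Let kern0_int i : leb.-integrable setT (EFin \o kern0 i).
Proof. by apply: ext0_integrable; exact: kern_int. Qed.
Let mass_kern0 i : mass (kern0 i) = k i. Proof. exact: mass_ext0. Qed.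

Lemma cumul_ext0_0 x : cumul (ext0 (cst 0 : R -> R)) x = 0.
Proof.
rewrite /cumul (_ : (fun r => _) = fun=> 0) ?Rintegral_cst ?mul0r//.
apply/funext => r; have [r0|r0] := ltP r 0; first by rewrite ext0_neg// mul0r.
by rewrite ext0E// mul0r.
Qed.

Variables (n : nat) (T : R) (w : Omega).
Hypothesis T0 : 0 <= T.
Hypothesis Ttau : (T%:E < tau n w)%E.

(** Up to [T < tau n] the stopping is invisible and jump [n] has not occurred, so the compensator is
    a genuine convolution with the partner's count. *)
Lemma comp_conv i t : 0 <= t -> t <= T ->
  C n i t w = mu i * t + kconv (kern0 i) (fun s => N n (par i) s w) t.
Proof.
move=> t0 tT; have tn : (t%:E < tau n w)%E by rewrite (le_lt_trans _ Ttau)// lee_fin.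
rewrite (@conv_count _ _ _ _ tau Z (hawkes_time_gt0 H) (kern0 i) (kern0_ge0 i) (@kern0_neg (i)) (kern0_int i)).
rewrite /stopped_comp stopped_time_id//; congr (_ + _).
rewrite big_ord_recr /= leNgt tn /= mul0r addr0; apply: eq_bigr => m _.
rewrite kernel4E; case: eqP => _; first by rewrite andbT.
by rewrite andbF mul0r cumul_ext0_0 mulr0.
Qed.

Lemma count_volterra i t : 0 <= t -> t <= T ->
  N n i t w = M n (unit_weight i) t w + mu i * t + kconv (kern0 i) (fun s => N n (par i) s w) t.
Proof. by move=> t0 tT; rewrite wmart_unit -addrA -comp_conv// subrK. Qed.

Let N_neg i t : t <= 0 -> N n i t w = 0.
Proof. by move=> t0; rewrite (stopped_count0 _ (hawkes_time_gt0 H)). Qed.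
Let N_bound i t : `|N n i t w| <= n.+1%:R.
Proof. by rewrite ger0_norm ?stopped_count_ge0// stopped_count_le. Qed.
Let mN i : measurable_fun setT (fun s => N n i s w).
Proof. by apply: measurable_count_time; exact: hawkes_time_gt0 H. Qed.

Definition tail (D : R) := \sum_i (k i - cumul (kern0 i) D).

Lemma tail_term i D : 0 <= k i - cumul (kern0 i) D <= tail D.
Proof.
have h0 j : 0 <= k j - cumul (kern0 j) D by rewrite subr_ge0 -mass_kern0; exact: (cumul_le_mass (kern0_ge0 j) (@kern0_neg j) (kern0_int j)).
by rewrite h0/= /tail (bigD1 i)//= lerDl sumr_ge0.
Qed.

Let ksum := \sum_i k i.
Let k_ksum i : k i <= ksum. Proof. by rewrite /ksum (bigD1 i)//= lerDl sumr_ge0. Qed.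

(** The deviation [x j] solves a Volterra equation whose source is the martingale plus
    [rate (par j)] times the error made in replacing [k * pos] by the mass of [k] times [pos]. All
    times [s <= T] are included, as the convolution also looks at negative ones. *)
Lemma lln_path m D i t : 0 <= m -> 0 <= D ->
  (forall j u, 0 <= u -> u <= T -> `|M n (unit_weight j) u w| <= m) ->
  0 <= t -> t <= T ->
  let e := m + (\sum_j rate j) * (ksum * D + 2 * T * tail D) in
  `|N n i t w - rate i * t| <= (e + k i * e) / (1 - q).
Proof.
move=> m0 D0 hm t0 tT; cbv zeta.
set e := m + (\sum_j rate j) * (ksum * D + 2 * T * tail D).
have r0 j : 0 <= rate j by exact: (rate_ge0 g_ge0 h_ge0 hg_lt1 H).
have tl0 : 0 <= tail D by have /andP[a b] := tail_term i D; exact: le_trans b.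
have ks0 : 0 <= ksum by exact: sumr_ge0.
have b0 : 0 <= ksum * D + 2 * T * tail D by rewrite addr_ge0// !mulr_ge0.
have e0 : 0 <= e by rewrite addr_ge0// mulr_ge0// sumr_ge0.
have mpos : measurable_fun setT (@pos R).
  rewrite (_ : @pos R = fun t => Num.max t 0)//; exact: measurable_maxr.
have pos_le s : s <= T -> `|pos s| <= T.
  by move=> sT; rewrite ger0_norm /pos ?le_max ?lexx ?orbT// ge_max sT.
pose x j s := N n j s w - rate j * pos s.
have mx j : measurable_fun setT (x j).
  by apply: measurable_funB => //; exact: measurable_funM.
have x_bound j s : s <= T -> `|x j s| <= n.+1%:R + rate j * T.
  move=> sT; rewrite (le_trans (ler_normB _ _))// lerD// normrM ger0_norm// ler_wpM2l//.
  exact: pos_le.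
have x_neg j s : s <= 0 -> x j s = 0.
  by move=> s0; rewrite /x N_neg// /pos (max_idPr s0) mulr0 subrr.
have main j B : 0 <= B -> (forall s, s <= T -> `|x (par j) s| <= B) ->
   forall s, s <= T -> `|x j s| <= e + k j * B.
  move=> B0 hB s sT; have [s0|/ltW s0] := leP s 0.
    by rewrite x_neg// normr0 addr_ge0// mulr_ge0.
  have pss : pos s = s by exact/max_idPl.
  have -> : x j s = M n (unit_weight j) s w + kconv (kern0 j) (x (par j)) s -
     rate (par j) * (k j * pos s - kconv (kern0 j) pos s).
    have := @conv_lin _ (kern0 j) (kern0_ge0 j) (@kern0_neg (j)) (kern0_int j) 1 (- rate (par j))
       (fun s => N n (par j) s w) pos n.+1%:R T s (mN (par j)) mpos (fun u _ => N_bound (par j) u)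
       (fun u us => pos_le u (le_trans us sT)).
    rewrite (_ : (fun u => _) = x (par j)); last first.
      by apply/funext => u; rewrite mul1r mulNr.
    move=> ->; rewrite /x count_volterra// pss.
    have := rateE hg_lt1 mu j; move: (kconv _ _ s) (kconv _ _ s) (M _ _ _ _) => c1 c2 c3 ->.
    ring.
  have h1 := hm j s s0 sT.
  have h2 : `|kconv (kern0 j) (x (par j)) s| <= k j * B.
    have hz := @conv_diff _ (kern0 j) (kern0_ge0 j) (@kern0_neg (j)) (kern0_int j)
      (x (par j)) (fun=> 0) B 0 s s B (mx (par j)) (measurable_cst _).
    move: hz; rewrite {2}/kconv (_ : (fun r => _) = fun=> 0); last by apply/funext => r; rewrite mulr0.
    rewrite Rintegral_cst// mul0r subr0 mass_kern0; apply.
    - by move=> u us; apply: hB; exact: le_trans sT.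
    - by move=> u _; rewrite normr0.
    - by move=> r r0'; rewrite subr0; apply: hB; rewrite (le_trans _ sT)// gerBl.
  (* [pos] is 1-Lipschitz and at most [T], so [D] is its modulus over a window of length [D] and [T]
     its bound. *)
  have h3 : `|k j * pos s - kconv (kern0 j) pos s| <= ksum * D + 2 * T * tail D.
    have hz := @conv_approx _ (kern0 j) (kern0_ge0 j) (@kern0_neg (j)) (kern0_int j)
      pos T D D T s mpos sT T0 D0 pos_le.
    rewrite mass_kern0 in hz; apply: le_trans (hz _) _.
      by move=> u v uv _; apply: le_trans; exact: pos_incr.
    apply: lerD; first by rewrite ler_wpM2r.
    by apply: ler_wpM2l; [rewrite mulr_ge0|have /andP[] := tail_term j D].
  have rs : rate (par j) <= \sum_i rate i by rewrite (bigD1 (par j))//= lerDl sumr_ge0.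
  have h12 := le_trans (ler_normD _ _) (lerD h1 h2).
  apply: (le_trans (ler_normB _ _)); rewrite normrM (ger0_norm (r0 _)) /e.
  rewrite [leRHS]addrAC; apply: lerD; first exact: h12.
  by apply: ler_pM.
have := @volterra_sup _ R (fun s => s <= T) (x i) (x (par i)) e e (k i) (k (par i)) e0 e0 (k0 _) (k0 _).
rewrite kmassM => /(_ hg_lt1 (ex_intro _ _ (x_bound i)) (main i)).
have := main (par i); rewrite parK => h2 /(_ h2 t tT).
by rewrite /x (_ : pos t = t)//; exact/max_idPl.
Qed.

(* [lo a] and [hi a] are the two components whose difference is S_1 (a = false)
   or S_2 (a = true). *)
Definition lo (a : bool) : 'I_4 := inord (if a then 2 else 0).
Definition hi (a : bool) : 'I_4 := inord (if a then 3 else 1).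
Definition diff_weight (a : bool) (i : 'I_4) : R := unit_weight (lo a) i - unit_weight (hi a) i.

Lemma par_lo a : par (lo a) = lo (~~ a).
Proof. by apply/val_inj; case: a; rewrite /par /lo /= !inordK. Qed.

Lemma par_hi a : par (hi a) = hi (~~ a).
Proof. by apply/val_inj; case: a; rewrite /par /hi /= !inordK. Qed.

Lemma kern_hi a : kern g h (hi a) = kern g h (lo a).
Proof. by case: a; rewrite /kern /hi /lo /= !inordK. Qed.

Lemma kmass_lo a : k (lo a) = if a then L1norm g else L1norm h.
Proof. by case: a; rewrite /kmass /kern /lo /= inordK. Qed.

Lemma wmart_diff a u : M n (diff_weight a) u w =
  M n (unit_weight (lo a)) u w - M n (unit_weight (hi a)) u w.
Proof.
have e th : M n th u w = \sum_i th i * (N n i u w - C n i u w).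
  by rewrite /wmart -sumrB; apply: eq_bigr => i _; rewrite mulrBr.
by rewrite !e -sumrB; apply: eq_bigr => i _; rewrite /diff_weight mulrBl.
Qed.

Hypothesis mu_lo : forall a, mu (lo a) = mu (hi a).

Definition sdiff a t := N n (lo a) t w - N n (hi a) t w.

Lemma sdiff_volterra a t : 0 <= t -> t <= T ->
  sdiff a t = M n (diff_weight a) t w + kconv (kern0 (lo a)) (sdiff (~~ a)) t.
Proof.
move=> t0 tT; rewrite /sdiff (count_volterra (lo a))// (count_volterra (hi a))//.
rewrite wmart_diff par_lo par_hi kern_hi mu_lo.
have := @conv_lin _ (kern0 (lo a)) (kern0_ge0 _) (@kern0_neg (lo a)) (kern0_int _) 1 (-1)
  (fun s => N n (lo (~~ a)) s w) (fun s => N n (hi (~~ a)) s w) n.+1%:R n.+1%:R t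
  (mN _) (mN _) (fun u _ => N_bound _ u) (fun u _ => N_bound _ u).
rewrite (_ : (fun u => _) = sdiff (~~ a)); last by apply/funext => u; rewrite /sdiff mul1r mulN1r.
rewrite -/(sdiff (~~ a)) => ->.
move: (kconv _ _ _) (kconv _ _ _) (M _ _ _ _) (M _ _ _ _) => c1 c2 c3 c4; ring.
Qed.

Let s_neg a t : t <= 0 -> sdiff a t = 0.
Proof. by move=> t0; rewrite /sdiff !N_neg// subrr. Qed.

Let ms a : measurable_fun setT (sdiff a).
Proof. exact: measurable_funB. Qed.

Let s_bound a t : `|sdiff a t| <= 2 * n.+1%:R.
Proof. by rewrite (le_trans (ler_normB _ _))// mulr_natl mulr2n lerD. Qed.

Let conv0 i t : kconv (kern0 i) (fun=> 0) t = 0.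
Proof.
rewrite /kconv (_ : (fun r => _) = fun=> 0) ?Rintegral_cst ?mul0r//.
by apply/funext => r; rewrite mulr0.
Qed.

Let q_lo a : k (lo a) * k (lo (~~ a)) = q.
Proof. by rewrite -par_lo kmassM. Qed.

Lemma sdiff_bound B : 0 <= B ->
  (forall a u, 0 <= u -> u <= T -> `|M n (diff_weight a) u w| <= B) ->
  forall a t, t <= T -> `|sdiff a t| <= (B + k (lo a) * B) / (1 - q).
Proof.
move=> B0 hB.
have main a Y : 0 <= Y -> (forall s, s <= T -> `|sdiff (~~ a) s| <= Y) ->
   forall s, s <= T -> `|sdiff a s| <= B + k (lo a) * Y.
  move=> Y0 hY s sT; have [s0|/ltW s0] := leP s 0.
    by rewrite s_neg// normr0 addr_ge0// mulr_ge0.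
  rewrite sdiff_volterra// (le_trans (ler_normD _ _))// lerD ?hB//.
  have hz := @conv_diff _ (kern0 (lo a)) (kern0_ge0 _) (@kern0_neg (lo a)) (kern0_int _)
    (sdiff (~~ a)) (fun=> 0) Y 0 s s Y (ms _) (measurable_cst _).
  rewrite conv0 subr0 mass_kern0 in hz; apply: hz.
  - by move=> u us; apply: hY; exact: le_trans sT.
  - by move=> u _; rewrite normr0.
  - by move=> r r0; rewrite subr0; apply: hY; rewrite (le_trans _ sT)// gerBl.
move=> a t tT.
have sb : exists Y : R, forall p, p <= T -> `|sdiff a p| <= Y by exists (2 * n.+1%:R).
have := @volterra_sup _ R (fun s => s <= T) (sdiff a) (sdiff (~~ a)) B B (k (lo a)) (k (lo (~~ a))) B0 B0 (k0 _) (k0 _).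
rewrite q_lo => /(_ hg_lt1 sb (main a)).
by have := main (~~ a); rewrite negbK => h2 /(_ h2 t tT).
Qed.

(** The absorption argument is applied to increments indexed by pairs of times: a convolution shifts
    both times by the same lag, and the set [I] of admissible pairs is stable under such shifts. *)
Lemma sdiff_modulus D W : 0 <= W ->
  (forall a u v, 0 <= u -> u <= v -> v <= T -> v - u <= D ->
     `|M n (diff_weight a) v w - M n (diff_weight a) u w| <= W) ->
  forall a u v, u <= v -> v <= T -> v - u <= D ->
     `|sdiff a v - sdiff a u| <= (W + k (lo a) * W) / (1 - q).
Proof.
move=> W0 hW.
pose I (p : R * R) := [/\ p.1 <= p.2, p.2 <= T & p.2 - p.1 <= D].
pose y a (p : R * R) := sdiff a p.2 - sdiff a p.1.
have main a Y : 0 <= Y -> (forall p, I p -> `|y (~~ a) p| <= Y) ->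
   forall p, I p -> `|y a p| <= W + k (lo a) * Y.
  move=> Y0 hY [u v] [/= uv vT vu]; rewrite /y /=.
  have WY : 0 <= W + k (lo a) * Y by rewrite addr_ge0// mulr_ge0.
  have [v0|/ltW v0] := leP v 0; first by rewrite !s_neg ?subrr ?normr0// (le_trans uv).
  have cd z : z <= v -> v - z <= D ->
      `|kconv (kern0 (lo a)) (sdiff (~~ a)) v - kconv (kern0 (lo a)) (sdiff (~~ a)) z| <= k (lo a) * Y.
    move=> zv vz; rewrite -mass_kern0.
    apply: (@conv_diff _ (kern0 (lo a)) (kern0_ge0 _) (@kern0_neg (lo a)) (kern0_int _)
      _ _ (2 * n.+1%:R) (2 * n.+1%:R)) => //.
    move=> r r0; apply: (hY (z - r, v - r)); split => /=.
    - by rewrite lerD2r.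
    - by rewrite (le_trans _ vT)// gerBl.
    - by rewrite opprB addrA subrK.
  (* For [u <= 0] the value at [u] is the value at 0, so the martingale increment is taken from 0
     while the convolution is still compared at nonpositive arguments if needed. *)
  have [u0|/ltW u0] := leP u 0.
    rewrite (s_neg _ u0) -(s_neg a (lexx 0)).
    have D0 : v - 0 <= D by rewrite subr0 (le_trans _ vu)// lerBrDr gerDl.
    rewrite (sdiff_volterra a v0 vT) (sdiff_volterra a (lexx 0) T0) opprD addrACA.
    rewrite (le_trans (ler_normD _ _))// lerD//; first exact: hW.
    exact: cd.
  have uT := le_trans uv vT.
  rewrite (sdiff_volterra a v0 vT) (sdiff_volterra a u0 uT) opprD addrACA.
  by rewrite (le_trans (ler_normD _ _))// lerD//; [exact: hW|exact: cd].
move=> a u v uv vT vu.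
have yb : exists Y : R, forall p, I p -> `|y a p| <= Y.
  by exists (2 * n.+1%:R + 2 * n.+1%:R) => p _; rewrite (le_trans (ler_normB _ _))// lerD.
have := @volterra_sup _ _ I (y a) (y (~~ a)) W W (k (lo a)) (k (lo (~~ a))) W0 W0 (k0 _) (k0 _).
rewrite q_lo => /(_ hg_lt1 yb (main a)).
by have := main (~~ a); rewrite negbK => h2 /(_ h2 (u, v)); apply; split.
Qed.

(* Replacing [kconv k s] by [k s] costs the modulus [W] on the window [D] plus the
   mass of the kernel beyond [D]. *)
Lemma sdiff_approx D B W a t : 0 <= B -> 0 <= W ->
  (forall a u, 0 <= u -> u <= T -> `|M n (diff_weight a) u w| <= B) ->
  (forall a u v, 0 <= u -> u <= v -> v <= T -> v - u <= D ->
     `|M n (diff_weight a) v w - M n (diff_weight a) u w| <= W) ->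
  0 <= t -> t <= T ->
  let K := (1 + ksum) / (1 - q) in
  `|sdiff a t - (M n (diff_weight a) t w + k (lo a) * M n (diff_weight (~~ a)) t w) / (1 - q)|
   <= K * (ksum * (K * W) + 2 * (K * B) * tail D).
Proof.
move=> B0 W0 hB hW t0 tT; cbv zeta; set K := (1 + ksum) / (1 - q).
have q1 : 0 < 1 - q by rewrite subr_gt0.
have hs := sdiff_bound B0 hB; have hm := sdiff_modulus W0 hW.
have ks0 : 0 <= ksum by exact: sumr_ge0.
have K0 : 0 <= K by apply: divr_ge0; [exact: addr_ge0|exact: ltW].
have KX b X : 0 <= X -> (X + k (lo b) * X) / (1 - q) <= K * X.
  move=> X0; rewrite /K mulrAC ler_wpM2r ?invr_ge0 ?(ltW q1)//.
  by rewrite mulrDl mul1r lerD2l ler_wpM2r.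
pose r := ksum * (K * W) + 2 * (K * B) * tail D.
have hr b : `|k (lo b) * sdiff (~~ b) t - kconv (kern0 (lo b)) (sdiff (~~ b)) t| <= r.
  have hz := @conv_approx _ (kern0 (lo b)) (kern0_ge0 _) (@kern0_neg (lo b)) (kern0_int _)
      (sdiff (~~ b)) (K * B) D (K * W) T t (ms _) tT (mulr_ge0 K0 B0) (mulr_ge0 K0 W0).
  rewrite mass_kern0 in hz; apply: le_trans (hz _ _) _.
  - by move=> x xT; apply: le_trans (hs _ _ xT) _; exact: KX.
  - by move=> x y xy yT yx; apply: le_trans (hm _ _ _ xy yT yx) _; exact: KX.
  - apply: lerD; first by rewrite ler_wpM2r// mulr_ge0.
    apply: ler_wpM2l; first by apply: mulr_ge0 => //; exact: mulr_ge0.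
    by have /andP[] := tail_term (lo b) D.
have r0 : 0 <= r := le_trans (normr_ge0 _) (hr a).
(* With [z] as the error, the two Volterra equations become a linear system of determinant [1 - q],
   which is solved explicitly. *)
pose z b := k (lo b) * sdiff (~~ b) t - kconv (kern0 (lo b)) (sdiff (~~ b)) t.
have sE b : sdiff b t = M n (diff_weight b) t w + k (lo b) * sdiff (~~ b) t - z b.
  by rewrite {1}sdiff_volterra// /z; move: (kconv _ _ _) => c; ring.
have -> : sdiff a t - (M n (diff_weight a) t w + k (lo a) * M n (diff_weight (~~ a)) t w) / (1 - q) =
   - (z a + k (lo a) * z (~~ a)) / (1 - q).
  apply: (mulIf (lt0r_neq0 q1)); rewrite mulrBl !divfK ?gt_eqF//.
  have h1 := sE a; have h2 := sE (~~ a); rewrite negbK in h2.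
  rewrite -(q_lo a); move: h1 h2.
  move: (sdiff a t) (sdiff (~~ a) t) (z a) (z (~~ a)) (M _ _ _ _) (M _ _ _ _) (k _) (k _) =>
    s1 s2 z1 z2 m2 m1 k2 k1 h1 h2.
  have e1 : m1 = s1 - k1 * s2 + z1 by rewrite {1}h1; ring.
  have e2 : m2 = s2 - k2 * s1 + z2 by rewrite {1}h2; ring.
  by rewrite e1 e2; ring.
rewrite mulNr normrN normrM normfV (gtr0_norm q1).
apply: le_trans (KX a _ r0); rewrite ler_wpM2r ?invr_ge0 ?(ltW q1)//.
by rewrite (le_trans (ler_normD _ _))// lerD ?hr// normrM ger0_norm// ler_wpM2l// hr.
Qed.

End model_paths.

(** * The Lindeberg step for cosines *)

Section trigonometric_bounds.
Context {R : realType}.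
Implicit Types x y : R.

Lemma sin_abs_le x : `|sin x| <= `|x|.
Proof.
wlog x0 : x / 0 <= x.
  move=> hw; have [x0|/ltW x0] := leP 0 x; first exact: hw.
  by rewrite -normrN -sinN -(normrN x); apply: hw; rewrite oppr_ge0.
have dsin (y : R) : y \in `]0, x[ -> is_derive y 1 (@sin R) (cos y) by move=> _; exact: is_derive_sin.
have csin : {within `[0, x], continuous (@sin R)}.
  by apply: continuous_subspaceT => y; exact: continuous_sin.
have [c hc e] := MVT_segment x0 dsin csin.
rewrite sin0 !subr0 in e; rewrite e normrM ler_piMl//.
by rewrite ler_norml cos_geN1 cos_le1.
Qed.

Lemma one_minus_cos x : 1 - cos x = 2 * sin (x / 2) ^+ 2.
Proof.
have := cos_mulr2n (x / 2); rewrite (_ : (x / 2) *+ 2 = x); last by rewrite -mulr_natr divfK.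
by move=> ->; rewrite sin2cos2 -mulr_natr; ring.
Qed.

Lemma one_minus_cos_le x : 0 <= 1 - cos x <= x ^+ 2 / 2.
Proof.
rewrite one_minus_cos mulr_ge0 ?sqr_ge0//=.
have := sin_abs_le (x / 2); rewrite -ler_sqr ?nnegrE// !real_normK ?num_real//.
rewrite expr_div_n; lra.
Qed.

Lemma sin_taylor x : `|x - sin x| <= `|x| ^+ 3.
Proof.
wlog x0 : x / 0 <= x.
  move=> hw; have [x0|/ltW x0] := leP 0 x; first exact: hw.
  have -> : x - sin x = - (- x - sin (- x)) by rewrite sinN opprB opprK addrC.
  by rewrite normrN -(normrN x); apply: hw; rewrite oppr_ge0.
have df (y : R) : y \in `]0, x[ -> is_derive y 1 (fun y : R => y - sin y) (1 - cos y).
  by move=> _; apply: is_deriveB.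
have cf : {within `[0, x], continuous (fun y : R => y - sin y)}.
  by apply: continuous_subspaceT => y; apply: cvgB; [exact: cvg_id|exact: continuous_sin].
have [c hc e] := MVT_segment x0 df cf.
move: hc; rewrite in_itv /= => /andP[c0 cx]; rewrite sin0 !subr0 in e; rewrite e.
rewrite normrM (ger0_norm x0) exprSr ler_wpM2r//.
have /andP[h1 h2] := one_minus_cos_le c; rewrite ger0_norm//.
apply: le_trans h2 _; apply: (@le_trans _ _ (c ^+ 2)).
  by have := sqr_ge0 c; lra.
by rewrite ler_sqr ?nnegrE.
Qed.

(** With [y = x / 2] the left-hand side is [2 (y - sin y) (y + sin y)], which reduces the estimate
    to the two bounds for [sin]. *)
Lemma cos_taylor x : `|cos x - 1 + x ^+ 2 / 2| <= x ^+ 4.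
Proof.
pose y := x / 2; have xy : x = 2 * y by rewrite /y mulrC divfK.
have e : cos x - 1 + x ^+ 2 / 2 = 2 * ((y - sin y) * (y + sin y)).
  have := one_minus_cos x; rewrite -/y xy => h.
  rewrite (_ : cos (2 * y) = 1 - 2 * sin y ^+ 2); first by field.
  by rewrite -h; ring.
rewrite e normrM normrM ger0_norm//.
apply: (@le_trans _ _ (2 * (`|y| ^+ 3 * (2 * `|y|)))).
  rewrite ler_pM2l// ler_pM// ?sin_taylor// (le_trans (ler_normD _ _))//.
  by rewrite mulr_natl mulr2n lerD2l sin_abs_le.
have -> : 2 * (`|y| ^+ 3 * (2 * `|y|)) = 4 * `|y| ^+ 4 by ring.
have -> : `|y| ^+ 4 = y ^+ 4.
  by rewrite -normrX ger0_norm// exprn_even_ge0.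
have : 0 <= y ^+ 4 by rewrite exprn_even_ge0.
have -> : x ^+ 4 = 16 * y ^+ 4 by rewrite xy; ring.
lra.
Qed.

(** The natural remainder is cubic; [|y|^3 <= y^4 / r + r y^2] replaces it by second and fourth
    powers, whose moments are controlled. *)
Lemma cos_second_order x y (r : R) : 0 < r ->
  `|cos (x + y) - cos x + y * sin x + y ^+ 2 / 2 * cos x|
    <= (1 + r^-1) * y ^+ 4 + r * y ^+ 2.
Proof.
move=> r0.
have -> : cos (x + y) - cos x + y * sin x + y ^+ 2 / 2 * cos x =
   cos x * (cos y - 1 + y ^+ 2 / 2) + sin x * (y - sin y) by rewrite cosD; ring.
apply: (@le_trans _ _ (y ^+ 4 + `|y| ^+ 3)).
  rewrite (le_trans (ler_normD _ _))// !normrM lerD//.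
    rewrite -[leRHS]mul1r ler_pM ?cos_taylor//.
    by rewrite ler_norml cos_geN1 cos_le1.
  by rewrite -[leRHS]mul1r ler_pM ?sin_taylor// sin_max.
rewrite mulrDl mul1r -addrA lerD2l.
have -> : y ^+ 4 = `|y| ^+ 4 by rewrite -normrX ger0_norm// exprn_even_ge0.
have -> : y ^+ 2 = `|y| ^+ 2 by rewrite real_normK ?num_real.
set z := `|y|; have z0 : 0 <= z by exact: normr_ge0.
have e : r * (r^-1 * z ^+ 4 + r * z ^+ 2) = z ^+ 4 + r ^+ 2 * z ^+ 2 by field; rewrite gt_eqF.
rewrite -(ler_pM2l r0) e.
have := mulr_ge0 (sqr_ge0 z) (sqr_ge0 (z - r)); have := sqr_ge0 (r * z); nra.
Qed.

Lemma expRN_taylor x : 0 <= x -> `|expR (- x) - (1 - x)| <= x ^+ 2.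
Proof.
move=> x0; have h1 := expR_ge1Dx (- x); rewrite ger0_norm ?subr_ge0//.
have h2 := expR_ge1Dx x; have h3 := expRxMexpNx_1 x.
have e0 : 0 <= expR (- x) := expR_ge0 _.
have : expR (- x) * (1 + x) <= 1 by rewrite -[leRHS]h3 [leRHS]mulrC ler_wpM2l.
move: (expR (- x)) e0 {h1 h2 h3} => e e0 h; nra.
Qed.

Lemma expRN_le1 x : 0 <= x -> expR (- x) <= 1.
Proof.
move=> x0; have h2 := expR_ge1Dx x; have h3 := expRxMexpNx_1 x.
have e0 : 0 <= expR (- x) := expR_ge0 _.
have : expR (- x) * (1 + x) <= 1 by rewrite -[leRHS]h3 [leRHS]mulrC ler_wpM2l.
move: (expR (- x)) e0 {h2 h3} => e e0 h; nra.
Qed.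

End trigonometric_bounds.

(** * Replacement of one increment and accumulation of errors *)

Section lindeberg.
Context {R : realType} d (T : measurableType d) (P : probability T R).
Local Notation E := (Ex P).

(** Pointwise [|f| <= b / 2 + f^2 / (2 b)], which takes the place of the Cauchy-Schwarz
    inequality. *)
Lemma Ex_abs_le (f : T -> R) (b : R) : bmf f -> 0 < b -> E (fun w => f w ^+ 2) <= b ^+ 2 ->
  E (fun w => `|f w|) <= b.
Proof.
move=> bf b0 h.
have : E (fun w => `|f w|) <= E (fun w => b / 2 + (2 * b)^-1 * f w ^+ 2).
  apply: Ex_le; first exact: bmf_norm.
    by apply: bmfD; [exact: bmf_cst|exact/bmfZ/bmfX].
  move=> w; have b2 : 0 < 2 * b by rewrite mulr_gt0.
  rewrite -(ler_pM2l b2).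
  have -> : 2 * b * (b / 2 + (2 * b)^-1 * f w ^+ 2) = b ^+ 2 + f w ^+ 2.
    by field; rewrite gt_eqF.
  rewrite -(real_normK (num_real (f w))); have := sqr_ge0 (`|f w| - b); lra.
rewrite ExD ?ExZ ?Ex_cst//; try exact: bmfX; try exact: bmf_cst; last exact/bmfZ/bmfX.
move/le_trans; apply.
have : (2 * b)^-1 * E (fun w => f w ^+ 2) <= (2 * b)^-1 * b ^+ 2.
  by rewrite ler_wpM2l// invr_ge0 mulr_ge0// ltW.
have -> : (2 * b)^-1 * b ^+ 2 = b / 2 by field; rewrite gt_eqF.
by move=> h2; rewrite [leRHS]splitr lerD2l.
Qed.

(** In the second-order expansion the linear term has mean zero and [xi ^+ 2] may be exchanged for
    the energy [Q], then [Q] for the constant [q], then [1 - q / 2] for [expR (- (q / 2))]. The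
    phase [c] lets the same statement cover sines. *)
Lemma lindeberg_step (X xi Q : T -> R) (q r c : R) : bmf X -> bmf xi -> bmf Q ->
  0 <= q -> 0 < r -> (forall w, 0 <= Q w) ->
  E (fun w => sin (X w + c) * xi w) = 0 ->
  E (fun w => cos (X w + c) * xi w ^+ 2) = E (fun w => cos (X w + c) * Q w) ->
  `|E (fun w => cos (X w + xi w + c)) - expR (- (q / 2)) * E (fun w => cos (X w + c))| <=
  (1 + r^-1) * E (fun w => xi w ^+ 4) + r * E (fun w => xi w ^+ 2) +
    E (fun w => `|Q w - q|) + q ^+ 2.
Proof.
move=> bX bxi bQ q0 r0 Q0 h1 h2.
have bXc : measurable_fun setT (fun w => X w + c).
  by have [] : bmf (fun w => X w + c) by apply: bmfD => //; exact: bmf_cst.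
have bc : bmf (fun w => cos (X w + c)) by exact: bmf_cos.
have bs : bmf (fun w => sin (X w + c)) by exact: bmf_sin.
have bcx : bmf (fun w => cos (X w + xi w + c)).
  apply: bmf_cos; have [] // : bmf (fun w => X w + xi w + c).
  by apply: bmfD; [exact: bmfD|exact: bmf_cst].
pose rem w := cos (X w + xi w + c) - cos (X w + c) + xi w * sin (X w + c) +
  xi w ^+ 2 / 2 * cos (X w + c).
have brem : bmf rem.
  apply: bmfD; first by apply: bmfD; [exact: bmfB|exact: bmfM].
  by apply: bmfM => //; apply: bmfM; [exact: bmfX|exact: bmf_cst].
have hrem : `|E rem| <= (1 + r^-1) * E (fun w => xi w ^+ 4) + r * E (fun w => xi w ^+ 2).
  rewrite -!ExZ; try exact: bmfX.
  rewrite -ExD; try exact/bmfZ/bmfX.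
  apply: Ex_norm_le => //; first by apply: bmfD; exact/bmfZ/bmfX.
  by move=> w; rewrite /rem [X w + xi w + c]addrAC; exact: cos_second_order.
have eq1 : E (fun w => cos (X w + xi w + c)) - expR (- (q / 2)) * E (fun w => cos (X w + c)) =
   E rem - E (fun w => 2^-1 * (cos (X w + c) * (Q w - q))) -
     (expR (- (q / 2)) - (1 - q / 2)) * E (fun w => cos (X w + c)).
  have b2 : bmf (fun w => cos (X w + c) * xi w ^+ 2) by apply: bmfM => //; exact: bmfX.
  have b3 : bmf (fun w => cos (X w + c) * Q w) by exact: bmfM.
  have e1 : E rem = E (fun w => cos (X w + xi w + c)) - E (fun w => cos (X w + c)) +
      2^-1 * E (fun w => cos (X w + c) * Q w).
    rewrite -h2 -ExB// -ExZ// -[X in X + _]addr0 -[X in _ + X + _]h1 -ExD//.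
    - rewrite -ExD; first by apply: eq_Ex => w; rewrite /rem; ring.
      + by apply: bmfD; [exact: bmfB|exact: bmfM].
      + exact: bmfZ.
    - exact: bmfB.
    - exact: bmfM.
  have e2 : E (fun w => 2^-1 * (cos (X w + c) * (Q w - q))) =
     2^-1 * (E (fun w => cos (X w + c) * Q w) - q * E (fun w => cos (X w + c))).
    rewrite -(ExZ _ _ bc) -(ExB P b3 (bmfZ _ bc)) ExZ; last first.
      by apply: bmfM => //; apply: bmfB => //; exact: bmf_cst.
    by congr (_ * _); apply: eq_Ex => w; ring.
  by rewrite e1 e2; move: (E _) (E _) (E _) => a1 a2 a3; field.
rewrite eq1 (le_trans (ler_normB _ _))// lerD//; last first.
  rewrite normrM -[leRHS]mulr1 ler_pM//.
    apply: le_trans (expRN_taylor (divr_ge0 q0 _)) _ => //.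
    by rewrite expr_div_n; have := sqr_ge0 q; lra.
  rewrite -[leRHS](Ex_cst P); apply: Ex_norm_le => //; first exact: bmf_cst.
  by move=> w; rewrite ler_norml cos_geN1 cos_le1.
rewrite (le_trans (ler_normB _ _))// lerD//.
apply: Ex_norm_le.
- by apply/bmfZ/bmfM => //; apply: bmfB => //; exact: bmf_cst.
- by apply: bmf_norm; apply: bmfB => //; exact: bmf_cst.
- move=> w; rewrite normrM normrM mulrA ler_piMl//.
  have : `|cos (X w + c)| <= 1 by rewrite ler_norml cos_geN1 cos_le1.
  rewrite ger0_norm//; have := normr_ge0 (cos (X w + c)); lra.
Qed.

(* The factors [expR (- q)] are contractions, so that the errors of the
   successive Lindeberg steps add up. *)
Lemma contraction_telescope (a q err : nat -> R) m : (forall k, 0 <= q k) ->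
  (forall k, (k < m)%N -> `|a k.+1 - expR (- q k) * a k| <= err k) ->
  `|a m - expR (- \sum_(k < m) q k) * a 0| <= \sum_(k < m) err k.
Proof.
move=> q0; elim: m => [|m IH] h.
  by rewrite !big_ord0 oppr0 expR0 mul1r subrr normr0.
rewrite !big_ord_recr /= opprD expRD mulrC.
have -> : a m.+1 - a 0 * (expR (- (\sum_(i < m) q i)) * expR (- q m)) =
   (a m.+1 - expR (- q m) * a m) +
   expR (- q m) * (a m - expR (- \sum_(i < m) q i) * a 0) by ring.
rewrite (le_trans (ler_normD _ _))// [leLHS]addrC; apply: lerD; last exact: (h m (ltnSn m)).
rewrite normrM ger0_norm ?expR_ge0// -[leRHS]mul1r ler_pM ?expR_ge0 ?expRN_le1//.
by apply: IH => k km; apply: h; rewrite ltnS ltnW.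
Qed.

End lindeberg.

#[local] Opaque stopped_comp stopped_count stopped_time compensated.

(** * Law of large numbers and increments of the martingales *)

Section model_limits.
Context {R : realType}.
Notation leb := (@lebesgue_measure R).
Variables (g h : R -> R).
Hypothesis g_ge0 : forall t : R, 0 <= t -> 0 <= g t.
Hypothesis h_ge0 : forall t : R, 0 <= t -> 0 <= h t.
Hypothesis g_int : leb.-integrable `[0, +oo[ (EFin \o g).
Hypothesis h_int : leb.-integrable `[0, +oo[ (EFin \o h).
Hypothesis hg_lt1 : L1norm h * L1norm g < 1.
Variables (mu : 'I_4 -> R) (d : measure_display) (Omega : measurableType d).
Variables (P : probability Omega R) (tau : nat -> Omega -> \bar R) (Z : nat -> Omega -> 'I_4).
Hypothesis H : hawkes tau Z P mu (kernel4 g h).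
Local Notation E := (Ex P).
Local Notation N := (stopped_count tau Z).
Local Notation M := (wmart tau Z mu (kernel4 g h)).
Local Notation k := (kmass g h).
Local Notation q := (L1norm h * L1norm g).
Local Notation rate := (rate g h mu).
Local Notation tail := (tail g h).

Let ki := kernel4_int g_int h_int.
Let k0 := kmass_ge0 g_ge0 h_ge0.
Let bN n i t : bmf (N n i t) := bmf_count H n i t.
Let r0 i : 0 <= rate i := rate_ge0 g_ge0 h_ge0 hg_lt1 H i.
Let bM n th t (t0 : 0 <= t) : bmf (M n th t) := adapted_bmf H (adapted_wmart H ki n th t0).

Lemma tail_ge0 D : 0 <= tail D.
Proof. by have /andP[a b] := tail_term g_ge0 h_ge0 g_int h_int (inord 0) D; exact: le_trans b. Qed.

Lemma tail_small (e : R) : 0 < e -> exists2 D, 0 <= D & tail D <= e.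
Proof.
move=> e0.
have kg i r : 0 <= ext0 (kern g h i) r by apply: ext0_ge0 => t; exact: kern_ge0.
have kn i r : r < 0 -> ext0 (kern g h i) r = 0 by exact: ext0_neg.
have kint i : leb.-integrable setT (EFin \o ext0 (kern g h i)).
  by apply: ext0_integrable; exact: kern_int.
have /choice[x hx] : forall i, exists x, 0 <= x /\ mass (ext0 (kern g h i)) - cumul (ext0 (kern g h i)) x <= e / 4.
  move=> i; have e4 : 0 < e / 4 by rewrite divr_gt0.
  by have [x x0 hx] := cumul_cvg (kg i) (kint i) e4; exists x.
exists (\sum_i x i); first by apply: sumr_ge0 => i _; have [] := hx i.
apply: (@le_trans _ _ (\sum_(i < 4) e / 4)); last first.
  by rewrite sumr_const card_ord -[leLHS]mulr_natr divfK.
apply: ler_sum => i _; have [xi0 hi] := hx i; apply: le_trans hi; rewrite /kmass -mass_ext0 lerD2l lerN2.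
apply: cumul_nd => //; first exact: kn.
by rewrite (bigD1 i)//= lerDl sumr_ge0// => j _; have [] := hx j.
Qed.

(** The three terms come from the martingales, from the lag window [D] and from the kernel mass
    beyond [D]. Only the last one is of order [T^2], and its factor is small once [D] is large. *)
Lemma good_bound : exists2 A : R, 0 <= A & forall n (T D : R), 1 <= T -> 0 <= D ->
  exists G : Omega -> R, [/\ bmf G,
    forall w i t, (T%:E < tau n w)%E -> 0 <= t -> t <= T -> (N n i t w - rate i * t) ^+ 2 <= G w,
    (forall w, 0 <= G w) & E G <= A * (T + D ^+ 2 + T ^+ 2 * tail D ^+ 2)].
Proof.
have [L [L0 hL]] := Ex_count_sqr g_ge0 h_ge0 g_int h_int hg_lt1 H.
pose rs := \sum_j rate j; pose ks := \sum_j k j.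
have rs0 : 0 <= rs by exact: sumr_ge0.
have ks0 : 0 <= ks by exact: sumr_ge0.
have q1 : 0 < 1 - q by rewrite subr_gt0.
pose K := (1 + ks) / (1 - q).
have K0 : 0 <= K by apply: divr_ge0; [exact: addr_ge0|exact: ltW].
(* The constants are introduced through existentials so that the linear arithmetic at the end sees
   them as atoms. *)
have [A1 [A10 A1E]] : exists a, 0 <= a /\ a = 2 + 8 * 1048 * L * 2.
  by eexists; split; last reflexivity; lra.
have [A2 [A20 A2E]] : exists a, 0 <= a /\ a = 4 * rs ^+ 2 * ks ^+ 2.
  eexists; split; last reflexivity.
  by apply: mulr_ge0; [apply: mulr_ge0 => //; exact: sqr_ge0|exact: sqr_ge0].
have [A3 [A30 A3E]] : exists a, 0 <= a /\ a = 16 * rs ^+ 2.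
  by eexists; split; last reflexivity; apply: mulr_ge0 => //; exact: sqr_ge0.
exists (K ^+ 2 * (A1 + A2 + A3)).
  by apply: mulr_ge0; [exact: sqr_ge0|apply: addr_ge0 => //; exact: addr_ge0].
move=> n T D T1 D0; have T0 : 0 < T by rewrite (lt_le_trans _ T1).
have /choice[W hW] := fun j => unit_mart_sup g_int h_int H n j (ltW T0).
pose WS w := \sum_j W j w.
have bWS : bmf WS by apply: bmf_sum => j; have [] := hW j.
have W0 j w : 0 <= W j w by have [] := hW j.
have WS0 w : 0 <= WS w by exact: sumr_ge0.
pose B := rs * (ks * D + 2 * T * tail D).
pose G w := K ^+ 2 * (2 * (T + T^-1 * WS w) + 2 * B ^+ 2).
exists G; split.
- apply: bmfZ; apply: bmfD; last exact: bmf_cst.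
  by apply: bmfZ; apply: bmfD; [exact: bmf_cst|exact: bmfZ].
- move=> w i t Tn t0 tT.
  have m20 : 0 <= T + T^-1 * WS w.
    by apply: addr_ge0; [exact: ltW|apply: mulr_ge0 => //; rewrite invr_ge0 ltW].
  (* [M^4 <= W] gives [2 M^2 <= T + W / T]. The weight [T] is the right one because [E W] is of
     order [T^2], which makes the mean of [m^2] of order [T]. *)
  pose m := Num.sqrt (T + T^-1 * WS w).
  have hm j u : 0 <= u -> u <= T -> `|M n (unit_weight j) u w| <= m.
    move=> u0 uT; rewrite -sqrtr_sqr ler_sqrt//.
    have [_ _ h4 _] := hW j; have := h4 u w u0 uT => {}h4.
    have h5 : W j w <= WS w by rewrite /WS (bigD1 j)//= lerDl sumr_ge0.
    have := le_trans h4 h5; move: (M _ _ _ _) (WS w) => x s.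
    rewrite (_ : x ^+ 4 = (x ^+ 2) ^+ 2); last by rewrite -exprM.
    move: (x ^+ 2) (sqr_ge0 x) => y y0 ys.
    rewrite -(ler_pM2l T0) mulrDr mulrA mulfV ?gt_eqF// mul1r.
    have := sqr_ge0 (T - y); nra.
  have m0 : 0 <= m by exact: sqrtr_ge0.
  have := lln_path g_ge0 h_ge0 g_int h_int hg_lt1 H (ltW T0) Tn i m0 D0 hm t0 tT.
  rewrite -/rs -/ks -/B => hl.
  have B0 : 0 <= B.
    by rewrite mulr_ge0// addr_ge0 ?mulr_ge0 ?tail_ge0// ltW.
  have {}hl : `|N n i t w - rate i * t| <= K * (m + B).
    apply: le_trans hl _; rewrite /K mulrAC; apply: ler_wpM2r; first by rewrite invr_ge0 ltW.
    rewrite mulrDl mul1r lerD2l ler_wpM2r ?addr_ge0//.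
    by rewrite /ks (bigD1 i)//= lerDl sumr_ge0.
  rewrite -(real_normK (num_real (_ - _))).
  apply: (@le_trans _ _ ((K * (m + B)) ^+ 2)).
    by rewrite ler_sqr ?nnegrE// mulr_ge0// addr_ge0.
  rewrite exprMn /G -(sqr_sqrtr m20) -/m; apply: ler_wpM2l; first exact: sqr_ge0.
  have := sqr_ge0 (m - B); nra.
- move=> w; apply: mulr_ge0; first exact: sqr_ge0.
  apply: addr_ge0; last by apply: mulr_ge0 => //; exact: sqr_ge0.
  apply: mulr_ge0 => //; apply: addr_ge0; first exact: ltW.
  by apply: mulr_ge0 => //; rewrite invr_ge0 ltW.
- have EW : E WS <= 4 * (1048 * (L * (T + T ^+ 2))).
    rewrite /WS (Ex_sum P _ (F := W)); last by move=> j; have [] := hW j.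
    apply: (@le_trans _ _ (\sum_(j < 4) 1048 * (L * (T + T ^+ 2)))).
      apply: ler_sum => j _; have [_ _ _ h4] := hW j; apply: le_trans h4 _.
      by apply: ler_wpM2l; [exact: ler0n|exact: hL n j T (ltW T0)].
    by rewrite sumr_const card_ord -[leLHS]mulr_natl.
  have b1 : bmf (fun w => T^-1 * WS w) by exact: bmfZ.
  have b2 : bmf (fun w => T + T^-1 * WS w) by apply: bmfD => //; exact: bmf_cst.
  have b3 : bmf (fun w => 2 * (T + T^-1 * WS w)) by exact: bmfZ.
  have b4 : bmf (fun w => 2 * (T + T^-1 * WS w) + 2 * B ^+ 2) by apply: bmfD => //; exact: bmf_cst.
  have -> : E G = K ^+ 2 * (2 * (T + T^-1 * E WS) + 2 * B ^+ 2).
    rewrite /G (ExZ P _ b4) (ExD P b3 (bmf_cst _ _)) (ExZ P _ b2) (ExD P (bmf_cst _ T) b1) (ExZ P _ bWS).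
    by rewrite !Ex_cst.
  rewrite -[leRHS]mulrA; apply: ler_wpM2l; first exact: sqr_ge0.
  have h1 : T^-1 * E WS <= 8 * 1048 * L * T.
    rewrite -(ler_pM2l T0) mulrA mulfV ?gt_eqF// mul1r; apply: le_trans EW _.
    have : L * T <= L * T ^+ 2 by rewrite ler_wpM2l// expr2 ler_peMr// ltW.
    lra.
  have h2 : 2 * B ^+ 2 <= A2 * D ^+ 2 + A3 * (T ^+ 2 * tail D ^+ 2).
    rewrite /B A2E A3E exprMn.
    have : (ks * D + 2 * T * tail D) ^+ 2 <= 2 * (ks ^+ 2 * D ^+ 2) + 8 * (T ^+ 2 * tail D ^+ 2).
      have := sqr_ge0 (ks * D - 2 * T * tail D); nra.
    move=> h3; have : rs ^+ 2 * (ks * D + 2 * T * tail D) ^+ 2 <=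
       rs ^+ 2 * (2 * (ks ^+ 2 * D ^+ 2) + 8 * (T ^+ 2 * tail D ^+ 2)).
      by apply: ler_wpM2l => //; exact: sqr_ge0.
    lra.
  have TT0 : 0 <= T ^+ 2 * tail D ^+ 2 := mulr_ge0 (sqr_ge0 _) (sqr_ge0 _).
  have h3 : 0 <= A1 * (D ^+ 2 + T ^+ 2 * tail D ^+ 2).
    by apply: mulr_ge0 => //; apply: addr_ge0 => //; exact: sqr_ge0.
  have h4 : 0 <= A2 * (T + T ^+ 2 * tail D ^+ 2).
    by apply: mulr_ge0 => //; apply: addr_ge0 => //; exact: ltW.
  have h5 : 0 <= A3 * (T + D ^+ 2).
    by apply: mulr_ge0 => //; apply: addr_ge0; [exact: ltW|exact: sqr_ge0].
  have h6 : A1 * T = 2 * T + 2 * (8 * 1048 * L * T) by rewrite A1E; ring.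
  move: h2 h3 h4 h5 h6.
  move: (A1) (A2) (A3) (B ^+ 2) (T ^+ 2 * tail D ^+ 2) (D ^+ 2) (T^-1 * E WS) h1 => a1 a2 a3 b tt dd ew h1.
  move=> h2 h3 h4 h5 h6; lra.
Qed.

(** First [D] makes the tail small, then [T] dominates [D], then [n] makes explosion before [T]
    unlikely. *)
Lemma lln (e : R) : 0 < e -> exists2 T0, 1 <= T0 & forall T, T0 <= T -> exists n0, forall n,
  (n0 <= n)%N -> fine (P [set w | (tau n w <= T%:E)%E]) <= e /\
  forall i t, 0 <= t -> t <= T -> E (fun w => (N n i t w - rate i * t) ^+ 2) <= e * T ^+ 2.
Proof.
move=> e0; have [A A0 hA] := good_bound.
have A1 : 0 < A + 1 by rewrite ltr_wpDl.
pose eta := Num.min 1 (e / (8 * (A + 1))).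
have eta0 : 0 < eta by rewrite lt_min ltr01 divr_gt0// mulr_gt0.
have [D D0 tD] := tail_small eta0.
pose T0 := Num.max 1 (8 * (A + 1) * (1 + D ^+ 2) / e).
exists T0; first by rewrite le_max lexx.
move=> T; rewrite ge_max => /andP[T1 hT].
have Tp : 0 < T by rewrite (lt_le_trans _ T1).
have [K hK] := explosion_bound g_ge0 h_ge0 g_int h_int hg_lt1 H (ltW Tp).
pose rs := \sum_j rate j; have rs0 : 0 <= rs by exact: sumr_ge0.
pose Kb := `|K| * (2 + 2 * rs ^+ 2 * T ^+ 2) + `|K|.
have S2 : 0 <= 2 * rs ^+ 2 * T ^+ 2.
  by apply: mulr_ge0; [apply: mulr_ge0 => //; exact: sqr_ge0|exact: sqr_ge0].
have S0 : 0 <= 2 + 2 * rs ^+ 2 * T ^+ 2 by exact: addr_ge0.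
have Kb0 : 0 <= Kb by apply: addr_ge0 => //; exact: mulr_ge0.
exists (Num.truncn (Kb / e * 2)).+1 => n nn.
have hn : Kb / n.+1%:R <= e / 2.
  rewrite ler_pdivrMr// -ler_pdivrMl ?divr_gt0//.
  have := truncnS_gt (Kb / e * 2) => /ltW h1.
  have h2 : Kb / e * 2 <= n.+1%:R by apply: le_trans h1 _; rewrite ler_nat (leq_trans nn).
  by rewrite (_ : (e / 2)^-1 * Kb = Kb / e * 2)//; field; rewrite gt_eqF.
have n1 : 1 <= n.+1%:R :> R by rewrite ler1n.
pose bad : set Omega := [set w | (tau n w <= T%:E)%E].
have mbad : measurable bad by exact: (measurable_time_le H).
have pb : fine (P bad) <= `|K| / n.+1%:R ^+ 4.
  apply: le_trans (hK n) _; rewrite ler_wpM2r ?ler_norm// invr_ge0 exprn_ge0//.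
have n4 j : (0 < j)%N -> n.+1%:R <= n.+1%:R ^+ j :> R.
  by case: j => // j _; rewrite exprS ler_peMr ?ler0n// exprn_ege1.
split.
  apply: le_trans pb _; apply: (@le_trans _ _ (Kb / n.+1%:R)); last by apply: le_trans hn _; lra.
  rewrite ler_pM ?invr_ge0 ?exprn_ge0//.
    by rewrite /Kb lerDr; exact: mulr_ge0.
  by rewrite lef_pV2 ?posrE ?exprn_gt0// n4.
move=> i t t0 tT.
have [G [bG hG G0 EG]] := hA n T D T1 D0.
(* On the event [bad] the squared deviation is bounded trivially by [Bn], of order [n^2], against a
   probability of order [n^-4]. *)
pose Bn := 2 * n.+1%:R ^+ 2 + 2 * rs ^+ 2 * T ^+ 2.
have Bn0 : 0 <= Bn by apply: addr_ge0 => //; apply: mulr_ge0 => //; exact: sqr_ge0.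
apply: (@le_trans _ _ (E (fun w => G w + Bn * \1_bad w))).
  apply: Ex_le.
  - by apply: bmfX; apply: bmfB => //; exact: bmf_cst.
  - by apply: bmfD => //; apply/bmfZ/bmf_indic.
  - move=> w; have [nT|Tn] := leP (tau n w) T%:E; last first.
      apply: le_trans (hG w i t Tn t0 tT) _.
      by rewrite lerDl mulr_ge0// indicE.
    rewrite indicE mem_set// mulr1; apply: (@le_trans _ _ Bn); last by rewrite lerDr.
    have h1 := stopped_count_ge0 tau Z n i t w; have h2 := stopped_count_le tau Z n i t w.
    have h3 : rate i * t <= rs * T.
      by apply: ler_pM => //; rewrite /rs (bigD1 i)//= lerDl sumr_ge0.
    have h4 : 0 <= rate i * t by rewrite mulr_ge0.
    have h5 : N n i t w ^+ 2 <= n.+1%:R ^+ 2 by rewrite ler_sqr ?nnegrE.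
    have h6 : (rate i * t) ^+ 2 <= (rs * T) ^+ 2 by rewrite ler_sqr ?nnegrE// mulr_ge0// ltW.
    rewrite (exprMn_comm 2 (mulrC rs T)) in h6.
    have -> : Bn = 2 * n.+1%:R ^+ 2 + 2 * (rs ^+ 2 * T ^+ 2) by rewrite /Bn mulrA.
    move: h5 h6; move: (N n i t w) (rate i * t) (n.+1%:R ^+ 2) (rs ^+ 2 * T ^+ 2) => x y u v h5 h6.
    have := sqr_ge0 (x + y); nra.
rewrite ExD//; last by apply/bmfZ/bmf_indic.
rewrite ExZ; last exact: bmf_indic.
rewrite Ex_indic//.
have hb : Bn * fine (P bad) <= e / 2 * T ^+ 2.
  apply: (@le_trans _ _ (e / 2)); last by rewrite ler_peMr ?divr_ge0 ?(ltW e0)// exprn_ege1.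
  apply: le_trans hn; apply: (@le_trans _ _ (Bn * (`|K| / n.+1%:R ^+ 4))).
    by rewrite ler_wpM2l.
  apply: (@le_trans _ _ (`|K| * (2 + 2 * rs ^+ 2 * T ^+ 2) / n.+1%:R)); last first.
    by rewrite ler_wpM2r ?invr_ge0// /Kb lerDl.
  rewrite mulrCA -[leRHS]mulrA ler_wpM2l//.
  have h1 : n.+1%:R ^+ 2 / n.+1%:R ^+ 4 <= n.+1%:R^-1 :> R.
    rewrite (_ : n.+1%:R ^+ 2 / n.+1%:R ^+ 4 = (n.+1%:R ^+ 2)^-1 :> R).
      by rewrite lef_pV2 ?posrE ?exprn_gt0// n4.
    by rewrite (exprD _ 2 2) invfM mulrA mulfV ?mul1r// expf_neq0// pnatr_eq0.
  have h2 : (n.+1%:R ^+ 4)^-1 <= n.+1%:R^-1 :> R by rewrite lef_pV2 ?posrE ?exprn_gt0// n4.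
  rewrite /Bn [leLHS]mulrDl [leRHS]mulrDl; apply: lerD.
    by rewrite -[leLHS]mulrA ler_pM2l.
  exact: ler_wpM2l.
suff hg : E G <= e / 2 * T ^+ 2.
  by apply: le_trans (lerD hg hb) _; rewrite -mulrDl -splitr.
apply: le_trans EG _.
have ht2 : tail D ^+ 2 <= eta.
  have tl0 := tail_ge0 D; have e1 : eta <= 1 by rewrite /eta ge_min lexx.
  rewrite expr2 (le_trans _ tD)// ler_piMr// (le_trans tD)//.
have he : A * eta <= e / 8.
  apply: (@le_trans _ _ ((A + 1) * (e / (8 * (A + 1))))).
    by rewrite ler_pM ?(ltW eta0)// ?lerDl// /eta ge_min lexx orbT.
  by rewrite le_eqVlt; apply/orP; left; apply/eqP; field; rewrite gt_eqF.
have hTT : A * (T + D ^+ 2) <= e / 8 * T ^+ 2.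
  rewrite ler_pdivrMr// in hT.
  apply: (@le_trans _ _ ((A + 1) * (1 + D ^+ 2) * T)).
    have D2 := sqr_ge0 D; rewrite -mulrA ler_pM ?lerDl// ?addr_ge0 ?(ltW Tp)//.
    by rewrite mulrDl mul1r lerD2l ler_peMr.
  have : (8 * (A + 1) * (1 + D ^+ 2)) * T <= T * e * T by rewrite ler_pM2r.
  by move=> hh; rewrite -(ler_pM2l (ltr0Sn R 7)); lra.
have : A * (T ^+ 2 * tail D ^+ 2) <= e / 8 * T ^+ 2.
  rewrite mulrCA mulrC ler_wpM2r ?sqr_ge0// (le_trans _ he)// ler_wpM2l//.
rewrite mulrDr; have : 0 <= e * T ^+ 2 by rewrite mulr_ge0 ?sqr_ge0// ltW.
lra.
Qed.

Definition energy_fun n (th : 'I_4 -> R) s t w :=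
  \sum_i th i ^+ 2 * N n i t w - \sum_i th i ^+ 2 * N n i s w.

Lemma bmf_energy_fun n th s t : bmf (energy_fun n th s t).
Proof. by apply: bmfB; apply: bmf_sum => i; exact: bmfZ. Qed.

Lemma energy_fun_ge0 n th s t w : s <= t -> 0 <= energy_fun n th s t w.
Proof.
move=> st; rewrite /energy_fun -sumrB; apply: sumr_ge0 => i _.
by rewrite -mulrBr mulr_ge0 ?sqr_ge0// subr_ge0 stopped_count_nd.
Qed.

(** * Lindeberg sum over the blocks of one grid *)

Section block.
Variables (n : nat) (T : R) (m : nat) (th : nat -> 'I_4 -> R) (q_ : nat -> R) (qm dl r : R).
Hypotheses (T0 : 0 < T) (m0 : (0 < m)%N) (q_ge0 : forall j, 0 <= q_ j) (dl0 : 0 < dl) (r_gt0 : 0 < r).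
Hypothesis q_le : forall j, q_ j <= qm.
Definition btime (j : nat) : R := T * (j%:R / m%:R).
Let V j := energy_fun n (th j) (btime j) (btime j.+1).
Hypothesis hV : forall j, (j < m)%N -> E (fun w => (V j w - q_ j) ^+ 2) <= dl ^+ 2.

Let bt0 j : 0 <= btime j. Proof. by rewrite mulr_ge0 ?divr_ge0// ltW. Qed.
Let btS j : btime j <= btime j.+1.
Proof. by rewrite ler_pM2l// ler_pM2r ?invr_gt0 ?ltr0n// ler_nat. Qed.
Let bV j : bmf (V j) := bmf_energy_fun _ _ _ _.
Let V0 j w : 0 <= V j w. Proof. exact: energy_fun_ge0. Qed.

Lemma block_energy_sqr j : (j < m)%N -> E (fun w => V j w ^+ 2) <= 2 * (qm ^+ 2 + dl ^+ 2).
Proof.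
move=> jm; have qm0 : 0 <= qm := le_trans (q_ge0 0) (q_le 0).
apply: (@le_trans _ _ (E (fun w => 2 * qm ^+ 2 + 2 * (V j w - q_ j) ^+ 2))).
  apply: Ex_le; first exact: bmfX.
    apply: bmfD; first exact: bmf_cst.
    by apply: bmfZ; apply: bmfX; apply: bmfB => //; exact: bmf_cst.
  move=> w; have : q_ j ^+ 2 <= qm ^+ 2 by rewrite ler_sqr ?nnegrE.
  have := sqr_ge0 (V j w - 2 * q_ j); move: (V j w) (q_ j) (qm ^+ 2) => x y z; nra.
have bq : bmf (fun w => (V j w - q_ j) ^+ 2).
  by apply: bmfX; apply: bmfB => //; exact: bmf_cst.
rewrite ExD; [|exact: bmf_cst|exact: bmfZ].
by rewrite Ex_cst ExZ// mulrDr lerD2l ler_pM2l// hV.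
Qed.

Lemma block_fourth j : (j < m)%N -> exists W : Omega -> R, [/\ bmf W, forall w, 0 <= W w,
  forall u w, btime j <= u -> u <= btime j.+1 -> (M n (th j) u w - M n (th j) (btime j) w) ^+ 4 <= W w &
  E W <= 1048 * (2 * (qm ^+ 2 + dl ^+ 2))].
Proof.
move=> jm; have [W [bW W0 hW EW]] := wmart_sup H ki n (th j) (bt0 j) (btS j).
exists W; split => //; apply: le_trans EW _; apply: ler_wpM2l; first exact: ler0n.
exact: block_energy_sqr.
Qed.

Definition bsum (j : nat) (w : Omega) :=
  \sum_(l < j) (M n (th l) (btime l.+1) w - M n (th l) (btime l) w).

(** The past sum is known at the beginning of block [j], so its sine and cosine are admissible
    multipliers of the next increment. *)
Lemma bsum_adapted j : adapted tau Z (btime j) (bsum j).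
Proof.
elim: j => [|j IH].
  by rewrite (_ : bsum 0 = fun=> 0); [exact: bmf_cst|apply/funext => w; rewrite /bsum big_ord0].
rewrite (_ : bsum j.+1 = fun w => bsum j w + (M n (th j) (btime j.+1) w - M n (th j) (btime j) w)).
  apply: bmfD; first exact: adapted_mono (btS j) IH.
  have a1 := adapted_wmart H ki n (th j) (bt0 j.+1).
  have a2 := adapted_mono (btS j) (adapted_wmart H ki n (th j) (bt0 j)).
  exact: bmfB a1 a2.
by apply/funext => w; rewrite /bsum big_ord_recr.
Qed.

(* The remainder has to be summed over [m] blocks, where [qm] is of order [1 / m]:
   it becomes small by choosing first [r], then [m], then [dl]. *)
Lemma block_cos c : `|E (fun w => cos (bsum m w + c)) - expR (- \sum_(j < m) (q_ j / 2)) * cos c| <=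
  m%:R * ((1 + r^-1) * (1048 * (2 * (qm ^+ 2 + dl ^+ 2))) + r * (qm + dl) + dl + qm ^+ 2).
Proof.
set err := (X in m%:R * X).
have qm0 : 0 <= qm := le_trans (q_ge0 0) (q_le 0).
have -> : m%:R * err = \sum_(j < m) err by rewrite sumr_const card_ord mulr_natl.
have -> : cos c = E (fun w => cos (bsum 0 w + c)).
  rewrite -[LHS](Ex_cst P); apply: eq_Ex => w; by rewrite /bsum big_ord0 add0r.
apply: (@contraction_telescope _ (fun j => E (fun w => cos (bsum j w + c))) (fun j => q_ j / 2) (fun=> err)).
  by move=> j; rewrite divr_ge0.
move=> j jm; pose xi w := M n (th j) (btime j.+1) w - M n (th j) (btime j) w.
have bxi : bmf xi by apply: bmfB; exact: bM.
have aX := bsum_adapted j; have bX := adapted_bmf H aX.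
have aXc : measurable_fun setT ((fun w => bsum j w + c) : g_sigma_algebraType (history_gen tau Z (btime j)) -> R).
  by apply: measurable_funD; [exact: aX.1|exact: measurable_cst].
have -> : (fun w => cos (bsum j.+1 w + c)) = fun w => cos (bsum j w + xi w + c).
  by apply/funext => w; rewrite {1}/bsum big_ord_recr.
have h1 : E (fun w => sin (bsum j w + c) * xi w) = 0.
  by apply: (wmart_orth H ki) => //; exact: bmf_sin.
have h2 : E (fun w => cos (bsum j w + c) * xi w ^+ 2) = E (fun w => cos (bsum j w + c) * V j w).
  by apply: (wmart_second_moment H ki) => //; exact: bmf_cos.
apply: le_trans (lindeberg_step bX bxi (bV j) (q_ge0 j) r_gt0 (V0 j) h1 h2) _.
have hd : E (fun w => `|V j w - q_ j|) <= dl.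
  by apply: Ex_abs_le => //; [apply: bmfB => //; exact: bmf_cst|exact: hV].
have h4 : E (fun w => xi w ^+ 4) <= 1048 * (2 * (qm ^+ 2 + dl ^+ 2)).
  have [W [bW W0 hW EW]] := block_fourth jm; apply: le_trans EW.
  by apply: Ex_le => //; [exact: bmfX|move=> w; exact: hW].
have h3 : E (fun w => xi w ^+ 2) <= qm + dl.
  have := wmart_second_moment H ki n (th j) (bt0 j) (btS j) (bmf_cst (g_sigma_algebraType (history_gen tau Z (btime j))) 1).
  rewrite (_ : (fun w => 1 * _ ^+ 2) = fun w => xi w ^+ 2); last by apply/funext => w; rewrite mul1r.
  move=> ->; rewrite (_ : (fun w => 1 * _) = V j); last by apply/funext => w; rewrite mul1r.
  apply: (@le_trans _ _ (E (fun w => q_ j + `|V j w - q_ j|))).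
    apply: Ex_le => //.
      by apply: bmfD; [exact: bmf_cst|apply: bmf_norm; apply: bmfB => //; exact: bmf_cst].
    by move=> w; rewrite -lerBlDl ler_norm.
  rewrite ExD; [|exact: bmf_cst|apply: bmf_norm; apply: bmfB => //; exact: bmf_cst].
  by rewrite Ex_cst lerD.
rewrite /err; apply: lerD; last by rewrite ler_sqr ?nnegrE.
apply: lerD => //; apply: lerD.
  by apply: ler_wpM2l => //; rewrite addr_ge0// invr_ge0 ltW.
by rewrite ler_pM2l.
Qed.

End block.

End model_limits.

Lemma sqr_sum4_le {R : realType} (x : 'I_4 -> R) : (\sum_i `|x i|) ^+ 2 <= 4 * \sum_i x i ^+ 2.
Proof.
rewrite [in leRHS](eq_bigr (fun i => `|x i| ^+ 2)); last by move=> i _; rewrite real_normK// num_real.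
rewrite !big_ord_recr !big_ord0 /= !add0r.
move: `|_| `|_| `|_| `|_| => a b c e.
have := sqr_ge0 (a - b); have := sqr_ge0 (a - c); have := sqr_ge0 (a - e).
have := sqr_ge0 (b - c); have := sqr_ge0 (b - e); have := sqr_ge0 (c - e); nra.
Qed.

(** * Rescaled increments over the blocks *)

Section block_limits.
Context {R : realType}.
Notation leb := (@lebesgue_measure R).
Variables (g h : R -> R).
Hypothesis g_ge0 : forall t : R, 0 <= t -> 0 <= g t.
Hypothesis h_ge0 : forall t : R, 0 <= t -> 0 <= h t.
Hypothesis g_int : leb.-integrable `[0, +oo[ (EFin \o g).
Hypothesis h_int : leb.-integrable `[0, +oo[ (EFin \o h).
Hypothesis hg_lt1 : L1norm h * L1norm g < 1.
Variables (mu : 'I_4 -> R) (d : measure_display) (Omega : measurableType d).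
Variables (P : probability Omega R) (tau : nat -> Omega -> \bar R) (Z : nat -> Omega -> 'I_4).
Hypothesis H : hawkes tau Z P mu (kernel4 g h).
Local Notation E := (Ex P).
Local Notation N := (stopped_count tau Z).
Local Notation M := (wmart tau Z mu (kernel4 g h)).
Local Notation rate := (rate g h mu).

Let ki := kernel4_int g_int h_int.
Let bN n i t : bmf (N n i t) := bmf_count H n i t.
Let r0 i : 0 <= rate i := rate_ge0 g_ge0 h_ge0 hg_lt1 H i.
Let bM n th t (t0 : 0 <= t) : bmf (M n th t) := adapted_bmf H (adapted_wmart H ki n th t0).

Lemma wmartZ n c th t w : M n (fun i => c * th i) t w = c * M n th t w.
Proof.
by rewrite /wmart mulrBr !mulr_sumr; congr (_ - _); apply: eq_bigr => i _; rewrite mulrA.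
Qed.

Lemma wmart_sum n (I : finType) (c : I -> R) (th : I -> 'I_4 -> R) t w :
  M n (fun i => \sum_a c a * th a i) t w = \sum_a c a * M n (th a) t w.
Proof.
transitivity (\sum_a (\sum_i c a * th a i * N n i t w -
    \sum_i c a * th a i * stopped_comp tau Z mu (kernel4 g h) n i t w)).
  rewrite sumrB /wmart; congr (_ - _); rewrite exchange_big /=; apply: eq_bigr => i _; exact: mulr_suml.
apply: eq_bigr => a _; rewrite /wmart mulrBr !mulr_sumr.
by congr (_ - _); apply: eq_bigr => i _; rewrite mulrA.
Qed.

Definition scale (T : R) := T `^ (- 2^-1).

Lemma scale_sqr T : 0 < T -> scale T ^+ 2 = T^-1.
Proof.
move=> T0; rewrite /scale powRN exprVn; congr (_^-1).
by rewrite powR12_sqrt ?sqr_sqrtr ?ltW.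
Qed.

Definition block_variance (m : nat) (th : nat -> 'I_4 -> R) j := (\sum_i th j i ^+ 2 * rate i) / m%:R.

Lemma block_variance_ge0 m th j : 0 <= block_variance m th j.
Proof. by apply: divr_ge0 => //; apply: sumr_ge0 => i _; rewrite mulr_ge0 ?sqr_ge0. Qed.

(** After rescaling, the energy of a block minus its limit is [T^-1] times a weighted sum of
    deviations [N - rate * t] at the two ends of the block, which the law of large numbers makes
    small. *)
Lemma block_energy_cvg (m : nat) (th : nat -> 'I_4 -> R) (B dl : R) : (0 < m)%N -> 0 < dl ->
  (forall j i, th j i ^+ 2 <= B) ->
  exists2 T0, 1 <= T0 & forall T, T0 <= T -> exists n0, forall n, (n0 <= n)%N ->
    forall j, (j < m)%N ->
      E (fun w => (energy_fun tau Z n (fun i => scale T * th j i) (btime T m j) (btime T m j.+1) w -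
         block_variance m th j) ^+ 2) <= dl ^+ 2.
Proof.
move=> m0 dl0 hB; have B0 : 0 <= B := le_trans (sqr_ge0 _) (hB 0%N ord0).
(* 64 collects 4 from the square of a sum of four terms, 2 from the square of a difference, 2 for
   the two ends and 4 for the components. *)
have [A [A0 AE]] : exists A, 0 <= A /\ A = 64 * B ^+ 2.
  by eexists; split; last reflexivity; rewrite mulr_ge0 ?sqr_ge0.
have e0 : 0 < dl ^+ 2 / (A + 1) by rewrite divr_gt0 ?exprn_gt0// ltr_wpDl.
have [T0 T01 hT] := lln g_ge0 h_ge0 g_int h_int hg_lt1 H e0.
exists T0 => // T TT; have [n0 hn] := hT T TT; exists n0 => n nn j jm.
have [_ {}hn] := hn n nn.
have Tp : 0 < T by apply: lt_le_trans TT; apply: lt_le_trans T01.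
have m0R : 0 < m%:R :> R by rewrite ltr0n.
pose D i t w := N n i t w - rate i * t.
have bD i t : bmf (D i t) by apply: bmfB => //; exact: bmf_cst.
have bt0 l : 0 <= btime T m l by rewrite mulr_ge0 ?divr_ge0// ltW.
have btT l : (l <= m)%N -> btime T m l <= T.
  by move=> lm; rewrite /btime ler_piMr ?(ltW Tp)// ler_pdivrMr// mul1r ler_nat.
pose t1 := btime T m j; pose t2 := btime T m j.+1.
have tE : t2 - t1 = T / m%:R.
  by rewrite /t1 /t2 /btime -mulrBr -mulrBl -natrB// subSnn mul1r.
have key w : energy_fun tau Z n (fun i => scale T * th j i) t1 t2 w - block_variance m th j =
    T^-1 * \sum_i th j i ^+ 2 * (D i t2 w - D i t1 w).
  have -> : block_variance m th j = T^-1 * \sum_i th j i ^+ 2 * (rate i * (t2 - t1)).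
    rewrite tE /block_variance mulr_suml mulr_sumr; apply: eq_bigr => i _.
    by field; rewrite !gt_eqF.
  rewrite /energy_fun -sumrB (eq_bigr (fun i => T^-1 * (th j i ^+ 2 * (N n i t2 w - N n i t1 w)))); last first.
    by move=> i _; rewrite exprMn scale_sqr// -mulrBr -!mulrA.
  rewrite -mulr_sumr -mulrBr -sumrB; congr (_ * _); apply: eq_bigr => i _.
  by rewrite -mulrBr /D; congr (_ * _); rewrite mulrBr; move: (N _ _ _ _) (N _ _ _ _) => x y; ring.
have bound w : (energy_fun tau Z n (fun i => scale T * th j i) t1 t2 w - block_variance m th j) ^+ 2 <=
    T^-1 ^+ 2 * (B ^+ 2 * \sum_i (8 * D i t2 w ^+ 2 + 8 * D i t1 w ^+ 2)).
  rewrite key exprMn ler_wpM2l ?sqr_ge0//.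
  have -> : (\sum_i th j i ^+ 2 * (D i t2 w - D i t1 w)) ^+ 2 =
      `|\sum_i th j i ^+ 2 * (D i t2 w - D i t1 w)| ^+ 2 by rewrite real_normK// num_real.
  apply: (@le_trans _ _ ((B * \sum_i `|D i t2 w - D i t1 w|) ^+ 2)).
    rewrite ler_sqr ?nnegrE ?mulr_ge0 ?sumr_ge0// mulr_sumr (le_trans (ler_norm_sum _ _ _))//.
    by apply: ler_sum => i _; rewrite normrM ger0_norm ?sqr_ge0// ler_wpM2r.
  rewrite exprMn ler_wpM2l ?sqr_ge0//.
  apply: (@le_trans _ _ (4 * \sum_i (D i t2 w - D i t1 w) ^+ 2)).
    exact: sqr_sum4_le.
  rewrite mulr_sumr; apply: ler_sum => i _; move: (D i t2 w) (D i t1 w) => x y.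
  have := sqr_ge0 (x + y); nra.
have b1 i : bmf (fun w => 8 * D i t2 w ^+ 2) by apply: bmfZ; apply: bmfX.
have b2 i : bmf (fun w => 8 * D i t1 w ^+ 2) by apply: bmfZ; apply: bmfX.
have b3 : bmf (fun w => \sum_i (8 * D i t2 w ^+ 2 + 8 * D i t1 w ^+ 2)) by apply: bmf_sum => i; apply: bmfD.
have b4 : bmf (fun w => B ^+ 2 * \sum_i (8 * D i t2 w ^+ 2 + 8 * D i t1 w ^+ 2)) by exact: bmfZ.
apply: (@le_trans _ _ (E (fun w => T^-1 ^+ 2 * (B ^+ 2 * \sum_i (8 * D i t2 w ^+ 2 + 8 * D i t1 w ^+ 2))))).
  have b5 := bmf_energy_fun H n (fun i => scale T * th j i) t1 t2.
  exact: (Ex_le P (bmfX 2 (bmfB b5 (bmf_cst _ (block_variance m th j)))) (bmfZ (T^-1 ^+ 2) b4)).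
rewrite (ExZ P _ b4) (ExZ P _ b3) (Ex_sum P _ (F := fun i w => 8 * D i t2 w ^+ 2 + 8 * D i t1 w ^+ 2)); last first.
  by move=> i; exact: bmfD.
have hs : \sum_(i < 4) E (fun w => 8 * D i t2 w ^+ 2 + 8 * D i t1 w ^+ 2) <=
    64 * (dl ^+ 2 / (A + 1) * T ^+ 2).
  apply: (@le_trans _ _ (\sum_(i < 4) 16 * (dl ^+ 2 / (A + 1) * T ^+ 2))); last first.
    by rewrite sumr_const card_ord -[leLHS]mulr_natr mulrAC -natrM.
  apply: ler_sum => i _; rewrite (ExD P (b1 i) (b2 i)).
  rewrite (ExZ P _ (bmfX 2 (bD i t2))) (ExZ P _ (bmfX 2 (bD i t1))).
  have e1 := hn i t2 (bt0 _) (btT j.+1 jm); have e2 := hn i t1 (bt0 _) (btT j (ltnW jm)).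
  move: e1 e2; move: (E _) (E _) (_ * T ^+ 2) => x y z; lra.
apply: (@le_trans _ _ (T^-1 ^+ 2 * (B ^+ 2 * (64 * (dl ^+ 2 / (A + 1) * T ^+ 2))))).
  by rewrite ler_wpM2l ?sqr_ge0// ler_wpM2l ?sqr_ge0.
rewrite (_ : T^-1 ^+ 2 * _ = A * (dl ^+ 2 / (A + 1))); last first.
  by rewrite AE; field; rewrite -AE !gt_eqF// ltr_wpDl.
rewrite mulrCA -[leRHS]mulr1 ler_wpM2l ?sqr_ge0// ler_pdivrMr ?ltr_wpDl// mul1r lerDl//.
Qed.

Lemma btime_mul (T : R) m L j : (0 < L)%N -> btime T (m * L) (j * L) = btime T m j.
Proof.
by move=> L0; rewrite /btime !natrM invfM mulrACA mulfV ?mulr1// pnatr_eq0 -lt0n.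
Qed.

Lemma divn_block L k j : (0 < L)%N -> (k * L <= j < k.+1 * L)%N -> (j %/ L)%N = k.
Proof.
by move=> L0; rewrite -leq_divRL// -ltn_divLR// ltnS -eqn_leq => /eqP.
Qed.

Lemma sum_blocks (m L : nat) (F : nat -> R) : (0 < L)%N ->
  \sum_(j < m * L) F (j %/ L)%N = \sum_(k < m) L%:R * F k.
Proof.
move=> L0; rewrite -(big_mkord xpredT (fun j => F (j %/ L)%N)) big_nat_mul big_mkord.
apply: eq_bigr => k _; rewrite (eq_big_nat _ _ (F2 := fun=> F k)); last first.
  by move=> j /(divn_block L0) ->.
by rewrite sumr_const_nat mulSn addnK mulr_natl.
Qed.

Lemma telescope_blocks (m L : nat) (f : nat -> R -> R) T : (0 < L)%N ->
  \sum_(j < m * L) (f (j %/ L)%N (btime T (m * L) j.+1) - f (j %/ L)%N (btime T (m * L) j)) =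
  \sum_(k < m) (f k (btime T m k.+1) - f k (btime T m k)).
Proof.
move=> L0; rewrite -(big_mkord xpredT (fun j => f (j %/ L)%N (btime T (m * L) j.+1) -
  f (j %/ L)%N (btime T (m * L) j))) big_nat_mul big_mkord.
apply: eq_bigr => k _.
rewrite (eq_big_nat _ _ (F2 := fun j => f k (btime T (m * L) j.+1) - f k (btime T (m * L) j))); last first.
  by move=> j /(divn_block L0) ->.
by rewrite telescope_sumr ?leq_mul2r ?leqnSn ?orbT// !btime_mul.
Qed.

(* The coarse grid is refined into [m * L] blocks so that the Lindeberg error is
   small; the weights [th] stay constant on each coarse block. *)
Lemma block_increments_cos (m : nat) (th : nat -> 'I_4 -> R) (B c e : R) : (0 < m)%N -> 0 < e ->
  (forall j i, th j i ^+ 2 <= B) ->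
  exists2 T0, 1 <= T0 & forall T, T0 <= T -> exists n0, forall n, (n0 <= n)%N ->
    `|E (fun w => cos (\sum_(j < m) scale T * (M n (th j) (btime T m j.+1) w - M n (th j) (btime T m j) w) + c))
      - expR (- \sum_(j < m) (block_variance m th j / 2)) * cos c| <= e.
Proof.
move=> m0 e0 hB; have B0 : 0 <= B := le_trans (sqr_ge0 _) (hB 0%N ord0).
have [C [C0 CE]] : exists C, 0 <= C /\ C = B * \sum_i rate i.
  by eexists; split; last reflexivity; rewrite mulr_ge0 ?sumr_ge0.
(* The three quarters of [e] that are spent: [r * C] from the second moments, [A * C^2 / K] from the
   squares of block variances, made small by [L], and all terms with [dl], chosen last because they
   carry the factor [K]. *)
pose r := e / (4 * (C + 1)).
have C1 : 0 < C + 1 by rewrite ltr_wpDl.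
have r_gt0 : 0 < r by rewrite divr_gt0// mulr_gt0.
have [Y [Y0 YE]] : exists Y : R, 0 <= Y /\ Y = 2096.
  by eexists; split; last reflexivity; exact: ler0n.
have r1 : 0 <= 1 + r^-1 by rewrite addr_ge0// invr_ge0 ltW.
have [A [A0 AE]] : exists A, 0 < A /\ A = (1 + r^-1) * Y + 1.
  by eexists; split; last reflexivity; rewrite ltr_wpDl// mulr_ge0.
pose L := (Num.truncn (4 * A * C ^+ 2 / e)).+1.
have L0 : (0 < L)%N by [].
pose K := (m * L)%N; have K0 : (0 < K)%N by rewrite muln_gt0 m0.
have KR : 0 < K%:R :> R by rewrite ltr0n.
have hK : A * (C ^+ 2 / K%:R) <= e / 4.
  rewrite mulrA ler_pdivrMr// [leRHS]mulrC -ler_pdivrMr ?divr_gt0//.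
  rewrite (_ : A * _ / _ = 4 * A * C ^+ 2 / e); last by field; rewrite gt_eqF.
  apply: ltW; apply: lt_le_trans (truncnS_gt _) _; rewrite ler_nat /K -/L.
  by rewrite -[leqLHS]mul1n leq_mul2r m0 orbT.
pose dl := Num.min 1 (e / (4 * (K%:R * (A + r + 1)))).
have Ar : 0 < A + r + 1 by rewrite !addr_gt0.
have dl0 : 0 < dl by rewrite lt_min ltr01 divr_gt0// mulr_gt0// mulr_gt0.
have dl1 : dl <= 1 by rewrite ge_min lexx.
have hdl : K%:R * (A + r + 1) * dl <= e / 4.
  have hh : dl <= e / (4 * (K%:R * (A + r + 1))) by rewrite ge_min lexx orbT.
  rewrite mulrC -ler_pdivlMr ?mulr_gt0// (le_trans hh)// le_eqVlt; apply/orP; left; apply/eqP.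
  by field; rewrite !gt_eqF.
pose ft j := th (j %/ L)%N.
have hft j i : ft j i ^+ 2 <= B by exact: hB.
have [T0 T01 hT] := block_energy_cvg K0 dl0 hft.
exists T0 => // T TT; have [n0 hn] := hT T TT; exists n0 => n nn; have {}hn := hn n nn.
have Tp : 0 < T by apply: lt_le_trans TT; apply: lt_le_trans T01.
pose qm := C / K%:R.
have hq j : block_variance K ft j <= qm.
  rewrite /block_variance /qm ler_wpM2r ?invr_ge0// CE mulr_sumr.
  by apply: ler_sum => i _; rewrite ler_wpM2r.
have := block_cos g_int h_int H Tp K0 (block_variance_ge0 K ft) dl0 r_gt0 hq hn c.
rewrite (_ : (fun w => cos (bsum _ _ _ _ _ _ _ _ _ _ w + c)) =
  fun w => cos (\sum_(j < m) scale T * (M n (th j) (btime T m j.+1) w - M n (th j) (btime T m j) w) + c)); last first.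
  apply/funext => w; congr (cos (_ + c)); rewrite /bsum.
  rewrite (telescope_blocks m (fun k t => M n (fun i => scale T * th k i) t w) T L0).
  apply: eq_bigr => k _.
  by rewrite [RHS]mulrBr; congr (_ - _); exact: wmartZ.
have hs : \sum_(j < K) block_variance K ft j = \sum_(j < m) block_variance m th j.
  rewrite (sum_blocks m (fun k => (\sum_i th k i ^+ 2 * rate i) / K%:R) L0); apply: eq_bigr => k _.
  rewrite mulrCA /block_variance; congr (_ * _).
  by rewrite /K natrM invfM mulrCA mulfV ?mulr1// pnatr_eq0 -lt0n.
rewrite -(mulr_suml _ _ (fun j : 'I_K => block_variance K ft j)) hs mulr_suml.
move=> hb; apply: le_trans hb _.
have e1 : K%:R * qm = C by rewrite /qm mulrC divfK// gt_eqF.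
have e2 : K%:R * qm ^+ 2 = C ^+ 2 / K%:R by rewrite /qm; field; rewrite gt_eqF.
have rC : r * C <= e / 4.
  apply: (@le_trans _ _ (r * (C + 1))); first by rewrite ler_pM2l// lerDl.
  by rewrite le_eqVlt; apply/orP; left; apply/eqP; rewrite /r; field; rewrite gt_eqF.
have d2 : dl ^+ 2 <= dl by rewrite expr2 ler_piMr ?(ltW dl0).
have hA : K%:R * ((1 + r^-1) * (1048 * (2 * (qm ^+ 2 + dl ^+ 2))) + qm ^+ 2 + dl) <= A * (C ^+ 2 / K%:R) + K%:R * (A * dl).
  rewrite -e2 AE.
  rewrite (_ : ((1 + r^-1) * Y + 1) * (K%:R * qm ^+ 2) + K%:R * (((1 + r^-1) * Y + 1) * dl) =
    K%:R * (((1 + r^-1) * Y + 1) * (qm ^+ 2 + dl))); last by ring.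
  rewrite ler_pM2l//.
  rewrite YE; have : (1 + r^-1) * dl ^+ 2 <= (1 + r^-1) * dl by rewrite ler_wpM2l.
  move: (1 + r^-1) (qm ^+ 2) (dl ^+ 2) (dl) => x y z u hh; lra.
have -> : K%:R * ((1 + r^-1) * (1048 * (2 * (qm ^+ 2 + dl ^+ 2))) + r * (qm + dl) + dl + qm ^+ 2) =
  K%:R * ((1 + r^-1) * (1048 * (2 * (qm ^+ 2 + dl ^+ 2))) + qm ^+ 2 + dl) + r * (K%:R * qm) + K%:R * (r * dl).
  by move: ((1 + r^-1) * _) => x; ring.
rewrite e1; have hh : K%:R * (A * dl) + K%:R * (r * dl) <= K%:R * (A + r + 1) * dl.
  rewrite -mulrDr -mulrDl -[leRHS]mulrA ler_pM2l// ler_pM2r// lerDl//.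
move: hA hK rC hh hdl; move: (K%:R * (_ + _ + dl)) (A * (C ^+ 2 / _)) (K%:R * (A * dl)) (r * C) (K%:R * (r * dl)) (K%:R * (A + r + 1) * dl).
by move=> x1 x2 x3 x4 x5 x6; lra.
Qed.

(** A block variance is at most [C / m], so fourth moments are of order [m^-2] with a constant
    independent of [m]; summed over the cells this leaves order [1 / m], the source of tightness. *)
Lemma block_increments_sup (a : bool) : exists2 A : R, 0 <= A & forall (m : nat) (e : R), (0 < m)%N -> 0 < e ->
  exists2 T0, 1 <= T0 & forall T, T0 <= T -> exists n0, forall n, (n0 <= n)%N ->
    forall j, (j < m)%N -> exists W : Omega -> R, [/\ bmf W, forall w, 0 <= W w,
      forall u w, btime T m j <= u -> u <= btime T m j.+1 ->
        (scale T * (M n (diff_weight a) u w - M n (diff_weight a) (btime T m j) w)) ^+ 4 <= W w &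
      E W <= A / m%:R ^+ 2 + e].
Proof.
have hB (j : nat) i : diff_weight a i ^+ 2 <= 1 :> R.
  rewrite /diff_weight /unit_weight; case: (_ == _); case: (_ == _);
  by rewrite ?subrr ?subr0 ?sub0r ?sqrrN ?expr1n ?expr0n.
have [C [C0 CE]] : exists C, 0 <= C /\ C = \sum_i rate i.
  by eexists; split; last reflexivity; rewrite ?sumr_ge0.
have [A [A0 AE]] : exists A : R, 0 <= A /\ A = 2096 by eexists; split; last reflexivity; exact: ler0n.
exists (A * C ^+ 2); first by rewrite mulr_ge0 ?sqr_ge0.
move=> m e m0 e0; pose dl := Num.min 1 (e / (A + 1)).
have A1 : 0 < A + 1 by rewrite ltr_wpDl.
have dl0 : 0 < dl by rewrite lt_min ltr01 divr_gt0.
have [T0 T01 hT] := block_energy_cvg m0 dl0 hB.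
exists T0 => // T TT; have [n0 hn] := hT T TT; exists n0 => n nn; have {}hn := hn n nn.
have Tp : 0 < T by apply: lt_le_trans TT; apply: lt_le_trans T01.
pose qm := C / m%:R.
have hq j : block_variance m (fun=> diff_weight a) j <= qm.
  rewrite /block_variance /qm ler_wpM2r ?invr_ge0// CE.
  by apply: ler_sum => i _; rewrite ler_piMl// (hB 0%N).
move=> j jm.
have [W [bW W0 hW EW]] := block_fourth g_int h_int H (th := fun _ i => scale T * diff_weight a i) Tp m0 (block_variance_ge0 m (fun=> diff_weight a)) hq hn jm.
exists W; split => //.
  by move=> u w u1 u2; have := hW u w u1 u2; rewrite !wmartZ -mulrBr.
apply: le_trans EW _.
have d2 : A * dl ^+ 2 <= e.
  apply: (@le_trans _ _ (A * dl)).
    by rewrite ler_wpM2l// expr2 ler_piMr ?(ltW dl0)// ge_min lexx.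
  apply: (@le_trans _ _ ((A + 1) * dl)); first by rewrite ler_wpM2r ?(ltW dl0)// lerDl.
  by rewrite mulrC -ler_pdivlMr// ge_min lexx orbT.
have -> : A * C ^+ 2 / m%:R ^+ 2 = A * qm ^+ 2 by rewrite /qm expr_div_n [RHS]mulrA.
move: d2; rewrite AE; move: (qm ^+ 2) (dl ^+ 2) => x y; lra.
Qed.

End block_limits.

(** * Trigonometric approximation of Lipschitz functions *)

Section bernstein.
Context {R : realType}.
Implicit Types (phi psi : nat -> R) (p : R).

(* [bern N phi p] is the expectation of [phi] at a binomial variable (N, p). *)
Fixpoint bern (N : nat) phi p : R :=
  if N is N'.+1 then p * bern N' (phi \o S) p + (1 - p) * bern N' phi p else phi 0%N.

Lemma bern_affine N (a b : R) phi p : bern N (fun l => a + b * phi l) p = a + b * bern N phi p.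
Proof.
elim: N phi => [|N IH] phi //=.
rewrite (_ : (fun l => a + b * phi l) \o S = fun l => a + b * (phi \o S) l)// !IH; ring.
Qed.

Lemma bern_dist N phi psi y p : 0 <= p -> p <= 1 -> (forall l, `|phi l - y| <= psi l) ->
  `|bern N phi p - y| <= bern N psi p.
Proof.
move=> p0 p1; elim: N phi psi => [|N IH] phi psi hl /=; first exact: hl.
rewrite (_ : _ - y = p * (bern N (phi \o S) p - y) + (1 - p) * (bern N phi p - y)); last by ring.
have p1' : 0 <= 1 - p by rewrite subr_ge0.
apply: le_trans (ler_normD _ _) _; rewrite !normrM (ger0_norm p0) (ger0_norm p1').
by apply: lerD; apply: ler_wpM2l => //; apply: IH => l; exact: hl.
Qed.

Lemma bern_sqr N (c : R) p : bern N (fun l => (l%:R + c) ^+ 2) p = N%:R * (p * (1 - p)) + (N%:R * p + c) ^+ 2.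
Proof.
elim: N c => [|N IH] c /=; first by rewrite !mul0r !add0r.
rewrite IH (_ : _ \o S = fun l => (l%:R + (c + 1)) ^+ 2); last first.
  by apply/funext => l /=; rewrite -[l.+1%:R]natr1; congr (_ ^+ 2); ring.
by rewrite IH -natr1; ring.
Qed.

End bernstein.

Section trig.
Context {R : realType} (I : finType).
Implicit Types (f p : (I -> R) -> R) (x th : I -> R).

(** Trigonometric polynomials in several variables. The free phase [c] contains the sines, so that
    convergence of all such cosines is convergence of characteristic functions in real form. *)
Inductive trig : ((I -> R) -> R) -> Prop :=
| trig_cos th c : trig (fun x => cos (\sum_i th i * x i + c))
| trig_add p1 p2 : trig p1 -> trig p2 -> trig (fun x => p1 x + p2 x)
| trig_scale (a : R) p : trig p -> trig (fun x => a * p x).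

Lemma trig_cst (a : R) : trig (fun=> a).
Proof.
have := trig_scale a (trig_cos (fun=> 0) 0).
rewrite (_ : (fun x => a * _) = fun=> a)//; apply/funext => x.
by rewrite big1 ?add0r ?cos0 ?mulr1// => i _; rewrite mul0r.
Qed.

(** Product-to-sum formula for two cosines, extended bilinearly by the two inductions. *)
Lemma trig_mul p1 p2 : trig p1 -> trig p2 -> trig (fun x => p1 x * p2 x).
Proof.
move=> t1 t2; elim: t1 => [th c|q1 q2 _ h1 _ h2|a q _ hq].
- elim: t2 => [th' c'|q1 q2 _ h1 _ h2|a q _ hq].
  + have := trig_scale 2^-1 (trig_add (trig_cos (fun i => th i - th' i) (c - c'))
       (trig_cos (fun i => th i + th' i) (c + c'))).
    rewrite (_ : (fun x => 2^-1 * _) = fun x => cos (\sum_i th i * x i + c) * cos (\sum_i th' i * x i + c'))//.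
    apply/funext => x.
    have e1 : \sum_i (th i - th' i) * x i + (c - c') = (\sum_i th i * x i + c) - (\sum_i th' i * x i + c').
      by under eq_bigr do rewrite mulrBl; rewrite sumrB; move: (\sum_i _) (\sum_i _) => u v; ring.
    have e2 : \sum_i (th i + th' i) * x i + (c + c') = (\sum_i th i * x i + c) + (\sum_i th' i * x i + c').
      by under eq_bigr do rewrite mulrDl; rewrite big_split /=; move: (\sum_i _) (\sum_i _) => u v; ring.
    by rewrite e1 e2; move: (_ + c) (_ + c') => u v; rewrite cosB cosD; field.
  + rewrite (_ : (fun x => _) = fun x => cos (\sum_i th i * x i + c) * q1 x + cos (\sum_i th i * x i + c) * q2 x).
      exact: trig_add.
    by apply/funext => x; rewrite mulrDr.
  + rewrite (_ : (fun x => _) = fun x => a * (cos (\sum_i th i * x i + c) * q x)); first exact: trig_scale.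
    by apply/funext => x; rewrite mulrCA.
- rewrite (_ : (fun x => _) = fun x => q1 x * p2 x + q2 x * p2 x); first exact: trig_add.
  by apply/funext => x; rewrite mulrDl.
- rewrite (_ : (fun x => _) = fun x => a * (q x * p2 x)); first exact: trig_scale.
  by apply/funext => x; rewrite mulrA.
Qed.

Lemma trig_bern N (phi : nat -> (I -> R) -> R) p : (forall l, trig (phi l)) -> trig p ->
  trig (fun x => bern N (phi ^~ x) (p x)).
Proof.
move=> tphi tp; elim: N phi tphi => [|N IH] phi tphi; first exact: tphi.
have t1 : trig (fun x => p x * bern N ((phi ^~ x) \o S) (p x)).
  by apply: trig_mul => //; apply: (IH (fun l => phi l.+1)) => l.
have t2 : trig (fun x => (1 + -1 * p x) * bern N (phi ^~ x) (p x)).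
  apply: trig_mul; last exact: IH.
  by apply: trig_add; [exact: trig_cst|exact: trig_scale].
have := trig_add t1 t2; congr trig; apply/funext => x /=; by rewrite mulN1r.
Qed.

Lemma trig_bmf d (T : measurableType d) (X : T -> I -> R) p :
  (forall i, measurable_fun setT (X ^~ i)) -> trig p -> bmf (fun w => p (X w)).
Proof.
move=> mX; elim=> [th c|p1 p2 _ h1 _ h2|a q _ hq].
- split; last by exists 1 => w; rewrite ler_norml cos_geN1 cos_le1.
  apply: measurableT_comp; first exact: continuous_measurable_fun (@continuous_cos R).
  apply: measurable_funD => //; apply: measurable_sum => i.
  exact: measurable_funM.
- exact: bmfD.
- exact: bmfZ.
Qed.

End trig.

Section trig_approximation.
Context {R : realType} (I : finType).
Implicit Types (f G p : (I -> R) -> R) (x y c : I -> R).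

Definition l1_lipschitz K f := forall x y, `|f x - f y| <= K * \sum_i `|x i - y i|.

(** The sine of a rescaled coordinate moved into the unit interval, where Bernstein polynomials
    operate. Large [A] makes [A sin (x i / A)] a smooth truncation of [x i]. *)
Let u (A : R) x i := (1 + sin (x i / A)) / 2.

Let u01 A x i : 0 <= u A x i <= 1.
Proof.
have h1 := sin_geN1 (x i / A); have h2 := sin_le1 (x i / A).
by apply/andP; rewrite /u; split; lra.
Qed.

Let trig_u A i : trig (fun x => u A x i).
Proof.
have t1 := trig_cos (fun j : I => if j == i then A^-1 else 0) (- (pi / 2) : R).
have := trig_add (trig_cst I 2^-1) (trig_scale 2^-1 t1).
congr trig; apply/funext => x.
rewrite (bigD1 i)//= big1 ?addr0; last by move=> j /negPf ->; rewrite mul0r.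
by rewrite eqxx cosBpihalf /u [A^-1 * _]mulrC; field.
Qed.

(** Induction on the coordinates of [s]: the new coordinate is frozen at the nodes [l / N], the
    induction hypothesis approximates each frozen function, and a Bernstein polynomial in [u A x i]
    interpolates between the nodes. *)
Lemma bern_approx A G L : 0 <= L -> l1_lipschitz L G -> forall (s : seq I) c (e : R), 0 < e ->
  exists2 p, trig p & forall x, `|G (fun i => if i \in s then u A x i else c i) - p x| <= e.
Proof.
move=> L0 GL; elim=> [|i s IH] c e e0.
  by exists (fun=> G c); [exact: trig_cst|move=> x; rewrite subrr normr0 ltW].
have [si|si] := boolP (i \in s).
  have [p tp hp] := IH c e e0; exists p => // x; rewrite (_ : (fun j => _) = fun j => if j \in s then u A x j else c j)//.
  apply/funext => j; rewrite in_cons; case: eqP => [->|//]; by rewrite si.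
have [eta eta0 hL1] : exists2 eta, 0 < eta & L * eta <= e / 4.
  have L1 : 0 < L + 1 by rewrite ltr_wpDl.
  exists (e / (4 * (L + 1))); first by rewrite divr_gt0// mulr_gt0.
  apply: (@le_trans _ _ ((L + 1) * (e / (4 * (L + 1))))).
    by apply: ler_wpM2r; [rewrite divr_ge0 ?mulr_ge0 ?ltW|rewrite lerDl].
  by rewrite le_eqVlt; apply/orP; left; apply/eqP; field; rewrite gt_eqF.
have [N N0 hL2] : exists2 N : nat, 0 < N%:R :> R & L / (eta * N%:R) <= e / 4.
  exists (Num.truncn (4 * L / (eta * e))).+1; first by rewrite ltr0n.
  have /ltW := truncnS_gt (4 * L / (eta * e)); set n1 := _.+1%:R => hh.
  have n0 : 0 < n1 by rewrite ltr0n.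
  rewrite ler_pdivrMr ?mulr_gt0// -(ler_pM2l (ltr0Sn R 3)).
  move: hh; rewrite ler_pdivrMr ?mulr_gt0// => /le_trans; apply.
  by rewrite le_eqVlt; apply/orP; left; apply/eqP; field.
have e2 : 0 < e / 2 by rewrite divr_gt0.
have /choice[p hp] : forall l : nat, exists p, trig p /\ forall x,
    `|G (fun j => if j \in s then u A x j else if j == i then l%:R / N%:R else c j) - p x| <= e / 2.
  by move=> l; have [p tp hp] := IH (fun j => if j == i then l%:R / N%:R else c j) _ e2; exists p.
exists (fun x => bern N (p ^~ x) (u A x i)).
  by apply: trig_bern => // l; have [] := hp l.
move=> x; rewrite distrC.
set y := G _; have /andP[u0 u1] := u01 A x i.
pose a := e / 2 + L * eta; pose b := L / (eta * N%:R ^+ 2).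
have hl l : `|p l x - y| <= a + b * (l%:R + - (N%:R * u A x i)) ^+ 2.
  have [_ h1] := hp l; have {h1} := h1 x; set y' := G _ => h1.
  have h2 : `|y' - y| <= L * `|l%:R / N%:R - u A x i|.
    apply: le_trans (GL _ _) _; rewrite (bigD1 i)//= big1.
      by rewrite addr0 (negPf si) eqxx in_cons eqxx.
    by move=> j ji; rewrite in_cons (negPf ji) /=; case: ifP; rewrite subrr normr0.
  (* A quadratic majorant of the distance, so that the binomial variance bounds the Bernstein error;
     with [eta] and [N] as chosen it costs [e / 4 + e / 4], beside [e / 2] from the induction. *)
  have h3 t : `|t| <= eta + t ^+ 2 / eta.
    have [te|te] := leP `|t| eta; first by rewrite (le_trans te)// lerDl divr_ge0 ?sqr_ge0// ltW.
    apply: (@le_trans _ _ (t ^+ 2 / eta)); last by rewrite lerDr ltW.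
    by rewrite ler_pdivlMr// -[in leRHS]real_normK ?num_real// expr2 ler_wpM2l// ltW.
  rewrite -(subrKA y') (le_trans (ler_normD _ _))// /a -addrA lerD//; first by rewrite distrC.
  apply: le_trans h2 _; apply: le_trans (ler_wpM2l L0 (h3 _)) _.
  rewrite le_eqVlt; apply/orP; left; apply/eqP; rewrite /b; field.
  by rewrite !gt_eqF.
have := @bern_dist _ N (fun l => p l x) (fun l => a + b * (l%:R + - (N%:R * u A x i)) ^+ 2) y _ u0 u1 hl.
rewrite bern_affine bern_sqr subrr expr0n addr0 => hb; apply: le_trans hb _.
have hu : u A x i * (1 - u A x i) <= 1.
  by rewrite -[leRHS]mulr1 ler_pM ?subr_ge0// gerBl.
have : b * (N%:R * (u A x i * (1 - u A x i))) <= L / (eta * N%:R).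
  apply: (@le_trans _ _ (b * (N%:R * 1))).
    by apply: ler_wpM2l; [rewrite divr_ge0// mulr_ge0 ?sqr_ge0// ltW|rewrite ler_pM2l].
  by rewrite le_eqVlt; apply/orP; left; apply/eqP; rewrite /b; field; rewrite !gt_eqF.
rewrite /a; move: (b * _) hL1 hL2; move: (L * eta) (L / _) => v1 v2 v3; lra.
Qed.

(** A quadratic bound is wanted because the error will be integrated against second moments. *)
Lemma sub_sin_le (x : R) : `|x - sin x| <= 2 * x ^+ 2.
Proof.
rewrite -(real_normK (num_real x)); have [x1|/ltW x1] := leP `|x| 1.
  apply: le_trans (sin_taylor x) _; rewrite exprSr.
  have := sqr_ge0 `|x|; have := normr_ge0 x; move: `|x| x1 => y y1 y0 y2.
  by apply: (@le_trans _ _ (y ^+ 2)); [rewrite ler_piMr|lra].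
apply: le_trans (ler_normB _ _) _; have := sin_abs_le x.
move: `|x| `|sin x| x1 => y z y1; nra.
Qed.

(** [f] is replaced by its value at [A sin (x i / A)], which differs from [x i] by at most
    [2 x i ^+ 2 / A]; [A] is chosen so that [2 K / A <= e]. *)
Lemma trig_approx f Mb K (e : R) : 0 <= K -> l1_lipschitz K f -> (forall x, `|f x| <= Mb) -> 0 < e ->
  exists2 p, trig p & forall x, `|f x - p x| <= e * (1 + \sum_i x i ^+ 2) /\ `|p x| <= Mb + e.
Proof.
move=> K0 fK fM e0; pose A := 2 * K / e + 1.
have A0 : 0 < A by rewrite ltr_wpDl// divr_ge0 ?mulr_ge0// ltW.
pose G y := f (fun i => A * (2 * y i - 1)).
have L0 : 0 <= 2 * A * K by rewrite !mulr_ge0// ltW.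
have GL : l1_lipschitz (2 * A * K) G.
  move=> x y; apply: le_trans (fK _ _) _; rewrite !mulr_sumr; apply: ler_sum => i _.
  rewrite (_ : A * (2 * x i - 1) - A * (2 * y i - 1) = 2 * A * (x i - y i)); last by ring.
  by rewrite normrM (@ger0_norm _ (2 * A)) ?mulr_ge0 ?(ltW A0)// mulrCA mulrA.
have [p tp hp] := @bern_approx A G _ L0 GL (enum I) (fun=> 0) e e0.
exists p => // x; have {}hp := hp x.
have GE : G (fun i => if i \in enum I then u A x i else 0) = f (fun i => A * sin (x i / A)).
  rewrite /G; congr f; apply/funext => i; rewrite mem_enum /u inE; congr (_ * _); move: (sin _) => z; lra.
rewrite GE in hp; split; last first.
  rewrite -[p x](subrK (f (fun i => A * sin (x i / A)))) (le_trans (ler_normD _ _))// addrC lerD//.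
  by rewrite distrC.
rewrite mulrDr mulr1 -(subrKA (f (fun i => A * sin (x i / A)))) (le_trans (ler_normD _ _))// addrC lerD//.
apply: le_trans (fK _ _) _; rewrite !mulr_sumr; apply: ler_sum => i _.
rewrite (_ : x i - A * sin (x i / A) = A * (x i / A - sin (x i / A))); last by rewrite mulrBr [A * (x i / A)]mulrC divfK// gt_eqF.
rewrite normrM (gtr0_norm A0).
apply: (@le_trans _ _ (K * (A * (2 * (x i / A) ^+ 2)))).
  by apply: ler_wpM2l => //; rewrite ler_pM2l// sub_sin_le.
rewrite (_ : K * _ = (2 * K / A) * x i ^+ 2); last by field; rewrite gt_eqF.
rewrite ler_wpM2r ?sqr_ge0// ler_pdivrMr// /A mulrDr mulr1 mulrCA mulfV ?gt_eqF// mulr1 lerDl ltW//.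
Qed.

(** Besides the approximation of the expectation, this is how [f] composed with [X] is seen to be
    measurable: it is a pointwise limit of trigonometric polynomials in [X]. *)
Lemma trig_dct d (T : measurableType d) (P : probability T R) (X : T -> I -> R) f Mb K :
  (forall i, measurable_fun setT (X ^~ i)) -> 0 <= K -> l1_lipschitz K f -> (forall x, `|f x| <= Mb) ->
  exists2 p : nat -> (I -> R) -> R,
    forall n, trig (p n) /\ forall x, `|f x - p n x| <= n.+1%:R^-1 * (1 + \sum_i x i ^+ 2) &
    bmf (fun w => f (X w)) /\ Ex P (fun w => p n (X w)) @[n --> \oo] --> Ex P (fun w => f (X w)).
Proof.
move=> mX K0 fK fM.
have /choice[p hp] : forall n : nat, exists p, trig p /\ forall x,
    `|f x - p x| <= n.+1%:R^-1 * (1 + \sum_i x i ^+ 2) /\ `|p x| <= Mb + n.+1%:R^-1.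
  move=> n; have n0 : 0 < n.+1%:R^-1 :> R by rewrite invr_gt0.
  by have [p tp h] := trig_approx K0 fK fM n0; exists p.
exists p; first by move=> n; have [tp h] := hp n; split=> // x; have [] := h x.
apply: (@Ex_dct _ _ _ P (fun n w => p n (X w)) (fun w => f (X w)) (Mb + 1)).
- by move=> n; have [tp _] := hp n; have [] := trig_bmf mX tp.
- move=> n w; have [_ h] := hp n; have [_ h2] := h (X w); apply: le_trans h2 _.
  by rewrite lerD2l invf_le1 ?ler1n.
- move=> w; apply/cvgrPdist_le => e e0; set S := \sum_i (X w) i ^+ 2.
  have S0 : 0 < 1 + S by rewrite ltr_pwDl// sumr_ge0// => i _; exact: sqr_ge0.
  have h0 : 0 < e / (1 + S) by rewrite divr_gt0.
  near=> n; have [_ h] := hp n; have [h1 _] := h (X w); apply: le_trans h1 _; rewrite -/S.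
  rewrite -ler_pdivlMr//; near: n.
  by apply: filterS (near_infty_natSinv_lt (PosNum h0)) => k /ltW.
Unshelve. all: by end_near.
Qed.

End trig_approximation.

(** * Iterated limits and passage from cosines to Lipschitz functions *)

Section eventually.
Context {R : realType}.

(* The order of the limits is [n --> oo] first (the localisation at the [n]-th
   jump is removed), then [T --> +oo]. *)
Definition evn (A : R -> nat -> Prop) :=
  exists2 T0, 1 <= T0 & forall T, T0 <= T -> exists n0, forall n, (n0 <= n)%N -> A T n.

Lemma evn_imp (A B : R -> nat -> Prop) : (forall T n, 1 <= T -> A T n -> B T n) -> evn A -> evn B.
Proof.
move=> AB [T0 T01 h]; exists T0 => // T TT; have [n0 hn] := h T TT.
by exists n0 => n nn; apply: AB (hn n nn); exact: le_trans TT.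
Qed.

Lemma evn_and (A B : R -> nat -> Prop) : evn A -> evn B -> evn (fun T n => A T n /\ B T n).
Proof.
move=> [T0 T01 hA] [T1 T11 hB]; exists (Num.max T0 T1); first by rewrite le_max T01.
move=> T; rewrite ge_max => /andP[h0 h1]; have [n0 hn0] := hA T h0; have [n1 hn1] := hB T h1.
exists (maxn n0 n1) => n; rewrite geq_max => /andP[k0 k1]; split; [exact: hn0|exact: hn1].
Qed.

Lemma evn_forall (I : finType) (A : I -> R -> nat -> Prop) : (forall i, evn (A i)) ->
  evn (fun T n => forall i, A i T n).
Proof.
move=> hA; suff : evn (fun T n => forall i, i \in enum I -> A i T n).
  by apply: evn_imp => T n _ h i; apply: h; rewrite mem_enum.
elim: (enum I) => [|i s IH]; first by exists 1 => // T _; exists 0%N.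
apply: evn_imp (evn_and (hA i) IH) => T n _ [h1 h2] j.
by rewrite in_cons => /predU1P[->//|]; exact: h2.
Qed.

Context (I : finType) d (Omega : measurableType d) (P : probability Omega R).
Context d' (Omega' : measurableType d') (Q : probability Omega' R).
Variables (X : R -> nat -> Omega -> I -> R) (Y : Omega' -> I -> R) (C : R).
Hypothesis bX : forall T n i, 1 <= T -> bmf (fun w => X T n w i).
Hypothesis mY : forall i, measurable_fun setT (Y ^~ i).
Hypothesis C0 : 0 <= C.
Hypothesis X2 : evn (fun T n => forall i, Ex P (fun w => X T n w i ^+ 2) <= C).
Hypothesis Xcos : forall th c (e : R), 0 < e -> evn (fun T n =>
  `|Ex P (fun w => cos (\sum_i th i * X T n w i + c)) - Ex Q (fun w => cos (\sum_i th i * Y w i + c))| <= e).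

Lemma trig_cvg p : trig p -> forall e : R, 0 < e -> evn (fun T n =>
  `|Ex P (fun w => p (X T n w)) - Ex Q (fun w => p (Y w))| <= e).
Proof.
elim=> [th c|p1 p2 t1 h1 t2 h2|a q tq hq] e e0; first exact: Xcos.
- have e2 : 0 < e / 2 by rewrite divr_gt0.
  apply: evn_imp (evn_and (h1 _ e2) (h2 _ e2)) => T n T1 [k1 k2].
  have mX i : measurable_fun setT (X T n ^~ i) by have [] := bX n i T1.
  rewrite (ExD P (trig_bmf mX t1) (trig_bmf mX t2)) (ExD Q (trig_bmf mY t1) (trig_bmf mY t2)).
  by rewrite opprD addrACA [e]splitr (le_trans (ler_normD _ _))// lerD.
- have e2 : 0 < e / (`|a| + 1) by rewrite divr_gt0// ltr_wpDl.
  apply: evn_imp (hq _ e2) => T n T1 k1.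
  have mX i : measurable_fun setT (X T n ^~ i) by have [] := bX n i T1.
  rewrite (ExZ P a (trig_bmf mX tq)) (ExZ Q a (trig_bmf mY tq)) -mulrBr normrM.
  apply: (@le_trans _ _ ((`|a| + 1) * (e / (`|a| + 1)))).
    by rewrite ler_pM// lerDl.
  by rewrite mulrC divfK// gt_eqF// ltr_wpDl.
Qed.

(** On the side of [X] the approximation error is integrated against the uniform second moment bound
    [C]; on the side of [Y] dominated convergence makes it small. *)
Lemma lipschitz_cvg f Mb K : 0 <= K -> l1_lipschitz K f -> (forall x, `|f x| <= Mb) ->
  forall e : R, 0 < e -> evn (fun T n => bmf (fun w => f (X T n w)) /\
  `|Ex P (fun w => f (X T n w)) - Ex Q (fun w => f (Y w))| <= e).
Proof.
move=> K0 fK fM e e0.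
have e3 : 0 < e / 3 by rewrite divr_gt0.
have [p hp [bfY pY]] := trig_dct Q mY K0 fK fM.
pose D := 1 + #|I|%:R * C.
have D0 : 0 < D by rewrite ltr_pwDl// mulr_ge0.
have eD : 0 < e / 3 / D by rewrite divr_gt0.
have [N h1 h2] : exists2 N, `|Ex Q (fun w => f (Y w)) - Ex Q (fun w => p N (Y w))| <= e / 3 &
    N.+1%:R^-1 <= e / 3 / D.
  near \oo => N; exists N; near: N.
    by move/cvgrPdist_le : pY => /(_ _ e3).
  by apply: filterS (near_infty_natSinv_lt (PosNum eD)) => k /ltW.
have [tp hpN] := hp N.
apply: evn_imp (evn_and X2 (trig_cvg tp e3)) => T n T1 [k1 k2].
have mX i : measurable_fun setT (X T n ^~ i) by have [] := bX n i T1.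
have [_ _ [bfX _]] := trig_dct P mX K0 fK fM; split => //.
have bp := trig_bmf mX tp.
have b1 : bmf (fun w => \sum_i X T n w i ^+ 2).
  by apply: bmf_sum => i; apply: bmfX; exact: bX.
have h3 : `|Ex P (fun w => f (X T n w)) - Ex P (fun w => p N (X T n w))| <= e / 3.
  rewrite -(ExB P bfX bp); apply: le_trans (Ex_norm P (bmfB bfX bp)) _.
  apply: (@le_trans _ _ (Ex P (fun w => N.+1%:R^-1 * (1 + \sum_i X T n w i ^+ 2)))).
    apply: Ex_le => //; first by apply: bmf_norm; exact: bmfB.
    by apply: bmfZ; apply: bmfD => //; exact: bmf_cst.
  rewrite (ExZ P _ (bmfD (bmf_cst _ 1) b1)) (ExD P (bmf_cst _ 1) b1) Ex_cst.
  rewrite (Ex_sum P _ (F := fun i w => X T n w i ^+ 2)); last by move=> i; apply: bmfX; exact: bX.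
  apply: (@le_trans _ _ (N.+1%:R^-1 * D)); last by rewrite -ler_pdivlMr.
  rewrite ler_wpM2l ?invr_ge0// lerD2l.
  by apply: (@le_trans _ _ (\sum_(i : I) C)); [exact: ler_sum|rewrite sumr_const mulr_natl].
move: h1 h3 k2; rewrite !ler_norml => /andP[a1 a2] /andP[a3 a4] /andP[a5 a6].
apply/andP; move: (Ex P _) (Ex Q _) (Ex P _) (Ex Q _) a1 a2 a3 a4 a5 a6 => x1 x2 x3 x4; split; lra.
Unshelve. all: by end_near.
Qed.

End eventually.

(** * Brownian increments *)

Section independence.
Context {R : realType} d (Omega : measurableType d) (P : probability Omega R) (I : finType).
Variable X : I -> Omega -> R.
Hypothesis mX : forall a, measurable_fun setT (X a).
Hypothesis indX : mutually_independent P X.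
Local Notation E := (Ex P).
Local Notation bmfR f := (bmf (f : measurableTypeR R -> R)).

Let bmf_comp (f : R -> R) a : bmfR f -> bmf (fun w => f (X a w)).
Proof. by move=> [mf [K fK]]; split; [exact: measurableT_comp|exists K]. Qed.

Let bmf_prod (p : pred I) (phi : I -> R -> R) : (forall a, bmfR (phi a)) ->
  bmf (fun w => \prod_(a | p a) phi a (X a w)).
Proof.
move=> bphi; elim: (index_enum I) => [|a s IH].
  by under eq_fun do rewrite big_nil; exact: bmf_cst.
under eq_fun do rewrite big_cons.
by case: (p a) => //; apply: bmfM => //; exact: bmf_comp.
Qed.

(** For indicators this is the definition of independence. The list [s] holds the indices whose
    function is still arbitrary; the induction releases them one at a time. *)
Lemma independent_prod (phi : I -> R -> R) : (forall a, bmfR (phi a)) ->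
  E (fun w => \prod_a phi a (X a w)) = \prod_a E (fun w => phi a (X a w)).
Proof.
move=> bphi; suff : forall (s : seq I) phi, (forall a, bmfR (phi a)) ->
    (forall a, a \notin s -> exists2 B : set R, measurable B & phi a = \1_B) ->
    E (fun w => \prod_a phi a (X a w)) = \prod_a E (fun w => phi a (X a w)).
  by move=> /(_ (enum I)); apply => // a; rewrite mem_enum.
move=> {phi bphi} s; elim: s => [|i s IH] phi bphi hphi.
  have /choice[B hB] : forall a, exists B : set R, measurable B /\ phi a = \1_B.
    by move=> a; have [B mB e] := hphi a isT; exists B.
  pose A := [set w | forall a, B a (X a w)].
  have AE : A = \bigcap_(a in [set: I]) (X a @^-1` B a).
    by apply/seteqP; split => [w h a _|w h a]; [exact: h|exact: (h a Logic.I)].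
  have mp a : measurable (X a @^-1` B a).
    by rewrite -[X in measurable X]setTI; apply: mX => //; have [] := hB a.
  have mA : measurable A by rewrite AE; apply: fin_bigcap_measurable => //; exact: finite_finset.
  transitivity (E \1_A).
    apply: eq_Ex => w; rewrite indicE; have [Aw|Aw] := pselect (A w).
      rewrite mem_set//= big1// => a _; have [_ ->] := hB a; rewrite indicE mem_set//; exact: Aw.
    rewrite memNset//=; have [a hNa] : exists a, ~ B a (X a w) by apply/existsNP.
    by rewrite (bigD1 a)//=; have [_ ->] := hB a; rewrite indicE memNset// mul0r.
  have eE a : E (fun w => phi a (X a w)) = fine (P (X a @^-1` B a)).
    rewrite -Ex_indic//; apply: eq_Ex => w; have [_ ->] := hB a.
    by rewrite !indicE; congr (_%:R); apply/idP/idP; rewrite !inE.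
  rewrite Ex_indic//; apply: EFin_inj; rewrite fineK ?fin_num_measure// indX; last first.
    by move=> a; have [] := hB a.
  rewrite (big_morph EFin (@EFinM R) erefl); apply: eq_bigr => a _.
  by rewrite eE fineK ?fin_num_measure.
have [si|si] := boolP (i \in s).
  apply: IH => // a sa; apply: hphi; rewrite in_cons negb_or sa andbT.
  by apply: contraNneq sa => ->.
pose U w := \prod_(a | a != i) phi a (X a w).
have bU : bmf U by exact: bmf_prod.
pose V := \prod_(a | a != i) E (fun w => phi a (X a w)).
have step (B : set R) : measurable B -> E (fun w => \1_B (X i w) * U w) = E (fun w => \1_B (X i w) : R) * V.
  move=> mB; pose phiB a := if a == i then \1_B else phi a.
  have hB : (forall a, bmfR (phiB a)).
    by move=> a; rewrite /phiB; case: eqP => // _; exact: bmf_indic.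
  have := IH phiB hB; rewrite (bigD1 i)//= {3}/phiB eqxx.
  rewrite (_ : \prod_(a | a != i) _ = V); last by apply: eq_bigr => a /negPf ai; rewrite /phiB ai.
  move=> <-; last first.
    move=> a sa; rewrite /phiB; case: eqP => [_|/eqP ai]; first by exists B.
    by apply: hphi; rewrite in_cons negb_or ai.
  apply: eq_Ex => w; rewrite [in RHS](bigD1 i)//= /phiB eqxx; congr (_ * _).
  by apply: eq_bigr => a /negPf ai; rewrite ai.
have EU : E U = V.
  have := step setT measurableT.
  rewrite (_ : (fun w => _ * U w) = U); last by apply/funext => w; rewrite indicT mul1r.
  have -> : (fun w => \1_setT (X i w)) = (fun=> 1) :> (Omega -> R) by apply/funext => w; rewrite indicT.
  by rewrite Ex_cst mul1r.
pose D w := U w - V.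
have bD : bmf D by apply: bmfB => //; exact: bmf_cst.
(* [U - V] is orthogonal to every event of the sigma-algebra generated by [X i], hence, by
   [bounded_orth], to [phi i (X i)]. *)
pose G := preimage_set_system setT (X i) measurable.
have GG A : <<s G >> A -> exists2 B : set R, measurable B & A = X i @^-1` B.
  move=> GA; have : G A by apply: (GA G); split => //; exact: sigma_algebra_preimage (sigma_algebra_measurable (measurableTypeR R)).
  by move=> [B mB <-]; exists B => //; rewrite setTI.
have mG A : <<s G >> A -> measurable A.
  by move=> /GG[B mB ->]; rewrite -[X in measurable X]setTI; exact: mX.
have D0 A : <<s G >> A -> E (fun w => \1_A w * D w) = 0.
  move=> /GG[B mB ->]; have b1 : bmf (fun w => \1_B (X i w) : R) by apply: bmf_comp; exact: bmf_indic.
  rewrite (_ : (fun w => _) = fun w => \1_B (X i w) * U w - V * \1_B (X i w)); last first.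
    by apply/funext => w; rewrite /D mulrBr [_ * V]mulrC; congr (_ * _ - _ * _);
       rewrite !indicE; congr (_%:R); apply/idP/idP; rewrite !inE.
  rewrite (ExB P (bmfM b1 bU) (bmfZ V b1)) (step _ mB) (ExZ P V b1) [V * _]mulrC subrr//.
have bG : bmf ((fun w => phi i (X i w)) : g_sigma_algebraType G -> R).
  have [mf [K fK]] := bphi i; split; last by exists K.
  move=> _ B mB; rewrite setTI; apply: sub_sigma_algebra.
  exists (phi i @^-1` B); last by rewrite setTI.
  by rewrite -[X in measurable X]setTI; exact: mf.
have b0 : bmf (fun w => phi i (X i w)) by exact: bmf_comp.
have := bounded_orth mG bD D0 bG.
rewrite (_ : (fun w => _) = fun w => phi i (X i w) * U w - V * phi i (X i w)); last first.
  by apply/funext => w; rewrite /D mulrBr [_ * V]mulrC.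
rewrite (ExB P (bmfM b0 bU) (bmfZ V b0)) (ExZ P V b0) => /eqP; rewrite subr_eq0 => /eqP h.
rewrite [RHS](bigD1 i)//= -/V [RHS]mulrC -h; apply: eq_Ex => w.
by rewrite (bigD1 i).
Qed.

(** Addition formulas expand the cosine of the sum; every term containing a sine of one variable has
    expectation zero. *)
Lemma independent_cos (th : I -> R) c : (forall a, E (fun w => sin (th a * X a w)) = 0) ->
  E (fun w => cos (\sum_a th a * X a w + c)) = cos c * \prod_a E (fun w => cos (th a * X a w)).
Proof.
move=> sin0.
have bc a : bmfR (fun x => cos (th a * x)) by apply: bmf_cos; exact: measurable_funM.
have bs a : bmfR (fun x => sin (th a * x)) by apply: bmf_sin; exact: measurable_funM.
(* The list [s] holds the variables still inside the cosine, [phi] the factors already extracted.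
   The sine of the remaining sum is written as a cosine with phase [c - pi / 2], to stay within the
   induction hypothesis. *)
have main : forall (s : seq I), uniq s -> forall phi, (forall a, bmfR (phi a)) ->
    (forall a, a \in s -> phi a = fun=> 1) -> forall c,
    E (fun w => cos (\sum_(a <- s) th a * X a w + c) * \prod_a phi a (X a w)) =
    cos c * (\prod_(a <- s) E (fun w => cos (th a * X a w)) * \prod_a E (fun w => phi a (X a w))).
  elim=> [|i s IH] /= us phi bphi hphi {}c.
    rewrite big_nil mul1r -independent_prod// -(ExZ P); last exact: bmf_prod.
    by apply: eq_Ex => w; rewrite big_nil add0r.
  have /andP[si {}us] := us.
  pose ph f a : R -> R := if a == i then f else phi a.
  have bph f : bmfR f -> forall a, bmfR (ph f a).
    by move=> bf a; rewrite /ph; case: eqP.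
  have hph f a : a \in s -> ph f a = fun=> 1.
    move=> sa; rewrite /ph; case: eqP => [ai|_]; first by rewrite -ai sa in si.
    by apply: hphi; rewrite in_cons sa orbT.
  have prodE f w : \prod_a ph f a (X a w) = f (X i w) * \prod_a phi a (X a w).
    rewrite [LHS](bigD1 i)//= [in RHS](bigD1 i)//= hphi ?mem_head// mul1r /ph eqxx; congr (_ * _).
    by apply: eq_bigr => a /negPf ->.
  have prodEE f : \prod_a E (fun w => ph f a (X a w)) = E (fun w => f (X i w)) * \prod_a E (fun w => phi a (X a w)).
    rewrite [LHS](bigD1 i)//= [in RHS](bigD1 i)//= hphi ?mem_head// Ex_cst mul1r /ph eqxx; congr (_ * _).
    by apply: eq_bigr => a /negPf ->.
  have h1 := IH us _ (bph _ (bc i)) (hph _) c.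
  have h2 := IH us _ (bph _ (bs i)) (hph _) (c - pi / 2).
  rewrite !prodEE sin0 mul0r !mulr0 in h1 h2.
  rewrite big_cons mulrAC mulrA -!mulrA [E _ * _]mulrC in h1 *.
  have b1 : bmf (fun w => cos (\sum_(a <- s) th a * X a w + c) * \prod_a ph (fun x => cos (th i * x)) a (X a w)).
    apply: bmfM; last by apply: bmf_prod; exact: bph.
    apply: bmf_cos; apply: measurable_funD => //; apply: measurable_sum => a; exact: measurable_funM.
  have b2 : bmf (fun w => cos (\sum_(a <- s) th a * X a w + (c - pi / 2)) * \prod_a ph (fun x => sin (th i * x)) a (X a w)).
    apply: bmfM; last by apply: bmf_prod; exact: bph.
    apply: bmf_cos; apply: measurable_funD => //; apply: measurable_sum => a; exact: measurable_funM.
  transitivity (E (fun w => cos (\sum_(a <- s) th a * X a w + c) * \prod_a ph (fun x => cos (th i * x)) a (X a w)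
     - cos (\sum_(a <- s) th a * X a w + (c - pi / 2)) * \prod_a ph (fun x => sin (th i * x)) a (X a w))).
    apply: eq_Ex => w; rewrite !prodE big_cons !mulrA -mulrBl -addrA; congr (_ * _).
    by rewrite [_ + (c - _)]addrA; move: (_ + c) => u; rewrite cosBpihalf cosD; ring.
  by rewrite (ExB P b1 b2) h2 subr0 h1; ring.
have := main (index_enum I) (index_enum_uniq I) (fun _ _ => 1) (fun _ => bmf_cst _ 1) (fun _ _ => erefl) c.
rewrite (_ : \prod_a E (fun=> 1) = 1) ?mulr1; last by rewrite big1// => a _; rewrite Ex_cst.
by move=> <-; apply: eq_Ex => w; rewrite [X in _ = _ * X]big1 ?mulr1.
Qed.

End independence.

(** * Cosine transform of a centred normal law *)

Section normal.
Context {R : realType}.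
Notation leb := (@lebesgue_measure R).
Local Notation bmfR f := (bmf (f : measurableTypeR R -> R)).
Local Notation N s := (normal_prob (0 : R) s).

(** The Radon-Nikodym derivative of the normal law has the same integrals over measurable sets as
    the normal density, so they agree almost everywhere. *)
Lemma normal_expectation s (f : R -> R) : bmfR f ->
  Ex (N s) f = \int[leb]_x (f x * normal_pdf 0 s x).
Proof.
move=> bf; rewrite /Ex /Rintegral; congr fine.
have numu := normal_prob_dominates (0 : R) s.
have int_f : (N s).-integrable setT (EFin \o f) := bmf_integrable (N s) bf.
have := Radon_Nikodym_change_of_variables numu measurableT int_f => <-.
apply: ae_eq_integral => //.
- apply: emeasurable_funM; last by apply: measurable_int; exact: Radon_Nikodym_integrable.
  exact: measurable_int int_f.
- apply/measurable_EFinP; apply: measurable_funM; last exact: measurable_normal_pdf.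
  by have [] := bf.
- have : ae_eq leb setT (Radon_Nikodym (charge_of_finite_measure (N s)) leb) (EFin \o normal_pdf 0 s).
    apply: integral_ae_eq => //.
    + exact: Radon_Nikodym_integrable.
    + by apply/measurable_EFinP; exact: measurable_normal_pdf.
    + by move=> A _ mA; rewrite -Radon_Nikodym_integral.
  by apply: filterS => x h xT; rewrite h.
Qed.

Lemma lebesgue_measure_opp (A : set R) : measurable A -> leb (-%R @^-1` A) = leb A.
Proof.
move=> mA.
have mo : measurable_fun setT (fun x : measurableTypeR R => - (x : R) : measurableTypeR R).
  exact: oppr_measurable.
pose o_mixin := isMeasurableFun.Build _ _ _ _ _ mo.
pose o_mfun : {mfun _ >-> _} := HB.pack (fun x : measurableTypeR R => - (x : R) : measurableTypeR R) o_mixin.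
suff : leb A = pushforward leb o_mfun A by [].
apply: lebesgue_measure_unique => // X [[a b] _ <-].
rewrite /pushforward /=.
transitivity (leb [set` `[- b, - a[]); last first.
  by congr (leb _); apply/seteqP; split => x /=; rewrite !in_itv /= => /andP[h1 h2]; apply/andP; split; lra.
rewrite !lebesgue_measure_itv /= !lte_fin ltrN2; case: ifPn => // _.
by rewrite -!EFinB; congr (_%:E); ring.
Qed.

Lemma normal_pdf_opp s x : s != 0 -> normal_pdf 0 s (- x) = normal_pdf 0 s x :> R.
Proof. by move=> s0; rewrite !normal_pdfE// /normal_fun !subr0 sqrrN. Qed.

(** Reflection symmetry of the density. Adding 1 makes the integrand nonnegative, the setting in
    which the change of variables is applied. *)
Lemma normal_sin s th : s != 0 -> Ex (N s) (fun x => sin (th * x)) = 0.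
Proof.
move=> s0.
have bs : bmfR (fun x => sin (th * x)) by apply: bmf_sin; exact: measurable_funM.
have b1 : bmfR (fun x => 1 + sin (th * x)) by apply: bmfD => //; exact: bmf_cst.
have b2 : bmfR (fun x => 1 - sin (th * x)) by apply: bmfB => //; exact: bmf_cst.
suff : Ex (N s) (fun x => 1 + sin (th * x)) = Ex (N s) (fun x => 1 - sin (th * x)).
  rewrite (ExD (N s) (bmf_cst _ 1) bs) (ExB (N s) (bmf_cst _ 1) bs) !Ex_cst; lra.
rewrite !normal_expectation// /Rintegral; congr fine.
have mo : measurable_fun setT (fun x : measurableTypeR R => - (x : R) : measurableTypeR R).
  exact: oppr_measurable.
pose f x := ((1 + sin (th * x)) * normal_pdf 0 s x)%:E.
have mf : measurable_fun setT (f : measurableTypeR R -> \bar R).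
  apply/measurable_EFinP; apply: measurable_funM; last exact: measurable_normal_pdf.
  by have [] := b1.
have f0 x : (0 <= f x)%E.
  rewrite lee_fin; apply: mulr_ge0; last exact: normal_pdf_ge0.
  by have := sin_geN1 (th * x); lra.
have := @ge0_integral_pushforward _ _ _ _ R _ mo leb setT f measurableT mf.
move=> /(_ (fun y _ => f0 y)); rewrite preimage_setT => h.
have hr : (\int[leb]_x ((1 - sin (th * x)) * normal_pdf 0 s x)%:E = \int[leb]_x (f \o -%R) x)%E.
  by apply: eq_integral => x _; rewrite /f /= normal_pdf_opp// mulrN sinN.
rewrite [RHS]hr -h; apply: eq_measure_integral => A mA _.
by rewrite /pushforward -[LHS]lebesgue_measure_opp.
Qed.

(* The Gaussian moments are not needed: the integrand is, up to a constant, a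
   normal density, and [cos_exp_sqr] compares [cos] with such exponentials. *)
Lemma normal_exp_sqr s (dl : R) : 0 < s -> 0 <= dl ->
  Ex (N s) (fun x => expR (- (dl * x ^+ 2 / 2))) = (Num.sqrt (1 + dl * s ^+ 2))^-1.
Proof.
move=> s0 dl0; set r := Num.sqrt _.
have r2 : 0 < 1 + dl * s ^+ 2 by rewrite ltr_pwDl// mulr_ge0// sqr_ge0.
have r0 : 0 < r by rewrite sqrtr_gt0.
have rE : r ^+ 2 = 1 + dl * s ^+ 2 by rewrite sqr_sqrtr// ltW.
pose s' := s / r; have s'0 : 0 < s' by rewrite divr_gt0.
have mq : measurable_fun setT (fun x : measurableTypeR R => - (dl * (x : R) ^+ 2 / 2)).
  by apply: measurableT_comp => //; apply: measurable_funM => //; exact: measurable_funM.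
have be : bmfR (fun x => expR (- (dl * x ^+ 2 / 2))).
  split; first exact: measurableT_comp.
  exists 1 => x; rewrite ger0_norm ?expR_ge0// -expR0 ler_expR oppr_le0.
  by rewrite divr_ge0// mulr_ge0// sqr_ge0.
rewrite normal_expectation//.
have e1 x : expR (- (dl * x ^+ 2 / 2)) * normal_pdf 0 s x = r^-1 * normal_pdf 0 s' x.
  rewrite !normal_pdfE ?gt_eqF// /normal_fun !subr0.
  rewrite [LHS]mulrCA -expRD [RHS]mulrA; congr (_ * expR _).
    rewrite /normal_peak -invfM; congr (_^-1).
    rewrite -{1}(ger0_norm (ltW r0)) -sqrtr_sqr -sqrtrM ?sqr_ge0//; congr Num.sqrt.
    by rewrite /s' -!mulrnAr expr_div_n; field; rewrite gt_eqF.
  rewrite /s' expr_div_n rE -[_ / _ *+ 2]mulr_natr -[s ^+ 2 *+ 2]mulr_natr.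
  by field; rewrite !gt_eqF.
transitivity (\int[leb]_x (r^-1 * normal_pdf 0 s' x)).
  by rewrite /Rintegral; congr fine; apply: eq_integral => x _; rewrite e1.
rewrite RintegralZl//; last exact: integrable_normal_pdf.
by rewrite /Rintegral integral_normal_pdf /= mulr1.
Qed.

(** For [u = x^2 <= 1] both sides are of order [u^2], as [1 - expR (- (u / 2)) >= u / 4]; for
    [u > 1] the right-hand side is at least 32 / 9, more than any possible difference. *)
Lemma cos_exp_sqr (x : R) : `|cos x - expR (- (x ^+ 2 / 2))| <= 32 * (1 - expR (- (x ^+ 2 / 2))) ^+ 2.
Proof.
have x2 : 0 <= x ^+ 2 / 2 by rewrite divr_ge0// sqr_ge0.
have h1 := cos_taylor x; have h2 := expRN_taylor x2.
rewrite (exprM x 2 2) in h1; move: h1 h2 x2; set u := x ^+ 2 => h1 h2 x2.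
have hc := cos_le1 x; have hc' := cos_geN1 x.
have e1 := expRN_le1 x2; have e0 := expR_gt0 (- (u / 2)).
have [u1|u1] := leP u 1.
  move: h1 h2; rewrite !ler_norml => /andP[a1 a2] /andP[a3 a4].
  have h : u / 4 <= 1 - expR (- (u / 2)) by nra.
  have : (u / 4) ^+ 2 <= (1 - expR (- (u / 2))) ^+ 2.
    by rewrite ler_sqr ?nnegrE; lra.
  move: a1 a2 a3 a4 h => a1 a2 a3 a4 h hs; apply/andP; split; lra.
have : 1 + u / 2 <= expR (u / 2) := expR_ge1Dx (u / 2).
have : expR (- (u / 2)) * expR (u / 2) = 1 by rewrite -expRD addNr expR0.
move: (expR (- (u / 2))) (expR (u / 2)) e1 e0 => a b a1 a0 ab b1.
have a2 : a <= 2 / 3 by nra.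
have : 1 / 9 <= (1 - a) ^+ 2 by nra.
move=> h; rewrite ler_norml; apply/andP; split; lra.
Qed.

Lemma sqrt1D_bounds (v : R) : 0 <= v -> 1 - v / 2 <= (Num.sqrt (1 + v))^-1 <= 1 - v / 2 + v ^+ 2.
Proof.
move=> v0; have v1 : 0 < 1 + v by rewrite ltr_pwDl.
set r := Num.sqrt _; have r0 : 0 < r by rewrite sqrtr_gt0.
have rE : r ^+ 2 = 1 + v by rewrite sqr_sqrtr// ltW.
have ri : r * r^-1 = 1 by rewrite mulfV// gt_eqF.
have i0 : 0 < r^-1 by rewrite invr_gt0.
apply/andP; split.
  have hr : r <= 1 + v / 2 by have := sqr_ge0 (r - 1); nra.
  have [v2|v2] := leP (1 - v / 2) 0; first exact: le_trans (ltW i0).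
  rewrite -(ler_pM2l r0) ri; nra.
rewrite -(ler_pM2l r0) ri.
have p0 : 0 < 1 - v / 2 + v ^+ 2 by have := sqr_ge0 (v - 1 / 4); nra.
rewrite -ler_sqr ?nnegrE//; last by apply: mulr_ge0; exact: ltW.
rewrite expr1n exprMn rE.
have : (1 + v) * (1 - v / 2 + v ^+ 2) ^+ 2 = 1 + 5 / 4 * v ^+ 2 + 5 / 4 * v ^+ 3 + v ^+ 5 by field.
move=> ->; have := exprn_ge0 2 v0; have := exprn_ge0 3 v0; have := exprn_ge0 5 v0; lra.
Qed.

(** The square in [cos_exp_sqr] expands into exponentials whose means are explicit; their second
    differences give [128 v^2] and the Taylor errors at most [2 v^2]. This precision is enough
    because increments will be subdivided. *)
Lemma normal_cos s th : 0 < s ->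
  `|Ex (N s) (fun x => cos (th * x)) - expR (- ((th * s) ^+ 2 / 2))| <= 130 * ((th * s) ^+ 2) ^+ 2.
Proof.
move=> s0; set v := (th * s) ^+ 2; have v0 : 0 <= v by exact: sqr_ge0.
have th2 : 0 <= th ^+ 2 := sqr_ge0 th.
have bc : bmfR (fun x => cos (th * x)) by apply: bmf_cos; exact: measurable_funM.
pose e dl (x : R) := expR (- (dl * x ^+ 2 / 2)).
have be dl : 0 <= dl -> bmfR (e dl).
  move=> dl0; split.
    apply: measurableT_comp => //; apply: measurableT_comp => //.
    by apply: measurable_funM => //; exact: measurable_funM.
  exists 1 => x; rewrite ger0_norm ?expR_ge0//; apply: expRN_le1.
  by rewrite divr_ge0// mulr_ge0// sqr_ge0.
have th22 : 0 <= 2 * th ^+ 2 by rewrite mulr_ge0.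
have b1 := be _ th2; have b2 := be _ th22.
have vE : v = th ^+ 2 * s ^+ 2 by rewrite /v exprMn.
have h1 : `|Ex (N s) (fun x => cos (th * x)) - Ex (N s) (e (th ^+ 2))| <=
    32 * (1 - 2 * (Num.sqrt (1 + v))^-1 + (Num.sqrt (1 + 2 * v))^-1).
  rewrite -(ExB (N s) bc b1); apply: le_trans (Ex_norm (N s) (bmfB bc b1)) _.
  have b3 := bmfZ 2 b1; have b4 := bmfD (bmfB (bmf_cst (measurableTypeR R) 1) b3) b2.
  have -> : 32 * (1 - 2 * (Num.sqrt (1 + v))^-1 + (Num.sqrt (1 + 2 * v))^-1) =
    Ex (N s) (fun x => 32 * (1 - 2 * e (th ^+ 2) x + e (2 * th ^+ 2) x)).
    rewrite (ExZ (N s) 32 b4) (ExD (N s) (bmfB (bmf_cst (measurableTypeR R) 1) b3) b2).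
    rewrite (ExB (N s) (bmf_cst (measurableTypeR R) 1) b3) (ExZ (N s) 2 b1) Ex_cst.
    by rewrite !normal_exp_sqr// vE mulrA.
  apply: Ex_le; [exact: (bmf_norm (bmfB bc b1))|exact: (bmfZ 32 b4)|].
  move=> x; apply: le_trans (_ : _ <= 32 * (1 - e (th ^+ 2) x) ^+ 2) _.
    by have := cos_exp_sqr (th * x); rewrite /e exprMn.
  rewrite le_eqVlt; apply/orP; left; apply/eqP.
  have -> : e (2 * th ^+ 2) x = e (th ^+ 2) x ^+ 2.
    by rewrite /e [RHS]expr2 -expRD; congr expR; field.
  by ring.
have h2 : Ex (N s) (e (th ^+ 2)) = (Num.sqrt (1 + v))^-1 by rewrite normal_exp_sqr// vE.
rewrite h2 in h1; have v2 : 0 <= v / 2 by rewrite divr_ge0.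
have := expRN_taylor v2; have v3 : 0 <= 2 * v by rewrite mulr_ge0.
have /andP[c1 c2] := sqrt1D_bounds v0; have /andP[c3 c4] := sqrt1D_bounds v3.
move: h1 c1 c2 c3 c4; move: (Ex _ _) (Num.sqrt _)^-1 (Num.sqrt _)^-1 (expR _) => x a b y.
rewrite !ler_norml => /andP[a1 a2] a3 a4 a5 a6 /andP[a7 a8].
apply/andP; split; lra.
Qed.

End normal.

Lemma prod_dist_le {R : realType} (I : Type) (s : seq I) (x y : I -> R) :
  (forall a, `|x a| <= 1) -> (forall a, `|y a| <= 1) ->
  `|\prod_(a <- s) x a - \prod_(a <- s) y a| <= \sum_(a <- s) `|x a - y a|.
Proof.
move=> x1 y1; elim: s => [|a s IH]; first by rewrite !big_nil subrr normr0.
rewrite !big_cons; set u := \prod_(_ <- _) _; set v := \prod_(_ <- _) _.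
have v1 : `|v| <= 1.
  rewrite /v normr_prod; elim: s {IH u v} => [|b s IH]; first by rewrite big_nil.
  by rewrite big_cons mulr_ile1// ?prodr_ge0.
rewrite (_ : x a * u - y a * v = x a * (u - v) + (x a - y a) * v); last by ring.
rewrite (le_trans (ler_normD _ _))// addrC lerD// normrM.
  by rewrite ler_piMr.
by rewrite (le_trans _ IH)// ler_piMl.
Qed.

Lemma sum_row {R : realType} n L (i : 'I_n) (f : 'I_L -> R) :
  \sum_(a : 'I_n * 'I_L) (if a.1 == i then f a.2 else 0) = \sum_k f k.
Proof.
rewrite -(pair_bigA _ (fun j k => if j == i then f k else 0)) /= (bigD1 i)//=.
rewrite [X in _ + X]big1 ?addr0; last by move=> j /negPf ji; rewrite big1// => k _; rewrite ji.
by apply: eq_bigr => k _; rewrite eqxx.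
Qed.

(** * Joint cosine transform of Brownian increments *)

Section brownian.
Context {R : realType} d (Omega : measurableType d) (Q : probability Omega R) (n : nat).
Variable W : 'I_n -> R -> Omega -> R.
Hypothesis W_bm : brownian_motion Q W.
Local Notation E := (Ex Q).
Local Notation bmfR f := (bmf (f : measurableTypeR R -> R)).

Lemma measurable_increment i (s t : R) : 0 <= s -> s <= t -> t <= 1 ->
  measurable_fun setT (fun w => W i t w - W i s w).
Proof.
move=> s0 st t1; apply: measurable_funB; apply: (bm_measurable W_bm).
  by rewrite t1 (le_trans s0).
by rewrite s0 (le_trans st).
Qed.

Lemma bm_expectation i (s t : R) (f : R -> R) : 0 <= s -> s < t -> t <= 1 -> bmfR f ->
  E (fun w => f (W i t w - W i s w)) = Ex (normal_prob (0 : R) (Num.sqrt (t - s))) f.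
Proof.
move=> s0 st t1 bf; have mi := measurable_increment i s0 (ltW st) t1.
rewrite /Ex /Rintegral; congr fine.
have int1 : Q.-integrable setT (EFin \o (fun w => f (W i t w - W i s w))).
  apply: bmf_integrable; have [mf [K fK]] := bf; split; last by exists K.
  exact: (measurableT_comp mf mi).
have mf : measurable_fun setT (EFin \o f : measurableTypeR R -> \bar R).
  by apply/measurable_EFinP; have [] := bf.
have := @integral_pushforward _ _ _ (measurableTypeR R) R _ mi Q setT (EFin \o f) mf.
rewrite preimage_setT => /(_ int1 measurableT) <-.
by apply: eq_measure_integral => A mA _; exact: (bm_gaussian W_bm).
Qed.

Lemma bm_sin i (s t th : R) : 0 <= s -> s < t -> t <= 1 ->
  E (fun w => sin (th * (W i t w - W i s w))) = 0.
Proof.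
move=> s0 st t1; rewrite (@bm_expectation i s t (fun x => sin (th * x)))//.
  by apply: normal_sin; rewrite gt_eqF// sqrtr_gt0 subr_gt0.
by apply: bmf_sin; exact: measurable_funM.
Qed.

Lemma bm_cos_approx i (s t th : R) : 0 <= s -> s < t -> t <= 1 ->
  `|E (fun w => cos (th * (W i t w - W i s w))) - expR (- (th ^+ 2 * (t - s) / 2))| <=
  130 * (th ^+ 2 * (t - s)) ^+ 2.
Proof.
move=> s0 st t1; rewrite (@bm_expectation i s t (fun x => cos (th * x)))//.
  have ts : 0 < t - s by rewrite subr_gt0.
  have := @normal_cos R (Num.sqrt (t - s)) th.
  by rewrite exprMn sqr_sqrtr ?(ltW ts)// sqrtr_gt0 => /(_ ts).
by apply: bmf_cos; exact: measurable_funM.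
Qed.

Lemma bm_independent_grid L (s t : R) : (0 < L)%N -> 0 <= s -> s <= t -> t <= 1 ->
  mutually_independent Q (fun (a : 'I_n * 'I_L) w =>
    W a.1 (s + (t - s) * (a.2.+1%:R / L%:R)) w - W a.1 (s + (t - s) * (a.2%:R / L%:R)) w).
Proof.
move=> L0 s0 st t1; have LR : 0 < L%:R :> R by rewrite ltr0n.
have ts : 0 <= t - s by rewrite subr_ge0.
(* Independence of increments is assumed for monotone sequences of times that stay in [[0, 1]] at
   every index, hence the clamping at [L]. *)
pose p k := s + (t - s) * ((minn k L)%:R / L%:R).
have pE k : (k <= L)%N -> s + (t - s) * (k%:R / L%:R) = p k by rewrite /p => /minn_idPl ->.
rewrite (_ : (fun a w => _) = fun (a : 'I_n * 'I_L) w => W a.1 (p a.2.+1) w - W a.1 (p a.2) w); last first.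
  by apply/funext => a; apply/funext => w; rewrite !pE// ltnW.
apply: (bm_independent W_bm).
- move=> j k jk; rewrite /p lerD2l ler_wpM2l// ler_pM2r ?invr_gt0// ler_nat.
  by rewrite leq_min geq_minr andbT (leq_trans (geq_minl _ _)).
- move=> k; apply/andP; split; first by rewrite addr_ge0// mulr_ge0// divr_ge0.
  rewrite (le_trans _ t1)// -lerBrDl ler_piMr// ler_pdivrMr// mul1r ler_nat.
  exact: geq_minr.
Qed.

Let gridP L (s t : R) k : (k < L)%N -> 0 <= s -> s < t -> t <= 1 ->
  [/\ 0 <= s + (t - s) * (k%:R / L%:R), s + (t - s) * (k%:R / L%:R) < s + (t - s) * (k.+1%:R / L%:R) &
   s + (t - s) * (k.+1%:R / L%:R) <= 1].
Proof.
move=> kL s0 st t1; have LR : 0 < L%:R :> R by rewrite ltr0n (leq_ltn_trans _ kL).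
have ts : 0 < t - s by rewrite subr_gt0.
split.
- by rewrite addr_ge0// mulr_ge0 ?(ltW ts)// divr_ge0.
- by rewrite ltrD2l ltr_pM2l// ltr_pM2r ?invr_gt0// ltr_nat.
- by rewrite (le_trans _ t1)// -lerBrDl ler_piMr ?(ltW ts)// ler_pdivrMr// mul1r ler_nat.
Qed.

(* Splitting the increment into [L] independent ones divides the error of
   [bm_cos_approx] by [L]. *)
Lemma bm_char i (s t th : R) : 0 <= s -> s < t -> t <= 1 ->
  E (fun w => cos (th * (W i t w - W i s w))) = expR (- (th ^+ 2 * (t - s) / 2)).
Proof.
move=> s0 st t1; have ts : 0 < t - s by rewrite subr_gt0.
set v := th ^+ 2 * (t - s).
have v0 : 0 <= v by rewrite mulr_ge0 ?sqr_ge0// ltW.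
have key L : (0 < L)%N -> `|E (fun w => cos (th * (W i t w - W i s w))) - expR (- (v / 2))| <=
    130 * v ^+ 2 / L%:R.
  move=> L0; have LR : 0 < L%:R :> R by rewrite ltr0n.
  pose p (k : nat) := s + (t - s) * (k%:R / L%:R).
  pose X (a : 'I_n * 'I_L) w := W a.1 (p a.2.+1) w - W a.1 (p a.2) w.
  have gp (a : 'I_n * 'I_L) : [/\ 0 <= p a.2, p a.2 < p a.2.+1 & p a.2.+1 <= 1] by exact: gridP.
  have pd k : p k.+1 - p k = (t - s) / L%:R.
    by rewrite /p -[k.+1%:R]natr1; field; rewrite gt_eqF.
  (* Independence is stated jointly for all components, so a single component is selected by zero
     weights on the others. *)
  pose tha (a : 'I_n * 'I_L) := if a.1 == i then th else 0.
  have mX a : measurable_fun setT (X a).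
    by have [h1 h2 h3] := gp a; apply: measurable_increment => //; exact: ltW.
  have sin0 a : E (fun w => sin (tha a * X a w)) = 0.
    by have [h1 h2 h3] := gp a; exact: bm_sin.
  have := independent_cos mX (bm_independent_grid L0 s0 (ltW st) t1) 0 sin0.
  rewrite cos0 mul1r.
  have -> : (fun w => cos (\sum_a tha a * X a w + 0)) = fun w => cos (th * (W i t w - W i s w)).
    apply/funext => w; rewrite addr0; congr cos.
    rewrite (eq_bigr (fun a : 'I_n * 'I_L => if a.1 == i then th * (W i (p a.2.+1) w - W i (p a.2) w) else 0)); last first.
      by move=> [j k] _; rewrite /tha /X /=; case: eqP => [->|_]; rewrite ?mul0r.
    rewrite (sum_row i (fun k : 'I_L => th * (W i (p k.+1) w - W i (p k) w))) -mulr_sumr.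
    rewrite -(big_mkord xpredT (fun k => W i (p k.+1) w - W i (p k) w)) telescope_sumr//.
    by rewrite /p mul0r mulr0 addr0 divff ?gt_eqF// mulr1 subrKC.
  move=> ->.
  pose y (a : 'I_n * 'I_L) := expR (- (tha a ^+ 2 * (p a.2.+1 - p a.2) / 2)).
  have -> : expR (- (v / 2)) = \prod_a y a.
    rewrite /y -expR_sum; congr expR.
    rewrite (eq_bigr (fun a : 'I_n * 'I_L => if a.1 == i then - (v / L%:R / 2) else 0)); last first.
      move=> a _; rewrite pd /tha; case: ifP => _; last by rewrite expr0n/= !mul0r oppr0.
      by rewrite /v mulrA.
    rewrite (sum_row i (fun _ : 'I_L => - (v / L%:R / 2))) sumr_const card_ord -mulr_natl.
    by field; rewrite gt_eqF.
  have y1 a : `|y a| <= 1.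
    rewrite ger0_norm ?expR_ge0//; apply: expRN_le1.
    have [_ /ltW h _] := gp a; rewrite divr_ge0// mulr_ge0 ?sqr_ge0// subr_ge0//.
  have c1 a : `|E (fun w => cos (tha a * X a w))| <= 1.
    have bc : bmf (fun w => cos (tha a * X a w)) by apply: bmf_cos; exact: measurable_funM.
    apply: le_trans (Ex_norm Q bc) _; rewrite -(Ex_cst Q 1); apply: Ex_le; first exact: bmf_norm.
      exact: bmf_cst.
    by move=> w; rewrite ler_norml cos_geN1 cos_le1.
  apply: le_trans (prod_dist_le _ c1 y1) _.
  apply: (@le_trans _ _ (\sum_a (if a.1 == i then 130 * (v / L%:R) ^+ 2 else 0))).
    apply: ler_sum => a _; have [h1 h2 h3] := gp a.
    apply: le_trans (bm_cos_approx a.1 (tha a) h1 h2 h3) _; rewrite pd /tha.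
    case: ifP => _; first by rewrite /v mulrA.
    by rewrite expr0n/= mul0r expr0n/= mulr0.
  rewrite (sum_row i (fun _ : 'I_L => 130 * (v / L%:R) ^+ 2)) sumr_const card_ord -[leLHS]mulr_natl.
  rewrite le_eqVlt; apply/orP; left; apply/eqP; field; rewrite gt_eqF//.
apply/eqP; rewrite -subr_eq0 -normr_le0 leNgt; apply/negP => h0.
set D := `|_ - _| in h0 key.
have B0 : 0 <= 130 * v ^+ 2 by rewrite mulr_ge0 ?sqr_ge0// ler0n.
move: (130 * v ^+ 2) B0 key => B B0 key.
have := key (Num.truncn (B / D)).+1 isT; rewrite ler_pdivlMr ?ltr0n// leNgt => /negP; apply.
by rewrite mulrC -ltr_pdivrMr// truncnS_gt.
Qed.

Lemma bm_cos (m : nat) (th : 'I_n * 'I_m -> R) c : (0 < m)%N ->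
  E (fun w => cos (\sum_a th a * (W a.1 (a.2.+1%:R / m%:R) w - W a.1 (a.2%:R / m%:R) w) + c)) =
  cos c * expR (- \sum_a (th a ^+ 2 / m%:R / 2)).
Proof.
move=> m0; have mR : 0 < m%:R :> R by rewrite ltr0n.
have gE (k : nat) : 0 + (1 - 0) * (k%:R / m%:R) = k%:R / m%:R :> R by rewrite add0r subr0 mul1r.
pose X (a : 'I_n * 'I_m) w := W a.1 (a.2.+1%:R / m%:R) w - W a.1 (a.2%:R / m%:R) w.
have gp (a : 'I_n * 'I_m) : [/\ 0 <= a.2%:R / m%:R :> R, a.2%:R / m%:R < a.2.+1%:R / m%:R :> R & a.2.+1%:R / m%:R <= 1 :> R].
  by have := @gridP m 0 1 a.2 (ltn_ord _) (lexx _) ltr01 (lexx _); rewrite !gE.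
have mX a : measurable_fun setT (X a).
  by have [h1 h2 h3] := gp a; apply: measurable_increment => //; exact: ltW.
have ind : mutually_independent Q X.
  have := bm_independent_grid m0 (lexx 0) ler01 (lexx 1); congr mutually_independent.
  by apply/funext => a; apply/funext => w; rewrite !gE.
have sin0 a : E (fun w => sin (th a * X a w)) = 0.
  by have [h1 h2 h3] := gp a; exact: bm_sin.
rewrite (independent_cos mX ind c sin0); congr (_ * _); rewrite -sumrN expR_sum.
apply: eq_bigr => a _; have [h1 h2 h3] := gp a; rewrite bm_char//; congr expR.
rewrite -mulrBl -natrB// subSnn mul1r//.
Qed.

End brownian.

(** * Functionals of cadlag paths *)

Section unmeasured_integral.
Context {R : realType} d (T : measurableType d) (mu : {measure set T -> \bar R}).
Local Open Scope ereal_scope.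

(* No measurability is needed: an integral is by definition a difference of two
   suprema over simple functions. *)
Lemma integral_mono (f g : T -> \bar R) : (forall x, f x <= g x) ->
  \int[mu]_x f x <= \int[mu]_x g x.
Proof.
move=> fg; rewrite /integral !patch_setT; apply: leeB; apply: le_ereal_sup => _ /= [h hf <-]; exists h => // x.
  by apply: le_trans (hf x) _; apply: (@funepos_le _ _ setT); rewrite ?inE.
by apply: le_trans (hf x) _; apply: (@funeneg_le _ _ setT); rewrite ?inE.
Qed.

End unmeasured_integral.

(** * Lipschitz regularisation of functionals on path space *)

Section inf_convolution.
Context {R : realType} {V : normedModType R}.
Implicit Types (x y z : cadlag_path V) (F : cadlag_path V -> R) (k c e : R).

Definition path_close x y c := forall t : R, 0 <= t <= 1 -> `|x t - y t| <= c.

(* The Lipschitz regularisation of [F] for the uniform norm; it increases to [F]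
   as [k] grows because the uniform norm dominates the J1 distance. *)
Definition inf_conv F k x : R := inf [set r | exists z c, [/\ 0 <= c, path_close x z c & r = F z + k * c]].

Variables (F : cadlag_path V -> R) (Mb : R).
Hypothesis FM : forall x, `|F x| <= Mb.

Let lb k x : 0 <= k -> lbound [set r | exists z c, [/\ 0 <= c, path_close x z c & r = F z + k * c]] (- Mb).
Proof.
move=> k0 _ [z [c [c0 _ ->]]]; have := FM z; rewrite ler_norml => /andP[h _].
by rewrite (le_trans h)// lerDl mulr_ge0.
Qed.

Let ne k x : [set r | exists z c, [/\ 0 <= c, path_close x z c & r = F z + k * c]] (F x).
Proof. by exists x, 0; split => //; [move=> t _; rewrite subrr normr0|rewrite mulr0 addr0]. Qed.

Lemma inf_conv_le k x z c : 0 <= k -> 0 <= c -> path_close x z c -> inf_conv F k x <= F z + k * c.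
Proof.
move=> k0 c0 xz; apply: ge_inf; first by exists (- Mb); exact: lb.
by exists z, c.
Qed.

Lemma inf_conv_ge k x b : (forall z c, 0 <= c -> path_close x z c -> b <= F z + k * c) -> b <= inf_conv F k x.
Proof.
move=> h; apply: lb_le_inf; first by exists (F x); exact: ne.
by move=> _ [z [c [c0 xz ->]]]; exact: h.
Qed.

Lemma inf_conv_bound k x : 0 <= k -> `|inf_conv F k x| <= Mb.
Proof.
move=> k0; rewrite ler_norml; apply/andP; split.
  by apply: inf_conv_ge => z c c0 xz; apply: (@lb k x k0); exists z, c.
have h : path_close x x 0 by move=> t _; rewrite subrr normr0.
have := inf_conv_le k0 (lexx 0) h; rewrite mulr0 addr0 => /le_trans; apply.
exact: le_trans (ler_norm _) (FM x).
Qed.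

Lemma inf_conv_lip k x y c : 0 <= k -> 0 <= c -> path_close x y c -> inf_conv F k x <= inf_conv F k y + k * c.
Proof.
move=> k0 c0 xy; rewrite -lerBlDr; apply: inf_conv_ge => z c' c'0 yz.
rewrite lerBlDr -addrA -mulrDr; apply: inf_conv_le => //; first exact: addr_ge0.
move=> t t01; rewrite -(subrKA (y t)) (le_trans (ler_normD _ _))// addrC lerD//; [exact: yz|exact: xy].
Qed.

Lemma inf_conv_dist k x y c : 0 <= k -> 0 <= c -> path_close x y c -> `|inf_conv F k x - inf_conv F k y| <= k * c.
Proof.
move=> k0 c0 xy; have yx : path_close y x c by move=> t t01; rewrite distrC xy.
have := inf_conv_lip k0 c0 xy; have := inf_conv_lip k0 c0 yx.
by rewrite ler_norml => h1 h2; apply/andP; split; lra.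
Qed.

(** A competitor [z] uniformly close to [x] lies in a J1 ball, through the identity time change, and
    continuity bounds [F z] from below. A distant one pays a penalty of at least [2 Mb]. *)
Lemma inf_conv_cvg x e : continuous F -> 0 < e -> exists2 k0, 0 <= k0 & forall k, k0 <= k -> F x - e <= inf_conv F k x.
Proof.
move=> cF e0; have Mb0 : 0 <= Mb := le_trans (normr_ge0 _) (FM x).
have /cvgrPdist_lt /(_ _ e0) := cF x.
rewrite -nbhs_ballE => -[dl /= dl0 hdl].
exists (2 * Mb / dl); first by rewrite divr_ge0 ?mulr_ge0// ltW.
move=> k hk; apply: inf_conv_ge => z c c0 xz.
have k0 : 0 <= k by apply: le_trans hk; rewrite divr_ge0 ?mulr_ge0// ltW.
have [cd|dc] := ltP c dl.
  have : ball x dl z.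
    exists id; first by split=> //; rewrite image_id.
    by exists c => // t t01; rewrite subrr normr0; split => //; apply: xz; rewrite in_itv/= in t01.
  move=> /hdl /=; rewrite ltr_norml => /andP[_ h].
  by have := mulr_ge0 k0 c0; lra.
have h1 : 2 * Mb <= k * c.
  rewrite ler_pdivrMr// in hk; apply: le_trans hk _; exact: ler_wpM2l.
have := FM x; have := FM z; rewrite !ler_norml => /andP[a1 a2] /andP[a3 a4]; lra.
Qed.

End inf_convolution.

(** * Closure properties of cadlag paths *)

Section cadlag_paths.
Context {R : realType} {V : normedModType R}.
Implicit Types f g : R -> V.

Lemma cadlag_eq f g : (forall t : R, t <= 1 -> f t = g t) -> cadlag f -> cadlag g.
Proof.
move=> fg [h1 h2]; split => t /andP[t0 t1].
  rewrite -fg ?(ltW t1)//; have h := h1 t; rewrite t0 t1 in h; apply: cvg_trans (h isT).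
  apply: near_eq_cvg; near=> x; apply: fg; near: x.
  by apply: nbhs_right_le.
have h := h2 t; rewrite t0 t1 in h; have {}h := h isT.
apply/cvg_ex; have /cvg_ex[l hl] := h; exists l; apply: cvg_trans hl.
apply: near_eq_cvg; near=> x; apply: fg; apply: (le_trans _ t1); near: x.
exact: nbhs_left_le.
Unshelve. all: by end_near.
Qed.

Lemma cadlagD f g : cadlag f -> cadlag g -> cadlag (fun t => f t + g t).
Proof.
move=> [f1 f2] [g1 g2]; split => t t01; first by apply: cvgD; [exact: f1|exact: g1].
by apply: is_cvgD; [exact: f2|exact: g2].
Qed.

Lemma cadlag_cst (c : V) : cadlag (fun=> c).
Proof. by split=> t _; [exact: cvg_cst | exact: is_cvg_cst]. Qed.

Lemma cadlag_sum I (s : seq I) (F : I -> R -> V) : (forall i, cadlag (F i)) ->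
  cadlag (fun t => \sum_(i <- s) F i t).
Proof.
move=> cF; elim: s => [|i s IH].
  by rewrite (_ : (fun t => _) = fun=> 0); [exact: cadlag_cst|apply/funext => t; rewrite big_nil].
rewrite (_ : (fun t => _) = fun t => F i t + \sum_(j <- s) F j t); first exact: cadlagD.
by apply/funext => t; rewrite big_cons.
Qed.

Lemma cadlag_step (s : R) (c : V) : cadlag (fun t => (s <= t)%R%:R *: c).
Proof.
split=> t _.
  have [st|ts] := leP s t; apply: cvg_near_cst; near=> x; congr ((nat_of_bool _)%:R *: _).
    by apply: (le_trans st); near: x; exact: nbhs_right_ge.
  by apply/negbTE; rewrite -ltNge; near: x; exact: nbhs_right_lt.
apply/cvg_ex; have [st|ts] := ltP s t.
  exists c; apply: cvg_near_cst; near=> x.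
  by rewrite (_ : s <= x = true) ?scale1r//; near: x; exact: nbhs_left_ge.
exists 0; apply: cvg_near_cst; near=> x.
rewrite (_ : s <= x = false) ?scale0r//; apply/negbTE; rewrite -ltNge; apply: (lt_le_trans _ ts).
near: x; exact: nbhs_left_lt.
Unshelve. all: by end_near.
Qed.

Lemma cadlag_continuous_within (f : R -> R) (c : V) : {within `[0, 1], continuous f} ->
  cadlag (fun t => f t *: c).
Proof.
move=> /(continuous_within_itvP _ ltr01)[h1 h2 h3].
have hin (t : R) : 0 < t -> t < 1 -> f x @[x --> t] --> f t.
  by move=> t0 t1; apply: h1; rewrite in_itv/= t0.
split => t /andP[t0 t1].
  apply: cvgZr_tmp; move: t0; rewrite le_eqVlt => /predU1P[t0|t0]; first by rewrite -t0.
  by apply: cvg_at_right_filter; exact: hin.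
apply: is_cvgZr_tmp; apply/cvg_ex; exists (f t).
move: t1; rewrite le_eqVlt => /predU1P[t1|t1]; first by rewrite t1.
by apply: cvg_at_left_filter; exact: hin.
Qed.

End cadlag_paths.

Section row2_norm.
Context {R : realType}.

Lemma row2E (x y : R) : row2 x y = x *: row2 1 0 + y *: row2 0 1.
Proof.
by apply/rowP => i; rewrite !mxE; case: ifP => _; rewrite ?mulr1 ?mulr0 ?addr0 ?add0r.
Qed.

Lemma row2_norm (x y : R) : `|row2 x y| <= `|x| + `|y|.
Proof.
change (mx_norm (row2 x y) <= `|x| + `|y|).
have [->|/mx_norm_neq0[[i j] ->]] := eqVneq (mx_norm (row2 x y)) 0.
  by rewrite addr_ge0.
by rewrite !mxE; case: ifP => _; rewrite ?lerDl ?lerDr.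
Qed.

Lemma row2B (x y x' y' : R) : row2 x y - row2 x' y' = row2 (x - x') (y - y').
Proof. by apply/rowP => i; rewrite !mxE; case: ifP. Qed.

Lemma row2Z (c x y : R) : c *: row2 x y = row2 (c * x) (c * y).
Proof. by apply/rowP => i; rewrite !mxE; case: ifP. Qed.

End row2_norm.

Lemma uniform_continuity_itv {R : realType} (f : R -> R) (e : R) :
  {within `[0, 1], continuous f} -> 0 < e ->
  exists2 dl, 0 < dl & forall s t, 0 <= s <= 1 -> 0 <= t <= 1 -> `|s - t| <= dl -> `|f s - f t| <= e.
Proof.
move=> cf e0; have e2 : 0 < e / 2 by rewrite divr_gt0.
have /compact_near_coveringP/near_covering_withinP := @segment_compact R 0 1.
pose P (dl x : R) := forall t, 0 <= t <= 1 -> `|x - t| <= dl -> `|f x - f t| <= e.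
move=> /(_ R (0^'+) P _) cov.
have : \forall dl \near 0^'+, `[0, 1]%classic `<=` P dl.
  apply: cov => x; rewrite /= in_itv /= => x01.
  have /subspace_continuousP := cf => /(_ x); rewrite /= in_itv/= => /(_ x01).
  move=> /cvgrPdist_le /(_ _ e2).
  rewrite near_withinE => -[r /= r0 hr].
  have r2 : 0 < r / 2 by rewrite divr_gt0.
  near=> z dl => /= z01 t t01 ztd.
  have hz : `|x - z| < r / 2.
    by near: z; exact: (nbhsx_ballx x _ r2).
  have hd : dl < r / 2 by near: dl; exact: nbhs_right_lt.
  have ht : `|x - t| < r.
    rewrite -(subrKA z) (le_lt_trans (ler_normD _ _))// [r]splitr ltrD// (le_lt_trans ztd)//.
  rewrite -(subrKA (f x)) (le_trans (ler_normD _ _))// [e]splitr lerD//.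
    rewrite distrC; apply: hr; last by rewrite in_itv.
    by rewrite /= (lt_trans hz)//; lra.
  by apply: hr; [exact: ht|rewrite in_itv].
move=> [r /= r0 hr]; exists (r / 2); first by rewrite divr_gt0.
move=> s t s01 t01 st.
have r2 : 0 < r / 2 by rewrite divr_gt0.
have := hr (r / 2); rewrite /= sub0r normrN gtr0_norm// => /(_ _ r2); apply => //.
  by rewrite ltr_pdivrMr// ltr_pMr// ltr1n.
Unshelve. all: by end_near.
Qed.

(** * Step paths *)

Section cells.
Context {R : realType}.
Variable m : nat.
Hypothesis m0 : (0 < m)%N.

Let mR : 0 < m%:R :> R. Proof. by rewrite ltr0n. Qed.

(** The value [k = m] is allowed for the end point [v = 1]. *)
Lemma cell_exists (v : R) : 0 <= v <= 1 ->
  exists2 k : nat, (k <= m)%N & k%:R / m%:R <= v < k.+1%:R / m%:R.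
Proof.
move=> /andP[v0 v1]; have vm : 0 <= v * m%:R by rewrite mulr_ge0.
have h1 := truncn_le (v * m%:R); have h2 := truncnS_gt (v * m%:R).
rewrite vm in h1; set k := Num.truncn _ in h1 h2.
exists k; last by rewrite ler_pdivrMr// ltr_pdivlMr// h1 h2.
by rewrite -(ler_nat R) (le_trans h1)// ler_piMl.
Qed.

Lemma cell_le1 k : (k <= m)%N -> 0 <= (k%:R / m%:R : R) <= 1.
Proof. by move=> km; rewrite divr_ge0//= ler_pdivrMr// mul1r ler_nat. Qed.

Variables (y : R -> R) (e : R).
Hypothesis e0 : 0 <= e.
Hypothesis osc : forall k u, (k < m)%N -> k%:R / m%:R <= u -> u <= k.+1%:R / m%:R ->
  `|y u - y (k%:R / m%:R)| <= e.

Let le_div (j k : nat) : (j <= k)%N -> j%:R / m%:R <= k%:R / m%:R :> R.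
Proof. by move=> jk; rewrite ler_pM2r ?invr_gt0// ler_nat. Qed.

Lemma cell_osc k u : (k <= m)%N -> k%:R / m%:R <= u < k.+1%:R / m%:R -> u <= 1 -> `|y u - y (k%:R / m%:R)| <= e.
Proof.
move=> km /andP[k1 k2] u1; move: km; rewrite leq_eqVlt => /predU1P[km|km]; last exact: osc (ltW k2).
have -> : u = k%:R / m%:R.
  by apply: le_anti; rewrite k1 andbT km divff// gt_eqF.
by rewrite subrr normr0.
Qed.

(** Two times at distance at most [1 / m] lie in the same cell or in adjacent ones, so three
    oscillations suffice. *)
Lemma cell_modulus u v : 0 <= u -> u <= v -> v <= 1 -> v - u <= m%:R^-1 -> `|y v - y u| <= 3 * e.
Proof.
move=> u0 uv v1 vu; have u1 : u <= 1 := le_trans uv v1.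
have u01 : 0 <= u <= 1 by rewrite u0.
have [k km /andP[k1 k2]] := cell_exists u01.
have h1 : `|y u - y (k%:R / m%:R)| <= e by apply: cell_osc; rewrite ?k1.
have [vk|kv] := leP v (k.+1%:R / m%:R).
  have h2 : `|y v - y (k%:R / m%:R)| <= e.
    move: km; rewrite leq_eqVlt => /predU1P[km|km]; last by apply: osc => //; exact: le_trans k1 uv.
    have -> : v = k%:R / m%:R.
      apply: le_anti; rewrite (le_trans k1 uv) andbT; move: v1.
      by rewrite km divff// gt_eqF.
    by rewrite subrr normr0.
  move: h1 h2; rewrite !ler_norml => /andP[a1 a2] /andP[a3 a4]; apply/andP; split; lra.
have k1m : (k.+1 < m)%N.
  rewrite -(ltr_nat R) -(ltr_pM2r (x := m%:R^-1)) ?invr_gt0// divff ?gt_eqF//.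
  exact: lt_le_trans kv v1.
have h2 : `|y v - y (k.+1%:R / m%:R)| <= e.
  apply: osc => //; first exact: ltW.
  have -> : k.+2%:R / m%:R = k.+1%:R / m%:R + m%:R^-1 :> R by rewrite -[k.+2%:R]natr1 mulrDl mul1r.
  by rewrite -(subrK u v) addrC lerD// ltW.
have h3 : `|y (k.+1%:R / m%:R) - y (k%:R / m%:R)| <= e.
  by apply: osc => //; [exact: ltnW|exact: le_div].
move: h1 h2 h3; rewrite !ler_norml => /andP[a1 a2] /andP[a3 a4] /andP[a5 a6].
apply/andP; split; lra.
Qed.

(** Chaining over the cells; the growth in [m] is compensated later by a kernel tail of order
    [1 / m]. *)
Lemma cell_sup u : y 0 = 0 -> 0 <= u <= 1 -> `|y u| <= m%:R * e.
Proof.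
move=> y0 u01.
have S1 k : k.+1%:R * e = e + k%:R * e by rewrite -natr1 mulrDl mul1r addrC.
have main k : (k <= m)%N -> `|y (k%:R / m%:R)| <= k%:R * e.
  elim: k => [|k IH] km; first by rewrite mul0r y0 normr0 mul0r.
  rewrite -(subrK (y (k%:R / m%:R)) (y (k.+1%:R / m%:R))) (le_trans (ler_normD _ _))//.
  by rewrite S1 lerD ?IH ?(ltnW km)// osc// le_div.
have [k km] := cell_exists u01; case/andP: u01 => u0 u1.
move: km; rewrite leq_eqVlt => /predU1P[km|km] /andP[k1 k2].
  have -> : u = k%:R / m%:R.
    by apply: le_anti; rewrite k1 andbT km divff// gt_eqF.
  by rewrite -[X in X%:R * e]km main// km.
apply: (@le_trans _ _ (k.+1%:R * e)); last by rewrite ler_wpM2r// ler_nat.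
rewrite -(subrK (y (k%:R / m%:R)) (y u)) (le_trans (ler_normD _ _))//.
by rewrite S1 lerD ?main ?(ltnW km)// osc// ltW.
Qed.

End cells.

Section step_paths.
Context {R : realType}.
Variables (a b q : R).
Hypotheses (a0 : 0 <= a) (b0 : 0 <= b) (q1 : q < 1).

(* The martingale part of [S] is [lmap] of the two difference martingales. *)
Definition lmap (x y : R) : 'rV[R]_2 := row2 ((x + a * y) / (1 - q)) ((y + b * x) / (1 - q)).

Definition lnorm : R := (1 + a + b) / (1 - q).

Lemma lnorm_ge0 : 0 <= lnorm.
Proof. by apply: divr_ge0; [rewrite !addr_ge0|rewrite subr_ge0 ltW]. Qed.

Lemma lmapE x y : lmap x y = x *: lmap 1 0 + y *: lmap 0 1.
Proof. by apply/rowP => i; rewrite !mxE; case: ifP => _; lra. Qed.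

Lemma lmap_norm x y : `|lmap x y| <= lnorm * (`|x| + `|y|).
Proof.
have q0 : 0 <= (1 - q)^-1 by rewrite invr_ge0 subr_ge0 ltW.
apply: le_trans (row2_norm _ _) _; rewrite !normrM (ger0_norm q0) -mulrDl /lnorm mulrAC.
rewrite ler_wpM2r//.
have h1 := ler_normD x (a * y); have h2 := ler_normD y (b * x).
rewrite normrM (ger0_norm a0) in h1; rewrite normrM (ger0_norm b0) in h2.
have h3 := mulr_ge0 a0 (normr_ge0 x); have h4 := mulr_ge0 b0 (normr_ge0 y); lra.
Qed.

Lemma lmapB x y x' y' : lmap x y - lmap x' y' = lmap (x - x') (y - y').
Proof. by rewrite /lmap row2B; congr row2; rewrite -mulrBl; congr (_ / _); ring. Qed.

Lemma lmap_sum (I : finType) (x y : I -> R) :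
  \sum_i lmap (x i) (y i) = lmap (\sum_i x i) (\sum_i y i).
Proof.
rewrite [RHS]lmapE !scaler_suml -big_split /=; apply: eq_bigr => i _; exact: lmapE.
Qed.

Variable m : nat.
Hypothesis m0 : (0 < m)%N.
Implicit Types xi : 'I_2 * 'I_m -> R.

(** The increment of cell [k] is added only at its right end, so in each cell the path keeps the
    value reached at the left end. *)
Definition step_fun xi (v : R) : 'rV[R]_2 :=
  \sum_(k < m) (k.+1%:R / m%:R <= v)%R%:R *: lmap (xi (ord0, k)) (xi (ord_max, k)).

Lemma step_fun_cadlag xi : cadlag (step_fun xi).
Proof. by apply: cadlag_sum => k; exact: cadlag_step. Qed.

Definition step_path xi := CadlagPath (step_fun_cadlag xi).

Lemma step_path_lipschitz xi xi' :
  path_close (step_path xi) (step_path xi') (lnorm * \sum_p `|xi p - xi' p|).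
Proof.
move=> v _; rewrite /= /step_fun -sumrB.
have -> : \sum_p `|xi p - xi' p| = \sum_(k < m) (`|xi (ord0, k) - xi' (ord0, k)| + `|xi (ord_max, k) - xi' (ord_max, k)|).
  rewrite (eq_bigr (fun p : 'I_2 * 'I_m => `|xi (p.1, p.2) - xi' (p.1, p.2)|)); last by case.
  rewrite -(pair_bigA _ (fun j k => `|xi (j, k) - xi' (j, k)|)) /= big_ord_recl big_ord1 -big_split /=.
  by apply: eq_bigr => k _; congr (_ + _); congr (`|xi (_, _) - xi' (_, _)|); apply/val_inj.
rewrite (le_trans (ler_norm_sum _ _ _))// mulr_sumr; apply: ler_sum => k _.
rewrite -scalerBr normrZ lmapB (le_trans _ (lmap_norm _ _))//.
by rewrite ler_piMl// ger0_norm ?ler0n// lern1 leq_b1.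
Qed.

Lemma step_path_increments (y : 'I_2 -> R -> R) v k : (k <= m)%N -> k%:R / m%:R <= v < k.+1%:R / m%:R ->
  step_path (fun p => y p.1 (p.2.+1%:R / m%:R) - y p.1 (p.2%:R / m%:R)) v =
  lmap (y ord0 (k%:R / m%:R) - y ord0 0) (y ord_max (k%:R / m%:R) - y ord_max 0).
Proof.
move=> km /andP[k1 k2]; rewrite /= /step_fun.
have mR : 0 < m%:R :> R by rewrite ltr0n.
have tele j : y j (k%:R / m%:R) - y j 0 =
    \sum_(l < m) (l < k)%N%:R * (y j (l.+1%:R / m%:R) - y j (l%:R / m%:R)).
  transitivity (\sum_(0 <= l < k) (y j (l.+1%:R / m%:R) - y j (l%:R / m%:R))).
    by rewrite (telescope_sumr (fun l : nat => y j (l%:R / m%:R)) (leq0n k)) mul0r.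
  rewrite -(big_mkord xpredT (fun l => (l < k)%N%:R * (y j (l.+1%:R / m%:R) - y j (l%:R / m%:R)))).
  rewrite [RHS](big_cat_nat (n := k))//= [X in _ = _ + X]big_nat_cond [X in _ = _ + X]big1 ?addr0; last first.
    by move=> l /andP[/andP[kl _] _]; rewrite ltnNge kl mul0r.
  by rewrite big_nat_cond [RHS]big_nat_cond; apply: eq_bigr => l /andP[/andP[_ lk] _]; rewrite lk mul1r.
rewrite !tele -lmap_sum; apply: eq_bigr => l _.
have -> : (l.+1%:R / m%:R <= v) = (l < k)%N.
  apply/idP/idP => [h|h].
    have := le_lt_trans h k2; rewrite ltr_pM2r ?invr_gt0// ltr_nat ltnS => hh.
    by [].
  by apply: le_trans k1; rewrite ler_pM2r ?invr_gt0// ler_nat.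
case: (l < k)%N; rewrite ?scale1r ?mul1r// scale0r !mul0r.
by apply/rowP => i; rewrite !mxE; case: ifP => _; rewrite !mulr0 addr0 mul0r.
Qed.

End step_paths.

(** * Convergence in law *)

Section rescaled_paths.
Context {R : realType}.
Notation leb := (@lebesgue_measure R).
Variables (g h : R -> R).
Hypothesis g_ge0 : forall t : R, 0 <= t -> 0 <= g t.
Hypothesis h_ge0 : forall t : R, 0 <= t -> 0 <= h t.
Hypothesis g_int : leb.-integrable `[0, +oo[ (EFin \o g).
Hypothesis h_int : leb.-integrable `[0, +oo[ (EFin \o h).
Hypothesis hg_lt1 : L1norm h * L1norm g < 1.
Variables (mu : 'I_4 -> R) (d : measure_display) (Omega : measurableType d).
Variables (P : probability Omega R) (tau : nat -> Omega -> \bar R) (Z : nat -> Omega -> 'I_4).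
Hypothesis H : hawkes tau Z P mu (kernel4 g h).
Hypothesis mu_lo : forall a, mu (lo a) = mu (hi a).
Local Notation E := (Ex P).
Local Notation N := (stopped_count tau Z).
Local Notation M := (wmart tau Z mu (kernel4 g h)).
Local Notation k := (kmass g h).
Local Notation a := (L1norm h).
Local Notation b := (L1norm g).
Local Notation q := (L1norm h * L1norm g).
Local Notation rate := (rate g h mu).
Local Notation tail := (tail g h).

Let ki := kernel4_int g_int h_int.
Let k0 := kmass_ge0 g_ge0 h_ge0.
Let bN n i t : bmf (N n i t) := bmf_count H n i t.
Let r0 i : 0 <= rate i := rate_ge0 g_ge0 h_ge0 hg_lt1 H i.
Let bM n th t (t0 : 0 <= t) : bmf (M n th t) := adapted_bmf H (adapted_wmart H ki n th t0).
Let a0 : 0 <= a. Proof. by have := k0 (lo false); rewrite kmass_lo. Qed.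
Let b0 : 0 <= b. Proof. by have := k0 (lo true); rewrite kmass_lo. Qed.

Definition is_snd (j : 'I_2) : bool := j != ord0.

Lemma S_processE n T w t : (T%:E < tau n w)%E -> t <= T ->
  S_process tau Z t w = row2 (sdiff tau Z n w false t) (sdiff tau Z n w true t).
Proof.
move=> Ttau tT; have tn : (t%:E <= tau n w)%E by apply: le_trans (ltW Ttau); rewrite lee_fin.
rewrite /S_process /= !(counting_processE Z (hawkes_time_le H) (hawkes_time_lt H) _ tn) /=.
by rewrite /sdiff /lo /hi.
Qed.

#[local] Transparent stopped_count.
Lemma S_path_cadlag n (T : R) w (c : R) : 0 < T -> (T%:E < tau n w)%E ->
  cadlag (fun v => c *: S_process tau Z (T * v) w).
Proof.
move=> T0 Ttau.
have cN i (x : 'rV[R]_2) : cadlag (fun v => N n i (T * v) w *: x).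
  pose st l (v : R) : 'rV[R]_2 := ((tau l w <= (T * v)%:E)%E && (Z l w == i))%:R *: x.
  have cst l : cadlag (st l).
    have [Zi|/negPf Zi] := eqVneq (Z l w) i; last first.
      rewrite (_ : st l = fun=> 0); first exact: cadlag_cst.
      by apply/funext => v; rewrite /st Zi andbF scale0r.
    case E : (tau l w) => [s| |].
    - rewrite (_ : st l = fun v => (s / T <= v)%R%:R *: x); first exact: cadlag_step.
      by apply/funext => v; rewrite /st E Zi eqxx andbT lee_fin ler_pdivrMr// mulrC.
    - rewrite (_ : st l = fun=> 0); first exact: cadlag_cst.
      by apply/funext => v; rewrite /st E /= scale0r.
    - by have := hawkes_time_gt0 H l w; rewrite E.
  have := cadlag_sum (index_enum 'I_n.+1) (F := fun l v => st l v) (fun l => cst l).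
  by congr cadlag; apply/funext => v; rewrite /stopped_count scaler_suml.
pose e1 : 'rV[R]_2 := c *: row2 1 0; pose e2 : 'rV[R]_2 := c *: row2 0 1.
pose f (v : R) : 'rV[R]_2 := (N n (lo false) (T * v) w *: e1 + N n (hi false) (T * v) w *: (- e1)) +
  (N n (lo true) (T * v) w *: e2 + N n (hi true) (T * v) w *: (- e2)).
apply: (@cadlag_eq _ _ f); last by apply: cadlagD; apply: cadlagD; exact: cN.
move=> v v1; rewrite (@S_processE n T)//; last by rewrite ler_piMr// ltW.
rewrite /f !scalerN -!scalerBl /e1 /e2 !scalerA ![_ * c]mulrC -!scalerA -scalerDr; congr (_ *: _).
by rewrite [RHS]row2E.
Qed.
#[local] Opaque stopped_count.

Definition pathM (T : R) n w (j : 'I_2) (v : R) := scale T * M n (diff_weight (is_snd j)) (T * v) w.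

Lemma scale_gt0 (T : R) : 0 < T -> 0 < scale T.
Proof. by move=> T0; exact: powR_gt0. Qed.

Definition incr (m : nat) (T : R) n w (p : 'I_2 * 'I_m) :=
  pathM T n w p.1 (p.2.+1%:R / m%:R) - pathM T n w p.1 (p.2%:R / m%:R).

(** The lag window is [T / m], one cell after rescaling. The modulus of the martingales over it is
    [3 e], and their supremum [m e] is multiplied by a tail of at most [1 / m]; hence [C] does not
    depend on [m]. *)
Lemma S_path_close : exists2 C : R, 0 <= C & forall (m n : nat) (T : R) w (e : R), (0 < m)%N -> 0 < T -> 0 <= e ->
  (T%:E < tau n w)%E -> tail (T / m%:R) <= m%:R^-1 ->
  (forall j l u, (l < m)%N -> l%:R / m%:R <= u -> u <= l.+1%:R / m%:R ->
     `|pathM T n w j u - pathM T n w j (l%:R / m%:R)| <= e) ->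
  forall v, 0 <= v <= 1 ->
    `|scale T *: S_process tau Z (T * v) w - step_path a b q (incr T n w : 'I_2 * 'I_m -> R) v| <= C * e.
Proof.
pose ks := \sum_i k i; have ks0 : 0 <= ks by exact: sumr_ge0.
have q1 : 0 < 1 - q by rewrite subr_gt0.
pose K := (1 + ks) / (1 - q).
have K0 : 0 <= K by apply: divr_ge0; [exact: addr_ge0|exact: ltW].
pose C1 := K * (ks * (K * 3) + 2 * K).
have C10 : 0 <= C1.
  apply: mulr_ge0 => //; apply: addr_ge0; last exact: mulr_ge0.
  by apply: mulr_ge0 => //; exact: mulr_ge0.
have l0 := lnorm_ge0 a0 b0 hg_lt1.
exists (2 * C1 + 2 * lnorm a b q); first by apply: addr_ge0; exact: mulr_ge0.
move=> m n T w e m0 T0 e0 Ttau tl osc v v01.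
have mR : 0 < m%:R :> R by rewrite ltr0n.
have s0 := scale_gt0 T0; have Tn0 : T != 0 by rewrite gt_eqF.
have sV0 : 0 <= (scale T)^-1 by rewrite invr_ge0 ltW.
have y0 j : pathM T n w j 0 = 0 by rewrite /pathM mulr0 (wmart0 H) mulr0.
have oscj j : forall l u, (l < m)%N -> l%:R / m%:R <= u -> u <= l.+1%:R / m%:R ->
     `|pathM T n w j u - pathM T n w j (l%:R / m%:R)| <= e by move=> l u; exact: osc.
pose jj (x : bool) : 'I_2 := if x then ord_max else ord0.
have jjK x : is_snd (jj x) = x by case: x.
have ME x t : M n (diff_weight x) t w = (scale T)^-1 * pathM T n w (jj x) (t / T).
  have tE : T * (t / T) = t by rewrite mulrC divfK.
  by rewrite /pathM jjK tE mulKf// gt_eqF.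
have tT t : 0 <= t -> t <= T -> 0 <= t / T <= 1.
  by move=> t0 t1; rewrite divr_ge0 ?(ltW T0)//= ler_pdivrMr// mul1r.
have hB x t : 0 <= t -> t <= T -> `|M n (diff_weight x) t w| <= (scale T)^-1 * (m%:R * e).
  move=> t0 t1; rewrite ME normrM (ger0_norm sV0) ler_wpM2l//.
  by apply: (cell_sup m0 e0 (oscj _) (y0 _)); exact: tT.
have hW x u t : 0 <= u -> u <= t -> t <= T -> t - u <= T / m%:R ->
    `|M n (diff_weight x) t w - M n (diff_weight x) u w| <= (scale T)^-1 * (3 * e).
  move=> u0 ut t1 tu; rewrite !ME -mulrBr normrM (ger0_norm sV0) ler_wpM2l//.
  apply: (cell_modulus m0 e0 (oscj _)).
  - by rewrite divr_ge0// ltW.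
  - by rewrite ler_pM2r ?invr_gt0.
  - by rewrite ler_pdivrMr// mul1r.
  - by rewrite -mulrBl ler_pdivrMr// mulrC.
have B0 : 0 <= (scale T)^-1 * (m%:R * e) by rewrite mulr_ge0// mulr_ge0// ltW.
have W0 : 0 <= (scale T)^-1 * (3 * e) by rewrite mulr_ge0// mulr_ge0.
have /andP[v0 v1] := v01.
have Tv0 : 0 <= T * v by rewrite mulr_ge0// ltW.
have TvT : T * v <= T by rewrite ler_piMr// ltW.
have approx x := sdiff_approx g_ge0 h_ge0 g_int h_int hg_lt1 H (ltW T0) Ttau mu_lo x B0 W0 hB hW Tv0 TvT.
cbv zeta in approx; rewrite -/ks -/K in approx.
have err x : `|scale T * sdiff tau Z n w x (T * v) -
    (pathM T n w (jj x) v + k (lo x) * pathM T n w (jj (~~ x)) v) / (1 - q)| <= C1 * e.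
  have -> : (pathM T n w (jj x) v + k (lo x) * pathM T n w (jj (~~ x)) v) / (1 - q) =
     scale T * ((M n (diff_weight x) (T * v) w + k (lo x) * M n (diff_weight (~~ x)) (T * v) w) / (1 - q)).
    by rewrite /pathM !jjK; ring.
  rewrite -mulrBr normrM gtr0_norm// -ler_pdivlMl//.
  apply: le_trans (approx x) _.
  have -> : (scale T)^-1 * (C1 * e) = K * (ks * (K * ((scale T)^-1 * (3 * e))) + 2 * (K * ((scale T)^-1 * (m%:R * e))) * m%:R^-1).
    by rewrite /C1; field; rewrite !gt_eqF.
  apply: ler_wpM2l => //; rewrite lerD2l; apply: ler_wpM2l => //.
  by apply: mulr_ge0 => //; exact: mulr_ge0.
rewrite (S_processE Ttau TvT) row2Z.
have -> : step_path a b q (incr T n w : 'I_2 * 'I_m -> R) v =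
  step_path a b q (fun p : 'I_2 * 'I_m => pathM T n w p.1 (p.2.+1%:R / m%:R) - pathM T n w p.1 (p.2%:R / m%:R)) v by [].
have [l lm lv] := cell_exists m0 v01.
rewrite (step_path_increments a b q m0 (pathM T n w) lm lv) !y0 !subr0.
rewrite -(subrKA (lmap a b q (pathM T n w ord0 v) (pathM T n w ord_max v))) (le_trans (ler_normD _ _))//.
rewrite mulrDl lerD//.
  rewrite /lmap row2B (le_trans (row2_norm _ _))// -mulrA mulr_natl mulr2n lerD//.
    by have := err false; rewrite kmass_lo.
  by have := err true; rewrite kmass_lo.
rewrite -[2 * _ * e]mulrA mulrCA lmapB (le_trans (lmap_norm a0 b0 hg_lt1 _ _))// ler_wpM2l// [leRHS]mulr_natl mulr2n.
by rewrite lerD//; apply: (cell_osc m0 e0 (oscj _)).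
Qed.

Lemma evn_tail (m : nat) (e : R) : (0 < m)%N -> 0 < e -> evn (fun T _ => tail (T / m%:R) <= e).
Proof.
move=> m0 e0; have [D D0 hD] := tail_small g_ge0 h_ge0 g_int h_int e0.
have mR : 0 < m%:R :> R by rewrite ltr0n.
exists (Num.max 1 (D * m%:R)); first by rewrite le_max lexx.
move=> T; rewrite ge_max => /andP[_ hT]; exists 0%N => n _; apply: le_trans hD.
have kg i r : 0 <= ext0 (kern g h i) r by apply: ext0_ge0 => t; exact: kern_ge0.
have kint i : leb.-integrable setT (EFin \o ext0 (kern g h i)).
  by apply: ext0_integrable; exact: kern_int.
apply: ler_sum => i _; rewrite lerD2l lerN2; apply: cumul_nd => //.
  by move=> r; exact: ext0_neg.
by rewrite ler_pdivlMr.
Qed.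

Lemma evn_explosion (e : R) : 0 < e -> evn (fun T n => fine (P [set w | (tau n w <= T%:E)%E]) <= e).
Proof.
move=> e0; have [T0 T01 hT] := lln g_ge0 h_ge0 g_int h_int hg_lt1 H e0.
exists T0 => // T TT; have [n0 hn] := hT T TT; exists n0 => n nn.
by have [] := hn n nn.
Qed.

Lemma pathM_sup : exists2 A : R, 0 <= A & forall (m : nat) (e : R), (0 < m)%N -> 0 < e ->
  evn (fun T n => forall (p : 'I_2 * 'I_m), exists W : Omega -> R, [/\ bmf W, forall w, 0 <= W w,
      forall u w, p.2%:R / m%:R <= u -> u <= p.2.+1%:R / m%:R ->
        (pathM T n w p.1 u - pathM T n w p.1 (p.2%:R / m%:R)) ^+ 4 <= W w &
      E W <= A / m%:R ^+ 2 + e]).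
Proof.
have hs (x : bool) := block_increments_sup g_ge0 h_ge0 g_int h_int hg_lt1 H x.
have [A1 A10 h1] := hs false; have [A2 A20 h2] := hs true.
exists (A1 + A2); first exact: addr_ge0.
move=> m e m0 e0; have mR : 0 < m%:R :> R by rewrite ltr0n.
have hx (x : bool) : evn (fun T n => forall j, (j < m)%N -> exists W : Omega -> R, [/\ bmf W, forall w, 0 <= W w,
      forall u w, btime T m j <= u -> u <= btime T m j.+1 ->
        (scale T * (M n (diff_weight x) u w - M n (diff_weight x) (btime T m j) w)) ^+ 4 <= W w &
      E W <= (A1 + A2) / m%:R ^+ 2 + e]).
  have A12 : (if x then A2 else A1) / m%:R ^+ 2 + e <= (A1 + A2) / m%:R ^+ 2 + e.
    rewrite lerD2r ler_wpM2r ?invr_ge0 ?exprn_ge0//.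
    by case: x; rewrite ?lerDl ?lerDr.
  have := if x as y return evn (fun T n => forall j, (j < m)%N -> exists W : Omega -> R, [/\ bmf W, forall w, 0 <= W w,
      forall u w, btime T m j <= u -> u <= btime T m j.+1 ->
        (scale T * (M n (diff_weight y) u w - M n (diff_weight y) (btime T m j) w)) ^+ 4 <= W w &
      E W <= (if y then A2 else A1) / m%:R ^+ 2 + e]) then h2 m e m0 e0 else h1 m e m0 e0.
  apply: evn_imp => T n _ hj j jm; have [W [bW W0 hW EW]] := hj j jm; exists W; split => //.
  exact: le_trans EW A12.
apply: evn_imp (evn_forall hx) => T n T1 hj [i j].
have T0 : 0 < T by apply: lt_le_trans T1.
have [W [bW W0 hW EW]] := hj (is_snd i) j (ltn_ord j); exists W; split => //= u w u1 u2.
rewrite /pathM -mulrBr; apply: hW; by rewrite /btime ler_pM2l.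
Qed.

(** The union of an explosion before [T] and of a large oscillation in some cell. There are [2 m]
    pairs of a component and a cell, each with a fourth moment of order [A / m^2], so Markov's
    inequality leaves order [1 / m]. *)
Lemma bad_event (e : R) : 0 < e -> exists2 A : R, 0 <= A & forall (m : nat) (eta : R), (0 < m)%N -> 0 < eta ->
  evn (fun T n => exists bad : set Omega, [/\ measurable bad, fine (P bad) <= A / m%:R + eta &
    forall w, ~ bad w -> (T%:E < tau n w)%E /\
      forall j l u, (l < m)%N -> l%:R / m%:R <= u -> u <= l.+1%:R / m%:R ->
        `|pathM T n w j u - pathM T n w j (l%:R / m%:R)| <= e]).
Proof.
move=> e0; have [A A0 hA] := pathM_sup.
have e4 : 0 < e ^+ 4 by rewrite exprn_gt0.
exists (2 * A / e ^+ 4); first by rewrite divr_ge0 ?mulr_ge0// ltW.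
move=> m eta m0 eta0; have mR : 0 < m%:R :> R by rewrite ltr0n.
(* Summed over the [2 m] pairs and divided by [e ^+ 4], the allowance [dl] contributes exactly
   [eta / 2]. *)
pose dl := eta / 2 * e ^+ 4 / (2 * m%:R).
have dl0 : 0 < dl by rewrite divr_gt0 ?mulr_gt0// divr_gt0.
have eta2 : 0 < eta / 2 by rewrite divr_gt0.
apply: evn_imp (evn_and (hA m dl m0 dl0) (evn_explosion eta2)) => T n T1 [/choice[W hW] hexp].
have bW p : bmf (W p) by have [] := hW p.
have W0 p w : 0 <= W p w by have [] := hW p.
pose B0 : set Omega := [set w | (tau n w <= T%:E)%E].
pose S w := \sum_p W p w.
have bS : bmf S by exact: bmf_sum.
have S0 w : 0 <= S w by exact: sumr_ge0.
pose B1 : set Omega := [set w | e ^+ 4 <= S w].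
have mB0 : measurable B0 by exact: (measurable_time_le H).
have mB1 : measurable B1.
  have [mS _] := bS; have := mS measurableT _ (measurable_itv `[e ^+ 4, +oo[).
  by rewrite setTI; congr measurable; apply/seteqP; split => w; rewrite /B1 /= in_itv/= andbT.
exists (B0 `|` B1); split; first exact: measurableU.
- apply: (@le_trans _ _ (fine (P B0) + fine (P B1))).
    rewrite -fineD ?fin_num_measure// fine_le ?fin_num_measure//; first exact: measurableU.
      by rewrite fin_numD !fin_num_measure.
    exact: measureU2.
  have hS : fine (P B1) <= E S / e ^+ 4 by exact: Ex_markov.
  have ES : E S <= (2 * m%:R) * (A / m%:R ^+ 2 + dl).
    rewrite /S (Ex_sum P _ (F := W))//.
    apply: (@le_trans _ _ (\sum_(p : 'I_2 * 'I_m) (A / m%:R ^+ 2 + dl))).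
      by apply: ler_sum => p _; have [] := hW p.
    by rewrite sumr_const card_prod !card_ord -[leLHS]mulr_natl natrM.
  apply: le_trans (lerD hexp hS) _.
  apply: (@le_trans _ _ (eta / 2 + (2 * m%:R) * (A / m%:R ^+ 2 + dl) / e ^+ 4)).
    by rewrite lerD2l ler_wpM2r// invr_ge0 ltW.
  rewrite le_eqVlt; apply/orP; left; apply/eqP; rewrite /dl; field.
  by rewrite !gt_eqF.
- move=> w /not_orP[nB0 nB1]; split.
    by rewrite ltNge; apply/negP.
  move=> j l u lm u1 u2; have [_ _ h4 _] := hW (j, Ordinal lm).
  have := h4 u w u1 u2 => /= {}h4.
  have h5 : W (j, Ordinal lm) w <= S w by rewrite /S (bigD1 (j, Ordinal lm))//= lerDl sumr_ge0.
  have h6 : S w < e ^+ 4 by rewrite ltNge; apply/negP.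
  have := le_lt_trans (le_trans h4 h5) h6; move: (_ - _) => z hz.
  rewrite leNgt; apply/negP => ez; move: hz; rewrite ltNge => /negP; apply.
  by rewrite -[leRHS]ger0_norm ?exprn_even_ge0// normrX lerXn2r ?nnegrE ?(ltW e0)// ltW.
Qed.

End rescaled_paths.

(** * Joint limit of the martingale increments *)

Section increments_limit.
Context {R : realType}.
Notation leb := (@lebesgue_measure R).
Variables (g h : R -> R).
Hypothesis g_ge0 : forall t : R, 0 <= t -> 0 <= g t.
Hypothesis h_ge0 : forall t : R, 0 <= t -> 0 <= h t.
Hypothesis g_int : leb.-integrable `[0, +oo[ (EFin \o g).
Hypothesis h_int : leb.-integrable `[0, +oo[ (EFin \o h).
Hypothesis hg_lt1 : L1norm h * L1norm g < 1.
Variables (mu : 'I_4 -> R) (d : measure_display) (Omega : measurableType d).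
Variables (P : probability Omega R) (tau : nat -> Omega -> \bar R) (Z : nat -> Omega -> 'I_4).
Hypothesis H : hawkes tau Z P mu (kernel4 g h).
Hypothesis mu_lo : forall a, mu (lo a) = mu (hi a).
Variables (d' : measure_display) (Omega' : measurableType d') (Q : probability Omega' R).
Variable W : 'I_2 -> R -> Omega' -> R.
Hypothesis W_bm : brownian_motion Q W.
Local Notation M := (wmart tau Z mu (kernel4 g h)).
Local Notation rate := (rate g h mu).
Local Notation incr := (incr g h mu tau Z).

Let ki := kernel4_int g_int h_int.
Let r0 i : 0 <= rate i := rate_ge0 g_ge0 h_ge0 hg_lt1 H i.
Let bM n th t (t0 : 0 <= t) : bmf (M n th t) := adapted_bmf H (adapted_wmart H ki n th t0).

Lemma sum_lo_hi (F : 'I_4 -> R) : \sum_i F i = \sum_(j : 'I_2) (F (lo (is_snd j)) + F (hi (is_snd j))).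
Proof.
rewrite !big_ord_recl !big_ord0 /= !addr0.
rewrite (_ : lo (is_snd ord0) = ord0); last by apply/val_inj; rewrite /= inordK.
rewrite (_ : hi (is_snd ord0) = lift ord0 ord0); last by apply/val_inj; rewrite /= inordK.
rewrite (_ : lo (is_snd (lift ord0 ord0)) = lift ord0 (lift ord0 ord0)); last by apply/val_inj; rewrite /= inordK.
rewrite (_ : hi (is_snd (lift ord0 ord0)) = lift ord0 (lift ord0 (lift ord0 ord0))); last by apply/val_inj; rewrite /= inordK.
by rewrite !addrA.
Qed.

Lemma diff_weight_lo (x y : bool) : diff_weight x (lo y) = (x == y)%:R :> R.
Proof.
by rewrite /diff_weight /unit_weight -!val_eqE /lo /hi; case: x; case: y; rewrite /= !inordK //= subr0.
Qed.

Lemma diff_weight_hi (x y : bool) : diff_weight x (hi y) = - (x == y)%:R :> R.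
Proof.
by rewrite /diff_weight /unit_weight -!val_eqE /lo /hi; case: x; case: y; rewrite /= !inordK //= ?subr0 ?oppr0 ?sub0r.
Qed.

Lemma rate_hi x : rate (hi x) = rate (lo x).
Proof. by rewrite /rate mu_lo par_lo par_hi mu_lo /kmass kern_hi. Qed.

(** The two differences involve disjoint pairs of components, so no mixed term appears: this is why
    the limiting Brownian motions are independent. The factor 2 counts the two components of a pair,
    which have equal rates. *)
Lemma weighted_rate (c : 'I_2 -> R) :
  \sum_i (\sum_j c j * diff_weight (is_snd j) i) ^+ 2 * rate i = \sum_j c j ^+ 2 * (2 * rate (lo (is_snd j))).
Proof.
have snd_inj (j j' : 'I_2) : (is_snd j == is_snd j') = (j == j').
  by case: j => -[|[|//]] ?; case: j' => -[|[|//]] ?.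
rewrite sum_lo_hi; apply: eq_bigr => j _.
rewrite (bigD1 j)//= big1 ?addr0; last first.
  by move=> j' /negPf j'j; rewrite diff_weight_lo snd_inj j'j mulr0.
rewrite (bigD1 j)//= big1 ?addr0; last first.
  by move=> j' /negPf j'j; rewrite diff_weight_hi snd_inj j'j oppr0 mulr0.
rewrite diff_weight_lo diff_weight_hi eqxx rate_hi mulrN sqrrN mulr1 -mulrDr.
by congr (_ * _); rewrite mulr_natl.
Qed.

Definition sigma (j : 'I_2) : R := Num.sqrt (2 * rate (lo (is_snd j))).

Definition bm_incr (m : nat) w (p : 'I_2 * 'I_m) : R :=
  sigma p.1 * (W p.1 (p.2.+1%:R / m%:R) w - W p.1 (p.2%:R / m%:R) w).

Variable m : nat.
Hypothesis m0 : (0 < m)%N.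

Let mR : 0 < m%:R :> R. Proof. by rewrite ltr0n. Qed.

Lemma bmf_incr T n (p : 'I_2 * 'I_m) : 1 <= T -> bmf (fun w => incr T n w p).
Proof.
move=> T1; have T0 : 0 <= T by apply: le_trans T1.
by apply: bmfB; apply: bmfZ; apply: bM; rewrite mulr_ge0// divr_ge0.
Qed.

Lemma measurable_bm_incr p : measurable_fun setT (fun w => @bm_incr m w p).
Proof.
apply: measurable_funM => //; apply: (measurable_increment W_bm).
- by rewrite divr_ge0.
- by rewrite ler_pM2r ?invr_gt0// ler_nat.
- by rewrite ler_pdivrMr// mul1r ler_nat.
Qed.

Lemma incr_cos (th : 'I_2 * 'I_m -> R) c (e : R) : 0 < e -> evn (fun T n =>
  `|Ex P (fun w => cos (\sum_p th p * incr T n w p + c)) - Ex Q (fun w => cos (\sum_p th p * bm_incr w p + c))| <= e).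
Proof.
move=> e0.
(* Weights are extended by 0 to indices beyond [m], since the block estimate takes weights indexed
   by all natural numbers. *)
pose ct j (l : nat) := oapp (fun o : 'I_m => th (j, o)) 0 (insub l).
pose wt l i := \sum_(j : 'I_2) ct j l * diff_weight (is_snd j) i : R.
have ctE j (l : 'I_m) : ct j l = th (j, l) by rewrite /ct valK.
pose B := \sum_(l < m) \sum_i wt l i ^+ 2.
have hB l i : wt l i ^+ 2 <= B.
  have B0 : 0 <= B by apply: sumr_ge0 => l' _; apply: sumr_ge0 => i' _; exact: sqr_ge0.
  have [lm|ml] := ltnP l m; last first.
    rewrite /wt big1 ?expr0n// => j _; rewrite /ct insubF ?mul0r//.
    by apply/negbTE; rewrite -leqNgt.
  rewrite /B (bigD1 (Ordinal lm))//= (bigD1 i)//= -addrA lerDl addr_ge0//.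
    by apply: sumr_ge0 => i' _; exact: sqr_ge0.
  by apply: sumr_ge0 => l' _; apply: sumr_ge0 => i' _; exact: sqr_ge0.
have := block_increments_cos g_ge0 h_ge0 g_int h_int hg_lt1 H c m0 e0 hB.
apply: evn_imp => T n T1; have T0 : 0 < T by apply: lt_le_trans T1.
have -> : (fun w => cos (\sum_(j < m) scale T * (M n (wt j) (btime T m j.+1) w - M n (wt j) (btime T m j) w) + c)) =
    fun w => cos (\sum_p th p * incr T n w p + c).
  apply/funext => w; congr (cos (_ + c)).
  rewrite (eq_bigr (fun l : 'I_m => \sum_j th (j, l) * incr T n w (j, l))); last first.
    move=> l _; rewrite /wt !wmart_sum -sumrB mulr_sumr; apply: eq_bigr => j _.
    by rewrite ctE -mulrBr mulrCA /incr /pathM /= -mulrBr.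
  rewrite exchange_big /= (pair_bigA _ (fun j l => th (j, l) * incr T n w (j, l))) /=.
  by apply: eq_bigr => -[].
have -> : \sum_(j < m) block_variance g h mu m wt j / 2 = \sum_p ((th p * sigma p.1) ^+ 2 / m%:R / 2).
  rewrite (eq_bigr (fun l : 'I_m => \sum_j ((th (j, l) * sigma j) ^+ 2 / m%:R / 2))); last first.
    move=> l _; rewrite /block_variance /wt weighted_rate !mulr_suml; apply: eq_bigr => j _.
    by rewrite ctE exprMn sqr_sqrtr// mulr_ge0.
  rewrite exchange_big /= (pair_bigA _ (fun j l => (th (j, l) * sigma j) ^+ 2 / m%:R / 2)) /=.
  by apply: eq_bigr => -[].
have -> : (fun w => cos (\sum_p th p * bm_incr w p + c)) =
    fun w => cos (\sum_p (th p * sigma p.1) * (W p.1 (p.2.+1%:R / m%:R) w - W p.1 (p.2%:R / m%:R) w) + c).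
  by apply/funext => w; congr (cos (_ + c)); apply: eq_bigr => p _; rewrite /bm_incr mulrA.
by rewrite (bm_cos W_bm (fun p => th p * sigma p.1))// [cos c * _]mulrC.
Qed.

Lemma incr_cvg f Mb K (e : R) : 0 <= K -> l1_lipschitz K f -> (forall x, `|f x| <= Mb) -> 0 < e ->
  evn (fun T n => bmf (fun w => f (fun p : 'I_2 * 'I_m => incr T n w p)) /\
    `|Ex P (fun w => f (fun p => incr T n w p)) - Ex Q (fun w => f (@bm_incr m w))| <= e).
Proof.
move=> K0 fK fM e0; have [A A0 hA] := pathM_sup g_ge0 h_ge0 g_int h_int hg_lt1 H.
have C0 : 0 <= 1 + (A + 1) by rewrite !addr_ge0.
apply: (@lipschitz_cvg _ _ _ _ P _ _ Q (fun T n w p => incr T n w p) (@bm_incr m) (1 + (A + 1)) _ _ C0 _ _ f Mb K) => //.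
- by move=> T n p T1; exact: bmf_incr.
- exact: measurable_bm_incr.
(* The uniform second moment bound follows from the fourth one, as [z <= 1 + z^2] for [z] the
   squared increment. *)
- apply: evn_imp (hA m 1 m0 ltr01) => T n T1 hW p; have [V [bV V0 hV EV]] := hW p.
  have bi := bmf_incr n p T1.
  apply: (@le_trans _ _ (Ex P (fun w => 1 + V w))).
    apply: Ex_le; [exact: bmfX|by apply: bmfD => //; exact: bmf_cst|].
    move=> w; have : incr T n w p ^+ 4 <= V w.
      by apply: hV; rewrite ?ler_pM2r ?invr_gt0// ler_nat.
    rewrite (exprM _ 2 2); move: (incr T n w p ^+ 2) => z; have := sqr_ge0 (z - 1); have := sqr_ge0 z; nra.
  rewrite (ExD P (bmf_cst _ 1) bV) Ex_cst lerD2l (le_trans EV)// lerD2r.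
  by rewrite ler_piMr// invf_le1 ?exprn_gt0// exprn_ege1// ler1n.
- by move=> th c e' e'0; exact: incr_cos.
Qed.

End increments_limit.

Lemma to_pathE {R : realType} {V : normedModType R} (f : R -> V) : cadlag f -> to_path f = f :> (R -> V).
Proof. by move=> cf; rewrite /to_path; case: pselect. Qed.

Section arithmetic.
Context {R : realFieldType}.

Lemma bound_on_bad_event (M x y z : R) : x <= M -> - M <= y -> 0 <= z -> x - z - 2 * M <= y.
Proof. lra. Qed.

Lemma sum_of_errors (e e1 x1 x2 x3 x4 y z : R) : e = 5 * e1 -> x1 - e1 <= x2 -> x2 - e1 <= x3 ->
  - e1 <= x4 - x3 -> y <= e1 -> z <= e1 -> x1 - e <= x4 - y - z.
Proof. lra. Qed.

End arithmetic.

(** * Comparison of expectations of path functionals *)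

Section convergence.
Context {R : realType}.
Notation leb := (@lebesgue_measure R).
Variables (g h : R -> R).
Hypothesis g_ge0 : forall t : R, 0 <= t -> 0 <= g t.
Hypothesis h_ge0 : forall t : R, 0 <= t -> 0 <= h t.
Hypothesis g_int : leb.-integrable `[0, +oo[ (EFin \o g).
Hypothesis h_int : leb.-integrable `[0, +oo[ (EFin \o h).
Hypothesis hg_lt1 : L1norm h * L1norm g < 1.
Variables (mu : 'I_4 -> R) (d : measure_display) (Omega : measurableType d).
Variables (P : probability Omega R) (tau : nat -> Omega -> \bar R) (Z : nat -> Omega -> 'I_4).
Hypothesis H : hawkes tau Z P mu (kernel4 g h).
Hypothesis mu_lo : forall a, mu (lo a) = mu (hi a).
Variables (d' : measure_display) (Omega' : measurableType d') (Q : probability Omega' R).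
Variable W : 'I_2 -> R -> Omega' -> R.
Hypothesis W_bm : brownian_motion Q W.
Local Notation a := (L1norm h).
Local Notation b := (L1norm g).
Local Notation q := (L1norm h * L1norm g).
Local Notation rate := (rate g h mu).
Local Notation incr := (incr g h mu tau Z).
Local Notation sigma := (sigma g h mu).
Local Notation bm_incr := (bm_incr g h mu W).
Local Notation V := 'rV[R]_2.

Let a0 : 0 <= a. Proof. by have := kmass_ge0 g_ge0 h_ge0 (lo false); rewrite kmass_lo. Qed.
Let b0 : 0 <= b. Proof. by have := kmass_ge0 g_ge0 h_ge0 (lo true); rewrite kmass_lo. Qed.
Let l0 := lnorm_ge0 a0 b0 hg_lt1.

Definition limit_path (w : Omega') (v : R) : V :=
  lmap a b q (sigma ord0 * W ord0 v w) (sigma ord_max * W ord_max v w).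

Definition regular (w : Omega') := (forall i, W i 0 w = 0) /\
  forall i, {within `[0, 1]%classic, continuous (fun t => W i t w)}.

Lemma limit_path_cadlag w : regular w -> cadlag (limit_path w).
Proof.
move=> [_ cW].
have cj (c : R) j (x : V) : cadlag (fun v => (c * W j v w) *: x).
  have := cadlag_continuous_within (c *: x) (cW j).
  by congr cadlag; apply/funext => v; rewrite scalerA mulrC.
rewrite (_ : limit_path w = fun v => (sigma ord0 * W ord0 v w) *: lmap a b q 1 0 +
    (sigma ord_max * W ord_max v w) *: lmap a b q 0 1); first exact: cadlagD.
by apply/funext => v; exact: lmapE.
Qed.

Lemma regular_null : exists A : set Omega', [/\ measurable A, Q A = 0%E & forall w, ~ A w -> regular w].
Proof.
have [A [mA QA hA]] : {ae Q, forall w, regular w}.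
  by apply: filterS2 (bm_start W_bm) (bm_continuous W_bm) => w w0 cw; split.
exists A; split => // w nA; apply: contrapT => nr; apply: nA; exact: hA.
Qed.

Lemma step_path_cvg w (e : R) : regular w -> 0 < e -> exists m0 : nat, forall m, (m0 <= m)%N ->
  path_close (to_path (limit_path w)) (step_path a b q (@bm_incr m.+1 w)) e.
Proof.
move=> rw e0; have [W0 cW] := rw; have cY := limit_path_cadlag rw.
have s0 j : 0 <= sigma j by exact: sqrtr_ge0.
pose L := lnorm a b q * (sigma ord0 + sigma ord_max).
have L0 : 0 <= L by rewrite mulr_ge0// addr_ge0.
have e1 : 0 < e / (L + 1) by rewrite divr_gt0// ltr_wpDl.
have [d1 d10 h1] := uniform_continuity_itv (cW ord0) e1.
have [d2 d20 h2] := uniform_continuity_itv (cW ord_max) e1.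
exists (Num.truncn (d1^-1 + d2^-1)) => m hm v v01; rewrite to_pathE//.
have mR : 0 < m.+1%:R :> R by [].
have hm1 : d1^-1 + d2^-1 <= m.+1%:R.
  by apply: ltW; apply: lt_le_trans (truncnS_gt _) _; rewrite ler_nat ltnS.
have hd1 : m.+1%:R^-1 <= d1.
  rewrite -[d1]invrK lef_pV2 ?posrE ?invr_gt0// (le_trans _ hm1)// lerDl invr_ge0 ltW//.
have hd2 : m.+1%:R^-1 <= d2.
  rewrite -[d2]invrK lef_pV2 ?posrE ?invr_gt0// (le_trans _ hm1)// lerDr invr_ge0 ltW//.
have [k km kv] := @cell_exists R m.+1 isT v v01.
pose y j v := sigma j * W j v w.
have -> : step_path a b q (@bm_incr m.+1 w) v =
    step_path a b q (fun p : 'I_2 * 'I_m.+1 => y p.1 (p.2.+1%:R / m.+1%:R) - y p.1 (p.2%:R / m.+1%:R)) v.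
  by congr (step_path a b q _ v); apply/funext => p; rewrite /y -mulrBr.
rewrite (step_path_increments a b q (isT : (0 < m.+1)%N) y km kv) /y !W0 !mulr0 !subr0 /limit_path lmapB.
apply: le_trans (lmap_norm a0 b0 hg_lt1 _ _) _; rewrite -!mulrBr !normrM !(ger0_norm (s0 _)).
have k01 : 0 <= (k%:R / m.+1%:R : R) <= 1 by exact: (@cell_le1 R m.+1 isT k km).
have kd : `|v - k%:R / m.+1%:R| <= m.+1%:R^-1.
  case/andP: kv => k1 k2; rewrite ger0_norm ?subr_ge0// lerBlDr.
  by move: k2; rewrite -natr1 mulrDl mul1r addrC => /ltW.
have w1 : `|W ord0 v w - W ord0 (k%:R / m.+1%:R) w| <= e / (L + 1).
  by apply: h1 => //; exact: le_trans kd hd1.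
have w2 : `|W ord_max v w - W ord_max (k%:R / m.+1%:R) w| <= e / (L + 1).
  by apply: h2 => //; exact: le_trans kd hd2.
apply: (@le_trans _ _ (lnorm a b q * (sigma ord0 * (e / (L + 1)) + sigma ord_max * (e / (L + 1))))).
  by apply: ler_wpM2l => //; apply: lerD; apply: ler_wpM2l.
rewrite -mulrDl mulrA -/L mulrA ler_pdivrMr ?ltr_wpDl// mulrC ler_wpM2l ?(ltW e0)// lerDl//.
Qed.

Section functional.
Variables (F : cadlag_path V -> R) (Mb : R).
Hypothesis F_cont : continuous F.
Hypothesis F_bound : forall x, `|F x| <= Mb.

Let Mb0 : 0 <= Mb. Proof. exact: le_trans (normr_ge0 _) (F_bound (to_path (fun=> 0))). Qed.

Lemma functional_lipschitz m k : 0 <= k ->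
  l1_lipschitz (k * lnorm a b q) (fun xi : 'I_2 * 'I_m -> R => inf_conv F k (step_path a b q xi)).
Proof.
move=> k0 x y; rewrite -mulrA; apply: (inf_conv_dist F_bound) => //; last first.
  exact: step_path_lipschitz.
by rewrite mulr_ge0// sumr_ge0.
Qed.

Variable A : set Omega'.
Hypotheses (mA : measurable A) (QA : Q A = 0%E) (regA : forall w, ~ A w -> regular w).

(** Outside the null set [A] the Brownian paths are regular and the value is a limit of measurable
    ones; the indicator makes it measurable everywhere, without completeness of [Q]. *)
Definition limit_value (w : Omega') := \1_(~` A) w * F (to_path (limit_path w)).

Let f (k m : nat) w : R := inf_conv F k%:R (step_path a b q (@bm_incr m.+1 w)).

Let bmf_f k m : bmf (f k m).
Proof.
have kl0 : 0 <= k%:R * lnorm a b q by rewrite mulr_ge0.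
have mY : forall p, measurable_fun setT (fun w => @bm_incr m.+1 w p).
  by move=> p; exact: (measurable_bm_incr g h mu W_bm (isT : (0 < m.+1)%N) p).
have fM (x : 'I_2 * 'I_m.+1 -> R) : `|inf_conv F k%:R (step_path a b q x)| <= Mb by exact: (inf_conv_bound F_bound _ (ler0n R k)).
by have [p hp [bf _]] := trig_dct Q mY kl0 (functional_lipschitz (ler0n R k)) fM.
Qed.

Let mA' : measurable (~` A). Proof. exact: measurableC. Qed.

Let indic_bound (x : R) w : `|x| <= Mb -> `|\1_(~` A) w * x| <= Mb.
Proof.
by move=> xM; rewrite normrM indicE; case: (_ \in _); rewrite ?normr1 ?mul1r// normr0 mul0r.
Qed.

(** At fixed [k] the regularised functional is Lipschitz for the uniform norm, and the step paths
    built from Brownian increments converge uniformly to the limit path. *)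
Let cvg_m k : bmf (fun w => \1_(~` A) w * inf_conv F k%:R (to_path (limit_path w))) /\
  Ex Q (fun w => \1_(~` A) w * f k m w) @[m --> \oo] -->
  Ex Q (fun w => \1_(~` A) w * inf_conv F k%:R (to_path (limit_path w))).
Proof.
apply: (@Ex_dct _ _ _ Q (fun m w => \1_(~` A) w * f k m w) _ Mb).
- by move=> m; have [] := bmfM (bmf_indic mA') (bmf_f k m).
- by move=> m w; apply: indic_bound; exact: (inf_conv_bound F_bound _ (ler0n R k)).
- move=> w; rewrite indicE; case: (boolP (w \in ~` A)) => wA; last first.
    by rewrite (_ : (fun m => _) = fun=> 0) ?mul0r; [exact: cvg_cst|apply/funext => m; rewrite mul0r].
  apply: cvgM; first exact: cvg_cst.
  have rw : regular w by apply: regA; rewrite inE in wA.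
  apply/cvgrPdist_le => e e0; have e1 : 0 < e / (k%:R + 1) by rewrite divr_gt0// ltr_wpDl.
  have [m0 hm] := step_path_cvg rw e1.
  near=> m; apply: le_trans (inf_conv_dist F_bound (ler0n R k) (ltW e1) (hm m _)) _.
    by near: m; exact: nbhs_infty_ge.
  by rewrite mulrA ler_pdivrMr ?ltr_wpDl// mulrC ler_wpM2l ?(ltW e0)// lerDl.
Unshelve. all: by end_near.
Qed.

Let cvg_k : bmf limit_value /\
  Ex Q (fun w => \1_(~` A) w * inf_conv F k%:R (to_path (limit_path w))) @[k --> \oo] --> Ex Q limit_value.
Proof.
apply: (@Ex_dct _ _ _ Q (fun k w => \1_(~` A) w * inf_conv F k%:R (to_path (limit_path w))) _ Mb).
- by move=> k; have [[]] := cvg_m k.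
- by move=> k w; apply: indic_bound; exact: (inf_conv_bound F_bound _ (ler0n R k)).
- move=> w; rewrite /limit_value; apply: cvgM; first exact: cvg_cst.
  set x := to_path _; apply/cvgrPdist_le => e e0.
  have [k0 k00 hk] := inf_conv_cvg F_bound x F_cont e0.
  near=> k.
  have h1 : F x - e <= inf_conv F k%:R x by apply: hk; near: k; exact: nbhs_infty_ger.
  have h2 : inf_conv F k%:R x <= F x.
    have hx : path_close x x 0 by move=> t _; rewrite subrr normr0.
    by have := inf_conv_le F_bound (ler0n R k) (lexx 0) hx; rewrite mulr0 addr0.
  by rewrite ger0_norm ?subr_ge0// lerBlDr addrC -lerBlDr.
Unshelve. all: by end_near.
Qed.

Lemma bmf_limit_value : bmf limit_value. Proof. by have [] := cvg_k. Qed.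

Lemma Ex_null : Ex Q (\1_A : Omega' -> R) = 0.
Proof. by rewrite Ex_indic// QA. Qed.

(* Off the bad event the path is uniformly close to a step path; on it, the
   trivial bound [Mb] is used. *)
Lemma lower_sandwich (e : R) : 0 < e -> exists2 T0, 1 <= T0 & forall T, T0 <= T ->
  exists phi : Omega -> R, [/\ bmf phi,
    forall w, phi w <= F (to_path (fun v => scale T *: S_process tau Z (T * v) w)) &
    Ex Q limit_value - e <= Ex P phi].
Proof.
move=> e0; pose e1 := e / 5; have e10 : 0 < e1 by rewrite divr_gt0.
have e5 : e = 5 * e1 by rewrite /e1; field.
(* The five shares of [e] pay for the regularisation ([k]), the discretisation of the Brownian path
   ([m]), the limit of the increments ([T], [n]), the distance from the path to its step path ([ep])
   and the bad event ([m], [eta]). *)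
have [C C0 hC] := S_path_close g_ge0 h_ge0 g_int h_int hg_lt1 H mu_lo.
have [k hk] : exists k : nat, Ex Q limit_value - e1 <=
    Ex Q (fun w => \1_(~` A) w * inf_conv F k%:R (to_path (limit_path w))).
  have [_ /cvgrPdist_le /(_ _ e10) [k _ /(_ k (leqnn k))]] := cvg_k.
  by rewrite ler_norml => /andP[_ hk]; exists k; rewrite lerBlDr -lerBlDl.
pose ep := e1 / (k%:R * C + 1).
have kC0 : 0 <= k%:R * C by rewrite mulr_ge0.
have ep0 : 0 < ep by rewrite divr_gt0// ltr_wpDl.
have hep : k%:R * (C * ep) <= e1.
  by rewrite mulrA /ep mulrA ler_pdivrMr ?ltr_wpDl// mulrC ler_wpM2l ?(ltW e10)// lerDl.
have [Ab Ab0 hbad] := bad_event g_ge0 h_ge0 g_int h_int hg_lt1 H ep0.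
pose eta := e1 / (2 * (2 * Mb + 1)).
have M1 : 0 < 2 * Mb + 1 by rewrite ltr_wpDl// mulr_ge0.
have eta0 : 0 < eta by rewrite divr_gt0// mulr_gt0.
have eM : 0 < e1 / (2 * (2 * Mb + 1) * (Ab + 1)).
  by rewrite divr_gt0// mulr_gt0// ?mulr_gt0// ltr_wpDl.
have [m hm1 hm2] : exists2 m : nat, Ex Q (fun w => \1_(~` A) w * inf_conv F k%:R (to_path (limit_path w))) - e1 <=
    Ex Q (fun w => \1_(~` A) w * f k m w) & m.+1%:R^-1 <= e1 / (2 * (2 * Mb + 1) * (Ab + 1)).
  have [_ /cvgrPdist_le /(_ _ e10) hc] := cvg_m k.
  near \oo => m; exists m; last first.
    by near: m; apply: filterS (near_infty_natSinv_lt (PosNum eM)) => j /ltW.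
  have : `|Ex Q (fun w => \1_(~` A) w * inf_conv F k%:R (to_path (limit_path w))) -
      Ex Q (fun w => \1_(~` A) w * f k m w)| <= e1 by near: m.
  by rewrite ler_norml => /andP[_ h1]; rewrite lerBlDr -lerBlDl.
have hm3 : Ex Q (fun w => \1_(~` A) w * f k m w) = Ex Q (f k m).
  have bA := bmf_indic mA : bmf (\1_A : Omega' -> R).
  have b1 := bmfM bA (bmf_f k m).
  rewrite (_ : (fun w => _) = fun w => f k m w - \1_A w * f k m w); last first.
    apply/funext => w; rewrite !indicE in_setC; case: (w \in A); rewrite /= ?mul0r ?mul1r ?subrr ?subr0//.
  rewrite (ExB Q (bmf_f k m) b1) [X in _ - X](_ : _ = 0) ?subr0//.
  apply/eqP; rewrite -normr_le0; apply: le_trans (Ex_norm Q b1) _.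
  apply: (@le_trans _ _ (Ex Q (fun w => Mb * \1_A w))).
    apply: Ex_le; [exact: bmf_norm|exact: bmfZ|].
    move=> w; have i0 : 0 <= \1_A w :> R by rewrite indicE ler0n.
    rewrite [leRHS]mulrC normrM (ger0_norm i0); apply: ler_wpM2l => //.
    exact: (inf_conv_bound F_bound _ (ler0n R k)).
  by rewrite (ExZ Q Mb bA) Ex_null mulr0.
have kl0 : 0 <= k%:R * lnorm a b q by rewrite mulr_ge0.
have fM (x : 'I_2 * 'I_m.+1 -> R) : `|inf_conv F k%:R (step_path a b q x)| <= Mb by exact: (inf_conv_bound F_bound _ (ler0n R k)).
have mi0 : 0 < m.+1%:R^-1 :> R by rewrite invr_gt0.
have m0 : (0 < m.+1)%N by [].
have ev1 := incr_cvg g_ge0 h_ge0 g_int h_int hg_lt1 H mu_lo W_bm m0 kl0 (functional_lipschitz (ler0n R k)) fM e10.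
have ev2 := hbad m.+1 eta m0 eta0.
have ev3 := evn_tail g_ge0 h_ge0 g_int h_int m0 mi0.
have [T0 T01 hT] := evn_and ev1 (evn_and ev2 ev3).
exists T0 => // T TT; have [n hn] := hT T TT.
have [[bfi hfi] [[bad [mbad Pbad hgood]] htail]] := hn n (leqnn n).
have Tp : 0 < T by apply: lt_le_trans TT; apply: lt_le_trans T01.
pose fi w := inf_conv F k%:R (step_path a b q (fun p : 'I_2 * 'I_m.+1 => incr T n w p)).
have bb : bmf (fun w => 2 * Mb * \1_bad w) := bmfZ (2 * Mb) (bmf_indic mbad).
have bc : bmf (fun w => fi w - k%:R * (C * ep)) := bmfB bfi (bmf_cst Omega (k%:R * (C * ep))).
exists (fun w => fi w - k%:R * (C * ep) - 2 * Mb * \1_bad w); split.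
- exact: bmfB.
- move=> w; set x := to_path _; have [wb|wb] := pselect (bad w).
    rewrite indicE mem_set// mulr1.
    have := F_bound x; have := fM (fun p => incr T n w p); rewrite -/(fi w) !ler_norml => /andP[_ h1] /andP[h2 _].
    have h3 : 0 <= k%:R * (C * ep) by rewrite mulr_ge0// mulr_ge0// ltW.
    exact: bound_on_bad_event h1 h2 h3.
  rewrite indicE memNset// mulr0 subr0 lerBlDr.
  have [Ttau osc] := hgood w wb.
  apply: (inf_conv_le F_bound) => //; first by rewrite mulr_ge0// ltW.
  move=> v v01; rewrite distrC /x to_pathE; last exact: (S_path_cadlag H _ Tp Ttau).
  exact: (hC m.+1 n T w ep m0 Tp (ltW ep0) Ttau htail osc v v01).
- rewrite (ExB P bc bb) (ExB P bfi (bmf_cst _ _)) Ex_cst (ExZ P _ (bmf_indic mbad)) Ex_indic//.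
  rewrite -/fi in hfi.
  have h1 : 2 * Mb * fine (P bad) <= e1.
    have Pb0 : 0 <= Ab / m.+1%:R + eta by apply: addr_ge0; [exact: divr_ge0|exact: ltW].
    apply: (@le_trans _ _ ((2 * Mb + 1) * (Ab / m.+1%:R + eta))).
      apply: (@le_trans _ _ (2 * Mb * (Ab / m.+1%:R + eta))).
        by rewrite ler_wpM2l// mulr_ge0.
      by rewrite ler_wpM2r// lerDl.
    have h2 : Ab / m.+1%:R <= e1 / (2 * (2 * Mb + 1)).
      apply: (@le_trans _ _ ((Ab + 1) * (e1 / (2 * (2 * Mb + 1) * (Ab + 1))))).
        by rewrite ler_pM ?invr_ge0// lerDl.
      rewrite le_eqVlt; apply/orP; left; apply/eqP; field.
      by rewrite !gt_eqF// ltr_wpDl.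
    apply: (@le_trans _ _ ((2 * Mb + 1) * (e1 / (2 * (2 * Mb + 1)) + eta))).
      by rewrite ler_wpM2l ?(ltW M1)// lerD2r.
    rewrite le_eqVlt; apply/orP; left; apply/eqP; rewrite /eta; field.
    by rewrite gt_eqF.
  move: hfi; rewrite ler_norml => /andP[h2 _].
  have hm4 : Ex Q (fun w => \1_(~` A) w * f k m w) <= Ex Q (f k m).
    by rewrite le_eqVlt; apply/orP; left; apply/eqP; exact: hm3.
  exact: sum_of_errors e5 hk (le_trans hm1 hm4) h2 hep h1.
Unshelve. all: by end_near.
Qed.

End functional.

(** The integrand is squeezed between [limit_value] plus and minus [Mb] times the indicator of a
    null set, which gives its integral by monotonicity alone. *)
Lemma limit_expectation (F : cadlag_path V -> R) (Mb : R) (A : set Omega') : continuous F -> (forall x, `|F x| <= Mb) ->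
  measurable A -> Q A = 0%E -> (forall w, ~ A w -> regular w) ->
  (\int[Q]_w (F (to_path (limit_path w)))%:E = (Ex Q (limit_value F A))%:E)%E.
Proof.
move=> cF FM mA QA regA; have bl := bmf_limit_value cF FM mA regA.
have bA := bmfZ Mb (bmf_indic mA : bmf (\1_A : Omega' -> R)).
have A0 : Ex Q (fun w => Mb * \1_A w) = 0.
  by rewrite (ExZ Q Mb (bmf_indic mA)) (Ex_null mA QA) mulr0.
have hw w : limit_value F A w - Mb * \1_A w <= F (to_path (limit_path w)) <= limit_value F A w + Mb * \1_A w.
  rewrite /limit_value !indicE in_setC; case: (w \in A) => /=.
    by rewrite mul0r mulr1 sub0r add0r -ler_norml.
  by rewrite mul1r mulr0 subr0 addr0 lexx.
apply: le_anti; apply/andP; split.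
  rewrite -[in leRHS](addr0 (Ex Q _)) -A0 -(ExD Q bl bA) -(Ex_EFin Q (bmfD bl bA)).
  by apply: integral_mono => w; rewrite lee_fin; have /andP[] := hw w.
rewrite -[in leLHS](subr0 (Ex Q _)) -A0 -(ExB Q bl bA) -(Ex_EFin Q (bmfB bl bA)).
by apply: integral_mono => w; rewrite lee_fin; have /andP[] := hw w.
Qed.

Lemma rescaled_cvg_in_law : skorokhod_cvg_in_law P (fun T w v => scale T *: S_process tau Z (T * v) w) Q limit_path.
Proof.
have [A [mA QA regA]] := regular_null.
split.
- move=> T T0.
  (* A path can fail to be cadlag only if all [tau n] are at most [T], an event that is null by the
     explosion bound. *)
  pose B n : set Omega := [set w | (tau n w <= T%:E)%E].
  have mB n : measurable (B n) by exact: (measurable_time_le H).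
  exists (\bigcap_n B n); split; first exact: bigcap_measurable.
    have [K hK] := explosion_bound g_ge0 h_ge0 g_int h_int hg_lt1 H (ltW T0).
    have mI : measurable (\bigcap_n B n) by exact: bigcap_measurable.
    have fP : P (\bigcap_n B n) \is a fin_num by exact: fin_num_measure.
    rewrite -(fineK fP); congr (_%:E); apply/eqP; rewrite eq_le fine_ge0// andbT.
    rewrite leNgt; apply/negP => p0; set p := fine _ in p0.
    have hp n : p <= `|K| / n.+1%:R.
      apply: (@le_trans _ _ (fine (P (B n)))).
        rewrite /p fine_le ?fin_num_measure//; apply: le_measure; rewrite ?inE//.
        by move=> w; apply.
      apply: le_trans (hK n) _; apply: (@le_trans _ _ (`|K| / n.+1%:R ^+ 4)).
        by rewrite ler_wpM2r ?ler_norm// invr_ge0 exprn_ge0.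
      rewrite ler_wpM2l// lef_pV2 ?posrE ?exprn_gt0//.
      by rewrite exprS ler_peMr// exprn_ege1// ler1n.
    have := hp (Num.truncn (`|K| / p)); rewrite ler_pdivlMr// leNgt => /negP; apply.
    by rewrite mulrC -ltr_pdivrMr// truncnS_gt.
  move=> w /= ncad n _; rewrite /B /= leNgt; apply/negP => Ttau; apply: ncad.
  exact: (S_path_cadlag H _ T0 Ttau).
- exists A; split => // w /= ncad; apply: contrapT => nA; apply: ncad.
  by apply: limit_path_cadlag; exact: regA.
- move=> F cF [Mb FM]; rewrite unlock.
  have FM' x : `|- F x| <= Mb by rewrite normrN.
  have cF' : continuous (fun x => - F x) by move=> x; apply: (@continuous_comp _ _ _ F -%R); [exact: cF|exact: opp_continuous].
  rewrite (limit_expectation cF FM mA QA regA); set L := Ex Q _.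
  (* The lower bound for [- F] is the upper bound for [F]. *)
  have LN : Ex Q (limit_value (fun x => - F x) A) = - L.
    rewrite /L -mulN1r -(ExZ Q (-1) (bmf_limit_value cF FM mA regA)); apply: eq_Ex => w.
    by rewrite /limit_value mulrN mulN1r.
  pose I (T : R) := (\int[P]_w (F (to_path (fun v => scale T *: S_process tau Z (T * v) w)))%:E)%E.
  have key (e : R) : 0 < e -> exists T0 : R, forall T, T0 <= T -> ((L - e)%:E <= I T <= (L + e)%:E)%E.
    move=> e0.
    have [T1 _ h1] := lower_sandwich cF FM mA QA regA e0.
    have [T2 _ h2] := lower_sandwich cF' FM' mA QA regA e0.
    exists (Num.max T1 T2) => T; rewrite ge_max => /andP[/h1[p1 [b1 le1 E1]] /h2[p2 [b2 le2 E2]]].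
    apply/andP; split.
      apply: (@le_trans _ _ (Ex P p1)%:E); first by rewrite lee_fin.
      by rewrite -(Ex_EFin P b1); apply: integral_mono => w; rewrite lee_fin.
    apply: (@le_trans _ _ (- Ex P p2)%:E); last first.
      by rewrite lee_fin lerNl opprD -LN.
    rewrite -mulN1r -(ExZ P (-1) b2) -(Ex_EFin P (bmfZ (-1) b2)); apply: integral_mono => w.
    by rewrite lee_fin mulN1r lerNr.
  have fI T e : ((L - e)%:E <= I T <= (L + e)%:E)%E -> I T \is a fin_num /\ `|L - fine (I T)| <= e.
    case: (I T) => [r| |] /andP[]; rewrite ?lee_fin// => h1 h2; split => //=.
    by rewrite ler_norml; apply/andP; split; lra.
  apply: cvg_EFin.
    have [T0 hT] := key 1 ltr01.
    near=> T; have [] // := fI T 1; apply: hT; near: T; by apply: nbhs_pinfty_ge; exact: num_real.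
  apply/cvgrPdist_le => e e0; have [T0 hT] := key e e0.
  near=> T; have [] // := fI T e; apply: hT; near: T; by apply: nbhs_pinfty_ge; exact: num_real.
Unshelve. all: by end_near.
Qed.

End convergence.

Lemma powR_half {R : realType} (x : R) : 0 <= x -> x `^ 2^-1 = Num.sqrt x.
Proof. by move=> x0; rewrite powR12_sqrt. Qed.

Lemma powR_three_halves {R : realType} (x : R) : 0 < x -> x `^ (3 / 2) = x * Num.sqrt x.
Proof.
move=> x0; rewrite (_ : 3 / 2 = 1 + 2^-1); last by field.
by rewrite powRD ?gt_eqF ?implybT// powRr1 ?ltW// powR12_sqrt ?ltW.
Qed.

(** * Identification of the limiting constants *)

Section limit_law.
Context {R : realType}.
Variables (g h : R -> R) (mu : 'I_4 -> R).
Hypothesis hg_lt1 : L1norm h * L1norm g < 1.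
Hypothesis mu_ge0 : forall i, 0 <= mu i.
Local Notation a := (L1norm h).
Local Notation b := (L1norm g).

(** The standard deviation contributes a factor [(1 - q)^(-1/2)] through the rate and the linear
    response a factor [(1 - q)^-1]; together they form the exponent 3/2. *)
Lemma sigmaE (j : 'I_2) (nu : R) : 0 <= nu -> rate g h mu (lo (is_snd j)) = nu / (1 - a * b) ->
  sigma g h mu j / (1 - a * b) = Num.sqrt 2 / (1 - a * b) `^ (3 / 2) * nu `^ 2^-1.
Proof.
move=> nu0 rE; have q1 : 0 < 1 - a * b by rewrite subr_gt0.
have s0 : Num.sqrt (1 - a * b) != 0 by rewrite gt_eqF// sqrtr_gt0.
rewrite /sigma rE sqrtrM// sqrtrM// sqrtrV ?ltW// powR_half// powR_three_halves//.
by field; rewrite s0 gt_eqF.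
Qed.

End limit_law.

Theorem proposition2 (R : realType) (g h : R -> R)
  (g_ge0 : forall t : R, 0 <= t -> 0 <= g t)
  (h_ge0 : forall t : R, 0 <= t -> 0 <= h t)
  (g_int : lebesgue_measure.-integrable `[0, +oo[ (EFin \o g))
  (h_int : lebesgue_measure.-integrable `[0, +oo[ (EFin \o h))
  (hg_lt1 : L1norm h * L1norm g < 1)
  (mu : 'I_4 -> R)
  (mu_ge0 : forall i, 0 <= mu i)
  (mu12 : mu (inord 0) = mu (inord 1))
  (mu34 : mu (inord 2) = mu (inord 3))
  (d : measure_display) (Omega : measurableType d) (P : probability Omega R)
  (tau : nat -> Omega -> \bar R) (Z : nat -> Omega -> 'I_4)
  (N_hawkes : hawkes tau Z P mu (kernel4 g h))
  (d' : measure_display) (Omega' : measurableType d') (Q : probability Omega' R)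
  (W : 'I_2 -> R -> Omega' -> R)
  (W_bm : brownian_motion Q W) :
  let a := L1norm h in
  let b := L1norm g in
  let nu1 := mu (inord 0) + a * mu (inord 2) in
  let nu2 := mu (inord 2) + b * mu (inord 0) in
  let W1 v w := W (inord 0) v w in
  let W2 v w := W (inord 1) v w in
  skorokhod_cvg_in_law
    P (fun T w v => T `^ (- 2^-1) *: S_process tau Z (T * v) w)
    Q (fun w v => (Num.sqrt 2 / (1 - a * b) `^ (3 / 2)) *:
         row2 (nu1 `^ 2^-1 * W1 v w + nu2 `^ 2^-1 * a * W2 v w)
              (nu1 `^ 2^-1 * b * W1 v w + nu2 `^ 2^-1 * W2 v w)).
Proof.
move=> a b nu1 nu2 W1 W2.
have mu_lo x : mu (lo x) = mu (hi x) by case: x.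
have := rescaled_cvg_in_law g_ge0 h_ge0 g_int h_int hg_lt1 N_hawkes mu_lo W_bm.
congr skorokhod_cvg_in_law; apply/funext => w; apply/funext => v.
have k0 := kmass_ge0 g_ge0 h_ge0.
have a0 : 0 <= a by have := k0 (lo false); rewrite kmass_lo.
have b0 : 0 <= b by have := k0 (lo true); rewrite kmass_lo.
have n1 : 0 <= nu1 by rewrite addr_ge0// mulr_ge0.
have n2 : 0 <= nu2 by rewrite addr_ge0// mulr_ge0.
have e0 : ord0 = inord 0 :> 'I_2 by apply/val_inj; rewrite /= inordK.
have e1 : ord_max = inord 1 :> 'I_2 by apply/val_inj; rewrite /= inordK.
have s1 := @sigmaE R g h mu hg_lt1 ord0 nu1 n1.
have s2 := @sigmaE R g h mu hg_lt1 ord_max nu2 n2.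
rewrite /rate !par_lo !kmass_lo -/a -/b in s1 s2.
have {}s1 := s1 erefl; have {}s2 := s2 erefl.
rewrite /limit_path /lmap row2Z -/a -/b /W1 /W2 -e0 -e1; move: s1 s2.
set s1 := sigma g h mu ord0; set s2 := sigma g h mu ord_max; set c := _ / _ `^ _.
move: (nu1 `^ _) (nu2 `^ _) => m1 m2 E1 E2.
move: (W ord0 v w) (W ord_max v w) => w1 w2; move: (1 - _)^-1 E1 E2 => D E1 E2.
congr row2.
  transitivity (s1 * D * w1 + a * (s2 * D) * w2); first by ring.
  by rewrite E1 E2; ring.
transitivity (s2 * D * w2 + b * (s1 * D) * w1); first by ring.
by rewrite E1 E2; ring.
Qed.
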